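(* Let $G_0,G_1\in\mathbb{P}$ with $E(G_0),E(G_1)<+\infty$. Then $$\Gamma\text{-}\lim_{\epsilon\to0}\Big[\mathcal K+\frac{\epsilon^2}{2}\mathcal F+\iota_{G_0,G_1}\Big]=\mathcal K+\iota_{G_0,G_1}$$ as functionals on $C([0,1];\mathbb{P})$, both in the strong uniform topology of $C([0,1];\mathbb{P})$ and in the pointwise-in-time weak-$*$ topology of $\mathbb{P}\subset (C_0(\Omega;\mathcal H))^*$.
   Context: Fix $d\ge 1$ and a separable, locally compact, metrizable space $\Omega$. On $\mathbb{C}^{d\times d}$ use the real Frobenius product $\Phi:\Psi=\operatorname{Re}\operatorname{tr}(\Phi^*\Psi)$ and norm $|\Phi|_2=\sqrt{\Phi:\Phi}$; $A^{Sym}=\frac12(A+A^* )$; $I$ is the identity matrix; $\mathcal H$ is the space of Hermitian $d\times d$ matrices, $\mathcal H^+$ the positive-semidefinite ones. For an $\mathcal H$-valued Radon measure $G$ on $\Omega$, $\|G\|_{TV}=\sup\{|\int_\Omega dG:\Psi| : \Psi\in C_b(\Omega;\mathcal H),\ \sup_x|\Psi(x)|_2\le 1\}$. $\mathbb{P}$ is the set of finite $\mathcal H^+$-valued Radon measures $G$ on $\Omega$ with $\operatorname{tr}G(\Omega)=1$. For such $G$ with trace measure $\gamma=\operatorname{tr}G$ and density $g=\frac{dG}{d\gamma}$, write $\int_\Omega dG\,U:V=\int_\Omega (gU):V\,d\gamma$, and $L^2(dG;\mathcal H)$, $L^2(0,1;L^2(dG_t;\mathcal H))$ are defined by the norms squared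 $\int_\Omega dG\,U:U$ and $\int_0^1\int_\Omega dG_t\,U_t:U_t\,dt$. The equation $\partial_tG_t=(G_tU_t)^{Sym}$ holds weakly if for all $\Psi\in C^1([0,1];C_b(\Omega;\mathcal H))$ and $s,t\in[0,1]$, $\int_\Omega\Psi_t:dG_t-\int_\Omega\Psi_s:dG_s=\int_s^t\big(\int_\Omega dG_\tau:\partial_\tau\Psi_\tau+dG_\tau U_\tau:\Psi_\tau\big)d\tau$. The Fisher-Rao distance on $\mathbb{P}$ is given by $d_{FR}^2(G_0,G_1)=\inf\int_0^1\int_\Omega dG_t\,U_t:U_t\,dt$ over pairs $(G_t,U_t)_{t\in[0,1]}$ with $G\in C([0,1];\mathbb{P})$ (TV-continuous) having endpoints $G_0,G_1$, $U\in L^2(0,1;L^2(dG_t;\mathcal H))$ and $\partial_tG_t=(G_tU_t)^{Sym}$ weakly. The topologies of $d_{FR}$ and TV on $\mathbb{P}$ coincide, and $C([0,1];\mathbb{P})$ (with its uniform topology) is taken with respect to either one. A curve $x$ in a metric space $(X,d)$ is $AC^2([0,1];X)$ if $d(x_s,x_t)\le\int_s^t\eta(\tau)\,d\tau$ for all $0\le s\le t\le 1$ and some $0\le\eta\in L^2(0,1)$; its metric speed is $|\dot x_t|=\lim_{\delta\to0}d(x_t,x_{t+\delta})/|\delta|$ (exists a.e.). $|\dot G_t|_{FR}$ is the metric speed with respect to $d_{FR}$. Fix a reference non-negative scalar Radon measure $\Lambda$ on $\Omega$ such that $\operatorname{tr}(\Lambda I)$ is a probability measure. For $G\in\mathbb{P}$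 let $G=G^\Lambda+G^\perp$ be its Lebesgue decomposition with respect to $\Lambda$ and $\frac{dG^\Lambda}{d\Lambda}$ the density. Entropy: $E(G)=\int_\Omega-\log\det\big(\frac{dG^\Lambda}{d\Lambda}\big)d\Lambda\in[0,+\infty]$. Fisher information: $F(G)=\operatorname{tr}\int_\Omega\big[\big(\frac{dG^\Lambda}{d\Lambda}\big)^{-1}-I\big]d\Lambda\in[0,+\infty]$ (with the conventions $-\log\det A=+\infty$, $\operatorname{tr}A^{-1}=+\infty$ for singular $A\in\mathcal H^+$). For $G\in C([0,1];\mathbb{P})$: $\mathcal K(G)=\frac12\int_0^1|\dot G_t|_{FR}^2\,dt$, with $\mathcal K(G)=+\infty$ if $G\notin AC^2([0,1];(\mathbb{P},d_{FR}))$; $\mathcal F(G)=\int_0^1F(G_t)\,dt\in[0,+\infty]$; $\iota_{G_0,G_1}(G)=0$ if $G|_{t=0}=G_0$ and $G|_{t=1}=G_1$, and $+\infty$ otherwise. Pointwise-in-time weak-$*$ convergence $G^n\to G$ means $\int_\Omega\varphi:dG^n_t\to\int_\Omega\varphi:dG_t$ for every $t\in[0,1]$ and $\varphi\in C_0(\Omega;\mathcal H)$. $\Gamma$-convergence is understood sequentially: for every $\epsilon_n\to0$ ($\epsilon_n>0$), (liminf) $\Phi(G)\le\liminf_n\Phi_{\epsilon_n}(G^n)$ whenever $G^n\to G$ in the given topology; (limsup) every $G$ admits a sequence $G^n\to G$ in the given topology with $\limsup_n\Phi_{\epsilon_n}(G^n)\le\Phi(G)$. *)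

(* Defs.v *)
From HB Require Import structures.
From mathcomp Require Import all_boot all_order all_algebra.
From mathcomp Require Import sesquilinear spectral.
From mathcomp Require Import complex.
From mathcomp Require Import all_classical all_reals all_analysis.

Set Implicit Arguments.
Unset Strict Implicit.
Unset Printing Implicit Defensive.

Import Order.TTheory GRing.Theory Num.Theory.
Import numFieldNormedType.Exports.

Local Open Scope classical_set_scope.
Local Open Scope ring_scope.
Local Open Scope sesquilinear_scope.
Local Open Scope charge_scope.

Notation Re := complex.Re.
Notation Im := complex.Im.

Definition separable (T : topologicalType) : Prop :=
  exists2 S : set T, countable S & dense S.

Definition metrizable (R : realType) (T : topologicalType) : Prop :=
  exists dist : T -> T -> R,
    [/\ forall x, dist x x = 0,
        forall x y, dist x y = 0 -> x = y,
        forall x y, dist x y = dist y x,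
        forall x y z, dist x z <= dist x y + dist y z &
        forall x (A : set T), nbhs x A <->
          exists2 e : R, 0 < e & [set y | dist x y < e] `<=` A].

Notation borel T := (g_sigma_algebraType (@open T)).

Section matrices.
Context {R : realType} {d : nat}.
Implicit Types A B : 'M[R[i]]_d.

Definition frob A B : R := Re (\tr (A ^t* *m B)).

Definition frobnorm A : R := Num.sqrt (frob A A).

Definition hermitian_mx A : Prop := A \is hermsymmx.

Definition psd A : Prop :=
  hermitian_mx A /\ forall v : 'rV[R[i]]_d, 0 <= Re ((v *m A *m v ^t*) 0 0).

(* [neglogdet] and [trinv] are meant for [A] positive semidefinite, where the
   determinant and the trace of the inverse are real and nonnegative. *)
Definition neglogdet A : \bar R :=
  if \det A == 0 then +oo%E else (- ln (Re (\det A)))%:E.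

Definition trinv A : \bar R :=
  if \det A == 0 then +oo%E else (Re (\tr (invmx A)))%:E.

End matrices.

Section matrix_functions.
Context {R : realType} {d : nat}.

Definition mx_measurable {disp} {T : measurableType disp} (D : set T)
    (f : T -> 'M[R[i]]_d) : Prop :=
  forall i j, measurable_fun D (fun x => Re (f x i j)) /\
              measurable_fun D (fun x => Im (f x i j)).

Context {Omega : topologicalType}.
Implicit Types Psi : Omega -> 'M[R[i]]_d.

Definition mx_continuous Psi : Prop :=
  forall i j, continuous (fun x => Re (Psi x i j)) /\
              continuous (fun x => Im (Psi x i j)).

Definition CbH Psi : Prop :=
  [/\ forall x, hermitian_mx (Psi x), mx_continuous Psi &
      exists M : R, forall x, frobnorm (Psi x) <= M].

Definition C0H Psi : Prop :=
  [/\ forall x, hermitian_mx (Psi x), mx_continuous Psi &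
      forall e : R, 0 < e -> exists2 K : set Omega, compact K &
        forall x, ~ K x -> frobnorm (Psi x) < e].

(* [Psi] is of class C^1 from [0, 1] to (CbH, sup norm), with derivative [dPsi]. *)
Definition C1_CbH (Psi dPsi : R -> Omega -> 'M[R[i]]_d) : Prop :=
  [/\ forall t, t \in `[0, 1] -> CbH (Psi t) /\ CbH (dPsi t),
      forall t, t \in `[0, 1] -> forall e, 0 < e -> exists2 r, 0 < r &
        forall s, s \in `[0, 1] -> `|s - t| < r ->
          forall x, frobnorm (dPsi s x - dPsi t x) <= e &
      forall t, t \in `[0, 1] -> forall e, 0 < e -> exists2 r, 0 < r &
        forall s, s \in `[0, 1] -> `|s - t| < r -> forall x,
          frobnorm (Psi s x - Psi t x - real_complex R (s - t) *: dPsi t x)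
            <= e * `|s - t|].

End matrix_functions.

(* Finite positive-semidefinite-matrix-valued Borel measures. On a separable,
   locally compact, metrizable space these are automatically Radon. As for the
   scalar measures of the library, values on non-measurable sets carry no
   information. *)
Record psd_measure (R : realType) (d : nat) (Omega : ptopologicalType) := PsdMeasure {
  psdm :> set (borel Omega) -> 'M[R[i]]_d ;
  psdm_psd : forall A, psd (psdm A) ;
  psdm0 : psdm set0 = 0 ;
  psdm_sigma_additive : forall F : (set (borel Omega))^nat,
    (forall n, measurable (F n)) -> trivIset setT F -> forall i j,
      (fun n => \sum_(0 <= k < n) Re (psdm (F k) i j)) @ \oo
        --> Re (psdm (\bigcup_k F k) i j) /\
      (fun n => \sum_(0 <= k < n) Im (psdm (F k) i j)) @ \oo
        --> Im (psdm (\bigcup_k F k) i j) }.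

Record prob (R : realType) (d : nat) (Omega : ptopologicalType) := Prob {
  prob_measure :> psd_measure R d Omega ;
  prob_trace : \tr (prob_measure setT) = 1 }.

Lemma cvg_sumr (R : realType) (I : Type) (r : seq I) (f : I -> R^nat) (l : I -> R) :
  (forall i, f i @ \oo --> l i) ->
  (fun n => \sum_(i <- r) f i n) @ \oo --> \sum_(i <- r) l i.
Proof.
move=> fl; elim: r => [|i r ih].
  by under eq_fun do rewrite big_nil; rewrite big_nil; exact: cvg_cst.
by under eq_fun do rewrite big_cons; rewrite big_cons; exact: cvgD.
Qed.

Section components.
Context {R : realType} {d : nat} {Omega : ptopologicalType}.
Implicit Types G : psd_measure R d Omega.

Definition re_comp G i j : set (borel Omega) -> \bar R :=
  fun A => (Re (G A i j))%:E.

Definition im_comp G i j : set (borel Omega) -> \bar R :=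
  fun A => (Im (G A i j))%:E.

Definition trace_measure G : set (borel Omega) -> \bar R :=
  fun A => (Re (\tr (G A)))%:E.

Lemma EFin_semi_sigma_additive (f : set (borel Omega) -> R) :
  (forall F : (set (borel Omega))^nat, (forall n, measurable (F n)) ->
    trivIset setT F ->
    (fun n => \sum_(0 <= k < n) f (F k)) @ \oo --> f (\bigcup_k F k)) ->
  semi_sigma_additive (EFin \o f).
Proof.
move=> Hf F mF tF _ /=; apply: cvg_EFin.
  by apply: nearW => n /=; rewrite sumEFin.
rewrite [X in X @ _](_ : _ = fun n => \sum_(0 <= k < n) f (F k)); first exact: Hf.
by apply/funext => n /=; rewrite sumEFin.
Qed.

Lemma re_comp0 G i j : re_comp G i j set0 = 0%E.
Proof. by rewrite /re_comp psdm0 mxE. Qed.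

Lemma re_comp_fin G i j A : measurable A -> re_comp G i j A \is a fin_num.
Proof. by []. Qed.

Lemma re_comp_sigma_additive G i j : semi_sigma_additive (re_comp G i j).
Proof.
apply: (@EFin_semi_sigma_additive (fun A => Re (G A i j))) => F mF tF.
by have [] := psdm_sigma_additive G mF tF i j.
Qed.

HB.instance Definition _ G i j := isCharge.Build _ (borel Omega) R (re_comp G i j)
  (re_comp0 G i j) (@re_comp_fin G i j) (@re_comp_sigma_additive G i j).

Lemma im_comp0 G i j : im_comp G i j set0 = 0%E.
Proof. by rewrite /im_comp psdm0 mxE. Qed.

Lemma im_comp_fin G i j A : measurable A -> im_comp G i j A \is a fin_num.
Proof. by []. Qed.

Lemma im_comp_sigma_additive G i j : semi_sigma_additive (im_comp G i j).
Proof.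
apply: (@EFin_semi_sigma_additive (fun A => Im (G A i j))) => F mF tF.
by have [] := psdm_sigma_additive G mF tF i j.
Qed.

HB.instance Definition _ G i j := isCharge.Build _ (borel Omega) R (im_comp G i j)
  (im_comp0 G i j) (@im_comp_fin G i j) (@im_comp_sigma_additive G i j).

Lemma Re_sum (I : Type) (r : seq I) (P : pred I) (f : I -> R[i]) :
  Re (\sum_(i <- r | P i) f i) = \sum_(i <- r | P i) Re (f i).
Proof. by apply: (big_morph (@complex.Re R)) => // -[a b] [a' b']. Qed.

Lemma Re_tr (A : 'M[R[i]]_d) : Re (\tr A) = \sum_(i < d) Re (A i i).
Proof. exact: Re_sum. Qed.

Lemma psd_diag_ge0 (A : 'M[R[i]]_d) i : psd A -> 0 <= Re (A i i).
Proof.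
move=> [_ /(_ (delta_mx 0 i))]; rewrite -rowE !mxE (bigD1 i)//= big1 => [|j ji].
  by rewrite !mxE !eqxx conjC1 mulr1 addr0.
by rewrite !mxE eqxx/= (negbTE ji) conjC0 mulr0.
Qed.

Lemma trace_measure0 G : trace_measure G set0 = 0%E.
Proof. by rewrite /trace_measure psdm0 mxtrace0. Qed.

Lemma trace_measure_ge0 G A : (0 <= trace_measure G A)%E.
Proof.
rewrite /trace_measure Re_tr lee_fin; apply: sumr_ge0 => i _.
exact/psd_diag_ge0/psdm_psd.
Qed.

Lemma trace_measure_sigma_additive G : semi_sigma_additive (trace_measure G).
Proof.
apply: (@EFin_semi_sigma_additive (fun A => Re (\tr (G A)))) => F mF tF.
rewrite [X in X @ _](_ : _ = fun n =>
    \sum_(i < d) \sum_(0 <= k < n) Re (G (F k) i i)); last first.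
  by apply/funext => n; rewrite exchange_big/=; apply: eq_bigr => k _; rewrite Re_tr.
rewrite Re_tr; apply: cvg_sumr => i.
by have [] := psdm_sigma_additive G mF tF i i.
Qed.

HB.instance Definition _ G := isMeasure.Build _ (borel Omega) R (trace_measure G)
  (trace_measure0 G) (@trace_measure_ge0 G) (@trace_measure_sigma_additive G).

Lemma trace_measure_fin G : fin_num_fun (trace_measure G).
Proof. by []. Qed.

HB.instance Definition _ G := Measure_isFinite.Build _ (borel Omega) R
  (trace_measure G) (trace_measure_fin G).

(* dG/d(tr G), entry by entry; each entry is dominated by the trace. *)
Definition dens G (x : Omega) : 'M[R[i]]_d :=
  \matrix_(i, j) Complex
    (fine ('d (re_comp G i j) '/d (trace_measure G) x))
    (fine ('d (im_comp G i j) '/d (trace_measure G) x)).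

(* int dG : Psi *)
Definition pairing G (Psi : Omega -> 'M[R[i]]_d) : R :=
  \int[trace_measure G]_x frob (dens G x) (Psi x).

(* int dG U : V *)
Definition pairing2 G (U V : Omega -> 'M[R[i]]_d) : R :=
  \int[trace_measure G]_x frob (dens G x *m U x) (V x).

(* int dG U : U, possibly infinite *)
Definition sqnorm G (U : Omega -> 'M[R[i]]_d) : \bar R :=
  (\int[trace_measure G]_x (frob (dens G x *m U x) (U x))%:E)%E.

(* The total variation norm of the signed measure [G - G'], whose integrals are the
   differences of those against [G] and [G']. *)
Definition dTV G G' : \bar R :=
  ereal_sup [set `|pairing G Psi - pairing G' Psi|%:E |
    Psi in [set Psi | CbH Psi /\ forall x, frobnorm (Psi x) <= 1]].

End components.

Definition eq_measure (R : realType) (d : nat) (Omega : ptopologicalType)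
    (G G' : psd_measure R d Omega) : Prop :=
  forall A, measurable A -> G A = G' A.

(* C([0, 1]; P). The values of a curve outside [0, 1] carry no information. *)
Record curve (R : realType) (d : nat) (Omega : ptopologicalType) := Curve {
  curve_fun :> R -> prob R d Omega ;
  curve_continuous : forall t, t \in `[0, 1] ->
    dTV (curve_fun s) (curve_fun t) @[s --> within `[0, 1] (nbhs t)] --> 0%E }.

(* The integral from [s] to [t], with the usual sign when [t < s]. *)
Definition oriented_integral (R : realType) (s t : R) (f : R -> R) : R :=
  if s <= t then \int[lebesgue_measure]_(tau in `[s, t]) f tau
  else - \int[lebesgue_measure]_(tau in `[t, s]) f tau.

Section metric_curves.
Context {R : realType} {X : Type}.
Variable dist : X -> X -> \bar R.
Implicit Types x : R -> X.

Definition AC2 x : Prop :=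
  exists eta : R -> R,
    [/\ forall t, t \in `[0, 1] -> 0 <= eta t,
        measurable_fun `[0 : R, 1] eta,
        (\int[lebesgue_measure]_(t in `[0%R, 1%R]) (eta t ^+ 2)%:E < +oo)%E &
        forall s t, 0 <= s -> s <= t -> t <= 1 ->
          (dist (x s) (x t) <=
            \int[lebesgue_measure]_(tau in `[s, t]) (eta tau)%:E)%E].

(* The limit exists for almost every [t] when [x] is [AC2]. *)
Definition metric_speed x (t : R) : \bar R :=
  lim ((dist (x t) (x (t + delta)%R) * (`|delta|^-1)%:E)%E @[delta --> 0^']).

End metric_curves.

Section functionals.
Context {R : realType} {d : nat} {Omega : ptopologicalType}.
Local Notation P := (prob R d Omega).
Local Notation C01 := (curve R d Omega).

(* [\partial_t G_t = (G_t U_t)^Sym], weakly *)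
Definition weak_equation (G : R -> P) (U : R -> Omega -> 'M[R[i]]_d) : Prop :=
  forall Psi dPsi, C1_CbH Psi dPsi ->
  forall s t, s \in `[0, 1] -> t \in `[0, 1] ->
    pairing (G t) (Psi t) - pairing (G s) (Psi s) =
    oriented_integral s t (fun tau =>
      pairing (G tau) (dPsi tau) + pairing2 (G tau) (U tau) (Psi tau)).

Definition action (G : R -> P) (U : R -> Omega -> 'M[R[i]]_d) : \bar R :=
  (\int[lebesgue_measure]_(t in `[0%R, 1%R]) sqnorm (G t) (U t))%E.

(* [U] belongs to L^2(0, 1; L^2(dG_t; H)); elements of that space are
   represented by jointly Borel fields. *)
Definition L2_field (G : R -> P) (U : R -> Omega -> 'M[R[i]]_d) : Prop :=
  [/\ forall t x, t \in `[0, 1] -> hermitian_mx (U t x),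
      mx_measurable (`[0 : R, 1] `*` setT) (fun z : R * borel Omega => U z.1 z.2) &
      (action G U < +oo)%E].

Definition dFR (G0 G1 : P) : \bar R :=
  sqrte (ereal_inf [set e : \bar R | exists (G : C01) U,
    [/\ eq_measure (G 0) G0, eq_measure (G 1) G1,
        L2_field G U, weak_equation G U & e = action G U]]).

Definition kinetic (G : C01) : \bar R :=
  if `[< AC2 dFR G >] then
    ((2^-1)%:E * \int[lebesgue_measure]_(t in `[0%R, 1%R]) (metric_speed dFR G t) ^+ 2)%E
  else +oo%E.

Definition iota_endpoints (G0 G1 : P) (G : C01) : \bar R :=
  if `[< eq_measure (G 0) G0 /\ eq_measure (G 1) G1 >] then 0%E else +oo%E.

Section reference.
Variable Lambda : {measure set (borel Omega) -> \bar R}.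

Definition lebesgue_decomposition (G Ga Gs : psd_measure R d Omega) : Prop :=
  [/\ forall A, measurable A -> G A = Ga A + Gs A,
      forall A, measurable A -> Lambda A = 0%E -> Ga A = 0 &
      exists N, [/\ measurable N, Lambda N = 0%E & Gs (~` N) = 0]].

Definition has_density (G : psd_measure R d Omega) (h : borel Omega -> 'M[R[i]]_d) :
    Prop :=
  forall i j,
    [/\ Lambda.-integrable setT (fun x => (Re (h x i j))%:E),
        Lambda.-integrable setT (fun x => (Im (h x i j))%:E) &
        forall A, measurable A ->
          G A i j = Complex (\int[Lambda]_(x in A) Re (h x i j))
                            (\int[Lambda]_(x in A) Im (h x i j))].

(* A version of the density of the absolutely continuous part of [G]; for finite
   [Lambda] it exists and is unique up to [Lambda]-negligible sets. *)
Definition ac_density (G : psd_measure R d Omega) : borel Omega -> 'M[R[i]]_d :=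
  match pselect (exists h, exists2 Ga, (exists Gs, lebesgue_decomposition G Ga Gs)
                                     & has_density Ga h) with
  | left ex => sval (cid ex)
  | right _ => fun=> 0
  end.

Definition entropy (G : psd_measure R d Omega) : \bar R :=
  (\int[Lambda]_x neglogdet (ac_density G x))%E.

(* [d%:R] is the trace of the identity matrix. *)
Definition fisher (G : psd_measure R d Omega) : \bar R :=
  (\int[Lambda]_x (trinv (ac_density G x) - (d%:R)%:E))%E.

Definition fisher_path (G : C01) : \bar R :=
  (\int[lebesgue_measure]_(t in `[0%R, 1%R]) fisher (G t))%E.

End reference.

Definition uniform_cvg (Gn : nat -> C01) (G : C01) : Prop :=
  ereal_sup [set dTV (Gn n t) (G t) | t in `[0, 1]] @[n --> \oo] --> 0%E.

Definition pointwise_weakstar_cvg (Gn : nat -> C01) (G : C01) : Prop :=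
  forall t, t \in `[0, 1] -> forall phi, C0H phi ->
    pairing (Gn n t) phi @[n --> \oo] --> pairing (G t) phi.

End functionals.

(* Sequential Gamma-convergence as [eps -> 0+], for the convergence of sequences
   [conv] on [X]. *)
Definition gamma_limit (R : realType) (X : Type) (conv : (nat -> X) -> X -> Prop)
    (Phi_ : R -> X -> \bar R) (Phi : X -> \bar R) : Prop :=
  forall eps : R^nat, (forall n, 0 < eps n) -> eps @ \oo --> 0 ->
    (forall (xn : nat -> X) (x : X), conv xn x ->
      (Phi x <= limn_einf (fun n => Phi_ (eps n) (xn n)))%E) /\
    (forall x : X, exists2 xn : nat -> X, conv xn x &
      (limn_esup (fun n => Phi_ (eps n) (xn n)) <= Phi x)%E).

(* Main.v *)
Require Import Defs.
From HB Require Import structures.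
From mathcomp Require Import all_boot all_order all_algebra.
From mathcomp Require Import sesquilinear spectral complex ring lra.
From mathcomp Require Import all_classical all_reals all_analysis measurable_realfun.

Set Implicit Arguments.
Unset Strict Implicit.
Unset Printing Implicit Defensive.

Import Order.TTheory GRing.Theory Num.Theory.
Import numFieldNormedType.Exports.
Import Defs.

Local Open Scope classical_set_scope.
Local Open Scope ring_scope.
Local Open Scope sesquilinear_scope.

Local Notation Re := complex.Re.
Local Notation Im := complex.Im.
Local Open Scope charge_scope.

(* By duality against test fields solving the Hamilton-Jacobi equation, the distance is
d_FR(G, H) = 2 arccos fid(G, H) with fid(G, H) = inf_P (int dG : P + int dH : P^-1) / 2
over uniformly positive continuous P. Hence the kinetic energy, a supremum of discretised
energies, is weak-* lower semicontinuous. The recovery sequence mixes the curve with the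
reference measure in proportion [min t (1 - t) delta], delta = min epsilon 1/4. The cost of
the two ends is controlled by the integral of the trace of [(s + H)^-1] over [s], that is, by
the entropy, while the Fisher information is of order 1 / delta. *)

Local Notation "r *c A" := (real_complex _ r *: A) (at level 40, left associativity).

Local Notation intg mu D f := (mu.-integrable D (EFin \o f)).
Local Notation finmeas R Omega := {finite_measure set (borel Omega) -> \bar R}.

(** The distance is an infimum over curves, and neither its lower semicontinuity nor its behaviour
    under mixing can be read off that form. The formula through [fid] gives both: an infimum of
    functionals that are affine in the pair of measures and continuous against bounded continuous
    fields is concave and upper semicontinuous. The upper bound on the distance needs optimal maps,
    which are constructed over an invertible density only. Hence [A] and [B] are joined through a
    third measure, a small perturbation of [A] with invertible density, by two arcs glued at one
    time. Weak-* limits are limits against all bounded continuous fields because every measure in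
    play has trace one. In the lower bound the Fisher term is dropped, being nonnegative. In the
    upper bound both [delta] and [epsilon^2 / delta] must vanish, which the choice [epsilon]
    achieves; the cap [1/4] leaves a middle interval of length at least [1/2], on which the given
    curve is run in rescaled time, so that it rests while the mixing weight changes. *)

Lemma filter_ae_lebesgue (R : realType) : Filter (almost_everywhere (@lebesgue_measure R)).
Proof. exact: (ae_filter_ringOfSetsType (@lebesgue_measure R)). Qed.

#[local] Hint Extern 0 (Filter (nbhs (almost_everywhere _))) =>
  first [exact: ae_filter_ringOfSetsType | exact: filter_ae_lebesgue] : typeclass_instances.

Local Notation mtop := measurableT.
Local Notation mEFinP := measurable_EFinP.
Local Notation mcomp := measurableT_comp.
Local Notation mfun := (measurable_fun setT).
Local Notation mxmfun := (mx_measurable setT).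

(** * Complex numbers and the Frobenius product *)

Section complex_re.
Context {R : realType}.
Implicit Types z w : R[i].
Lemma Re_conj z: Re (Num.conj z) = Re z. Proof. by case: z. Qed.
Lemma Im_conj z: Im (Num.conj z) = - Im z. Proof. by case: z. Qed.
Lemma ReD z w: Re (z + w) = Re z + Re w. Proof. by case: z w => ? ? [? ?]. Qed.
Lemma ImD z w: Im (z + w) = Im z + Im w. Proof. by case: z w => ? ? [? ?]. Qed.
Lemma ReN z: Re (- z) = - Re z. Proof. by case: z. Qed.
Lemma ImN z: Im (- z) = - Im z. Proof. by case: z. Qed.
Lemma ReM z w: Re (z * w) = Re z * Re w - Im z * Im w.
by case: z w => ? ? [? ?]. Qed.
Lemma ImM z w: Im (z * w) = Re z * Im w + Im z * Re w.
by case: z w => ? ? [? ?]. Qed.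
Lemma ReMr (r: R) z: Re (real_complex R r * z) = r * Re z.
by rewrite ReM /= mul0r subr0. Qed.
Lemma ImMr (r: R) z: Im (real_complex R r * z) = r * Im z.
by rewrite ImM /= mul0r addr0. Qed.
Lemma conj_real_complex (r: R): Num.conj (real_complex R r) = real_complex R r.
by apply/eqP; rewrite eq_complex /= oppr0 !eqxx. Qed.
Lemma complex_ext z w: Re z = Re w -> Im z = Im w -> z = w.
by case: z w => a b [a' b'] /= -> ->. Qed.
Lemma Im_sum (I: Type) (r: seq I) (P: pred I) (f: I -> R[i]) :
 Im (\sum_(i <- r | P i) f i) = \sum_(i <- r | P i) Im (f i).
by apply: (big_morph (@complex.Im R)) => // -[a b] [a' b']. Qed.
End complex_re.

Section frobenius.
Context {R : realType} {d : nat}.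
Local Notation M := 'M[R[i]]_d.
Implicit Types (A B C X: M) (r s: R).
Lemma ctrM m n p (A: 'M[R[i]]_(m, n)) (B: 'M[R[i]]_(n, p)) :
 (A *m B) ^t* = B ^t* *m A ^t*.
by rewrite trmx_mul map_mxM. Qed.
Lemma ctrD A B: (A + B) ^t* = A ^t* + B ^t*.
by rewrite linearD /= map_mxD. Qed.
Lemma ctrN A: (- A) ^t* = - A ^t*.
by rewrite linearN /= map_mxN. Qed.
Lemma ctrB A B: (A - B) ^t* = A ^t* - B ^t*.
by rewrite ctrD ctrN. Qed.
Lemma ctrZ r A: (r *c A) ^t* = r *c A ^t*.
by apply/matrixP => i j; rewrite !mxE rmorphM; congr (_ * _); exact: conj_real_complex.
Qed.
Lemma ctr1: (1%:M : M) ^t* = 1%:M.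
by rewrite trmx1 map_mx1. Qed.
Lemma hermP A: hermitian_mx A <-> A ^t* = A.
rewrite /hermitian_mx; split.
 by move=> /is_hermitianmxP; rewrite expr0 scale1r => {2}->.
by move=> AA; apply/is_hermitianmxP; rewrite expr0 scale1r AA.
Qed.
Lemma frobE A B: frob A B =
 \sum_i \sum_j (Re (A i j) * Re (B i j) + Im (A i j) * Im (B i j)).
rewrite /frob Re_tr exchange_big /=; apply: eq_bigr => i _.
rewrite mxE Re_sum; apply: eq_bigr => j _.
by rewrite !mxE ReM Re_conj Im_conj mulNr opprK.
Qed.
Lemma frobC A B: frob A B = frob B A.
by rewrite !frobE; do 2 (apply: eq_bigr => ? _); rewrite mulrC (mulrC (Im _)). Qed.
Lemma frobDr A B C: frob A (B + C) = frob A B + frob A C.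
by rewrite /frob mulmxDr mxtraceD ReD. Qed.
Lemma frobNr A B: frob A (- B) = - frob A B.
by rewrite /frob mulmxN linearN /= ReN. Qed.
Lemma frobBr A B C: frob A (B - C) = frob A B - frob A C.
by rewrite frobDr frobNr. Qed.
Lemma frobZr A r B: frob A (r *c B) = r * frob A B.
by rewrite /frob -scalemxAr mxtraceZ ReMr. Qed.
Lemma frobDl A B C: frob (A + B) C = frob A C + frob B C.
by rewrite frobC frobDr !(frobC C). Qed.
Lemma frobNl A B: frob (- A) B = - frob A B.
by rewrite frobC frobNr frobC. Qed.
Lemma frobBl A B C: frob (A - B) C = frob A C - frob B C.
by rewrite frobDl frobNl. Qed.
Lemma frobZl r A B: frob (r *c A) B = r * frob A B.
by rewrite frobC frobZr frobC. Qed.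
Lemma frob0l A: frob 0 A = 0.
by rewrite -(subrr A) frobBl subrr. Qed.
Lemma frob0r A: frob A 0 = 0.
by rewrite frobC frob0l. Qed.
Lemma frob_mull A B C: frob (A *m B) C = frob B (A ^t* *m C).
by rewrite /frob ctrM mulmxA. Qed.
Lemma frob_mulr A B C: frob (A *m B) C = frob A (C *m B ^t*).
by rewrite /frob ctrM -mulmxA mxtrace_mulC mulmxA. Qed.
Lemma frob_ctr A B: frob (A ^t*) (B ^t*) = frob A B.
rewrite !frobE exchange_big /=; do 2 (apply: eq_bigr => ? _).
by rewrite !mxE !Re_conj !Im_conj mulrNN.
Qed.
Lemma frob1l A: frob 1%:M A = Re (\tr A).
by rewrite /frob ctr1 mul1mx. Qed.
Lemma frob_ge0 A: 0 <= frob A A.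
rewrite frobE; do 2 (apply: sumr_ge0 => ? _).
by rewrite -!expr2 addr_ge0 // sqr_ge0.
Qed.
Lemma frob_eq0 A: frob A A = 0 -> A = 0.
rewrite frobE => /eqP; rewrite psumr_eq0; last first.
 by move=> i _; apply: sumr_ge0 => j _; rewrite -!expr2 addr_ge0 // sqr_ge0.
move=> /allP /= A0; apply/matrixP => i j; have := A0 i (mem_index_enum _).
rewrite psumr_eq0; last by move=> k _; rewrite -!expr2 addr_ge0 // sqr_ge0.
move=> /allP /(_ j (mem_index_enum _)) /=.
rewrite -!expr2 paddr_eq0 ?sqr_ge0 // !sqrf_eq0 => /andP[/eqP a /eqP b].
by rewrite mxE; apply: complex_ext.
Qed.
Lemma fnorm_ge0 A: 0 <= frobnorm A.
exact: sqrtr_ge0. Qed.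
Lemma sqr_frobnorm A: frobnorm A ^+ 2 = frob A A.
by rewrite sqr_sqrtr // frob_ge0. Qed.
Lemma frobnorm0: frobnorm (0: M) = 0.
by rewrite /frobnorm frob0l sqrtr0. Qed.
Lemma frobnormN A: frobnorm (- A) = frobnorm A.
by rewrite /frobnorm frobNl frobNr opprK. Qed.
Lemma frobnormZ r A: frobnorm (r *c A) = `|r| * frobnorm A.
by rewrite /frobnorm frobZl frobZr mulrA -expr2 sqrtrM ?sqr_ge0 // sqrtr_sqr.
Qed.
Lemma frobnorm_ctr A: frobnorm (A ^t*) = frobnorm A.
by rewrite /frobnorm frob_ctr. Qed.
Lemma frob_CS A B: frob A B <= frobnorm A * frobnorm B.
have a0 := fnorm_ge0 A; have b0 := fnorm_ge0 B.
have := sqr_frobnorm A; have := sqr_frobnorm B.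
set a := frobnorm A in a0 *; set b := frobnorm B in b0 * => hb ha.
have [b00|b00] := eqVneq b 0.
 move: hb; rewrite b00 expr0n /= => /esym /frob_eq0 ->.
 by rewrite frob0r mulr0.
have bp: 0 < b by rewrite lt_neqAle eq_sym b00.
have [a00|a00] := eqVneq a 0.
 move: ha; rewrite a00 expr0n /= => /esym /frob_eq0 ->.
 by rewrite frob0l mul0r.
have ap: 0 < a by rewrite lt_neqAle eq_sym a00.
have := frob_ge0 (b *c A - a *c B).
rewrite !(frobBl, frobBr, frobZl, frobZr) (frobC B A) -ha -hb.
move=> h; have ab: 0 < a * b by rewrite mulr_gt0.
rewrite -(ler_pM2l ab); nra.
Qed.
Lemma frob_CS_norm A B: `|frob A B| <= frobnorm A * frobnorm B.
by rewrite ler_norml frob_CS andbT lerNl -frobNl -(frobnormN A) frob_CS.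
Qed.
Lemma frobnormD A B: frobnorm (A + B) <= frobnorm A + frobnorm B.
rewrite -(@ler_pXn2r _ 2) // ?nnegrE ?addr_ge0 ?fnorm_ge0 //.
rewrite sqr_frobnorm sqrrD !sqr_frobnorm frobDl !frobDr (frobC B A).
have := frob_CS A B; lra.
Qed.
Lemma frobnormB A B: frobnorm (A - B) <= frobnorm A + frobnorm B.
by rewrite -(frobnormN B) frobnormD. Qed.
Lemma frobnormM A B: frobnorm (A *m B) <= frobnorm A * frobnorm B.
rewrite -(@ler_pXn2r _ 2) // ?nnegrE ?mulr_ge0 ?fnorm_ge0 //.
rewrite exprMn !sqr_frobnorm !frobE.
pose q (z: R[i]) := Re z ^+ 2 + Im z ^+ 2.
have q0 z: 0 <= q z by rewrite addr_ge0 ?sqr_ge0.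
have ->: \sum_i \sum_j (Re ((A *m B) i j) * Re ((A *m B) i j) +
  Im ((A *m B) i j) * Im ((A *m B) i j)) = \sum_i \sum_j q ((A *m B) i j).
 by do 2 (apply: eq_bigr => ? _).
have ->: (\sum_i \sum_j (Re (A i j) * Re (A i j) + Im (A i j) * Im (A i j))) *
 (\sum_i \sum_j (Re (B i j) * Re (B i j) + Im (B i j) * Im (B i j))) =
 (\sum_i \sum_j (\sum_k q (A i k)) * (\sum_k q (B k j))).
 rewrite [X in _ * X]exchange_big /= mulr_suml; apply: eq_bigr => i _.
 by rewrite mulr_sumr; apply: eq_bigr => j _.
apply: ler_sum => i _; apply: ler_sum => j _.
rewrite mxE.
(* polynomial discriminant *)
pose x k := A i k; pose y k := B k j.
rewrite -/(x _) -[X in q X]/(\sum_k x k * y k).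
set S := \sum_k x k * y k.
have key (t: R[i]) : 0 <= \sum_k q (x k - t * Num.conj (y k)).
 by apply: sumr_ge0 => k _.
have expand (t: R[i]) : \sum_k q (x k - t * Num.conj (y k)) =
  \sum_k q (x k) + q t * \sum_k q (y k) - 2 * (Re t * Re S + Im t * Im S).
 rewrite /S Re_sum Im_sum !mulr_sumr -!big_split /= mulr_sumr -sumrB.
 apply: eq_bigr => k _.
 rewrite /q ReD ImD ReN ImN !ReM !ImM Re_conj Im_conj; ring.
set a := \sum_k q (x k); set b := \sum_k q (y k).
have a0: 0 <= a by apply: sumr_ge0 => k _.
have b0: 0 <= b by apply: sumr_ge0 => k _.
have [b00|bn0] := eqVneq b 0.
 have S0: S = 0.
  rewrite /S big1 // => k _.
  move: b00 => /eqP; rewrite psumr_eq0 // => /allP /(_ k (mem_index_enum _)) /=.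
  rewrite paddr_eq0 ?sqr_ge0 // !sqrf_eq0 => /andP[/eqP u /eqP v].
  by rewrite [y k](_: _ = 0) ?mulr0 //; apply: complex_ext.
 by rewrite S0 /q /= expr0n /= addr0 mulr_ge0.
have bp: 0 < b by rewrite lt_neqAle eq_sym bn0.
(* The value of [t] that minimises the expanded sum. *)
have := key (real_complex R b^-1 * S); rewrite expand -/a -/b => h.
move: h; rewrite /q !ReMr !ImMr => h.
have {h}: 0 <= b * (a + ((b^-1 * Re S) ^+ 2 + (b^-1 * Im S) ^+ 2) * b -
  2 * (b^-1 * Re S * Re S + b^-1 * Im S * Im S)) by rewrite mulr_ge0.
rewrite (_: b * _ = a * b - (Re S ^+ 2 + Im S ^+ 2)); last by field.
by rewrite subr_ge0.
Qed.
Lemma Re_le_frobnorm A i j: `|Re (A i j)| <= frobnorm A.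
rewrite -(@ler_pXn2r _ 2) // ?nnegrE ?normr_ge0 ?fnorm_ge0 //.
rewrite sqr_frobnorm frobE (bigD1 i) //= (bigD1 j) //= real_normK ?num_real //.
rewrite -!expr2 -!addrA lerDl addr_ge0 ?sqr_ge0 // addr_ge0 //.
 by apply: sumr_ge0 => k _; rewrite -!expr2 addr_ge0 ?sqr_ge0.
by do 2 (apply: sumr_ge0 => ? _); rewrite -!expr2 addr_ge0 ?sqr_ge0.
Qed.
Lemma Im_le_frobnorm A i j: `|Im (A i j)| <= frobnorm A.
rewrite -(@ler_pXn2r _ 2) // ?nnegrE ?normr_ge0 ?fnorm_ge0 //.
rewrite sqr_frobnorm frobE (bigD1 i) //= (bigD1 j) //= real_normK ?num_real //.
rewrite -!expr2 -!addrA [X in _ <= X]addrC -!addrA lerDl addr_ge0 //; last first.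
 rewrite addr_ge0 ?sqr_ge0 //.
 by do 2 (apply: sumr_ge0 => ? _); rewrite -!expr2 addr_ge0 ?sqr_ge0.
by apply: sumr_ge0 => k _; rewrite -!expr2 addr_ge0 ?sqr_ge0.
Qed.
End frobenius.

(** * Positive semidefinite matrices and their spectral calculus *)

Section psd_theory.
Context {R : realType} {d : nat}.
Local Notation M := 'M[R[i]]_d.
Implicit Types (A B C X Y P Q T: M) (r s: R) (mu nu: 'I_d -> R).
Lemma frob_quad A X: hermitian_mx A ->
 frob (A *m X) X = \sum_i Re ((row i (X ^t*) *m A *m (row i (X ^t*)) ^t*) 0 0).
move=> /hermP hA; rewrite /frob Re_tr; apply: eq_bigr => i _; congr (Re _).
rewrite ctrM hA -!row_mul.
have ->: (row i (X ^t*)) ^t* = col i X.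
 by rewrite tr_row map_col trmxCK.
by rewrite !mxE; apply: eq_bigr => k _; rewrite !mxE.
Qed.
Lemma psdP A: psd A <-> A ^t* = A /\ forall X, 0 <= frob (A *m X) X.
split.
 move=> [hA qA]; split; first exact/hermP.
 by move=> X; rewrite frob_quad //; apply: sumr_ge0.
move=> [/hermP hA qA]; split => // v.
(* All rows of the adjoint of [X] equal [v], so the matrix form is [d] times the vector form; for
   [d = 0] the vector form is an empty sum. *)
pose X : M := (\matrix_(i < d, j < d) v 0 j) ^t*.
have := qA X; rewrite frob_quad //.
have rX i: row i (X ^t*) = v.
 by rewrite trmxCK; apply/rowP => j; rewrite !mxE.
under eq_bigr do rewrite rX.
rewrite sumr_const card_ord; have [d0|d0] := posnP d; last by rewrite pmulrn_lge0.
by move=> _; rewrite mxE big1 // => i; have := ltn_ord i; rewrite {2}d0.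
Qed.
Lemma psd_herm A: psd A -> A ^t* = A. Proof. by move=> /psdP[]. Qed.
Lemma psd_quad A X: psd A -> 0 <= frob (A *m X) X.
by move=> /psdP[_]. Qed.
Lemma psd0: psd (0: M).
apply/psdP; split; first by rewrite trmx0 map_mx0.
by move=> X; rewrite mul0mx frob0l.
Qed.
Lemma psdD A B: psd A -> psd B -> psd (A + B).
move=> /psdP[hA qA] /psdP[hB qB]; apply/psdP; split; first by rewrite ctrD hA hB.
by move=> X; rewrite mulmxDl frobDl addr_ge0.
Qed.
Lemma psdZ r A: 0 <= r -> psd A -> psd (r *c A).
move=> r0 /psdP[hA qA]; apply/psdP; split; first by rewrite ctrZ hA.
by move=> X; rewrite -scalemxAl frobZl mulr_ge0.
Qed.
Lemma psd_congr A X: psd A -> psd (X *m A *m X ^t*).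
move=> /psdP[hA qA]; apply/psdP; split; first by rewrite !ctrM trmxCK hA mulmxA.
by move=> Y; rewrite -!mulmxA frob_mull.
Qed.
Lemma psd_congr_herm A T: T ^t* = T -> psd A -> psd (T *m A *m T).
by move=> hT pA; rewrite -{2}hT; exact: psd_congr. Qed.
Lemma psd1: psd (1%:M : M).
apply/psdP; split; first exact: ctr1.
by move=> X; rewrite mul1mx frob_ge0.
Qed.
Lemma psd_scalar r: 0 <= r -> psd (r *c (1%:M : M)).
by move=> r0; apply: psdZ => //; exact: psd1. Qed.
Lemma psd_tr_ge0 A: psd A -> 0 <= Re (\tr A).
by move=> pA; rewrite Re_tr; apply: sumr_ge0 => i _; exact: psd_diag_ge0. Qed.
Definition dg mu: M := diag_mx (\row_i real_complex R (mu i)).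
Lemma dgM mu nu: dg mu *m dg nu = dg (fun i => mu i * nu i).
rewrite /dg mulmx_diag; congr diag_mx; apply/rowP => i.
by rewrite !mxE rmorphM.
Qed.
Lemma dgD mu nu: dg mu + dg nu = dg (fun i => mu i + nu i).
by rewrite /dg -linearD /=; congr diag_mx; apply/rowP => i; rewrite !mxE rmorphD.
Qed.
Lemma dgZ r mu: r *c dg mu = dg (fun i => r * mu i).
by rewrite /dg -linearZ /=; congr diag_mx; apply/rowP => i; rewrite !mxE rmorphM.
Qed.
Lemma dg1: dg (fun=> 1) = 1%:M.
by apply/matrixP => i j; rewrite !mxE. Qed.
Lemma dg_adj mu: (dg mu) ^t* = dg mu.
apply/matrixP => i j; rewrite !mxE eq_sym rmorphMn /=.
by case: eqP => [->|//] /=; rewrite !mulr1n; exact: conj_real_complex.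
Qed.
(** Functional calculus in a fixed orthonormal basis: matrices of this form commute, and the lemmas
    below turn identities and inequalities between them into statements about eigenvalues. *)
Definition spf Q mu: M := Q ^t* *m dg mu *m Q.

Section fixed_basis.
Context {Q : M} (QQ: Q *m Q ^t* = 1%:M).
Lemma spfM mu nu: spf Q mu *m spf Q nu = spf Q (fun i => mu i * nu i).
rewrite /spf -!mulmxA (mulmxA Q) QQ mul1mx (mulmxA (dg mu)) dgM.
by rewrite !mulmxA.
Qed.
Lemma spfD mu nu: spf Q mu + spf Q nu = spf Q (fun i => mu i + nu i).
by rewrite /spf -mulmxDl -mulmxDr dgD. Qed.
Lemma spfZ r mu: r *c spf Q mu = spf Q (fun i => r * mu i).
by rewrite /spf -dgZ -scalemxAr -scalemxAl. Qed.
Lemma spf1: spf Q (fun=> 1) = 1%:M.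
by rewrite /spf dg1 mulmx1; exact: mulmx1C. Qed.
Lemma spf_adj mu: (spf Q mu) ^t* = spf Q mu.
by rewrite /spf !ctrM trmxCK dg_adj mulmxA. Qed.
Lemma spf_tr mu: \tr (spf Q mu) = real_complex R (\sum_i mu i).
rewrite /spf mxtrace_mulC mulmxA QQ mul1mx /mxtrace rmorph_sum /=.
by apply: eq_bigr => i _; rewrite !mxE eqxx mulr1n.
Qed.
Lemma spf_det mu: \det (spf Q mu) = real_complex R (\prod_i mu i).
rewrite /spf !det_mulmx mulrC mulrA -det_mulmx QQ det1 mul1r /dg det_diag.
by rewrite rmorph_prod; apply: eq_bigr => i _; rewrite mxE.
Qed.
Lemma spf_unit mu: (forall i, mu i != 0) -> spf Q mu \in unitmx.
move=> mu0; rewrite unitmxE spf_det unitfE fmorph_eq0.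
by apply/prodf_neq0 => i _.
Qed.
Lemma spf_inv mu: (forall i, mu i != 0) ->
 invmx (spf Q mu) = spf Q (fun i => (mu i)^-1).
move=> mu0; have U := spf_unit mu0.
apply: (can_inj (mulKmx U)); rewrite mulmxV // spfM -spf1; congr (spf _ _).
by apply/funext => i; rewrite divff.
Qed.
Lemma spf_frob mu nu: frob (spf Q mu) (spf Q nu) = \sum_i mu i * nu i.
by rewrite /frob spf_adj spfM spf_tr. Qed.
Lemma spf_psd mu: (forall i, 0 <= mu i) -> psd (spf Q mu).
move=> mu0; apply/psdP; split; first exact: spf_adj.
move=> X; rewrite /spf -!mulmxA frob_mull trmxCK frobE.
apply: sumr_ge0 => i _; apply: sumr_ge0 => j _.
set Y := Q *m X.
have ->: (dg mu *m Y) i j = real_complex R (mu i) * Y i j.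
 by rewrite /dg mul_diag_mx !mxE.
by rewrite ReMr ImMr -!mulrA -mulrDr mulr_ge0 // -!expr2 addr_ge0 ?sqr_ge0.
Qed.
Lemma psd_spf mu: psd (spf Q mu) -> forall i, 0 <= mu i.
move=> p i; have := psd_congr Q p.
rewrite /spf -!mulmxA QQ mulmx1 mulmxA QQ mul1mx => /(psd_diag_ge0 i).
by rewrite !mxE eqxx mulr1n.
Qed.
End fixed_basis.
Lemma psd_spectral A: psd A -> exists Q mu,
 [/\ Q *m Q ^t* = 1%:M, forall i, 0 <= mu i & A = spf Q mu].
move=> pA; have [hA _] := pA.
exists (spectralmx A), (fun i => Re (spectral_diag A 0 i)).
have U := spectral_unitarymx A.
have QQ: spectralmx A *m (spectralmx A) ^t* = 1%:M by exact/unitarymxP.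
have := hermitian_normalmx hA => /orthomx_spectralP; rewrite invmx_unitary // => E.
have AE: A = spf (spectralmx A) (fun i => Re (spectral_diag A 0 i)).
 rewrite /spf {1}E; congr (_ *m _ *m _); rewrite /dg; congr diag_mx.
 apply/rowP => i; rewrite mxE.
 have /mxOverP/(_ 0 i) := hermitian_spectral_diag_real hA.
 by move=> /complex_realP[x ->].
split=> //; move: pA; rewrite {1}AE; exact: psd_spf.
Qed.
(** Read off from a spectral decomposition picked by [cid], with default 0. Independence of the
    choice is [msqrt_unique]; until then only [msqrt_spec] is available, which provides the
    decomposition that was picked. *)
Definition msqrt A: M :=
 if pselect (exists S Q mu, [/\ Q *m Q ^t* = 1%:M, forall i, 0 <= mu i,
  A = spf Q mu & S = spf Q (fun i => Num.sqrt (mu i))]) is left e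
 then sval (cid e) else 0.
Lemma msqrt_spec A: psd A -> exists Q mu,
 [/\ Q *m Q ^t* = 1%:M, forall i, 0 <= mu i, A = spf Q mu &
  msqrt A = spf Q (fun i => Num.sqrt (mu i))].
move=> /psd_spectral[Q [mu [QQ m0 AE]]]; rewrite /msqrt; case: pselect => [e|].
 exact: (svalP (cid e)).
by case; exists (spf Q (fun i => Num.sqrt (mu i))), Q, mu.
Qed.
Lemma psd_msqrt A: psd A -> psd (msqrt A).
by move=> /msqrt_spec[Q [mu [QQ m0 _ ->]]]; apply: spf_psd => i; exact: sqrtr_ge0.
Qed.
Lemma msqrtK A: psd A -> msqrt A *m msqrt A = A.
move=> /msqrt_spec[Q [mu [QQ m0 AE ->]]]; rewrite spfM // AE; congr spf.
by apply/funext => i; rewrite -expr2 sqr_sqrtr.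
Qed.
Lemma msqrt_unit A: psd A -> A \in unitmx -> msqrt A \in unitmx.
move=> pA; rewrite -{1}(msqrtK pA) unitmx_mul => /andP[] //.
Qed.
Lemma psd_frob_ge0 A B: psd A -> psd B -> 0 <= frob A B.
move=> pA pB; rewrite frobC -(msqrtK pB) frob_mulr (psd_herm (psd_msqrt pB)) frobC.
exact: psd_quad.
Qed.
Lemma ctr_inv A: A \in unitmx -> (invmx A) ^t* = invmx (A ^t*).
by move=> uA; rewrite trmx_inv map_invmx. Qed.
Lemma psd_inv A: psd A -> A \in unitmx -> psd (invmx A).
move=> pA uA; apply/psdP; split; first by rewrite ctr_inv // (psd_herm pA).
move=> X; rewrite -{2}(mulKVmx uA X) frobC; exact: psd_quad.
Qed.
(* the square in [(P - T) P^-1 (P - T) >= 0] is completed with [T] in place of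
  the optimal [P] *)
Lemma frob_dual A P T: psd A -> psd P -> P \in unitmx -> T ^t* = T ->
 2 * frob A T <= frob A P + frob (T *m A *m T) (invmx P).
move=> pA pP uP hT.
have hPT: (P - T) ^t* = P - T by rewrite ctrB (psd_herm pP) hT.
have := psd_frob_ge0 pA (psd_congr_herm hPT (psd_inv pP uP)).
rewrite mulmxBl mulmxV // mulmxBl mul1mx mulmxBr mulmxKV // !frobBr.
by rewrite frob_mulr frob_mull hT -mulmxA; lra.
Qed.
Lemma frob_dual1 A P: psd A -> psd P -> P \in unitmx ->
 2 * Re (\tr A) <= frob A P + frob A (invmx P).
move=> pA pP uP; have := frob_dual pA pP uP ctr1.
by rewrite mul1mx mulmx1 (frobC _ 1%:M) frob1l.
Qed.
(** Coercivity with constant [c] is carried through the whole proof as [psd (A - c *c 1%:M)]; this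
    turns it into a lower bound on eigenvalues. *)
Lemma psd_coercive A c: psd (A - c *c 1%:M) -> 0 < c -> exists Q mu,
 [/\ Q *m Q ^t* = 1%:M, forall i, c <= mu i & A = spf Q mu].
move=> p c0; have pA: psd A.
 by rewrite -(subrK (c *c 1%:M) A); exact: (psdD p (psd_scalar (ltW c0))).
have [Q [mu [QQ m0 AE]]] := psd_spectral pA.
exists Q, mu; split => // i; move: p; rewrite AE -(spf1 QQ) spfZ -scaleN1r.
have ->: -1 = real_complex R (-1) by rewrite rmorphN rmorph1.
rewrite spfZ spfD => /(psd_spf QQ) /(_ i); rewrite /=; lra.
Qed.
Lemma coercive_unit A c: psd (A - c *c 1%:M) -> 0 < c -> A \in unitmx.
move=> /psd_coercive H c0; have [Q [mu [QQ m0 ->]]] := H c0.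
by apply: spf_unit => // i; rewrite gt_eqF // (lt_le_trans c0).
Qed.
Lemma coercive_psd A c: psd (A - c *c 1%:M) -> 0 < c -> psd A.
move=> p c0.
by rewrite -(subrK (c *c 1%:M) A); exact: (psdD p (psd_scalar (ltW c0))).
Qed.
Lemma frobnorm_inv A c: psd (A - c *c 1%:M) -> 0 < c ->
 frobnorm (invmx A) <= d%:R / c.
move=> /psd_coercive H c0; have [Q [mu [QQ m0 ->]]] := H c0.
have mup i: 0 < mu i by rewrite (lt_le_trans c0).
rewrite spf_inv //; last by move=> i; rewrite gt_eqF.
rewrite -(@ler_pXn2r _ 2) // ?nnegrE ?mulr_ge0 ?fnorm_ge0 // ?invr_ge0 ?(ltW c0) //.
rewrite sqr_frobnorm spf_frob // (@le_trans _ _ (\sum_(i < d) c^-1 ^+ 2)) //.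
 apply: ler_sum => i _; rewrite expr2 ler_pM ?invr_ge0 ?(ltW (mup _)) //;
 by rewrite lef_pV2 // posrE.
rewrite sumr_const card_ord -[leLHS]mulr_natl exprMn; apply: ler_wpM2r; first exact: sqr_ge0.
by case: (d) => [|n]; rewrite ?expr0n // -natrX ler_nat expnS leq_pmulr.
Qed.
Lemma tr_inv_le A c: psd (A - c *c 1%:M) -> 0 < c ->
 Re (\tr (invmx A)) <= d%:R / c.
move=> /psd_coercive H c0; have [Q [mu [QQ m0 ->]]] := H c0.
have mup i: 0 < mu i by rewrite (lt_le_trans c0).
rewrite spf_inv //; last by move=> i; rewrite gt_eqF.
rewrite spf_tr //= (@le_trans _ _ (\sum_(i < d) c^-1)) //.
 by apply: ler_sum => i _; rewrite lef_pV2 // posrE.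
by rewrite sumr_const card_ord -[leLHS]mulr_natl.
Qed.
(** The l2 norm of the nonnegative eigenvalues is at most their l1 norm. This makes the trace a
    dominating function for every entry of a density. *)
Lemma frobnorm_psd A: psd A -> frobnorm A <= Re (\tr A).
move=> pA; have [Q [mu [QQ m0 ->]]] := psd_spectral pA.
have s0: 0 <= \sum_i mu i by exact: sumr_ge0.
rewrite spf_tr //=; rewrite -(@ler_pXn2r _ 2) ?nnegrE ?fnorm_ge0 //.
rewrite sqr_frobnorm spf_frob // expr2 mulr_suml; apply: ler_sum => i _.
apply: ler_wpM2l => //.
by rewrite (bigD1 i) //= lerDl; exact: sumr_ge0.
Qed.
End psd_theory.

(** * Measurability of complex and matrix-valued functions *)

Section complex_measurable.
Context {R : realType} {disp : measure_display} {T : measurableType disp}.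
Variable D : set T.
Hypothesis mD : measurable D.
Implicit Types f g : T -> R[i].
Definition cmeas f := measurable_fun D (fun x => Re (f x)) /\
  measurable_fun D (fun x => Im (f x)).
Lemma cmeas_cst c: cmeas (fun=> c).
by split; exact: measurable_cst. Qed.
Lemma cmeasD f g: cmeas f -> cmeas g -> cmeas (fun x => f x + g x).
by move=> [rf If] [rg Ig]; split;
 [under eq_fun do rewrite ReD|under eq_fun do rewrite ImD]; exact: measurable_funD.
Qed.
Lemma cmeasN f: cmeas f -> cmeas (fun x => - f x).
by move=> [rf If]; split; [under eq_fun do rewrite ReN|under eq_fun do rewrite ImN];
 exact: mcomp.
Qed.
Lemma cmeasM f g: cmeas f -> cmeas g -> cmeas (fun x => f x * g x).
move=> [rf If] [rg Ig]; split.
 by under eq_fun do rewrite ReM; apply: measurable_funB; exact: measurable_funM.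
by under eq_fun do rewrite ImM; apply: measurable_funD; exact: measurable_funM.
Qed.
Lemma cmeas_conj f: cmeas f -> cmeas (fun x => Num.conj (f x)).
move=> [rf If]; split; first by under eq_fun do rewrite Re_conj.
by under eq_fun do rewrite Im_conj; exact: mcomp.
Qed.
Lemma cmeas_real (u: T -> R): measurable_fun D u -> cmeas (fun x => real_complex R (u x)).
by move=> mu; split => //=; exact: measurable_cst. Qed.
Lemma cmeas_sum (I: Type) (s: seq I) (P: pred I) (f: I -> T -> R[i]) :
 (forall i, cmeas (f i)) -> cmeas (fun x => \sum_(i <- s | P i) f i x).
move=> mf; elim: s => [|i s IH].
 by under eq_fun do rewrite big_nil; exact: cmeas_cst.
under eq_fun do rewrite big_cons.
by case: (P i) => //; exact: cmeasD.
Qed.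
Lemma cmeas_prod (I: Type) (s: seq I) (P: pred I) (f: I -> T -> R[i]) :
 (forall i, cmeas (f i)) -> cmeas (fun x => \prod_(i <- s | P i) f i x).
move=> mf; elim: s => [|i s IH].
 by under eq_fun do rewrite big_nil; exact: cmeas_cst.
under eq_fun do rewrite big_cons.
by case: (P i) => //; exact: cmeasM.
Qed.
(** The inverse is discontinuous at 0, where its value is 0 by convention; it is the pointwise limit
    of [u / (u^2 + 1/(n+1))], and these are continuous functions of [u]. *)
Lemma measurable_inv (u: T -> R): measurable_fun D u -> measurable_fun D (fun x => (u x)^-1).
move=> mu; pose h n x := u x / (u x ^+ 2 + n.+1%:R^-1).
apply: (measurable_fun_cvg (h := h)).
 move=> n; apply: measurable_funM => //.
 apply: (@mcomp _ _ _ _ _ _ (fun y: R => (y ^+ 2 + n.+1%:R^-1)^-1)) => //.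
 apply: continuous_measurable_fun => y; apply: cvgV.
  by rewrite gt_eqF // ltr_wpDl ?sqr_ge0 ?invr_gt0 ?ltr0n.
 by apply: cvgD; [exact: exprn_continuous|exact: cvg_cst].
move=> x Dx; have [ux0|u0] := eqVneq (u x) 0.
 rewrite ux0 invr0 (_: (fun _ => _) = fun=> 0); first exact: cvg_cst.
 by apply/funext => n; rewrite /h ux0 mul0r.
rewrite [X in _ --> X](_: _ = u x / (u x ^+ 2 + 0)); last first.
 by rewrite addr0 expr2 invfM mulrA divff ?mul1r.
apply: cvgM; first exact: cvg_cst.
apply: cvgV; first by rewrite addr0 expf_neq0.
by apply: cvgD; [exact: cvg_cst|exact: cvg_harmonic].
Qed.
Lemma complex_invE (z: R[i]): z^-1 = Complex
 (Re z / (Re z ^+ 2 + Im z ^+ 2)) (- Im z / (Re z ^+ 2 + Im z ^+ 2)).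
by case: z => a b; rewrite /= mulNr. Qed.
Lemma cmeas_inv f: cmeas f -> cmeas (fun x => (f x)^-1).
move=> [rf If].
have m2: measurable_fun D (fun x => (Re (f x) ^+ 2 + Im (f x) ^+ 2)^-1).
 by apply: measurable_inv; apply: measurable_funD; exact: measurable_funX.
split.
 by under eq_fun do rewrite complex_invE /=; exact: measurable_funM.
under eq_fun do rewrite complex_invE /=.
by apply: measurable_funM => //; exact: mcomp.
Qed.
Lemma cmeas_det n (f: T -> 'M[R[i]]_n) :
 (forall i j, cmeas (fun x => f x i j)) -> cmeas (fun x => \det (f x)).
move=> mf; rewrite /determinant; apply: cmeas_sum => s.
by apply: cmeasM; [exact: cmeas_cst|exact: cmeas_prod].
Qed.
End complex_measurable.

Section matrix_measurable.
Context {R : realType} {d : nat} {disp : measure_display} {T : measurableType disp}.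
Variable D : set T.
Hypothesis mD : measurable D.
Local Notation M := 'M[R[i]]_d.
Implicit Types f g : T -> M.
Lemma mxm_cst A: mx_measurable D (fun=> A : M).
by move=> i j; split; exact: measurable_cst. Qed.
Lemma mxmD f g: mx_measurable D f -> mx_measurable D g ->
 mx_measurable D (fun x => f x + g x).
by move=> mf mg i j; under eq_fun do rewrite mxE; under [X in _ /\ measurable_fun _ X]eq_fun do rewrite mxE;
 exact: (cmeasD (mf i j) (mg i j)).
Qed.
Lemma mxmN f: mx_measurable D f -> mx_measurable D (fun x => - f x).
by move=> mf i j; under eq_fun do rewrite mxE; under [X in _ /\ measurable_fun _ X]eq_fun do rewrite mxE;
 exact: (cmeasN (mf i j)).
Qed.
Lemma mxmB f g: mx_measurable D f -> mx_measurable D g ->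
 mx_measurable D (fun x => f x - g x).
by move=> mf mg; apply: mxmD => //; exact: mxmN. Qed.
Lemma mxmM f g: mx_measurable D f -> mx_measurable D g ->
 mx_measurable D (fun x => f x *m g x).
move=> mf mg i j; under eq_fun do rewrite mxE; under [X in _ /\ measurable_fun _ X]eq_fun do rewrite mxE.
by apply: (@cmeas_sum R _ T D) => k; apply: cmeasM; [exact: mf|exact: mg].
Qed.
Lemma mxmZ (u: T -> R) f: measurable_fun D u -> mx_measurable D f ->
 mx_measurable D (fun x => u x *c f x).
move=> mu mf i j; under eq_fun do rewrite mxE; under [X in _ /\ measurable_fun _ X]eq_fun do rewrite mxE.
by apply: (@cmeasM R _ T D); [exact: cmeas_real|exact: mf].
Qed.
Lemma mxm_ctr f: mx_measurable D f -> mx_measurable D (fun x => (f x) ^t*).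
move=> mf i j; under eq_fun do rewrite !mxE; under [X in _ /\ measurable_fun _ X]eq_fun do rewrite !mxE.
exact: (cmeas_conj (mf j i)).
Qed.
Lemma mxm_if (b: T -> bool) f g: measurable_fun D b ->
 mx_measurable D f -> mx_measurable D g ->
 mx_measurable D (fun x => if b x then f x else g x).
move=> mb mf mg i j; split.
 rewrite (_: (fun _ => _) = fun x => if b x then Re (f x i j) else Re (g x i j)).
  by apply: measurable_fun_if => //; [apply: (measurable_funS mD _ (mf i j).1)|
  apply: (measurable_funS mD _ (mg i j).1)] => ? [].
 by apply/funext => x; case: ifP.
rewrite (_: (fun _ => _) = fun x => if b x then Im (f x i j) else Im (g x i j)).
 by apply: measurable_fun_if => //; [apply: (measurable_funS mD _ (mf i j).2)|
  apply: (measurable_funS mD _ (mg i j).2)] => ? [].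
by apply/funext => x; case: ifP.
Qed.
(** By Cramer's formula the entries of the inverse are rational functions of the entries. *)
Lemma mxm_inv f: mx_measurable D f -> (forall x, D x -> f x \in unitmx) ->
 mx_measurable D (fun x => invmx (f x)).
move=> mf uf i j.
have H: cmeas D (fun x => (\det (f x))^-1 * \adj (f x) i j).
 apply: cmeasM; first by apply: cmeas_inv => //; exact: cmeas_det.
 under [X in cmeas _ X]eq_fun do rewrite mxE.
 rewrite /cofactor; apply: cmeasM; first exact: cmeas_cst.
 apply: cmeas_det => k l.
 under [X in cmeas _ X]eq_fun do rewrite !mxE; exact: mf.
have E x: D x -> invmx (f x) i j = (\det (f x))^-1 * \adj (f x) i j.
 by move=> Dx; rewrite /invmx uf // mxE.
split.
 by apply: (eq_measurable_fun _ _ H.1) => x /[!inE] Dx; rewrite E.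
by apply: (eq_measurable_fun _ _ H.2) => x /[!inE] Dx; rewrite E.
Qed.
Lemma measurable_frob f g: mx_measurable D f -> mx_measurable D g ->
 measurable_fun D (fun x => frob (f x) (g x)).
move=> mf mg; under eq_fun do rewrite frobE.
apply: measurable_sum => i; apply: measurable_sum => j.
by apply: measurable_funD; apply: measurable_funM;
 [exact: (mf i j).1|exact: (mg i j).1|exact: (mf i j).2|exact: (mg i j).2].
Qed.
Lemma measurable_tr f: mx_measurable D f -> measurable_fun D (fun x => Re (\tr (f x))).
by move=> mf; under eq_fun do rewrite -frob1l; apply: measurable_frob => //; exact: mxm_cst.
Qed.
Lemma mxm_cvg (F: (T -> M)^nat) f: (forall n, mx_measurable D (F n)) ->
 (forall x, D x -> forall i j, (fun n => Re (F n x i j)) @ \oo --> Re (f x i j) /\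
  (fun n => Im (F n x i j)) @ \oo --> Im (f x i j)) ->
 mx_measurable D f.
move=> mF Ff i j; split.
 apply: (measurable_fun_cvg (fun n => (mF n i j).1)) => x Dx.
 exact: (Ff x Dx i j).1.
apply: (measurable_fun_cvg (fun n => (mF n i j).2)) => x Dx.
exact: (Ff x Dx i j).2.
Qed.
End matrix_measurable.

(** * Measurability of the matrix square root *)

Section square_root_measurable.
Context {R : realType} {d : nat}.
Local Notation M := 'M[R[i]]_d.
(* Visser's iteration, which increases to the square root on [0, 1] *)
Fixpoint visser (A: M) (n: nat) : M :=
 if n is m.+1 then visser A m + 2^-1 *c (A - visser A m *m visser A m) else 0.
Fixpoint visserr (a: R) (n: nat) : R :=
 if n is m.+1 then visserr a m + 2^-1 * (a - visserr a m * visserr a m) else 0.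
Lemma visser_spf Q (mu: 'I_d -> R) n: Q *m Q ^t* = 1%:M ->
 visser (spf Q mu) n = spf Q (fun i => visserr (mu i) n).
move=> QQ; elim: n => [|n IH] /=.
 by rewrite /spf [dg _](_: _ = 0) ?mulmx0 ?mul0mx //; apply/matrixP => i j;
  rewrite !mxE mul0rn.
rewrite IH spfM // -scaleN1r.
have ->: -1 = real_complex R (-1) by rewrite rmorphN rmorph1.
by rewrite spfZ spfD spfZ spfD; congr spf; apply/funext => i; rewrite mulN1r.
Qed.
(** With [s] the root, one step multiplies the error [s - y] by [1 - (y + s)/2], which is at most
    [1 - s/2] as long as [y >= 0]; for [s = 0] the iteration stays at 0. *)
Lemma visserr_cvg (a: R): 0 <= a <= 1 -> visserr a @ \oo --> Num.sqrt a.
move=> /andP[a0 a1]; set s := Num.sqrt a.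
have s0: 0 <= s by exact: sqrtr_ge0.
have ss: s * s = a by rewrite -expr2 sqr_sqrtr.
have s1: s <= 1 by rewrite -(sqrtr1 R) ler_wsqrtr.
have [s00|sn0] := eqVneq s 0.
 have a00: a = 0 by rewrite -ss s00 mulr0.
 rewrite s00 a00 (_: visserr 0 = fun=> 0); first exact: cvg_cst.
 by apply/funext; elim=> //= n ->; rewrite mulr0 subr0 mulr0 addr0.
have sp: 0 < s by rewrite lt_neqAle eq_sym sn0.
have B n: 0 <= visserr a n <= s /\ s - visserr a n <= (1 - s / 2) ^+ n * s.
 elim: n => [|n [/andP[y0 ys] IH]] /=; first by rewrite lexx s0 subr0 expr0 mul1r.
 set y := visserr a n in y0 ys IH *.
 have E: s - (y + 2^-1 * (a - y * y)) = (s - y) * (1 - (y + s) / 2).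
  by rewrite -ss; field.
 split.
  apply/andP; split; first by rewrite -ss; nra.
  by rewrite -subr_ge0 E mulr_ge0 ?subr_ge0 //; lra.
 rewrite E exprS -mulrA.
 apply: (@le_trans _ _ ((s - y) * (1 - s / 2))).
  apply: ler_wpM2l; first by rewrite subr_ge0.
  lra.
 by rewrite mulrC ler_wpM2l //; lra.
have C: (fun n => s - (1 - s / 2) ^+ n * s) @ \oo --> s.
 rewrite -[X in _ --> X](subr0 s) -[in X in _ --> X](mul0r s).
 apply: cvgB; first exact: cvg_cst.
 apply: cvgM; last exact: cvg_cst.
 apply: cvg_expr; rewrite ger0_norm; lra.
apply: (squeeze_cvgr _ C (cvg_cst s)); apply: nearW => n.
have [/andP[_ h1] h2] := B n.
by rewrite h1 andbT lerBlDr -lerBlDl.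
Qed.
Lemma mxm_msqrt {disp: measure_display} {T : measurableType disp} (D: set T) (f: T -> M) :
 measurable D -> mx_measurable D f -> (forall x, D x -> psd (f x)) ->
 mx_measurable D (fun x => msqrt (f x)).
move=> mD mf pf.
(* Division by one plus the trace brings all eigenvalues into [0, 1], where the iteration converges,
   and never divides by zero. *)
pose c x := 1 + Re (\tr (f x)).
have mc: measurable_fun D c by apply: measurable_funD => //; exact: measurable_tr.
pose F n x := Num.sqrt (c x) *c visser ((c x)^-1 *c f x) n.
apply: (mxm_cvg (F := F)).
 move=> n; apply: mxmZ => //.
  apply: (mcomp (f := @Num.sqrt R)) => //.
  by apply: continuous_measurable_fun => y; exact: sqrt_continuous.
 have mg: mx_measurable D (fun x => (c x)^-1 *c f x).
  by apply: mxmZ => //; exact: measurable_inv.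
 elim: n => [|n IH] /=; first exact: mxm_cst.
 apply: mxmD => //; apply: mxmZ => //; apply: mxmB => //.
 exact: mxmM.
move=> x Dx i j; have [Q [mu [QQ m0 fE sE]]] := msqrt_spec (pf x Dx).
have cE: c x = 1 + \sum_k mu k by rewrite /c fE spf_tr.
have c1: 1 <= c x by rewrite cE lerDl; exact: sumr_ge0.
have c0: 0 < c x by rewrite (lt_le_trans ltr01).
have mb k: 0 <= (c x)^-1 * mu k <= 1.
 rewrite mulr_ge0 ?invr_ge0 ?(ltW c0) //= ler_pdivrMl // mulr1 cE (bigD1 k) //=.
 by rewrite addrCA lerDl addr_ge0 // sumr_ge0.
have FE n: F n x = spf Q (fun k => Num.sqrt (c x) * visserr ((c x)^-1 * mu k) n).
 by rewrite /F fE spfZ (visser_spf _ _ QQ) spfZ.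
have lim k: (fun n => Num.sqrt (c x) * visserr ((c x)^-1 * mu k) n) @ \oo -->
  Num.sqrt (mu k).
 rewrite [X in _ --> X](_: _ = Num.sqrt (c x) * Num.sqrt ((c x)^-1 * mu k)).
  by apply: cvgM; [exact: cvg_cst|exact: visserr_cvg].
 by rewrite -sqrtrM ?(ltW c0) // mulrA divff ?mul1r // gt_eqF.
have entry nu: spf Q nu i j = \sum_k Num.conj (Q k i) * real_complex R (nu k) * Q k j.
 rewrite /spf mxE; apply: eq_bigr => k _; congr (_ * _).
 by rewrite /dg mul_mx_diag !mxE.
rewrite sE; split.
 under eq_fun do rewrite FE entry Re_sum.
 rewrite entry Re_sum; apply: cvg_sumr => k.
 have R1 (r: R) : Re (Num.conj (Q k i) * real_complex R r * Q k j) =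
  r * Re (Num.conj (Q k i) * Q k j) by rewrite mulrAC mulrC ReMr.
 under eq_fun do rewrite R1.
 by rewrite R1; apply: cvgM; [exact: lim|exact: cvg_cst].
under eq_fun do rewrite FE entry Im_sum.
rewrite entry Im_sum; apply: cvg_sumr => k.
have R1 (r: R) : Im (Num.conj (Q k i) * real_complex R r * Q k j) =
  r * Im (Num.conj (Q k i) * Q k j) by rewrite mulrAC mulrC ImMr.
under eq_fun do rewrite R1.
by rewrite R1; apply: cvgM; [exact: lim|exact: cvg_cst].
Qed.
End square_root_measurable.

(** * Real-valued integrals *)

Section real_integrals.
Context {R : realType} {disp : measure_display} {T : measurableType disp}.
Variable mu : {measure set T -> \bar R}.
Implicit Types (D: set T) (f g h: T -> R).
Local Notation intg D f := (mu.-integrable D (EFin \o f)).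
Lemma intg_mfun D f: intg D f -> measurable_fun D f.
by move=> /measurable_int /mEFinP. Qed.
Lemma intg_dom D f h: measurable D -> measurable_fun D f ->
 (forall x, D x -> `|f x| <= h x) -> intg D h -> intg D f.
move=> mD mf fh ih; apply: (le_integrable mD _ _ ih); first exact/mEFinP.
move=> x Dx /=; by rewrite lee_fin (le_trans (fh x Dx)) // ler_norm.
Qed.
Lemma intgD D f g: measurable D -> intg D f -> intg D g -> intg D (fun x => f x + g x).
move=> mD If Ig.
by apply: (eq_integrable mD _ _ _ (integrableD mD If Ig)) => x _ /=; rewrite EFinD.
Qed.
Lemma intgZ D r f: measurable D -> intg D f -> intg D (fun x => r * f x).
move=> mD If.
by apply: (eq_integrable mD _ _ _ (integrableZl mD r If)) => x _ /=; rewrite EFinM.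
Qed.
Lemma intgB D f g: measurable D -> intg D f -> intg D g -> intg D (fun x => f x - g x).
move=> mD If Ig.
by apply: (eq_integrable mD _ _ _ (integrableB mD If Ig)) => x _ /=; rewrite EFinB.
Qed.
Lemma intgM_bounded D f g (K: R): measurable D -> intg D f -> measurable_fun D g ->
 (forall x, D x -> `|g x| <= K) -> intg D (fun x => g x * f x).
move=> mD If mg gK; have /(intgZ K mD) Ih := integrable_norm If.
apply: (intg_dom mD _ _ Ih).
 by apply: measurable_funM => //; exact: intg_mfun If.
by move=> x Dx; rewrite normrM ler_wpM2r // gK.
Qed.
Lemma intg_sum D (I: Type) (s: seq I) (F: I -> T -> R): measurable D ->
 (forall i, intg D (F i)) -> intg D (fun x => \sum_(i <- s) F i x).
move=> mD IF; elim: s => [|i s IH].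
 by under eq_fun do rewrite big_nil; exact: integrable0.
under [X in _.-integrable _ (_ \o X)]eq_fun do rewrite big_cons.
exact: intgD.
Qed.
Lemma Rintegral_sum D (I: Type) (s: seq I) (F: I -> T -> R): measurable D ->
 (forall i, intg D (F i)) ->
 \int[mu]_(x in D) (\sum_(i <- s) F i x) = \sum_(i <- s) \int[mu]_(x in D) F i x.
move=> mD IF; elim: s => [|i s IH].
 rewrite big_nil /Rintegral.
 by under eq_integral do rewrite big_nil; rewrite integral0.
rewrite big_cons -IH -RintegralD //; last exact: intg_sum.
by apply: eq_Rintegral => x _; rewrite big_cons.
Qed.
Lemma EFin_Rintegral D f: measurable D -> intg D f ->
 (\int[mu]_(x in D) f x)%:E = (\int[mu]_(x in D) (f x)%:E)%E.
by move=> mD If; rewrite /Rintegral fineK //; exact: integrable_fin_num. Qed.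
(** Over any measurable part of the set where [f < 0] the integral is both nonnegative and
    nonpositive, so [f] vanishes almost everywhere on that set, which is therefore null. *)
Lemma Rintegral_ge0_ae f: intg setT f ->
 (forall A, measurable A -> 0 <= \int[mu]_(x in A) f x) ->
 {ae mu, forall x, 0 <= f x}.
move=> If f0; have mf := intg_mfun If.
pose A := [set x | f x < 0].
have mA: measurable A.
 have := mf mtop `]-oo, 0[%classic (measurable_itv _).
 by rewrite setTI; congr measurable; apply/seteqP; split => x /=; rewrite in_itv.
have : ae_eq mu A (EFin \o f) (cst 0%E).
 apply: integral_ae_eq => //; first exact: integrableS If.
 move=> E EA mE; rewrite integral0; have IE: intg E f by exact: integrableS If.
 rewrite -(EFin_Rintegral mE IE); congr EFin; apply/eqP.
 rewrite eq_le f0 // andbT -[leRHS]oppr0 -[leLHS]opprK lerN2 /Rintegral.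
 rewrite -fineN -integralN; last exact: integrable_add_def.
 by rewrite fine_ge0 // integral_ge0 // => x /EA /=; rewrite lee_fin oppr_ge0 => /ltW.
move=> [N [mN N0 NA]]; exists N; split => // x /= /negP; rewrite -ltNge => fx0.
apply: NA => /= H; have [] := H fx0; move: fx0; lra.
Qed.
End real_integrals.

(** * Densities of matrix measures with respect to scalar measures *)

Section densities.
Context {R : realType} {d : nat} {Omega : ptopologicalType}.
Local Notation M := 'M[R[i]]_d.
Implicit Types (mu: finmeas R Omega) (g: borel Omega -> M)
 (G: psd_measure R d Omega) (A: set (borel Omega)).
Definition wdens mu g G := [/\ mxmfun g,
 forall i j, intg mu setT (fun x => Re (g x i j)) /\ intg mu setT (fun x => Im (g x i j)) &
 forall A, measurable A -> forall i j,
  Re (G A i j) = \int[mu]_(x in A) Re (g x i j) /\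
  Im (G A i j) = \int[mu]_(x in A) Im (g x i j)].
(** Positivity is asked at every point and not just almost everywhere, so that pointwise matrix
    inequalities need no exceptional set. *)
Definition hasdens mu g G := wdens mu g G /\ forall x, psd (g x).
Lemma intg_frob mu g A W: measurable A ->
 (forall i j, intg mu setT (fun x => Re (g x i j)) /\ intg mu setT (fun x => Im (g x i j))) ->
 intg mu A (fun x => frob (g x) W).
move=> mA ig; under [X in _.-integrable _ (_ \o X)]eq_fun do rewrite frobE.
apply: intg_sum => // i; apply: intg_sum => // j; apply: intgD => //.
 under [X in _.-integrable _ (_ \o X)]eq_fun do rewrite mulrC.
 by apply: intgZ => //; apply: (integrableS mtop) => //; exact: (ig i j).1.
under [X in _.-integrable _ (_ \o X)]eq_fun do rewrite mulrC.
by apply: intgZ => //; apply: (integrableS mtop) => //; exact: (ig i j).2.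
Qed.
Lemma wdens_frob mu g G A W: wdens mu g G -> measurable A ->
 frob (G A) W = \int[mu]_(x in A) frob (g x) W.
move=> [mg ig Gg] mA; rewrite frobE.
have iA i j: intg mu A (fun x => Re (g x i j)) /\ intg mu A (fun x => Im (g x i j)).
 by have [h1 h2] := ig i j; split; apply: (integrableS mtop).
under eq_Rintegral do rewrite frobE.
have iRe i j: intg mu A (fun x => Re (g x i j) * Re (W i j)).
 under [X in _.-integrable _ (_ \o X)]eq_fun do rewrite mulrC.
 by apply: intgZ => //; exact: (iA i j).1.
have iIm i j: intg mu A (fun x => Im (g x i j) * Im (W i j)).
 under [X in _.-integrable _ (_ \o X)]eq_fun do rewrite mulrC.
 by apply: intgZ => //; exact: (iA i j).2.
rewrite Rintegral_sum //; last first.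
 by move=> i; apply: intg_sum => // j; exact: intgD.
apply: eq_bigr => i _; rewrite Rintegral_sum //; last by move=> j; exact: intgD.
apply: eq_bigr => j _; rewrite RintegralD // !RintegralZr //; try exact: (iA _ _).1.
 by have [-> ->] := Gg A mA i j.
exact: (iA i j).2.
Qed.
Lemma dominates_comp mu G i j: trace_measure G `<< mu ->
 re_comp G i j `<< mu /\ im_comp G i j `<< mu.
move=> /null_content_dominatesP Gmu.
have N A: measurable A -> mu A = 0%E -> G A i j = 0.
 move=> mA /(Gmu A mA); rewrite /trace_measure => -[t0].
 have /frobnorm_psd: psd (G A) by exact: psdm_psd.
 rewrite t0 => n0.
 apply: complex_ext; apply/eqP; rewrite -normr_le0 (le_trans _ n0) //.
  exact: Re_le_frobnorm.
 exact: Im_le_frobnorm.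
split; apply/null_content_dominatesP => A mA /(N A mA).
 by rewrite /re_comp => ->.
by rewrite /im_comp => ->.
Qed.
Lemma wdens_exists mu G: trace_measure G `<< mu -> exists g,
 wdens mu g G /\ forall x, (g x) ^t* = g x.
move=> Gmu.
pose re i j x := fine ('d (re_comp G i j) '/d mu x).
pose im i j x := fine ('d (im_comp G i j) '/d mu x).
have dr i j := (dominates_comp i j Gmu).1.
have di i j := (dominates_comp i j Gmu).2.
have reE i j: EFin \o re i j = ('d (re_comp G i j) '/d mu).
 by apply/funext => x; rewrite /= /re fineK //; apply: Radon_Nikodym_fin_num; exact: dr.
have imE i j: EFin \o im i j = ('d (im_comp G i j) '/d mu).
 by apply/funext => x; rewrite /= /im fineK //; apply: Radon_Nikodym_fin_num; exact: di.
have ire i j: intg mu setT (re i j) by rewrite reE; apply: Radon_Nikodym_integrable; exact: dr.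
have iim i j: intg mu setT (im i j) by rewrite imE; apply: Radon_Nikodym_integrable; exact: di.
have reI A i j: measurable A -> \int[mu]_(x in A) re i j x = Re (G A i j).
 move=> mA; rewrite /Rintegral -[X in integral _ _ X]/(EFin \o re i j) reE.
 by rewrite -Radon_Nikodym_integral //; exact: dr.
have imI A i j: measurable A -> \int[mu]_(x in A) im i j x = Im (G A i j).
 move=> mA; rewrite /Rintegral -[X in integral _ _ X]/(EFin \o im i j) imE.
 by rewrite -Radon_Nikodym_integral //; exact: di.
(* The entrywise derivatives form a Hermitian matrix only almost everywhere. Averaging with the
   adjoint makes it Hermitian everywhere and keeps the integrals, because [G A] is Hermitian. *)
pose g x : M := \matrix_(i, j) Complex (2^-1 * (re i j x + re j i x))
 (2^-1 * (im i j x - im j i x)).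
have rg i j: intg mu setT (fun x => Re (g x i j)).
 under [X in _.-integrable _ (_ \o X)]eq_fun do rewrite mxE /=.
 by apply: intgZ => //; exact: intgD.
have Ig i j: intg mu setT (fun x => Im (g x i j)).
 under [X in _.-integrable _ (_ \o X)]eq_fun do rewrite mxE /=.
 by apply: intgZ => //; exact: intgB.
have herm A i j: G A j i = Num.conj (G A i j).
 have /psd_herm h: psd (G A) by exact: psdm_psd.
 by rewrite -{1}h !mxE.
exists g; split; last first.
 move=> x; apply/matrixP => i j; rewrite !mxE; apply: complex_ext.
  by rewrite Re_conj /= addrC.
 by rewrite Im_conj /= -mulrN opprB.
split => //; first by move=> i j; split; exact: intg_mfun.
move=> A mA i j; have iS f: intg mu setT f -> intg mu A f.
 by move=> ?; apply: (integrableS mtop).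
split.
 under eq_Rintegral do rewrite mxE /=.
 rewrite RintegralZl //; last by apply: intgD => //; exact: iS.
 rewrite RintegralD //; try exact: iS.
 by rewrite !reI // (herm A i j) Re_conj; lra.
under eq_Rintegral do rewrite mxE /=.
rewrite RintegralZl //; last by apply: intgB => //; exact: iS.
rewrite RintegralB //; try exact: iS.
by rewrite !imI // (herm A i j) Im_conj; lra.
Qed.
(** Rational matrices are indexed by a countable type, so that [pickle] enumerates them and
    countably many null sets can be united. *)
Definition ratmx (q: {ffun 'I_d * 'I_d -> rat * rat}): M :=
 \matrix_(i, j) Complex (ratr (q (i, j)).1) (ratr (q (i, j)).2).
Lemma ratmx_dense (X: M) (e: R): 0 < e -> exists q, frobnorm (X - ratmx q) <= e.
move=> e0; pose dl := e / (2 * d.+1%:R).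
have d0: 0 < dl by rewrite divr_gt0 // mulr_gt0.
have near (a: R) : exists q: rat, `|a - ratr q| <= dl.
 have : a - dl < a + dl by rewrite ltrBlDr -addrA ltrDl addr_gt0.
 move=> /rat_in_itvoo[q]; rewrite in_itv /= => /andP[h1 h2]; exists q.
 by rewrite ler_norml; lra.
pose f a := sval (cid (near a)).
have fP a: `|a - ratr (f a)| <= dl by rewrite /f; exact: (svalP (cid (near a))).
exists [ffun ij => (f (Re (X ij.1 ij.2)), f (Im (X ij.1 ij.2)))].
rewrite -(@ler_pXn2r _ 2) ?nnegrE ?fnorm_ge0 ?(ltW e0) //.
rewrite sqr_frobnorm frobE.
apply: (@le_trans _ _ (\sum_(i < d) \sum_(j < d) (2 * dl ^+ 2))).
 apply: ler_sum => i _; apply: ler_sum => j _.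
 rewrite !mxE !ffunE /= ReD ImD ReN ImN /= -!expr2.
 have h (u: R) : `|u| <= dl -> u ^+ 2 <= dl ^+ 2.
  by move=> ud; rewrite -(@real_normK _ u) ?num_real // lerXn2r ?nnegrE // ltW.
 by rewrite mulr2n mulrDl mul1r; apply: lerD; apply: h.
rewrite !sumr_const card_ord -!mulrnA -[leLHS]mulr_natr /dl.
have n0: (0: R) <= d%:R by exact: ler0n.
have ->: 2 * (e / (2 * d.+1%:R)) ^+ 2 * (d * d)%:R =
  e ^+ 2 * (2^-1 * (d%:R / d.+1%:R) ^+ 2).
 by rewrite natrM -natr1; field; rewrite nat1r pnatr_eq0.
rewrite ler_piMr ?sqr_ge0 //.
have r1: d%:R / d.+1%:R <= 1 :> R by rewrite ler_pdivrMr // mul1r ler_nat.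
have r0: 0 <= d%:R / d.+1%:R :> R by rewrite divr_ge0.
set r := _ / _ in r1 r0 *; nra.
Qed.
Lemma psd_rat (A: M): A ^t* = A ->
 (forall q, 0 <= frob (A *m ratmx q) (ratmx q)) -> psd A.
move=> hA qA; apply/psdP; split => // X.
apply/ler_addgt0Pr => e e0.
set N := frobnorm A; set x := frobnorm X.
have N0: 0 <= N by exact: fnorm_ge0.
have x0: 0 <= x by exact: fnorm_ge0.
pose C := N * (2 * x + 1) + 1.
have C0: 0 < C by rewrite /C ltr_wpDl // mulr_ge0 // addr_ge0 // mulr_ge0.
pose dl := Num.min 1 (e / C).
have d0: 0 < dl by rewrite lt_min ltr01 divr_gt0.
have [q hq] := ratmx_dense X d0.
set Y := ratmx q in hq; have := qA q; rewrite -/Y => Y0.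
have nY: frobnorm Y <= x + 1.
 rewrite -(subKr X Y) (le_trans (frobnormB _ _)) // lerD2l (le_trans hq) //.
 by rewrite ge_min lexx.
have E: frob (A *m X) X = frob (A *m Y) Y + frob (A *m (X - Y)) X + frob (A *m Y) (X - Y).
 by rewrite mulmxBr frobBl frobBr; ring.
have h1: - (N * dl * x) <= frob (A *m (X - Y)) X.
 rewrite -[leRHS]opprK lerN2 (le_trans (ler_norm _)) // normrN.
 apply: le_trans (frob_CS_norm _ _) _; apply: ler_wpM2r => //.
 apply: le_trans (frobnormM _ _) _; exact: ler_wpM2l.
have h2: - (N * (x + 1) * dl) <= frob (A *m Y) (X - Y).
 rewrite -[leRHS]opprK lerN2 (le_trans (ler_norm _)) // normrN.
 apply: le_trans (frob_CS_norm _ _) _; apply: ler_pM => //; try exact: fnorm_ge0.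
 apply: le_trans (frobnormM _ _) _; exact: ler_wpM2l.
have h3: dl * C <= e by rewrite -ler_pdivlMr // ge_min lexx orbT.
move: (frob (A *m Y) Y) (frob (A *m (X - Y)) X) (frob (A *m Y) (X - Y)) E h1 h2 h3 Y0 d0.
by rewrite /C => a b c -> h1 h2 h3 a0 d0; lra.
Qed.
(** Each rational test matrix yields a scalar density whose integrals are nonnegative, hence is
    itself nonnegative off a null set. Countably many such tests decide positivity, by density. *)
Lemma wdens_psd mu g G: wdens mu g G -> (forall x, (g x) ^t* = g x) ->
 {ae mu, forall x, psd (g x)}.
move=> wg hg; have [mg ig Gg] := wg.
pose P n (x: borel Omega) := if @unpickle {ffun 'I_d * 'I_d -> rat * rat} n is Some q
 then 0 <= frob (g x *m ratmx q) (ratmx q) else true.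
have : {ae mu, forall x, forall n, P n x}.
 apply/ae_foralln => n; rewrite /P; case: unpickle => [q|]; last exact: aeW.
 apply: (@Rintegral_ge0_ae _ _ _ mu (fun x => frob (g x *m ratmx q) (ratmx q))).
  under [X in _.-integrable _ (_ \o X)]eq_fun do rewrite frob_mulr.
  exact: intg_frob.
 move=> A mA; under eq_Rintegral do rewrite frob_mulr.
 rewrite -(wdens_frob _ wg) // -frob_mulr; apply: psd_quad; exact: psdm_psd.
apply: filterS => x Px; apply: psd_rat => // q.
by have := Px (pickle q); rewrite /P pickleK.
Qed.
Lemma hasdens_exists mu G: trace_measure G `<< mu -> exists g, hasdens mu g G.
move=> /wdens_exists[g [wg hg]]; have [mg ig Gg] := wg.
(* On the exceptional null set [N] the density is replaced by 0. *)
have [N [mN N0 NP]] := wdens_psd wg hg.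
pose b x := x \in N.
have mb: mfun b.
 apply: (measurable_fun_bool true); rewrite setTI.
 rewrite (_: _ @^-1` _ = N) //.
 by apply/seteqP; split => x /=; rewrite /b; [exact: set_mem|exact: mem_set].
exists (fun x => if b x then 0 else g x); split; last first.
 move=> x; rewrite /b; case: ifPn => [_|]; first exact: psd0.
 rewrite notin_setE => Nx; apply: contrapT => npsd; exact/Nx/NP.
have mg': mxmfun (fun x => if b x then 0 else g x).
 by apply: mxm_if => //; exact: mxm_cst.
have aeE (F: M -> R) A : ae_eq mu A (EFin \o (fun x => F (g x)))
  (EFin \o (fun x => F (if b x then 0 else g x))).
 exists N; split => // x /= /not_implyP[_ H]; apply: contrapT => Nx; apply: H.
 by rewrite /b memNset.
split => //.
 move=> i j; split.
  apply: (@intg_dom _ _ _ mu _ _ (fun x => `|Re (g x i j)|)) => //.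
  - exact: (mg' i j).1.
  - by move=> x _; case: ifP => // _; rewrite mxE /= normr0.
  - by apply: integrable_norm => //; exact: (ig i j).1.
 apply: (@intg_dom _ _ _ mu _ _ (fun x => `|Im (g x i j)|)) => //.
 - exact: (mg' i j).2.
 - by move=> x _; case: ifP => // _; rewrite mxE /= normr0.
 - by apply: integrable_norm => //; exact: (ig i j).2.
move=> A mA i j; have [-> ->] := Gg A mA i j.
have mS f: mfun f -> measurable_fun A (EFin \o f).
 by move=> mf; apply/mEFinP; exact: measurable_funS mf.
split; congr fine; apply: ae_eq_integral => //.
- exact: mS (mg i j).1.
- exact: mS (mg' i j).1.
- exact: (aeE (fun Z => Re (Z i j)) A).
- exact: mS (mg i j).2.
- exact: mS (mg' i j).2.
- exact: (aeE (fun Z => Im (Z i j)) A).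
Qed.
End densities.

(** * Integrals against a matrix measure, computed from any density *)

Section density_calculus.
Context {R : realType} {d : nat} {Omega : ptopologicalType}.
Local Notation M := 'M[R[i]]_d.
Implicit Types (mu: finmeas R Omega) (g: borel Omega -> M)
 (G H: psd_measure R d Omega) (A: set (borel Omega)).
Definition tr_re (A: M): R := Re (\tr A).
Lemma psd_le_tr (A: M): psd A -> frobnorm A <= tr_re A.
exact: frobnorm_psd. Qed.
Lemma hasdens_meas mu g G: hasdens mu g G -> mxmfun g.
by case=> -[]. Qed.
Lemma hasdens_psd mu g G x: hasdens mu g G -> psd (g x).
by case=> _; exact. Qed.
Lemma hasdens_tr_meas mu g G: hasdens mu g G -> mfun (fun x => tr_re (g x)).
by move=> /hasdens_meas; exact: measurable_tr. Qed.
Lemma hasdens_tr_intg mu g G: hasdens mu g G -> intg mu setT (fun x => tr_re (g x)).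
move=> [[mg ig _] _].
under [X in _.-integrable _ (_ \o X)]eq_fun do rewrite /tr_re -frob1l frobC.
exact: intg_frob.
Qed.
Lemma hasdens_tr_ge0 mu g G x: hasdens mu g G -> 0 <= tr_re (g x).
by case=> _ /(_ x) /psd_tr_ge0. Qed.
Lemma hasdens_trace mu g G A: hasdens mu g G -> measurable A ->
 trace_measure G A = (\int[mu]_(x in A) (tr_re (g x))%:E)%E.
move=> hg mA; rewrite /trace_measure -frob1l frobC (wdens_frob _ hg.1 mA).
rewrite EFin_Rintegral //; last by apply: intg_frob => //; case: hg => -[].
by apply: eq_integral => x _; rewrite frobC frob1l.
Qed.
Lemma hasdens_dom mu g G: hasdens mu g G -> trace_measure G `<< mu.
move=> hg; apply/null_content_dominatesP => A mA A0.
rewrite (hasdens_trace hg mA); apply: null_set_integral => //.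
by apply/mEFinP; apply: measurable_funS (hasdens_tr_meas hg).
Qed.
Lemma hasdens_change mu g G (f: borel Omega -> \bar R): hasdens mu g G ->
 mfun f -> (forall x, (0 <= f x)%E) ->
 (\int[trace_measure G]_x f x = \int[mu]_x (f x * (tr_re (g x))%:E))%E.
move=> hg mf f0; have dom := hasdens_dom hg.
rewrite -(Radon_Nikodym_SigmaFinite.change_of_variables dom f0 mtop mf).
have mRN: mfun (Radon_Nikodym_SigmaFinite.f (trace_measure G) mu).
 exact: measurable_int (Radon_Nikodym_SigmaFinite.f_integrable dom).
have mt: mfun (fun x => (tr_re (g x))%:E).
 by apply/mEFinP; exact: hasdens_tr_meas hg.
apply: ae_eq_integral => //; try exact: emeasurable_funM.
apply: ae_eqe_mul2l; apply: integral_ae_eq => //.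
 exact: Radon_Nikodym_SigmaFinite.f_integrable.
move=> E _ mE; rewrite -(Radon_Nikodym_SigmaFinite.f_integral dom) //.
exact: hasdens_trace.
Qed.
Lemma hasdens_changeR mu g G (u: borel Omega -> R): hasdens mu g G ->
 mfun u ->
 (\int[trace_measure G]_x (u x)%:E = \int[mu]_x (u x * tr_re (g x))%:E)%E.
move=> hg mu_; rewrite integralE [RHS]integralE.
have mU: mfun (EFin \o u) by exact/mEFinP.
rewrite (hasdens_change hg (measurable_funepos mU)) //.
rewrite (hasdens_change hg (measurable_funeneg mU)) //.
congr (_ - _)%E; apply: eq_integral => x _; have t0 := hasdens_tr_ge0 x hg.
 by rewrite !funeposE /= -!EFin_max -EFinM maxr_pMl // mul0r.
by rewrite !funenegE /= -!EFin_max -EFinM maxr_pMl // mul0r mulNr.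
Qed.
Lemma trace_dom_refl G: trace_measure G `<< trace_measure G.
by move=> A. Qed.
Lemma dens_meas G: mxmfun (dens G: borel Omega -> M).
have D i j := dominates_comp i j (@trace_dom_refl G).
move=> i j; split; under eq_fun do rewrite mxE /=.
 apply/mEFinP; apply: eq_measurable_fun; last first.
  exact: measurable_int (Radon_Nikodym_integrable (D i j).1).
 by move=> x _ /=; rewrite fineK //; apply: Radon_Nikodym_fin_num; exact: (D i j).1.
apply/mEFinP; apply: eq_measurable_fun; last first.
 exact: measurable_int (Radon_Nikodym_integrable (D i j).2).
by move=> x _ /=; rewrite fineK //; apply: Radon_Nikodym_fin_num; exact: (D i j).2.
Qed.
(** The chain rule for Radon-Nikodym derivatives, applied to each entry: it links a density with
    respect to any [mu] to [dens], the density with respect to the trace, through which all pairings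
    are defined. *)
Lemma hasdens_dens mu g G: hasdens mu g G ->
 {ae mu, forall x, g x = tr_re (g x) *c dens G x}.
move=> hg; have dom := hasdens_dom hg.
have [[mg ig Gg] pg] := hg.
have self := @trace_dom_refl G.
have T: ae_eq mu setT ('d (charge_of_finite_measure (trace_measure G)) '/d mu)
  (fun x => (tr_re (g x))%:E).
 apply: integral_ae_eq => //.
 - exact: Radon_Nikodym_integrable.
 - by apply/mEFinP; exact: hasdens_tr_meas hg.
 - move=> E _ mE; rewrite -Radon_Nikodym_integral //.
  exact: hasdens_trace.
have ReE i j: {ae mu, forall x, Re (g x i j) = tr_re (g x) * Re (dens G x i j)}.
 have E1 := Radon_Nikodym_chain_rule (dominates_comp i j self).1 dom.
 have E2: ae_eq mu setT ('d (re_comp G i j) '/d mu) (fun x => (Re (g x i j))%:E).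
  apply: integral_ae_eq => //.
  - exact: Radon_Nikodym_integrable (dominates_comp i j dom).1.
  - by apply/mEFinP; exact: (mg i j).1.
  - move=> E _ mE; rewrite -Radon_Nikodym_integral //; last exact: (dominates_comp i j dom).1.
  rewrite -EFin_Rintegral //; last first.
  by apply: (integrableS mtop) => //; exact: (ig i j).1.
  by congr EFin; exact: (Gg E mE i j).1.
 move: E1 E2 T; apply: filterS3 => x /(_ I) e1 /(_ I) e2 /(_ I) e3.
 move: e1; rewrite e2 /= e3 mxE /= => e1.
 apply/EFin_inj; rewrite e1 EFinM muleC fineK //.
 by apply: Radon_Nikodym_fin_num; exact: (dominates_comp i j self).1.
have ImE i j: {ae mu, forall x, Im (g x i j) = tr_re (g x) * Im (dens G x i j)}.
 have E1 := Radon_Nikodym_chain_rule (dominates_comp i j self).2 dom.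
 have E2: ae_eq mu setT ('d (im_comp G i j) '/d mu) (fun x => (Im (g x i j))%:E).
  apply: integral_ae_eq => //.
  - exact: Radon_Nikodym_integrable (dominates_comp i j dom).2.
  - by apply/mEFinP; exact: (mg i j).2.
  - move=> E _ mE; rewrite -Radon_Nikodym_integral //; last exact: (dominates_comp i j dom).2.
  rewrite -EFin_Rintegral //; last first.
  by apply: (integrableS mtop) => //; exact: (ig i j).2.
  by congr EFin; exact: (Gg E mE i j).2.
 move: E1 E2 T; apply: filterS3 => x /(_ I) e1 /(_ I) e2 /(_ I) e3.
 move: e1; rewrite e2 /= e3 mxE /= => e1.
 apply/EFin_inj; rewrite e1 EFinM muleC fineK //.
 by apply: Radon_Nikodym_fin_num; exact: (dominates_comp i j self).2.
have A: {ae mu, forall x, forall ij: 'I_d * 'I_d,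
  Re (g x ij.1 ij.2) = tr_re (g x) * Re (dens G x ij.1 ij.2) /\
  Im (g x ij.1 ij.2) = tr_re (g x) * Im (dens G x ij.1 ij.2)}.
 pose P n (x: borel Omega) : Prop := if @unpickle ('I_d * 'I_d)%type n is Some ij
  then Re (g x ij.1 ij.2) = tr_re (g x) * Re (dens G x ij.1 ij.2) /\
  Im (g x ij.1 ij.2) = tr_re (g x) * Im (dens G x ij.1 ij.2) else True.
 have : {ae mu, forall x, forall n, P n x}.
  apply/ae_foralln => n; rewrite /P; case: unpickle => [ij|]; last exact: aeW.
  by apply: filterS2 (ReE ij.1 ij.2) (ImE ij.1 ij.2) => x h1 h2.
 by apply: filterS => x Px ij; have := Px (pickle ij); rewrite /P pickleK.
apply: filterS A => x H; apply/matrixP => i j; rewrite mxE.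
by have [h1 h2] := H (i, j); apply: complex_ext; rewrite ?ReMr ?ImMr.
Qed.
(** Homogeneity of degree one in the matrix absorbs the factor between the two densities, so that
    the integral does not depend on the reference measure. *)
Lemma hasdens_integral mu g G (F: M -> borel Omega -> R): hasdens mu g G ->
 (forall (B: M) (r: R) x, F (r *c B) x = r * F B x) ->
 (forall g', mxmfun g' -> mfun (fun x => F (g' x) x)) ->
 (\int[trace_measure G]_x (F (dens G x) x)%:E = \int[mu]_x (F (g x) x)%:E)%E.
move=> hg hF mF; rewrite (hasdens_changeR hg); last by apply: (mF (dens G)); exact: dens_meas.
apply: ae_eq_integral => //.
- apply/mEFinP/measurable_funM; first by apply: (mF (dens G)); exact: dens_meas.
 exact: hasdens_tr_meas hg.
- by apply/mEFinP; apply: (mF g); exact: hasdens_meas hg.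
- apply: filterS (hasdens_dens hg) => x gE _.
 by rewrite [in RHS]gE hF mulrC.
Qed.
Lemma pairing_dens mu g G (Psi: Omega -> M): hasdens mu g G ->
 mxmfun (Psi: borel Omega -> M) ->
 pairing G Psi = \int[mu]_x frob (g x) (Psi x).
move=> hg mP; congr fine.
apply: (hasdens_integral (F := fun (B: M) x => frob B (Psi x)) hg).
 by move=> A r x; rewrite frobZl.
by move=> g' mg'; exact: measurable_frob.
Qed.
Lemma pairing2_dens mu g G (U V: Omega -> M): hasdens mu g G ->
 mxmfun (U: borel Omega -> M) ->
 mxmfun (V: borel Omega -> M) ->
 pairing2 G U V = \int[mu]_x frob (g x *m U x) (V x).
move=> hg mU mV; congr fine.
apply: (hasdens_integral (F := fun (B: M) x => frob (B *m U x) (V x)) hg).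
 by move=> A r x; rewrite -scalemxAl frobZl.
by move=> g' mg'; apply: measurable_frob => //; exact: mxmM.
Qed.
Lemma sqnorm_dens mu g G (U: Omega -> M): hasdens mu g G ->
 mxmfun (U: borel Omega -> M) ->
 (sqnorm G U = \int[mu]_x (frob (g x *m U x) (U x))%:E)%E.
move=> hg mU.
apply: (hasdens_integral (F := fun (B: M) x => frob (B *m U x) (U x)) hg).
 by move=> A r x; rewrite -scalemxAl frobZl.
by move=> g' mg'; apply: measurable_frob => //; exact: mxmM.
Qed.
Lemma hasdens_eq mu g G H: eq_measure G H -> hasdens mu g G -> hasdens mu g H.
by move=> GH [[mg ig Gg] pg]; split => //; split => // A mA; rewrite -GH //; exact: Gg. Qed.
Lemma hasdens_frob_intg mu g G (Psi: borel Omega -> M) (K: R): hasdens mu g G ->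
 mxmfun Psi -> (forall x, frobnorm (Psi x) <= K) ->
 intg mu setT (fun x => frob (g x) (Psi x)).
move=> hg mP PK; apply: (@intg_dom _ _ _ mu _ _ (fun x => K * tr_re (g x))) => //.
- by apply: measurable_frob => //; exact: hasdens_meas hg.
- move=> x _; apply: le_trans (frob_CS_norm _ _) _; rewrite mulrC.
 apply: ler_pM => //; try exact: fnorm_ge0.
 exact: psd_le_tr (hasdens_psd x hg).
- by apply: intgZ => //; exact: hasdens_tr_intg hg.
Qed.
Lemma prob_tr mu g (G: prob R d Omega): hasdens mu g G ->
 \int[mu]_x tr_re (g x) = 1.
move=> hg; have := hasdens_trace hg mtop.
by rewrite /trace_measure prob_trace /= /Rintegral => <-.
Qed.

Section of_density.
Variables (mu: finmeas R Omega) (g: borel Omega -> M).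
Hypotheses (mg: mxmfun g) (pg: forall x, psd (g x))
 (ig: intg mu setT (fun x => tr_re (g x))).
Let iRe i j: intg mu setT (fun x => Re (g x i j)).
apply: (intg_dom _ _ _ ig) => //; first exact: (mg i j).1.
by move=> x _; apply: le_trans (Re_le_frobnorm _ _ _) _; exact: psd_le_tr.
Qed.
Let iIm i j: intg mu setT (fun x => Im (g x i j)).
apply: (intg_dom _ _ _ ig) => //; first exact: (mg i j).2.
by move=> x _; apply: le_trans (Im_le_frobnorm _ _ _) _; exact: psd_le_tr.
Qed.
(** The value 0 on non-measurable sets is needed because [psdm_psd] ranges over all sets. *)
Definition of_dens_fun A: M := if `[< measurable A >] then
 \matrix_(i, j) Complex (\int[mu]_(x in A) Re (g x i j)) (\int[mu]_(x in A) Im (g x i j))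
 else 0.
Let of_dens_frob A W: measurable A ->
 frob (of_dens_fun A) W = \int[mu]_(x in A) frob (g x) W.
move=> mA; rewrite /of_dens_fun asboolT // frobE.
have SRe i j: intg mu A (fun x => Re (g x i j)) by exact: integrableS (iRe i j).
have SIm i j: intg mu A (fun x => Im (g x i j)) by exact: integrableS (iIm i j).
have iR i j: intg mu A (fun x => Re (g x i j) * Re (W i j)).
 under [X in _.-integrable _ (_ \o X)]eq_fun do rewrite mulrC.
 exact: intgZ.
have iI i j: intg mu A (fun x => Im (g x i j) * Im (W i j)).
 under [X in _.-integrable _ (_ \o X)]eq_fun do rewrite mulrC.
 exact: intgZ.
under eq_Rintegral do rewrite frobE.
rewrite Rintegral_sum //; last by move=> i; apply: intg_sum => // j; exact: intgD.
apply: eq_bigr => i _; rewrite Rintegral_sum //; last by move=> j; exact: intgD.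
by apply: eq_bigr => j _; rewrite RintegralD // !RintegralZr // !mxE.
Qed.
Lemma of_dens_psd A: psd (of_dens_fun A).
have [mA|nA] := pselect (measurable A); last first.
 by rewrite /of_dens_fun asboolF //; exact: psd0.
apply/psdP; split.
 rewrite /of_dens_fun asboolT //; apply/matrixP => i j; rewrite !mxE.
 have gE x: g x j i = Num.conj (g x i j).
  by rewrite -{1}(psd_herm (pg x)) !mxE.
 apply: complex_ext; rewrite ?Re_conj ?Im_conj /=.
  by apply: eq_Rintegral => x _; rewrite gE Re_conj.
 rewrite -mulN1r -RintegralZl //; last exact: integrableS (iIm j i).
 by apply: eq_Rintegral => x _; rewrite gE Im_conj mulN1r opprK.
move=> X; rewrite frob_mulr of_dens_frob //; apply: Rintegral_ge0 => x _.
by rewrite -frob_mulr psd_quad.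
Qed.
Lemma of_dens0: of_dens_fun set0 = 0.
rewrite /of_dens_fun asboolT //; apply/matrixP => i j; rewrite !mxE !Rintegral_set0.
exact: complex_ext.
Qed.
Let sigma (f: borel Omega -> R): intg mu setT f ->
 forall F: (set (borel Omega))^nat, (forall n, measurable (F n)) -> trivIset setT F ->
 (fun n => \sum_(0 <= k < n) \int[mu]_(x in F k) f x) @ \oo -->
  \int[mu]_(x in \bigcup_k F k) f x.
move=> If F mF tF; have mU: measurable (\bigcup_k F k) by exact: bigcup_measurable.
have /(_ F mF tF mU) : semi_sigma_additive (induced_charge If).
 exact: charge_semi_sigma_additive.
have iS A: measurable A -> intg mu A f.
 by move=> mA; exact: integrableS If.
rewrite /induced_charge -[X in _ --> X](EFin_Rintegral mU) //; last exact: iS.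
move=> /fine_cvg; rewrite (_: fine \o _ = (fun n => \sum_(0 <= k < n) \int[mu]_(x in F k) f x)) //.
apply/funext => n /=.
by under eq_bigr => k _ do rewrite -(EFin_Rintegral (mF k) (iS _ (mF k))); rewrite sumEFin.
Qed.
Lemma of_dens_sigma: forall F: (set (borel Omega))^nat,
  (forall n, measurable (F n)) -> trivIset setT F -> forall i j,
  (fun n => \sum_(0 <= k < n) Re (of_dens_fun (F k) i j)) @ \oo
  --> Re (of_dens_fun (\bigcup_k F k) i j) /\
  (fun n => \sum_(0 <= k < n) Im (of_dens_fun (F k) i j)) @ \oo
  --> Im (of_dens_fun (\bigcup_k F k) i j).
move=> F mF tF i j; have mU: measurable (\bigcup_k F k) by exact: bigcup_measurable.
have E n: of_dens_fun (F n) i j =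
  Complex (\int[mu]_(x in F n) Re (g x i j)) (\int[mu]_(x in F n) Im (g x i j)).
 by rewrite /of_dens_fun asboolT // mxE.
rewrite /of_dens_fun asboolT // mxE /=; split.
 rewrite (_: (fun n => _) = fun n => \sum_(0 <= k < n) \int[mu]_(x in F k) Re (g x i j)).
  exact: sigma.
 by apply/funext => n; apply: eq_bigr => k _; rewrite -/(of_dens_fun _) E.
rewrite (_: (fun n => _) = fun n => \sum_(0 <= k < n) \int[mu]_(x in F k) Im (g x i j)).
 exact: sigma.
by apply/funext => n; apply: eq_bigr => k _; rewrite -/(of_dens_fun _) E.
Qed.
Definition of_dens: psd_measure R d Omega :=
 PsdMeasure of_dens_psd of_dens0 of_dens_sigma.
Lemma of_densP: hasdens mu g of_dens.
split => //; split => // A mA i j.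
by rewrite /= /of_dens_fun asboolT // mxE.
Qed.
Hypothesis g1 : \int[mu]_x tr_re (g x) = 1.
Lemma of_dens_trace: \tr (of_dens setT) = 1.
have R1: Re (\tr (of_dens setT)) = 1.
 rewrite -frob1l frobC (of_dens_frob _ mtop) -g1.
 by apply: eq_Rintegral => x _; rewrite frobC frob1l.
apply: complex_ext => //=; have h := psd_herm (of_dens_psd setT).
have : \tr (of_dens_fun setT) = Num.conj (\tr (of_dens_fun setT)).
 by rewrite -{1}h /mxtrace rmorph_sum; apply: eq_bigr => i _; rewrite !mxE.
by move=> /(congr1 (@complex.Im R)); rewrite Im_conj => /eqP; rewrite -subr_eq0 opprK -mulr2n mulrn_eq0 => /eqP.
Qed.
Definition prob_of_dens: prob R d Omega := Prob of_dens_trace.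
End of_density.
End density_calculus.

(** * Metric topology, Borel sets and a positive function vanishing at infinity *)

Definition metrizes (R: realType) (T: topologicalType) (dist: T -> T -> R) :=
 [/\ forall x, dist x x = 0, forall x y, dist x y = dist y x,
  forall x y z, dist x z <= dist x y + dist y z &
  forall x (A: set T), nbhs x A <->
  exists2 e: R, 0 < e & [set y | dist x y < e] `<=` A].

Section metric_topology.
Context {R : realType} {Omega : ptopologicalType}.
Variable dist : Omega -> Omega -> R.
Hypothesis dM : metrizes dist.
Let dxx: forall x, dist x x = 0.
by case: dM. Qed.
Let dC: forall x y, dist x y = dist y x.
by case: dM. Qed.
Let dT: forall x y z, dist x z <= dist x y + dist y z.
by case: dM. Qed.
Let dN: forall x (A: set Omega), nbhs x A <->
 exists2 e: R, 0 < e & [set y | dist x y < e] `<=` A.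
by case: dM. Qed.
Lemma dist_ge0 x y: 0 <= dist x y.
have := dT x y x; rewrite dxx (dC y x); lra. Qed.
Lemma lip_continuous (u: Omega -> R) (K: R): 0 < K ->
 (forall x y, u x - u y <= K * dist x y) -> continuous u.
move=> K0 uK x; apply/cvgrPdist_lt => e e0; apply/dN.
exists (e / K); first by rewrite divr_gt0.
move=> y /= xy; rewrite ltr_norml.
have xy': K * dist x y < e by rewrite mulrC -ltr_pdivlMr.
have := uK x y; have := uK y x; rewrite (dC y x); lra.
Qed.
Lemma dist_open x e: open [set y | dist x y < e].
rewrite openE => y /= xy; apply/dN; exists (e - dist x y); first by rewrite subr_gt0.
by move=> z /= yz; have := dT x y z; lra.
Qed.
Lemma dist_closed x e: closed [set y | dist x y <= e].
rewrite -openC openE => y /= /negP; rewrite -ltNge => xy.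
apply/dN; exists (dist x y - e); first by rewrite subr_gt0.
move=> z /= yz xz; have := dT x z y; rewrite (dC z y); lra.
Qed.
Definition dset (A: set Omega) x := inf [set dist x y | y in A].
Lemma dset_lip (A: set Omega) x y: A !=set0 -> dset A x - dset A y <= dist x y.
move=> [a Aa].
have lb z: has_lbound [set dist z w | w in A].
 by exists 0 => _ [w _ <-]; exact: dist_ge0.
rewrite lerBlDr addrC -lerBlDr; apply: lb_le_inf; first by exists (dist y a), a.
move=> _ [w Aw <-]; rewrite lerBlDr addrC.
apply: le_trans (dT x y w); apply: ge_inf => //.
by exists w.
Qed.
Lemma dset_ge0 (A: set Omega) x: A !=set0 -> 0 <= dset A x.
move=> [a Aa]; apply: lb_le_inf; first by exists (dist x a), a.
by move=> _ [w Aw <-]; exact: dist_ge0.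
Qed.
Lemma closed_approx (A: set Omega): closed A -> exists f: nat -> Omega -> R,
 [/\ forall n, continuous (f n), forall n x, 0 <= f n x <= 1 &
  forall x, (fun n => f n x) @ \oo --> (\1_A x : R)].
move=> cA; have [->|/set0P A0] := eqVneq A set0.
 exists (fun _ _ => 0); split => //; first by move=> n x; exact: cvg_cst.
  by move=> n x; rewrite lexx ler01.
 by move=> x; rewrite indic0; exact: cvg_cst.
pose f n x := Num.max 0 (1 - n.+1%:R * dset A x).
exists f; split.
- move=> n; apply: (lip_continuous (K := n.+1%:R)) => //.
 move=> x y; rewrite /f.
 have h := dset_lip y x A0; rewrite (dC y x) in h.
 have h0: (0: R) <= n.+1%:R by [].
 have h2: n.+1%:R * (dset A y - dset A x) <= n.+1%:R * dist x y by exact: ler_wpM2l.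
 have h3: 0 <= n.+1%:R * dist x y by rewrite mulr_ge0 // dist_ge0.
 by rewrite !maxEge; do ?[case: ifPn; rewrite -?ltNge => ?]; lra.
- move=> n x; rewrite /f le_max lexx /= ge_max ler01 /= lerBlDr lerDl.
 by rewrite mulr_ge0 // dset_ge0.
- move=> x; rewrite indicE; have [xA|xA] := boolP (x \in A).
  have ->: f ^~ x = fun=> 1; last exact: cvg_cst.
  apply/funext => n; rewrite /f (_: dset A x = 0) ?mulr0 ?subr0.
  by rewrite max_r.
  apply/eqP; rewrite eq_le dset_ge0 // andbT -(dxx x).
  apply: ge_inf; first by exists 0 => _ [w _ <-]; exact: dist_ge0.
  by exists x => //; exact: set_mem.
 have [e e0 ed]: exists2 e: R, 0 < e & e <= dset A x.
  move: xA; rewrite notin_setE => xA.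
  have /dN[e e0 eA]: nbhs x (~` A) by apply: open_nbhs_nbhs; split => //; exact: closed_openC.
  exists e => //; apply: lb_le_inf; first by case: A0 => a Aa; exists (dist x a), a.
  by move=> _ [w Aw <-]; rewrite leNgt; apply/negP => xw; exact: (eA w xw Aw).
 have ef: \forall n \near \oo, f n x = 0.
  near=> n; rewrite /f max_l // subr_le0.
  apply: (@le_trans _ _ (n.+1%:R * e)); last by rewrite ler_wpM2l.
  rewrite -ler_pdivrMr // mul1r -natr1; apply: le_trans (_: _ <= n%:R) _; last by rewrite lerDl.
  near: n; exact: nbhs_infty_ger.
 apply: cvg_near_cst; exact: ef.
Unshelve. all: by end_near. Qed.
Lemma continuous_borel (f: Omega -> R): continuous f ->
 measurable_fun [set: borel Omega] (f: borel Omega -> R).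
move=> cf; apply: (measurability _ (RGenOpens.measurableE R)) => // _ [_ [a [b ->] <-]].
rewrite setTI; apply: sub_sigma_algebra.
move/continuousP : cf; apply; exact: interval_open.
Qed.
Lemma closed_borel (A: set Omega): closed A -> measurable (A: set (borel Omega)).
move=> cA; rewrite -(setCK A); apply: measurableC; apply: sub_sigma_algebra.
exact: closed_openC.
Qed.
Lemma borel_closedE: @measurable _ (borel Omega) = <<s [set A : set Omega | closed A] >>.
apply/seteqP; split; apply: smallest_sub.
- exact: smallest_sigma_algebra.
- move=> A /= oA; rewrite -(setCK A); apply: sigma_algebraC.
 by apply: sub_sigma_algebra; exact: open_closedC.
- exact: sigma_algebra_measurable.
- by move=> A cA; exact: closed_borel.
Qed.
(** Dynkin's theorem with the closed sets, which are stable under intersection, as generators. *)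
Lemma borel_closed_ind (P: set (set (borel Omega))) :
 P setT -> (forall A: set Omega, closed A -> P A) ->
 (forall A, measurable A -> P A -> P (~` A)) ->
 (forall F: (set (borel Omega))^nat, (forall n, measurable (F n)) -> trivIset setT F ->
  (forall n, P (F n)) -> P (\bigcup_k F k)) ->
 forall A, measurable A -> P A.
move=> PT Pc PC PU A mA; apply: (dynkin_induction borel_closedE) => //.
 by move=> B C; exact: closedI.
by rewrite -borel_closedE.
Qed.
(** [th] is the supremum of tents over the compact balls of radius [1/(n+1)] centred at a dense
    sequence, the tent of index [(k, n)] being capped at [2^-(k+n)]. Every tent is 1-Lipschitz,
    hence so is the supremum; local compactness puts each point strictly inside some compact ball;
    and the caps leave only finitely many balls above a given level. *)
Lemma exists_C0_positive: separable Omega -> locally_compact [set: Omega] ->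
 exists th: Omega -> R, [/\ continuous th, forall x, 0 < th x <= 1 &
  forall e, 0 < e -> exists2 K: set Omega, compact K & forall x, ~ K x -> th x < e].
move=> [S /countable_injP[io io_inj] dS] lc.
pose e k : Omega := if pselect (exists s, S s /\ io s = k) is left h then sval (cid h) else point.
have eS s: S s -> e (io s) = s.
 move=> Ss; rewrite /e; case: pselect => [h|]; last by case; exists s.
 have [Sc ioc] := svalP (cid h).
 by apply: io_inj; rewrite ?inE.
pose B k n := [set y | dist (e k) y <= n.+1%:R^-1].
pose F (x: Omega) (kn: nat * nat) : R := if `[< compact (B kn.1 kn.2) >]
 then Num.min (2^-1 ^+ (kn.1 + kn.2)) (Num.max 0 (kn.2.+1%:R^-1 - dist (e kn.1) x)) else 0.
have F0 x kn: 0 <= F x kn.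
 rewrite /F; case: ifP => // _; rewrite le_min exprn_ge0 ?invr_ge0 //=.
 by rewrite le_max lexx.
have p1 m: (2^-1 : R) ^+ m <= 1 by rewrite exprn_ile1 // ?invr_ge0 // invf_le1 // ler1n.
have F1 x kn: F x kn <= 2^-1 ^+ (kn.1 + kn.2).
 by rewrite /F; case: ifP => _; [rewrite ge_min lexx|rewrite exprn_ge0 // invr_ge0].
pose th x := sup (range (F x)).
have ub x: has_ubound (range (F x)).
 by exists 1 => _ [kn _ <-]; exact: le_trans (F1 x kn) (p1 _).
have hs x: has_sup (range (F x)) by split => //; exists (F x (0, 0)%N), (0, 0)%N.
have Fth x kn: F x kn <= th x by apply: ub_le_sup => //; exists kn.
exists th; split.
- apply: (lip_continuous (K := 1)) => // x y; rewrite mul1r lerBlDr addrC.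
 apply: ge_sup; first by exists (F x (0, 0)%N), (0, 0)%N.
 move=> _ [kn _ <-]; apply: (@le_trans _ _ (F y kn + dist x y)); last by rewrite lerD2r.
 rewrite /F; case: ifP => _; last by rewrite add0r dist_ge0.
 have := dT (e kn.1) x y; have := dist_ge0 x y.
 have lip (a b c t: R) : 0 <= t -> a - b <= t ->
  Num.min c (Num.max 0 a) <= Num.min c (Num.max 0 b) + t.
  move=> t0 ab; have b0: 0 <= Num.max 0 b by rewrite le_max lexx.
  have bb: b <= Num.max 0 b by rewrite le_max lexx orbT.
  have mx: Num.max 0 a <= Num.max 0 b + t by rewrite ge_max; apply/andP; split; lra.
  rewrite -lerBlDr le_min !lerBlDr; apply/andP; split; rewrite ge_min ?mx ?orbT //.
  by apply/orP; left; rewrite lerDl.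
 move=> h1 h2; apply: lip => //.
 by rewrite opprB [leLHS]addrC addrA subrK lerBlDl.
- move=> x; apply/andP; split; last first.
  apply: ge_sup; first by exists (F x (0, 0)%N), (0, 0)%N.
  by move=> _ [kn _ <-]; exact: le_trans (F1 x kn) (p1 _).
 have [U xU [cU clU]] := lc x I.
 have {xU} /dN[r r0 rU]: nbhs x U by move: xU; rewrite /within /=; apply: filterS => y /(_ I).
 (* Twice the radius, since the centre may lie one radius away from [x] and the ball must still fit
    into [U]. *)
 have [n nr]: exists n: nat, 2 * n.+1%:R^-1 < r.
  have h: 0 < r / 2 by rewrite divr_gt0.
  have [n _ /(_ n (leqnn n))] := near_infty_natSinv_lt (PosNum h).
  by move=> /= hn; exists n; rewrite mulrC -ltr_pdivlMr.
 have [s [/= xs Ss]]: [set y | dist x y < n.+1%:R^-1] `&` S !=set0.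
  apply: dS; last exact: dist_open.
  by exists x; rewrite /= dxx invr_gt0 ltr0n.
 apply: lt_le_trans (Fth x (io s, n)); rewrite /F /= asboolT.
  rewrite lt_min exprn_gt0 ?invr_gt0 // lt_max subr_gt0 eS // (dC s x) xs.
  by rewrite orbT.
 apply: (subclosed_compact _ cU); first exact: dist_closed.
 move=> y; rewrite /B /= eS // => sy; apply: rU => /=.
 have := dT x s y; move: nr xs sy; rewrite /=; set q : R := _^-1; lra.
- move=> eps eps0.
 have [J hJ]: exists J: nat, (2^-1 : R) ^+ J < eps.
  have := @cvg_expr R 2^-1; rewrite ger0_norm ?invr_ge0 // => /(_ _).
  have h2: (2^-1 : R) < 1 by rewrite invf_lt1 // ltr1n.
  move=> /(_ h2) /cvgrPdist_lt /(_ eps eps0) [J _ /(_ J (leqnn J))].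
  rewrite /= sub0r normrN ger0_norm; last by rewrite exprn_ge0 // invr_ge0.
  by move=> ?; exists J.
 pose K := \big[setU/set0]_(k < J) \big[setU/set0]_(n < J | `[< compact (B k n) >]) B k n.
 exists K.
  apply: bigsetU_compact => k _; apply: bigsetU_compact => n.
  by move=> /asboolP.
 move=> x Kx; apply: le_lt_trans hJ; apply: ge_sup; first by exists (F x (0, 0)%N), (0, 0)%N.
 move=> _ [[k n] _ <-]; have [kn|kn] := leqP J (k + n).
  apply: le_trans (F1 x (k, n)) _ => /=; rewrite -(subnK kn) exprD.
  by rewrite ler_piMl // exprn_ge0 // invr_ge0.
 rewrite /F /=; case: ifPn => [cB|_]; last by rewrite exprn_ge0 // invr_ge0.
 have kJ: (k < J)%N by rewrite (leq_ltn_trans _ kn) // leq_addr.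
 have nJ: (n < J)%N by rewrite (leq_ltn_trans _ kn) // leq_addl.
 rewrite ge_min; apply/orP; right; rewrite max_l ?exprn_ge0 ?invr_ge0 //.
 rewrite subr_le0 leNgt; apply/negP => xk; apply: Kx.
 rewrite /K (bigD1 (Ordinal kJ)) //=; left.
 by rewrite (bigD1 (Ordinal nJ)) //=; left; exact: ltW.
Qed.
End metric_topology.
Lemma quarter_triangle {R: realFieldType} (x1 x2 x3 x4 x5 Kp Kq f: R) :
 x1 <= Kp -> x2 <= Kq -> Kp <= f / 4 -> Kq <= f / 4 + f / 4 -> x3 < f / 4 ->
 x4 <= x3 + x2 -> x5 <= x1 + x4 -> x5 < f.
lra. Qed.

(** * Continuous test fields, and narrow convergence from weak-* convergence *)

Section continuous_fields.
Context {R : realType} {d : nat} {Omega : ptopologicalType}.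
Local Notation M := 'M[R[i]]_d.
Implicit Types (Psi: Omega -> M).
Lemma mx_continuous_borel Psi: mx_continuous Psi -> mxmfun (Psi: borel Omega -> M).
by move=> cP i j; have [h1 h2] := cP i j; split; exact: continuous_borel. Qed.
Lemma mx_continuous_cst (A: M): mx_continuous (fun _: Omega => A).
by move=> i j; split => x; exact: cvg_cst. Qed.
Lemma continuous_sumr (I: Type) (s: seq I) (F: I -> Omega -> R) :
 (forall i, continuous (F i)) -> continuous (fun x => \sum_(i <- s) F i x).
move=> cF; elim: s => [|i s IH].
 by under eq_fun do rewrite big_nil; move=> x; exact: cvg_cst.
under eq_fun do rewrite big_cons; move=> x.
by apply: continuousD; [exact: cF|exact: IH].
Qed.
Lemma mx_continuousD Psi Psi': mx_continuous Psi -> mx_continuous Psi' ->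
 mx_continuous (fun x => Psi x + Psi' x).
move=> cP cQ i j; split => x.
 by under eq_fun do rewrite mxE ReD; apply: continuousD; [exact: (cP i j).1|exact: (cQ i j).1].
by under eq_fun do rewrite mxE ImD; apply: continuousD; [exact: (cP i j).2|exact: (cQ i j).2].
Qed.
Lemma mx_continuousZ (u: Omega -> R) Psi: continuous u -> mx_continuous Psi ->
 mx_continuous (fun x => u x *c Psi x).
move=> cu cP i j; split => x.
 by under eq_fun do rewrite mxE ReMr; apply: continuousM; [exact: cu|exact: (cP i j).1].
by under eq_fun do rewrite mxE ImMr; apply: continuousM; [exact: cu|exact: (cP i j).2].
Qed.
Lemma mx_continuousM Psi Psi': mx_continuous Psi -> mx_continuous Psi' ->
 mx_continuous (fun x => Psi x *m Psi' x).
move=> cP cQ i j; split.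
 under eq_fun do rewrite mxE Re_sum; apply: continuous_sumr => k x.
 rewrite /continuous_at; under eq_fun do rewrite ReM; rewrite ReM.
 by apply: cvgB; apply: cvgM;
  [exact: (cP i k).1|exact: (cQ k j).1|exact: (cP i k).2|exact: (cQ k j).2].
under eq_fun do rewrite mxE Im_sum; apply: continuous_sumr => k x.
rewrite /continuous_at; under eq_fun do rewrite ImM; rewrite ImM.
by apply: cvgD; apply: cvgM;
 [exact: (cP i k).1|exact: (cQ k j).2|exact: (cP i k).2|exact: (cQ k j).1].
Qed.
Lemma mx_continuous_ctr Psi: mx_continuous Psi -> mx_continuous (fun x => (Psi x) ^t*).
move=> cP i j; split => x.
 by under eq_fun do rewrite !mxE Re_conj; exact: (cP j i).1.
by under eq_fun do rewrite !mxE Im_conj; apply: continuousN; exact: (cP j i).2.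
Qed.
Lemma CbH_meas Psi: CbH Psi -> mxmfun (Psi: borel Omega -> M).
by case=> _ cP _; exact: mx_continuous_borel. Qed.
Lemma pairing_CbH_intg mu g (G: psd_measure R d Omega) Psi: hasdens mu g G -> CbH Psi ->
 intg mu setT (fun x => frob (g x) (Psi x)).
by move=> hg bP; case: (bP) => _ _ [K PK]; apply: (hasdens_frob_intg hg (CbH_meas bP) PK). Qed.
Lemma CbHD Psi Psi': CbH Psi -> CbH Psi' -> CbH (fun x => Psi x + Psi' x).
move=> [h c [K b]] [h' c' [K' b']]; split.
- by move=> x; apply/hermP; rewrite ctrD; congr (_ + _); apply/hermP.
- exact: mx_continuousD.
- by exists (K + K') => x; apply: le_trans (frobnormD _ _) _; exact: lerD.
Qed.
Lemma CbHZ (u: Omega -> R) (L: R) Psi: continuous u -> (forall x, `|u x| <= L) -> CbH Psi ->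
 CbH (fun x => u x *c Psi x).
move=> cu uL [h c [K b]]; split.
- by move=> x; apply/hermP; rewrite ctrZ; congr (_ *c _); apply/hermP.
- exact: mx_continuousZ.
- exists (L * K) => x; rewrite frobnormZ; apply: ler_pM => //; exact: fnorm_ge0.
Qed.
Lemma CbH_cst (A: M): A ^t* = A -> CbH (fun _: Omega => A).
move=> hA; split; [by move=> _; apply/hermP|exact: mx_continuous_cst|].
by exists (frobnorm A).
Qed.
Lemma prob_dens (G: psd_measure R d Omega): exists g, hasdens (trace_measure G) g G.
exact: hasdens_exists (@trace_dom_refl _ _ _ G). Qed.
Lemma pairing1 (G: prob R d Omega): pairing G (fun=> 1%:M) = 1.
have [g hg] := prob_dens G.
rewrite (pairing_dens hg); last exact: mxm_cst.
by rewrite -(prob_tr hg); apply: eq_Rintegral => x _; rewrite frobC frob1l.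
Qed.

Section cutoff.
Variable th : Omega -> R.
Hypotheses (cth: continuous th) (th01: forall x, 0 < th x <= 1)
 (thv: forall e, 0 < e -> exists2 K: set Omega, compact K & forall x, ~ K x -> th x < e).
(** Cutoffs in [C_0] that reach 1 at each point for large [k]; they play the part of an exhaustion
    by compact sets. *)
Definition cut (k: nat) x: R := Num.min 1 (k.+1%:R * th x).
Lemma cut_continuous k: continuous (cut k).
rewrite (_: cut k = fun x => (1 + k.+1%:R * th x - `|1 - k.+1%:R * th x|) / 2); last first.
 by apply/funext => y; rewrite /cut minr_absE.
have ct: continuous (fun y => k.+1%:R * th y).
 by move=> x; rewrite /continuous_at; apply: cvgM; [exact: cvg_cst|exact: cth].
have cv: continuous (fun y => 1 - k.+1%:R * th y).
 by move=> x; rewrite /continuous_at; apply: cvgB; [exact: cvg_cst|exact: ct].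
move=> x; rewrite /continuous_at; apply: cvgM; last exact: cvg_cst.
apply: cvgB; first by apply: cvgD; [exact: cvg_cst|exact: ct].
by apply: cvg_norm; exact: cv.
Qed.
Lemma cut01 k x: 0 <= cut k x <= 1.
have /andP[t0 _] := th01 x.
by rewrite /cut le_min ler01 ge_min lexx /= mulr_ge0 // ltW.
Qed.
Lemma cut_norm k x: `|cut k x| <= 1.
by have /andP[h0 h1] := cut01 k x; rewrite ger0_norm. Qed.
Lemma cut_cvg x: (fun k => cut k x) @ \oo --> (1: R).
have /andP[t0 _] := th01 x; apply: cvg_near_cst; near=> k.
rewrite /cut min_l // -ler_pdivrMr // mul1r -natr1.
apply: le_trans (_: _ <= k%:R) _; last by rewrite lerDl.
by near: k; exact: nbhs_infty_ger.
Unshelve. all: by end_near. Qed.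
Lemma C0H_cut k Psi: CbH Psi -> C0H (fun x => cut k x *c Psi x).
move=> bP; have [h c _] := CbHZ (@cut_continuous k) (cut_norm k) bP; split => // e e0.
case: bP => _ _ [K PK].
have K1: 0 < `|K| + 1 by rewrite ltr_wpDl.
have [|C cC CP] := thv (e := e / (k.+1%:R * (`|K| + 1))).
 by rewrite divr_gt0 // mulr_gt0.
exists C => // x /CP; rewrite ltr_pdivlMr ?mulr_gt0 // mulrA => hx.
rewrite frobnormZ; apply: le_lt_trans hx; rewrite ger0_norm; last by have /andP[] := cut01 k x.
have /andP[c0 _] := cut01 k x; apply: ler_pM => //; first exact: fnorm_ge0.
 by rewrite /cut ge_min [th x * _]mulrC lexx orbT.
by rewrite (le_trans (PK x)) // (le_trans (ler_norm _)) // lerDl.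
Qed.
Lemma cut_tight (G: prob R d Omega) :
 (fun k => pairing G (fun x => cut k x *c 1%:M)) @ \oo --> (1: R).
have [g hg] := prob_dens G.
have mcut k: mfun (cut k: borel Omega -> R).
 exact: continuous_borel (@cut_continuous k).
have E k: pairing G (fun x => cut k x *c 1%:M) =
  fine (\int[trace_measure G]_x (cut k x * tr_re (g x))%:E).
 rewrite (pairing_dens hg); last by apply: mxmZ => //; exact: mxm_cst.
 by congr fine; apply: eq_integral => x _; rewrite frobZr frobC frob1l.
under eq_fun do rewrite E; rewrite -(prob_tr hg).
have ig := hasdens_tr_intg hg; have mg := hasdens_tr_meas hg.
rewrite /Rintegral; apply: fine_cvg; rewrite fineK; last exact: integrable_fin_num.
apply: (@dominated_cvg _ _ _ (trace_measure G) _ mtop _ _ (fun x => (tr_re (g x))%:E)) => //.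
- by move=> k; apply/mEFinP; exact: measurable_funM.
- move=> x _; apply: cvg_EFin; first exact: nearW.
 rewrite -[X in _ --> X]mul1r; apply: cvgM; [exact: cut_cvg|exact: cvg_cst].
- move=> k x _; rewrite /= lee_fin normrM (ger0_norm (hasdens_tr_ge0 x hg)).
 by rewrite ler_piMl ?cut_norm // (hasdens_tr_ge0 x hg).
Qed.
Lemma pairing_cut_err (G: prob R d Omega) Psi (K: R) k: CbH Psi ->
 (forall x, frobnorm (Psi x) <= K) ->
 `|pairing G Psi - pairing G (fun x => cut k x *c Psi x)| <=
  K * (1 - pairing G (fun x => cut k x *c 1%:M)).
move=> bP PK; have [g hg] := prob_dens G.
have mcut: mfun (cut k: borel Omega -> R).
 exact: continuous_borel (@cut_continuous k).
have bcP := CbHZ (@cut_continuous k) (cut_norm k) bP.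
have bc1 := CbHZ (@cut_continuous k) (cut_norm k) (CbH_cst (@ctr1 R d)).
have mP := CbH_meas bP.
rewrite (pairing_dens hg mP) (pairing_dens hg (CbH_meas bcP)) (pairing_dens hg (CbH_meas bc1)).
rewrite -{1}(prob_tr hg) -!RintegralB //;
 try (first [exact: (pairing_CbH_intg hg bP)|exact: (pairing_CbH_intg hg bcP)|
  exact: (hasdens_tr_intg hg)|exact: (pairing_CbH_intg hg bc1)]).
have i1: intg (trace_measure G) setT (fun x => frob (g x) (Psi x) - frob (g x) (cut k x *c Psi x)).
 by apply: intgB => //; [exact: pairing_CbH_intg hg bP|exact: pairing_CbH_intg hg bcP].
have i2: intg (trace_measure G) setT (fun x => tr_re (g x) - frob (g x) (cut k x *c 1%:M)).
 by apply: intgB => //; [exact: hasdens_tr_intg hg|exact: pairing_CbH_intg hg bc1].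
rewrite -RintegralZl //.
apply: le_trans (le_normr_Rintegral mtop i1) _.
apply: (le_Rintegral mtop (integrable_norm i1) (intgZ K mtop i2)).
move=> x _ /=; rewrite !frobZr (frobC _ 1%:M) frob1l -/(tr_re _).
have /andP[c0 c1] := cut01 k x.
rewrite -[X in `|X - _|]mul1r -[X in K * (X - _)]mul1r -!mulrBl normrM.
rewrite ger0_norm ?subr_ge0 // mulrCA ler_wpM2l ?subr_ge0 //.
apply: le_trans (frob_CS_norm _ _) _; rewrite mulrC; apply: ler_pM => //; try exact: fnorm_ge0.
exact: psd_le_tr (hasdens_psd x hg).
Qed.
(** No mass escapes, since all traces are 1: the mass outside a cutoff is one minus an integral
    against a [C_0] field, so it is small along the sequence as soon as it is small for the limit. A
    bounded field may then be replaced by its cut version. *)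
Lemma narrow_cvg (Gn: nat -> prob R d Omega) (G: prob R d Omega) :
 (forall phi, C0H phi -> (fun n => pairing (Gn n) phi) @ \oo --> pairing G phi) ->
 forall Psi, CbH Psi -> (fun n => pairing (Gn n) Psi) @ \oo --> pairing G Psi.
move=> H Psi bP; case: (bP) => _ _ [K0 PK0].
pose K := `|K0| + 1; have K1: 0 < K by rewrite ltr_wpDl.
have PK x: frobnorm (Psi x) <= K.
 by apply: le_trans (PK0 x) _; apply: le_trans (ler_norm _) _; rewrite lerDl.
apply/cvgrPdist_lt => e e0.
have e4: 0 < e / (4 * K) by rewrite divr_gt0 // mulr_gt0.
have [k _ /(_ k (leqnn k)) hk] := (cvgrPdist_lt _ _).1 (cut_tight G) _ e4.
have h1 := H _ (C0H_cut k (CbH_cst (@ctr1 R d))).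
have h2 := H _ (C0H_cut k bP).
have e4': 0 < e / 4 by rewrite divr_gt0.
near=> n.
have a1: `|pairing G (fun x => cut k x *c 1%:M) - pairing (Gn n) (fun x => cut k x *c 1%:M)| < e / (4 * K).
 by near: n; exact: ((cvgrPdist_lt _ _).1 h1).
have a2: `|pairing G (fun x => cut k x *c Psi x) - pairing (Gn n) (fun x => cut k x *c Psi x)| < e / 4.
 by near: n; exact: ((cvgrPdist_lt _ _).1 h2).
have b1 := pairing_cut_err G k bP PK; have b2 := pairing_cut_err (Gn n) k bP PK.
set p := pairing G (fun x => cut k x *c 1%:M) in a1 b1 hk.
set q := pairing (Gn n) (fun x => cut k x *c 1%:M) in a1 b2.
set u := pairing G (fun x => cut k x *c Psi x) in a2 b1.
set v := pairing (Gn n) (fun x => cut k x *c Psi x) in a2 b2.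
have c1: K * (1 - p) <= e / 4.
 rewrite mulrC -ler_pdivlMr // -mulrA -invfM; apply: le_trans (ler_norm _) _; exact: ltW.
have c2: K * (1 - q) <= e / 4 + e / 4.
 have ->: 1 - q = (1 - p) + (p - q) by ring.
 rewrite mulrDr lerD // mulrC -ler_pdivlMr // -mulrA -invfM.
 by apply: le_trans (ler_norm _) _; exact: ltW.
have l4: `|u - pairing (Gn n) Psi| <= `|u - v| + `|pairing (Gn n) Psi - v|.
 by rewrite (distrC (pairing (Gn n) Psi) v) ler_distD.
have l5: `|pairing G Psi - pairing (Gn n) Psi| <=
  `|pairing G Psi - u| + `|u - pairing (Gn n) Psi| by exact: ler_distD.
exact: (quarter_triangle b1 b2 c1 c2 a2 l4 l5).
Unshelve. all: by end_near. Qed.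
End cutoff.
End continuous_fields.

(** * Scalar measures obtained from a matrix measure *)

Section quadratic_measure.
Context {R : realType} {d : nat} {Omega : ptopologicalType}.
Local Notation M := 'M[R[i]]_d.
Implicit Types (G: psd_measure R d Omega) (W: M).
(** The proof [pW] is an argument because the measure structure attached below relies on it for
    nonnegativity. *)
Definition qmeas W (pW: psd W) G: set (borel Omega) -> \bar R :=
 fun A => (frob (G A) W)%:E.
Lemma qmeas0 W (pW: psd W) G: qmeas pW G set0 = 0%E.
by rewrite /qmeas psdm0 frob0l. Qed.
Lemma qmeas_ge0 W (pW: psd W) G A: (0 <= qmeas pW G A)%E.
by rewrite lee_fin; apply: psd_frob_ge0 => //; exact: psdm_psd. Qed.
Lemma qmeas_sigma_additive W (pW: psd W) G: semi_sigma_additive (qmeas pW G).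
apply: (@EFin_semi_sigma_additive _ _ (fun A => frob (G A) W)) => F mF tF.
rewrite [X in X @ _](_: _ = fun n => \sum_(i < d) \sum_(j < d)
  (Re (W i j) * (\sum_(0 <= k < n) Re (G (F k) i j)) +
  Im (W i j) * (\sum_(0 <= k < n) Im (G (F k) i j)))); last first.
 apply/funext => n; under eq_bigr do rewrite frobE.
 rewrite exchange_big /=; apply: eq_bigr => i _; rewrite exchange_big /=.
 apply: eq_bigr => j _; rewrite !mulr_sumr -big_split /=; apply: eq_bigr => k _.
 by rewrite (mulrC (Re (W _ _))) (mulrC (Im (W _ _))).
rewrite frobE; apply: cvg_sumr => i; apply: cvg_sumr => j.
have [h1 h2] := psdm_sigma_additive G mF tF i j.
rewrite (mulrC (Re (G _ _ _))) (mulrC (Im (G _ _ _))).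
by apply: cvgD; apply: cvgM => //; exact: cvg_cst.
Qed.
HB.instance Definition _ W (pW: psd W) G := isMeasure.Build _ (borel Omega) R (qmeas pW G)
 (qmeas0 pW G) (@qmeas_ge0 W pW G) (@qmeas_sigma_additive W pW G).
Lemma qmeas_fin W (pW: psd W) G: fin_num_fun (qmeas pW G).
by []. Qed.
HB.instance Definition _ W (pW: psd W) G := Measure_isFinite.Build _ (borel Omega) R
 (qmeas pW G) (qmeas_fin pW G).
End quadratic_measure.

Section nomeas.
Context {disp : measure_display} {T : measurableType disp} {R : realType}.
Variable mu : {measure set T -> \bar R}.
(** The integral is a difference of suprema over simple functions below the positive and the
    negative part, hence monotone for arbitrary functions. It is used for integrands in time whose
    measurability is not established, such as the right-hand side of the weak equation. *)
Lemma le_integral_any (D: set T) (f g: T -> \bar R) :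
 (forall x, D x -> f x <= g x)%E -> (\int[mu]_(x in D) f x <= \int[mu]_(x in D) g x)%E.
move=> fg; have fg' x: ((f \_ D) x <= (g \_ D) x)%E.
 by rewrite !patchE; case: ifPn => // /set_mem; exact: fg.
rewrite /integral; apply: leeB; apply: le_ereal_sup => _ [h hf <-]; exists h => // x.
 apply: le_trans (hf x) _; rewrite !funeposE; exact: (le_max2 (fg' x) (lexx _)).
apply: le_trans (hf x) _; rewrite !funenegE.
by apply: (le_max2 _ (lexx _)); rewrite leeN2.
Qed.
End nomeas.

(** * Approximation of Borel functions by continuous ones *)

Section borel_metric.
Context {R : realType} {Omega : ptopologicalType}.
Variable dist : Omega -> Omega -> R.
Hypothesis dM : metrizes dist.
Lemma measure_setC_fin (m: finmeas R Omega) A :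
 measurable A -> m (~` A) = (m setT - m A)%E.
move=> mA; rewrite -setTD measureD // ?setTI //.
by rewrite ltey_eq fin_num_measure.
Qed.
Lemma borel_measure_eq (m1 m2: finmeas R Omega) :
 (forall A: set Omega, closed A -> m1 A = m2 A) ->
 forall A, measurable A -> m1 A = m2 A.
move=> H; have HT: m1 setT = m2 setT by apply: H; exact: closedT.
apply: borel_closed_ind => //.
 by move=> A mA; rewrite !measure_setC_fin // HT => ->.
move=> F mF tF HF; have mU: measurable (\bigcup_k F k) by exact: bigcup_measurable.
have c1 := @measure_semi_sigma_additive _ _ _ m1 F mF tF mU.
have c2 := @measure_semi_sigma_additive _ _ _ m2 F mF tF mU.
have E: (fun n => \sum_(0 <= i < n) m1 (F i))%E = (fun n => \sum_(0 <= i < n) m2 (F i))%E.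
 by apply/funext => n; apply: eq_bigr => k _; exact: HF.
by rewrite -(cvg_lim _ c1) // -(cvg_lim _ c2) // E.
Qed.

Section lusin.
Import HBSimple.
Variable mu : finmeas R Omega.
Local Notation L1dist f g := (\int[mu]_x (`|f x - g x|)%:E)%E.
Lemma bounded_intg (f: borel Omega -> R) (K: R): mfun f ->
 (forall x, `|f x| <= K) -> intg mu setT f.
move=> mf fK; apply: (intg_dom _ mf (h := fun=> K)) => //.
exact: finite_measure_integrable_cst.
Qed.
Definition approximable (f: borel Omega -> R) := mfun f /\
 forall e: R, 0 < e -> exists2 u: Omega -> R, continuous u & (L1dist u f <= e%:E)%E.
Lemma L1_triangle (c: R) (p q r: borel Omega -> R): 0 <= c ->
 mfun q -> mfun r -> (forall x, `|p x| <= c * `|q x| + `|r x|) ->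
 (\int[mu]_x (`|p x|)%:E <= c%:E * (\int[mu]_x (`|q x|)%:E) + \int[mu]_x (`|r x|)%:E)%E.
move=> c0 mq mr h; have mn f: mfun f -> mfun (fun x: borel Omega => (`|f x : R|)%:E).
 by move=> mf; apply/mEFinP; exact: mcomp.
rewrite -ge0_integralZl_EFin //; last exact: mn.
rewrite -ge0_integralD //; [|by move=> x _; rewrite -EFinM lee_fin mulr_ge0|by apply: measurable_funeM; exact: mn|exact: mn].
by apply: le_integral_any => x _; rewrite -EFinM -EFinD lee_fin.
Qed.
Lemma approx_continuous (u: Omega -> R): continuous u -> approximable u.
move=> cu; split=> [|e e0]; first exact: continuous_borel.
by exists u => //; under eq_integral do rewrite subrr normr0; rewrite integral0 lee_fin ltW.
Qed.
Lemma approx_lin (a: R) f g: approximable f -> approximable g ->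
 approximable (fun x => a * f x + g x).
move=> [mf hf] [mg hg]; split=> [|e e0].
 by apply: measurable_funD => //; exact: measurable_funM.
have a1: 0 < `|a| + 1 by rewrite ltr_wpDl.
have e1: 0 < e / 2 / (`|a| + 1) by rewrite !divr_gt0.
have [u cu ue] := hf _ e1; have [|v cv ve] := hg (e / 2); first by rewrite divr_gt0.
have [mu_ mv] := (continuous_borel cu, continuous_borel cv).
exists (fun x => a * u x + v x).
 by move=> x; apply: cvgD; [apply: cvgM; [exact: cvg_cst|exact: cu]|exact: cv].
apply: le_trans (L1_triangle (q := fun x => u x - f x) (r := fun x => v x - g x) (normr_ge0 a) _ _ _) _.
- exact: measurable_funB.
- exact: measurable_funB.
- move=> x; rewrite -normrM; apply: le_trans (ler_normD _ _).
 by rewrite le_eqVlt; apply/orP; left; apply/eqP; congr `|_|; ring.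
rewrite [e]splitr EFinD; apply: leeD => //.
apply: le_trans (lee_wpmul2l _ ue) _; first by rewrite lee_fin.
rewrite -EFinM lee_fin mulrA ler_pdivrMr // [leLHS]mulrC.
by apply: ler_wpM2l; [rewrite divr_ge0 ?(ltW e0)|rewrite lerDl].
Qed.
Lemma approx_sum (I: Type) (s: seq I) (F: I -> borel Omega -> R) :
 (forall i, approximable (F i)) -> approximable (fun x => \sum_(i <- s) F i x).
move=> h; elim: s => [|i s IH].
 by under eq_fun do rewrite big_nil; apply: approx_continuous => x; exact: cvg_cst.
under eq_fun do rewrite big_cons -[X in X + _]mul1r.
exact: approx_lin.
Qed.
Lemma approx_limit (g: nat -> borel Omega -> R) (f: borel Omega -> R): mfun f ->
 (forall n, approximable (g n)) ->
 ((fun n => L1dist f (g n)) @ \oo --> (0: \bar R))%E -> approximable f.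
move=> mf hg h; split=> // e e0; have e2: 0 < e / 2 by rewrite divr_gt0.
have [N _ /(_ N (leqnn N)) hN] : \forall n \near \oo, (L1dist f (g n) < (e / 2)%:E)%E.
 apply: (h [set y : \bar R | (y < (e / 2)%:E)%E]); apply: open_nbhs_nbhs.
 by split; [exact: open_ereal_lt_ereal|rewrite /= lte_fin].
have [mg /(_ _ e2) [u cu ue]] := hg N; exists u => //.
apply: le_trans (L1_triangle (q := fun x => f x - g N x) (r := fun x => u x - g N x) ler01 _ _ _) _.
- exact: measurable_funB.
- by apply: measurable_funB => //; exact: continuous_borel.
- move=> x; rewrite mul1r [X in _ <= X + _]distrC [X in _ <= X]addrC; apply: le_trans (ler_normD _ _).
 by rewrite addrA subrK.
by rewrite mul1e [e]splitr EFinD; apply: leeD => //; exact: ltW.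
Qed.
Lemma approx_dominated (g: nat -> borel Omega -> R) (f: borel Omega -> R) (K: R): mfun f ->
 (forall n, approximable (g n)) -> (forall n x, `|g n x| <= K) ->
 (forall x, (fun n => g n x) @ \oo --> f x) -> approximable f.
move=> mf hg gK gf; apply: (approx_limit mf hg).
have [] := @dominated_convergence _ _ R mu setT mtop (fun n x => (g n x)%:E)
 (fun x => (f x)%:E) (fun=> K%:E).
- by move=> n; apply/mEFinP; have [] := hg n.
- exact/mEFinP.
- by apply: aeW => x _; apply: cvg_EFin; [exact: nearW|exact: gf].
- exact: finite_measure_integrable_cst.
- by apply: aeW => x n _; rewrite lee_fin.
move=> _ h _; rewrite (_: (fun n => _) = (fun n => \int[mu]_x `|(g n x)%:E - (f x)%:E|)%E) //.
by apply/funext => n; apply: eq_integral => x _; rewrite -EFinB abse_EFin distrC.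
Qed.
(** Closeness in L1 to continuous functions survives bounded pointwise limits and affine
    combinations, so it passes from closed sets to all Borel sets by Dynkin induction. *)
Lemma approx_indic A: measurable A -> approximable (\1_A : borel Omega -> R).
have I01 (B: set (borel Omega)) x : 0 <= (\1_B x : R) <= 1.
 by rewrite indicE; case: (x \in B); rewrite ?lexx ?ler01.
suff H : forall A, measurable A -> measurable A /\ approximable (\1_A : borel Omega -> R).
 by move=> /H [].
have aT: approximable (\1_setT : borel Omega -> R).
 by rewrite indicT; apply: approx_continuous => x; exact: cvg_cst.
apply: borel_closed_ind => [|B cB|B mB [_ hB]|F mF tF hF]; split=> //.
- exact: closed_borel.
- have [f [cf f01 fB]] := closed_approx dM cB.
 apply: (approx_dominated (g := f) (K := 1)) => [|n|n x|x]; last exact: fB.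
 + by apply: measurable_indic; exact: closed_borel.
 + exact: approx_continuous.
 by have /andP[h0 h1] := f01 n x; rewrite ger0_norm.
- exact: measurableC.
- rewrite (_: \1_ _ = fun x => -1 * \1_B x + \1_setT x); first exact: approx_lin.
 by apply/funext => x; rewrite !indicE in_setC in_setT; case: (x \in B) => /=; ring.
- exact: bigcup_measurable.
have S1 n x: \sum_(0 <= k < n) (\1_(F k) x : R) = \1_(\bigcup_(k < n) F k) x.
 rewrite big_mkord indicE; have [[k kn Fkx]|nx] := pselect ((\bigcup_(k < n) F k) x).
  rewrite mem_set; last by exists k.
  rewrite (bigD1 (Ordinal kn)) //= indicE mem_set // big1 ?addr0 // => j jk.
  rewrite indicE memNset // => Fjx; move/eqP: jk; apply; apply/val_inj/tF => //.
  by exists x.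
 rewrite memNset // big1 // => j _; rewrite indicE memNset // => Fjx.
 by apply: nx; exists j => /=.
apply: (approx_dominated (g := fun n x => \sum_(0 <= k < n) \1_(F k) x) (K := 1)) => [|n|n x|x].
- by apply: measurable_indic; exact: bigcup_measurable.
- by apply: approx_sum => k; have [] := hF k.
- by rewrite S1; have /andP[h0 h1] := I01 (\bigcup_(k < n) F k) x; rewrite ger0_norm.
have [[k _ Fkx]|nx] := pselect ((\bigcup_k F k) x).
 rewrite [X in _ --> X]indicE mem_set; last by exists k.
 apply: cvg_near_cst; exists k.+1 => // n /= kn; rewrite S1 indicE mem_set //.
 by exists k.
apply: cvg_near_cst; apply: nearW => n; rewrite S1 !indicE !memNset // => -[k _ Fkx].
by apply: nx; exists k.
Qed.
Lemma approx_measurable (f: borel Omega -> R) (K: R): mfun f ->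
 (forall x, `|f x| <= K) -> approximable f.
move=> mf fK; have [g [_ _ gf]] := approximation_sfun_integrable mtop (bounded_intg mf fK).
pose G n : borel Omega -> R := g n.
apply: (approx_limit (g := G) mf _ gf) => n.
rewrite (_: G n = fun x => \sum_(y \in range (G n)) y * \1_(G n @^-1` [set y]) x); last first.
 by apply/funext => x; exact: (fimfunE (g n) x).
have fr: finite_set (range (G n)) by exact: (fimfunP (g n)).
under eq_fun do rewrite fsbig_finite //=.
apply: approx_sum => y; under eq_fun do rewrite -[_ * _]addr0.
apply: (approx_lin y (f := \1_(G n @^-1` [set y])) (g := fun=> 0)).
 by apply: approx_indic; exact: measurable_funPTI.
by apply: approx_continuous => x; exact: cvg_cst.
Qed.
(** Continuous functions with L1 errors at most [2^-n] have a summable total error, which is finite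
    almost everywhere and forces convergence there. The bound [K] is kept so that dominated
    convergence applies later. *)
Lemma lusin_ae (f: borel Omega -> R) (K: R): mfun f ->
 (forall x, `|f x| <= K) -> exists u: nat -> Omega -> R,
 [/\ forall n, continuous (u n), forall n x, `|u n x| <= K &
  {ae mu, forall x, (fun n => u n x) @ \oo --> f x}].
move=> mf fK; have K0: 0 <= K by apply: le_trans (fK point).
have h2: (2^-1 : R) < 1 by rewrite invf_lt1 // ltr1n.
have ap n: exists u: Omega -> R, [/\ continuous u, forall x, `|u x| <= K &
  (L1dist u f <= (2^-1 ^+ n)%:E)%E].
 have [_ /(_ (2^-1 ^+ n))[|u cu ue]] := approx_measurable mf fK.
  by rewrite exprn_gt0 // invr_gt0.
 (* Truncation to [[-K, K]], the range of [f], can only bring the approximation closer to [f]. *)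
 exists (fun x => Num.max (- K) (Num.min K (u x))); split.
 - have cc (c: R) : continuous (fun _: Omega => c) by move=> x; exact: cvg_cst.
  move=> x; apply: (max_fun_continuous (cc (- K))).
  by apply: (min_fun_continuous (cc K)).
 - move=> x; rewrite ler_norml le_max lexx /= ge_max ge_min lexx orTb andbT; lra.
 apply: le_trans ue; apply: le_integral_any => x _; rewrite lee_fin.
 have := fK x; rewrite ler_norml => /andP[f0 f1].
 case: (leP K (u x)) => h; rewrite ?(max_r (_: - K <= K)); [|lra|].
  by rewrite !ger0_norm; lra.
 case: (leP (- K) (u x)) => // h'; rewrite distrC [leRHS]distrC !ger0_norm; lra.
have [u uP]: exists u: nat -> Omega -> R, forall n, [/\ continuous (u n), forall x, `|u n x| <= K &
  (L1dist (u n) f <= (2^-1 ^+ n)%:E)%E].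
 by exists (fun n => sval (cid (ap n))) => n; exact: svalP (cid (ap n)).
have mu_ n: mfun (u n: borel Omega -> R).
 by apply: continuous_borel; have [] := uP n.
have md n: mfun (fun x: borel Omega => (`|u n x - f x|)%:E).
 by apply/mEFinP/mcomp => //; exact: measurable_funB.
pose W (x: borel Omega) := (\sum_(n <oo) (`|u n x - f x|)%:E)%E.
have fin: (\int[mu]_x W x < +oo)%E.
 rewrite integral_nneseries //; apply: (@le_lt_trans _ _ (\sum_(n <oo) ((2^-1 : R) ^+ n)%:E)%E).
  apply: lee_nneseries => [n *|n *]; first by apply: integral_ge0 => x _; rewrite lee_fin.
  by have [] := uP n.
 have := @cvg_geometric_series R 1 2^-1; rewrite ger0_norm ?invr_ge0 // => /(_ h2) H.
 have : (fun n => \sum_(0 <= k < n) ((2^-1 : R) ^+ k)%:E)%E @ \oo --> (1 / (1 - 2^-1))%:E.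
  apply: cvg_EFin; first by apply: nearW => n; rewrite sumEFin.
  rewrite (_: fine \o _ = series (geometric 1 2^-1)) //.
  by apply/funext => n /=; rewrite sumEFin; apply: eq_bigr => k _; rewrite /geometric /= mul1r.
 by move=> /cvg_lim -> //; exact: ltry.
exists u; split; [by move=> n; have [] := uP n|by move=> n; have [] := uP n|].
have isum: mu.-integrable setT W.
 apply/integrableP; split; first exact: ge0_emeasurable_sum.
 by under eq_integral do rewrite gee0_abs ?nneseries_ge0 //.
apply: filterS (integrable_ae mtop isum) => x /(_ I) fx.
have sc: cvgn (series (fun n => `|u n x - f x|)).
 have : (fun n => \sum_(0 <= k < n) (`|u k x - f x|)%:E)%E @ \oo --> (fine (W x))%:E.
  by rewrite fineK //; apply: is_cvg_nneseries.
 move=> /fine_cvg h; apply/cvg_ex; exists (fine (W x)).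
 rewrite (_: series _ = fine \o (fun n => \sum_(0 <= k < n) (`|u k x - f x|)%:E)%E) //.
 by apply/funext => n /=; rewrite sumEFin.
have c0: (fun n => u n x - f x) @ \oo --> 0 by apply/norm_cvg0P; exact: cvg_series_cvg_0 sc.
rewrite (_: (fun n => u n x) = fun n => (u n x - f x) + f x); last by apply/funext => n; rewrite subrK.
by rewrite -[X in _ --> X](add0r (f x)); apply: cvgD => //; exact: cvg_cst.
Qed.
End lusin.
End borel_metric.

(** * Continuous fields determine the measure; measurability along a curve *)

Section separation.
Context {R : realType} {d : nat} {Omega : ptopologicalType}.
Local Notation M := 'M[R[i]]_d.
Variable dist : Omega -> Omega -> R.
Hypothesis dM : metrizes dist.
Lemma pairing_closed (A: set Omega) (W: M): closed A -> W ^t* = W ->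
 exists Psi: nat -> Omega -> M, (forall n, CbH (Psi n)) /\
  forall G: psd_measure R d Omega,
  (fun n => pairing G (Psi n)) @ \oo --> frob (G A) W.
move=> cA hW; have [f [cf f01 fA]] := closed_approx dM cA.
have fn n x: `|f n x| <= 1 by have /andP[h0 h1] := f01 n x; rewrite ger0_norm.
exists (fun n x => f n x *c W); have CB n: CbH (fun x => f n x *c W).
 by apply: CbHZ (cf n) (fn n) _; exact: CbH_cst.
split => // G; have [g hg] := prob_dens G.
have mA: measurable (A: set (borel Omega)) by exact: closed_borel.
under eq_fun do rewrite (pairing_dens hg (CbH_meas (CB _))).
rewrite (wdens_frob _ hg.1 mA).
have mW: mfun (fun x => frob (g x) W).
 by apply: measurable_frob; [exact: hasdens_meas hg|exact: mxm_cst].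
have iW: (trace_measure G).-integrable setT (EFin \o (fun x => frob (g x) W)).
 by apply: intg_frob => //; case: hg => -[].
rewrite /Rintegral; apply: fine_cvg; rewrite fineK; last first.
 by apply: integrable_fin_num => //; exact: integrableS iW.
rewrite integral_mkcond restrict_EFin.
apply: (@dominated_cvg _ _ _ (trace_measure G) _ mtop _ _
 (fun x => `|frob (g x) W|%:E)) => //.
- by move=> n; apply/mEFinP/measurable_frob; [exact: hasdens_meas hg|exact: CbH_meas (CB n)].
- move=> x _; apply: cvg_EFin; first exact: nearW.
 rewrite (_: fine \o _ = fun n => f n x * frob (g x) W); last first.
  by apply/funext => n /=; rewrite frobZr.
 rewrite [X in _ --> X](_: _ = \1_A x * frob (g x) W).
  by apply: cvgM; [exact: fA|exact: cvg_cst].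
 by rewrite patchE indicE; case: ifP => _; rewrite ?mul1r ?mul0r.
- exact: integrable_norm iW.
- by move=> n x _; rewrite /= lee_fin frobZr normrM ler_piMl.
Qed.
(** With [D = A - B] and [c] its norm, [D + c] and [c] are positive semidefinite; subtracting the
    two tests amounts to testing with [D] itself. *)
Lemma frob_qmeas_eq (A B: M): A ^t* = A -> B ^t* = B ->
 (forall W, psd W -> frob A W = frob B W) -> A = B.
move=> hA hB H; pose D := A - B; pose c := frobnorm D.
have hD: D ^t* = D by rewrite ctrB hA hB.
have c0: 0 <= c by exact: fnorm_ge0.
have pD: psd (D + c *c 1%:M).
 apply/psdP; split; first by rewrite ctrD ctrZ ctr1 hD.
 move=> X; rewrite mulmxDl frobDl -scalemxAl mul1mx frobZl -lerBlDr sub0r -sqr_frobnorm.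
 rewrite lerNl -frobNl; apply: le_trans (frob_CS _ _) _; rewrite frobnormN expr2 mulrA.
 by apply: ler_wpM2r; [exact: fnorm_ge0|exact: frobnormM].
have := H _ pD; rewrite [X in X = _]frobDr [X in _ = X]frobDr (H _ (psd_scalar c0)) => /addIr h'.
by apply/eqP; rewrite -subr_eq0; apply/eqP/frob_eq0; rewrite -/D {1}/D frobBl h' subrr.
Qed.
Lemma eq_measure_CbH (G G': psd_measure R d Omega) :
 (forall Psi, CbH Psi -> pairing G Psi = pairing G' Psi) -> eq_measure G G'.
move=> H A mA; apply: frob_qmeas_eq; try by apply: psd_herm; exact: psdm_psd.
move=> W pW; suff : qmeas pW G A = qmeas pW G' A by case.
move: A mA; apply: (borel_measure_eq (m1 := qmeas pW G) (m2 := qmeas pW G')) => A cA.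
have [Psi [CP lim]] := pairing_closed cA (psd_herm pW).
congr EFin; have l1 := lim G; have l2 := lim G'.
have E: (fun n => pairing G (Psi n)) = (fun n => pairing G' (Psi n)).
 by apply/funext => n; exact: H.
by rewrite -(cvg_lim _ l1)// -(cvg_lim _ l2)// E.
Qed.

Section curve.
Variable x : R -> prob R d Omega.
Hypothesis hx : forall Psi, CbH Psi -> mfun (fun t => pairing (x t) Psi).
Lemma curve_frob_meas (W: M): psd W -> forall A, measurable A ->
 mfun (fun t => frob (x t A) W).
move=> pW; apply: borel_closed_ind.
- have [Psi [CP lim]] := pairing_closed (@closedT Omega) (psd_herm pW).
 by apply: (measurable_fun_cvg (h := fun n t => pairing (x t) (Psi n))) => [m|t _];
  [exact: hx|exact: lim].
- move=> A cA; have [Psi [CP lim]] := pairing_closed cA (psd_herm pW).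
 by apply: (measurable_fun_cvg (h := fun n t => pairing (x t) (Psi n))) => [m|t _];
  [exact: hx|exact: lim].
- move=> A mA HA.
 have [Psi [CP lim]] := pairing_closed (@closedT Omega) (psd_herm pW).
 have HT: mfun (fun t => frob (x t setT) W).
  by apply: (measurable_fun_cvg (h := fun n t => pairing (x t) (Psi n))) => [m|t _];
  [exact: hx|exact: lim].
 rewrite (_: (fun t => _) = fun t => frob (x t setT) W - frob (x t A) W).
  exact: (measurable_funB HT HA).
 apply/funext => t; have := measure_setC_fin (qmeas pW (x t)) mA.
 by rewrite /qmeas => -[].
- move=> F mF tF HF; have mU: measurable (\bigcup_k F k) by exact: bigcup_measurable.
 apply: (measurable_fun_cvg (h := fun n t => \sum_(0 <= k < n) frob (x t (F k)) W)).
  by move=> n; exact: measurable_sum.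
 move=> t _.
 have /fine_cvg := @measure_semi_sigma_additive _ _ _ (qmeas pW (x t)) F mF tF mU.
 rewrite (_: fine \o _ = fun n => \sum_(0 <= k < n) frob (x t (F k)) W) //.
 by apply/funext => n; rewrite /= /qmeas sumEFin.
Qed.
End curve.
End separation.

(** * Measurability in time of integrals over space *)

Section kernel.
Context {R : realType} {d : nat} {Omega : ptopologicalType}.
Local Notation M := 'M[R[i]]_d.

Section def.
Variables (x: R -> prob R d Omega) (W: M) (pW: psd W).
Hypothesis hk : forall A: set (borel Omega), measurable A -> mfun (fun t => frob (x t A) W).
(** The measurability hypothesis is an argument so that the kernel structure can be attached to the
    definition. *)
Definition qkernel of (forall A: set (borel Omega), measurable A ->
  mfun (fun t => frob (x t A) W)) :
 R -> {measure set (borel Omega) -> \bar R} := fun t => qmeas pW (x t).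
Let qkernel_meas U: measurable U -> mfun (qkernel hk ^~ U).
by move=> mU; apply/mEFinP; exact: hk. Qed.
HB.instance Definition _ := isKernel.Build _ _ _ _ _ (qkernel hk) qkernel_meas.
Let qkernel_uub: measure_fam_uub (qkernel hk).
exists (frobnorm W + 1) => t; rewrite /qkernel /= /qmeas lte_fin.
apply: (@le_lt_trans _ _ (frobnorm W)); last by rewrite ltrDl.
apply: le_trans (frob_CS _ _) _; rewrite ler_piMl ?fnorm_ge0 //.
apply: le_trans (frobnorm_psd (psdm_psd _ _)) _.
by rewrite prob_trace.
Qed.
HB.instance Definition _ := Kernel_isFinite.Build _ _ _ _ _ (qkernel hk) qkernel_uub.
Lemma qkernel_integral_meas (f: R * borel Omega -> \bar R) :
 (forall z, (0 <= f z)%E) -> mfun f ->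
 mfun (fun t => \int[qmeas pW (x t)]_y f (t, y))%E.
exact: (measurable_fun_integral_finite_kernel f (qkernel hk)). Qed.
End def.
Lemma density_change (mu nu: finmeas R Omega)
  (w: borel Omega -> R) (f: borel Omega -> \bar R) :
 intg mu setT w ->
 (forall A, measurable A -> nu A = \int[mu]_(y in A) (w y)%:E)%E ->
 mfun f -> (forall y, 0 <= f y)%E ->
 (\int[nu]_y f y = \int[mu]_y (f y * (w y)%:E))%E.
move=> iw nuE mf f0.
have dom: nu `<< mu.
 apply/null_content_dominatesP => A mA A0; rewrite nuE //.
 apply: null_set_integral => //; apply/mEFinP.
 exact: measurable_funS (intg_mfun iw).
rewrite -(Radon_Nikodym_SigmaFinite.change_of_variables dom f0 mtop mf).
have mRN: mfun (Radon_Nikodym_SigmaFinite.f nu mu).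
 exact: measurable_int (Radon_Nikodym_SigmaFinite.f_integrable dom).
have mt: mfun (fun x => (w x)%:E).
 by apply/mEFinP; exact: intg_mfun iw.
apply: ae_eq_integral => //; try exact: emeasurable_funM.
apply: ae_eqe_mul2l; apply: integral_ae_eq => //.
 exact: (Radon_Nikodym_SigmaFinite.f_integrable dom).
move=> E _ mE; rewrite -(Radon_Nikodym_SigmaFinite.f_integral dom) //.
exact: nuE.
Qed.
Lemma qmeas_change mu g (G: psd_measure R d Omega) W (pW: psd W) (f: borel Omega -> \bar R) :
 hasdens mu g G -> mfun f -> (forall y, 0 <= f y)%E ->
 (\int[qmeas pW G]_y f y = \int[mu]_y (f y * (frob (g y) W)%:E))%E.
move=> hg mf f0; have [_ ig _] := hg.1.
apply: density_change => //; first exact: intg_frob.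
move=> A mA; rewrite -EFin_Rintegral //; last exact: intg_frob.
by rewrite -(wdens_frob _ hg.1 mA).
Qed.

Section fields.
Variable x : R -> prob R d Omega.
Hypothesis hk : forall W: M, psd W -> forall A: set (borel Omega), measurable A ->
 mfun (fun t => frob (x t A) W).
Lemma mx_measurable_section (V: R * borel Omega -> M) t: mxmfun V ->
 mxmfun (fun y => V (t, y)).
move=> mV i j; split.
 by apply: (mcomp (f := fun z => Re (V z i j)) (g := pair t)) => //; exact: (mV i j).1.
by apply: (mcomp (f := fun z => Im (V z i j)) (g := pair t)) => //; exact: (mV i j).2.
Qed.
Lemma Rintegral4 (mu: {measure set (borel Omega) -> \bar R}) (f1 f2 f3 f4 f: borel Omega -> R) :
 intg mu setT f1 -> intg mu setT f2 -> intg mu setT f3 -> intg mu setT f4 ->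
 (forall y, f y = f1 y - f2 y - (f3 y - f4 y)) ->
 \int[mu]_y f1 y - \int[mu]_y f2 y - (\int[mu]_y f3 y - \int[mu]_y f4 y) = \int[mu]_y f y.
move=> I1 I2 I3 I4 E; rewrite -(RintegralB mtop I1 I2) -(RintegralB mtop I3 I4).
rewrite -(RintegralB mtop (intgB mtop I1 I2) (intgB mtop I3 I4)).
by apply: eq_Rintegral => y _; rewrite E.
Qed.
Lemma pairing_scalar_meas (W: M) (w: R * borel Omega -> R) (K: R): W ^t* = W ->
 mfun w -> (forall z, `|w z| <= K) ->
 mfun (fun t => pairing (x t) (fun y => w (t, y) *c W)).
move=> hW mw wK.
have msec t: mfun (fun y => w (t, y)).
 by apply: (mcomp (f := w)) => //; exact: pair1_measurable.
have step (W': M) (u: R * borel Omega -> R) (L: R) : psd W' -> mfun u ->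
  (forall z, 0 <= u z <= L) ->
  mfun (fun t => pairing (x t) (fun y => u (t, y) *c W')).
 move=> pW' mu u0.
 have m := @qkernel_integral_meas x W' pW' (hk pW') (EFin \o u) _ _.
 have {}m: mfun (fun t => \int[qmeas pW' (x t)]_y (u (t, y))%:E)%E.
  apply: m; first by move=> z; rewrite lee_fin; have /andP[] := u0 z.
  exact/mEFinP.
 have {}m := mcomp (fine_measurable mtop) m.
 apply: (eq_measurable_fun _ _ m) => t _ /=.
 have [g hg] := prob_dens (x t).
 have mus: mfun (fun y => u (t, y)).
  by apply: (mcomp (f := u)) => //; exact: pair1_measurable.
 rewrite (pairing_dens hg); last by apply: mxmZ => //; exact: mxm_cst.
 rewrite (qmeas_change pW' hg) //; last 2 first.
 - exact/mEFinP.
 - by move=> y; rewrite lee_fin; have /andP[] := u0 (t, y).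
 by congr fine; apply: eq_integral => y _; rewrite frobZr.
have K0: 0 <= K by apply: le_trans (wK (0, point)).
(* The kernel handles nonnegative functions and positive matrices only, so [w W] is written as [(w +
   K)(W + c) - (w + K) c - (K (W + c) - K c)]. *)
pose c := frobnorm W; have c0: 0 <= c by exact: fnorm_ge0.
have pWc: psd (W + c *c 1%:M).
 apply/psdP; split; first by rewrite ctrD ctrZ ctr1 hW.
 move=> X; rewrite mulmxDl frobDl -scalemxAl mul1mx frobZl -lerBlDr sub0r -sqr_frobnorm.
 rewrite lerNl -frobNl; apply: le_trans (frob_CS _ _) _; rewrite frobnormN expr2 mulrA.
 by apply: ler_wpM2r; [exact: fnorm_ge0|exact: frobnormM].
have mu1: mfun (fun z => w z + K) by exact: measurable_funD.
have u1 z: 0 <= w z + K <= 2 * K.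
 by have := wK z; rewrite ler_norml => /andP[h1 h2]; apply/andP; split; lra.
have u2 (z: R * borel Omega) : 0 <= K <= K by rewrite K0 lexx.
have m1 := step _ _ _ pWc mu1 u1.
have m2 := step _ _ _ (psd_scalar c0) mu1 u1.
have m3 := step _ (fun=> K) K pWc (measurable_cst K) u2.
have m4 := step _ (fun=> K) K (psd_scalar c0) (measurable_cst K) u2.
have := measurable_funB (measurable_funB m1 m2) (measurable_funB m3 m4).
apply: eq_measurable_fun => t _ /=.
have [g hg] := prob_dens (x t).
have mm (u: borel Omega -> R) (A: M) : mfun u -> mxmfun (fun y => u y *c A).
 by move=> mu; apply: mxmZ => //; exact: mxm_cst.
have ii (u: borel Omega -> R) (A: M) (L: R) : mfun u -> (forall y, `|u y| <= L) ->
  intg (trace_measure (x t)) setT (fun y => frob (g y) (u y *c A)).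
 move=> mu uL; apply: (hasdens_frob_intg (K := L * frobnorm A) hg); first exact: mm.
 by move=> y; rewrite frobnormZ ler_wpM2r ?fnorm_ge0.
have mK: measurable_fun [set: borel Omega] (fun=> K) by exact: measurable_cst.
have mwK: measurable_fun [set: borel Omega] (fun y => w (t, y) + K) by exact: measurable_funD.
have bK (y: borel Omega) : `|K| <= K by rewrite ger0_norm.
have bw y: `|w (t, y) + K| <= 2 * K.
 by have /andP[h1 h2] := u1 (t, y); rewrite ger0_norm.
rewrite (pairing_dens hg (mm _ _ mwK)) (pairing_dens hg (mm _ _ mwK)).
rewrite (pairing_dens hg (mm _ _ mK)) (pairing_dens hg (mm _ _ mK)) (pairing_dens hg (mm _ _ (msec t))).
have I1 := ii _ (W + c *c 1%:M) _ mwK bw; have I2 := ii _ (c *c 1%:M) _ mwK bw.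
have I3 := ii _ (W + c *c 1%:M) _ mK bK; have I4 := ii _ (c *c 1%:M) _ mK bK.
by apply: (Rintegral4 I1 I2 I3 I4) => y; rewrite !frobZr !frobDr !frobZr; ring.
Qed.
(** Products of a Hermitian [A] with [sym_basis i j] and [anti_basis i j] are the real and imaginary
    part of its entry [(i, j)]. Both matrices are Hermitian, so a matrix field splits into scalar
    functions times constant Hermitian matrices. *)
Definition sym_basis (i j: 'I_d): M := 2^-1 *c (delta_mx i j + delta_mx j i).
Definition anti_basis (i j: 'I_d): M :=
 2^-1 *c (Complex 0 1 *: delta_mx i j - Complex 0 1 *: delta_mx j i).
Lemma ctr_delta (i j: 'I_d): (delta_mx i j: M) ^t* = delta_mx j i.
by rewrite trmx_delta map_delta_mx. Qed.
Lemma frob_expand (A V: M): A ^t* = A -> frob A V =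
 \sum_i \sum_j (Re (V i j) * frob A (sym_basis i j) + Im (V i j) * frob A (anti_basis i j)).
move=> hA; rewrite frobE; apply: eq_bigr => i _; apply: eq_bigr => j _.
have ReA k l: Re (A k l) = frob A (delta_mx k l).
 rewrite frobE (bigD1 k) //= (bigD1 l) //= [X in _ = _ + X + _]big1 => [|b bl].
  rewrite big1 => [|a ak]; first by rewrite !mxE !eqxx /= mulr1 mulr0 !addr0.
  by apply: big1 => b _; rewrite !mxE (negbTE ak) /= !mulr0 addr0.
 by rewrite !mxE (negbTE bl) andbF /= !mulr0 addr0.
have ImA k l: Im (A k l) = frob A (Complex 0 1 *: delta_mx k l).
 have E (a b: 'I_d) : Re (A a b) * Re ((Complex 0 1 *: delta_mx k l : M) a b) +
  Im (A a b) * Im ((Complex 0 1 *: delta_mx k l : M) a b) =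
  Im (A a b) * ((a == k) && (b == l))%:R.
  rewrite !mxE ReM ImM; case: (_ && _) => /=; ring.
 rewrite frobE; under eq_bigr do under eq_bigr do rewrite E.
 rewrite (bigD1 k) //= (bigD1 l) //= [X in _ = _ + X + _]big1 => [|b bl]; last first.
  by rewrite (negbTE bl) andbF mulr0.
 rewrite [X in _ = _ + X]big1 => [|a ak]; last first.
  by apply: big1 => b _; rewrite (negbTE ak) mulr0.
 by rewrite !eqxx mulr1 !addr0.
rewrite /sym_basis /anti_basis !frobZr frobDr frobBr -!ReA -!ImA.
have ->: A j i = Num.conj (A i j) by rewrite -{1}hA !mxE.
by rewrite Re_conj Im_conj; field.
Qed.
Lemma pairing_field_meas (V: R * borel Omega -> M) (K: R): mxmfun V ->
 (forall z, frobnorm (V z) <= K) ->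
 mfun (fun t => pairing (x t) (fun y => V (t, y))).
move=> mV VK.
have hS i j: (sym_basis i j) ^t* = sym_basis i j.
 by rewrite /sym_basis ctrZ ctrD !ctr_delta addrC.
have hT i j: (anti_basis i j) ^t* = anti_basis i j.
 rewrite /anti_basis ctrZ ctrB; congr (_ *: _).
 have E (k l: 'I_d) : ((Complex 0 1: R[i]) *: delta_mx k l : M) ^t* = - (Complex 0 1 *: delta_mx l k).
  by rewrite linearZ /= map_mxZ ctr_delta -scaleNr; congr (_ *: _); apply: complex_ext; rewrite ?Re_conj ?Im_conj ?ReN ?ImN /= ?oppr0.
 by rewrite !E opprK addrC.
have H: mfun (fun t => \sum_i \sum_j
  (pairing (x t) (fun y => Re (V (t, y) i j) *c sym_basis i j) +
  pairing (x t) (fun y => Im (V (t, y) i j) *c anti_basis i j))).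
 apply: measurable_sum => i; apply: measurable_sum => j; apply: measurable_funD.
  apply: (@pairing_scalar_meas _ (fun z => Re (V z i j)) K) => //.
  exact: (mV i j).1.
  by move=> z; exact: le_trans (Re_le_frobnorm _ _ _) (VK z).
 apply: (@pairing_scalar_meas _ (fun z => Im (V z i j)) K) => //.
  exact: (mV i j).2.
 by move=> z; exact: le_trans (Im_le_frobnorm _ _ _) (VK z).
apply: (eq_measurable_fun _ _ H) => t _ /=.
have [g hg] := prob_dens (x t).
have mVt := mx_measurable_section t mV.
have mm (u: borel Omega -> R) (A: M) : mfun u -> mxmfun (fun y => u y *c A).
 by move=> mu; apply: mxmZ => //; exact: mxm_cst.
have ii (u: borel Omega -> R) (A: M) : mfun u -> (forall y, `|u y| <= K) ->
  intg (trace_measure (x t)) setT (fun y => u y * frob (g y) A).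
 move=> mu uL; under [X in _.-integrable _ (_ \o X)]eq_fun do rewrite -frobZr.
 apply: (hasdens_frob_intg (K := K * frobnorm A) hg); first exact: mm.
 by move=> y; rewrite frobnormZ ler_wpM2r ?fnorm_ge0.
have iR i j: intg (trace_measure (x t)) setT (fun y => Re (V (t, y) i j) * frob (g y) (sym_basis i j)).
 apply: ii; first exact: (mVt i j).1.
 by move=> y; exact: le_trans (Re_le_frobnorm _ _ _) (VK (t, y)).
have iI i j: intg (trace_measure (x t)) setT (fun y => Im (V (t, y) i j) * frob (g y) (anti_basis i j)).
 apply: ii; first exact: (mVt i j).2.
 by move=> y; exact: le_trans (Im_le_frobnorm _ _ _) (VK (t, y)).
rewrite (pairing_dens hg mVt).
under eq_Rintegral do rewrite (frob_expand _ (psd_herm (hasdens_psd _ hg))).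
rewrite Rintegral_sum //; last by move=> i; apply: intg_sum => // j; exact: intgD.
apply: eq_bigr => i _; rewrite Rintegral_sum //; last by move=> j; exact: intgD.
apply: eq_bigr => j _; rewrite RintegralD //.
rewrite !(pairing_dens hg); [|by apply: mm; exact: (mVt i j).2|by apply: mm; exact: (mVt i j).1].
by congr (_ + _); apply: eq_Rintegral => y _; rewrite frobZr.
Qed.
(** Large values are set to 0 instead of being rescaled: positive matrices stay positive, and
    quadratic forms of the truncation increase with [k], as monotone convergence requires. *)
Definition trunc (k: nat) (A: M): M := if frobnorm A <= k%:R then A else 0.
Lemma trunc_bound k A: frobnorm (trunc k A) <= k%:R.
by rewrite /trunc; case: ifP => // _; rewrite frobnorm0. Qed.
Lemma mxm_trunc {disp} {T: measurableType disp} (D: set T) (V: T -> M) k :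
 measurable D -> mx_measurable D V -> mx_measurable D (fun z => trunc k (V z)).
move=> mD mV.
have mb: measurable_fun D (fun z => frobnorm (V z) <= k%:R).
 apply: measurable_fun_ler; last exact: measurable_cst.
 apply: (@mcomp _ _ _ _ _ _ (@Num.sqrt R)); last exact: measurable_frob.
 by apply: continuous_measurable_fun => y; exact: sqrt_continuous.
exact: (mxm_if mD mb mV (mxm_cst D 0)).
Qed.
Lemma trunc_eventually (A: M): \forall k \near \oo, trunc k A = A.
near=> k; rewrite /trunc ifT //; near: k; exact: nbhs_infty_ger.
Unshelve. all: by end_near. Qed.
Lemma sqnorm_meas (U: R * borel Omega -> M): mxmfun U ->
 mfun (fun t => sqnorm (x t) (fun y => U (t, y))).
move=> mU.
apply: (emeasurable_fun_cvg (fun k t =>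
  (pairing (x t) (fun y => trunc k (U (t, y)) *m (trunc k (U (t, y))) ^t*))%:E)).
 move=> k; apply/mEFinP.
 apply: (pairing_field_meas (V := fun z => trunc k (U z) *m (trunc k (U z)) ^t*) (K := k%:R * k%:R)).
  by apply: mxmM => //; [exact: mxm_trunc|apply: mxm_ctr => //; exact: mxm_trunc].
 move=> z; apply: le_trans (frobnormM _ _) _; rewrite frobnorm_ctr.
 by apply: ler_pM; rewrite ?fnorm_ge0 ?trunc_bound.
move=> t _; have [g hg] := prob_dens (x t).
have mUt := mx_measurable_section t mU.
have mTt k: mxmfun (fun y => trunc k (U (t, y)) *m (trunc k (U (t, y))) ^t*).
 by apply: mxmM => //; [exact: mxm_trunc|apply: mxm_ctr => //; exact: mxm_trunc].
rewrite (sqnorm_dens hg mUt).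
have E k: (pairing (x t) (fun y => trunc k (U (t, y)) *m (trunc k (U (t, y))) ^t*))%:E =
  (\int[trace_measure (x t)]_y (frob (g y *m trunc k (U (t, y))) (trunc k (U (t, y))))%:E)%E.
 rewrite (pairing_dens hg (mTt k)) EFin_Rintegral //.
  by apply: eq_integral => y _; rewrite frob_mulr.
 apply: (hasdens_frob_intg (K := k%:R * k%:R) hg) => // y.
 apply: le_trans (frobnormM _ _) _; rewrite frobnorm_ctr.
 by apply: ler_pM; rewrite ?fnorm_ge0 ?trunc_bound.
under eq_fun do rewrite E.
have lim y: (frob (g y *m U (t, y)) (U (t, y)))%:E =
  limn (fun k => (frob (g y *m trunc k (U (t, y))) (trunc k (U (t, y))))%:E).
 apply/esym/cvg_lim => //; apply: cvg_near_cst.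
 by apply: filterS (trunc_eventually (U (t, y))) => k ->.
rewrite (eq_integral _ _ (fun y _ => lim y)).
apply: cvg_monotone_convergence => //.
- move=> k; apply/mEFinP/measurable_frob; last exact: mxm_trunc.
 by apply: mxmM => //; [exact: hasdens_meas hg|exact: mxm_trunc].
- by move=> k y _; rewrite lee_fin; apply: psd_quad; exact: hasdens_psd hg.
- move=> y _ m n mn; rewrite lee_fin /trunc.
 have q0: 0 <= frob (g y *m U (t, y)) (U (t, y)) by apply: psd_quad; exact: hasdens_psd hg.
 case: ifPn => [h|_]; last by rewrite mulmx0 frob0l; case: ifP => // _; rewrite mulmx0 frob0l.
 by rewrite ifT // (le_trans h) // ler_nat.
Qed.
End fields.
End kernel.

(** * Scalar derivatives *)

Section scalar_derivatives.
Context {R : realType}.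
Implicit Types (f g: R -> R) (x a b c: R).
Lemma deriveD' f g x a b: is_derive x 1 f a -> is_derive x 1 g b ->
 is_derive x 1 (fun t => f t + g t) (a + b).
by move=> hf hg; exact: is_deriveD. Qed.
Lemma deriveM' f g x a b: is_derive x 1 f a -> is_derive x 1 g b ->
 is_derive x 1 (fun t => f t * g t) (f x * b + g x * a).
by move=> hf hg; exact: is_deriveM. Qed.
Lemma deriveZ' c f x a: is_derive x 1 f a -> is_derive x 1 (fun t => c * f t) (c * a).
by move=> hf; exact: is_deriveZ. Qed.
Lemma deriveV' f x a: f x != 0 -> is_derive x 1 f a ->
 is_derive x 1 (fun t => (f t)^-1) (- f x ^- 2 * a).
by move=> f0 hf; exact: is_deriveV. Qed.
Lemma derive_affine (a b x: R): is_derive x 1 (fun t: R => a + b * t) b.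
have h := deriveD' (is_derive_cst a x 1) (deriveZ' b (is_derive_id x 1)).
by apply: (is_derive_eq h); rewrite add0r mulr1.
Qed.
Lemma derive_sin_affine (a b x: R) :
 is_derive x 1 (fun t: R => sin (a + b * t)) (cos (a + b * x) * b).
exact: (is_derive1_comp (is_derive_sin _) (derive_affine a b x)). Qed.
Lemma derive_cos_affine (a b x: R) :
 is_derive x 1 (fun t: R => cos (a + b * t)) (- sin (a + b * x) * b).
exact: (is_derive1_comp (is_derive_cos _) (derive_affine a b x)). Qed.
Lemma is_derive_continuous f x a: is_derive x 1 f a -> {for x, continuous f}.
by move=> [df _]; apply: differentiable_continuous; exact/derivable1_diffP. Qed.
Lemma mean_value f df s t: s <= t -> (forall x, s <= x <= t -> is_derive x 1 f (df x)) ->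
 exists2 c, s <= c <= t & f t - f s = df c * (t - s).
move=> st H; have h1 (x: R) : x \in `]s, t[ -> is_derive x 1 f (df x).
 by rewrite in_itv /= => /andP[h1 h2]; apply: H; rewrite !ltW.
have h2: {within `[s, t], continuous f}.
 by apply: derivable_within_continuous => x; rewrite in_itv /= => h; case: (H x h).
have [c cI E] := MVT_segment st h1 h2.
by exists c => //; move: cI; rewrite in_itv.
Qed.
Lemma mean_value_abs f df (L s t: R): 0 <= s <= 1 -> 0 <= t <= 1 ->
 (forall x, 0 <= x <= 1 -> is_derive x 1 f (df x)) ->
 exists2 c, 0 <= c <= 1 /\ `|c - s| <= `|t - s| & f t - f s = df c * (t - s).
move=> /andP[s0 s1] /andP[t0 t1] H; have [st|ts] := leP s t.
 have [c /andP[sc ct] E] := mean_value st (fun x h => H x (ltac:(lra))).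
 by exists c => //; split; [lra|rewrite !ger0_norm; lra].
have [c /andP[sc ct] E] := mean_value (ltW ts) (fun x h => H x (ltac:(lra))).
by exists c; [split; [lra|rewrite !ler0_norm; lra]|lra].
Qed.
End scalar_derivatives.

(** * The scalar Riccati equation *)

Section wave.
Context {R : realType}.
Variable w : R.
(** The solution of [y'' = - w^2 y] with [y(0) = 1] and [y(1) = m]; the arguments of the sines are
    spelled as [a + b * t] to match the derivative lemmas. *)
Definition wave m t: R := (sin w)^-1 * (sin (w + - w * t) + m * sin (0 + w * t)).
Definition dwave m t: R := (sin w)^-1 * (w * (m * cos (0 + w * t) - cos (w + - w * t))).
(** Twice the logarithmic derivative linearises the Riccati equation: [r' = - r^2/2 - 2 w^2], the
    Hamilton-Jacobi equation on one eigenvalue. *)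
Definition ric m t := 2 * (dwave m t * (wave m t)^-1).
Definition dric m t := - (2^-1 * (ric m t * ric m t) + 2 * w ^+ 2).
Lemma wave_derive (m t: R): is_derive t 1 (wave m) (dwave m t).
have h := deriveZ' (sin w)^-1 (deriveD' (derive_sin_affine w (- w) t)
 (deriveZ' m (derive_sin_affine 0 w t))).
by apply: (is_derive_eq h); rewrite /dwave; ring.
Qed.
Lemma dwave_derive (m t: R): is_derive t 1 (dwave m) (- w ^+ 2 * wave m t).
have h := deriveZ' (sin w)^-1 (deriveZ' w (deriveD' (deriveZ' m (derive_cos_affine 0 w t))
 (is_deriveN (derive_cos_affine w (- w) t)))).
by apply: (is_derive_eq h); rewrite /wave; ring.
Qed.
Lemma ric_derive (m t: R): wave m t != 0 -> is_derive t 1 (ric m) (dric m t).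
move=> y0; have h := deriveZ' 2 (deriveM' (dwave_derive m t) (deriveV' y0 (wave_derive m t))).
by apply: (is_derive_eq h); rewrite /dric /ric; field.
Qed.
Hypothesis w0 : 0 < w.
Hypothesis wpi : w <= pi / 2.
Let pi0: 0 < (pi: R). Proof. exact: pi_gt0. Qed.
Lemma sin_w_gt0: 0 < sin w.
by apply: sin_gt0_pi; have := pi0; move: w0 wpi; lra. Qed.
Lemma wave_coefs t: 0 <= t <= 1 -> [/\ 0 <= sin (w + - w * t), 0 <= sin (0 + w * t) &
 sin w <= sin (w + - w * t) + sin (0 + w * t)].
move=> /andP[t0 t1]; have p0 := pi0.
have a0: 0 <= w * t by rewrite mulr_ge0 // ltW.
have a1: w * t <= w by rewrite ler_piMr // ltW.
have I1: 0 <= w + - w * t <= pi by move: wpi a0 a1 p0; rewrite mulNr; lra.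
have I2: 0 <= 0 + w * t <= pi by move: wpi a0 a1 p0; lra.
have s1 := sin_ge0_pi I1; have s2 := sin_ge0_pi I2.
split => //; rewrite {1}(_: w = (w + - w * t) + (0 + w * t)); last by ring.
rewrite sinD lerD //; last by rewrite ler_piMl // cos_le1.
by rewrite ler_piMr // cos_le1.
Qed.
(** The two sine coefficients are nonnegative and add up to at least [sin w], so the wave stays
    above any nonnegative lower bound of its end values 1 and [m]. Hence the quotient [ric] has no
    pole on [0, 1]. *)
Lemma wave_lb m e t: 0 <= t <= 1 -> e <= m -> e <= 1 -> 0 <= e -> e <= wave m t.
move=> /wave_coefs[s1 s2 s3] em e1 e0; have s0 := sin_w_gt0.
rewrite /wave mulrC ler_pdivlMr //.
apply: (@le_trans _ _ (e * (sin (w + - w * t) + sin (0 + w * t)))).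
 by rewrite ler_wpM2l.
by rewrite mulrDr lerD // ?ler_wpM2r // ler_piMl.
Qed.
Lemma ric_bounds (e K: R): 0 < e -> exists B, 0 <= B /\ forall m t, e <= m <= K -> 0 <= t <= 1 ->
 [/\ wave m t != 0, `|ric m t| <= B & `|dric m t| <= B].
move=> e0; have s0 := sin_w_gt0; pose e1 := Num.min e 1.
have e10: 0 < e1 by rewrite lt_min e0 ltr01.
have e1e: e1 <= e by rewrite ge_min lexx. have e11: e1 <= 1 by rewrite ge_min lexx orbT.
pose B1 := 2 * ((sin w)^-1 * (w * (`|K| + 1)) * e1^-1).
have B10: 0 <= B1 by rewrite /B1 !mulr_ge0 // ?invr_ge0 // ?ltW // ltr_pwDr.
have X0: 0 <= 2^-1 * (B1 * B1) + 2 * w ^+ 2.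
 have := sqr_ge0 w; have : 0 <= B1 * B1 by rewrite mulr_ge0.
 lra.
exists (B1 + (2^-1 * (B1 * B1) + 2 * w ^+ 2)); split; first exact: addr_ge0.
move=> m t /andP[em mK] t01.
have lb: e1 <= wave m t by apply: wave_lb => //; [exact: le_trans em|exact: ltW].
have y0: 0 < wave m t by apply: lt_le_trans lb.
have rB: `|ric m t| <= B1.
 rewrite /ric !normrM (ger0_norm (ler0n _ 2)) ler_wpM2l //.
 have si: 0 <= (sin w)^-1 by rewrite invr_ge0 ltW.
 apply: ler_pM => //.
  rewrite (ger0_norm si) ler_wpM2l // (gtr0_norm w0) ler_wpM2l ?(ltW w0) //.
  apply: le_trans (ler_normB _ _) _; rewrite normrM.
  apply: lerD; last by rewrite ler_norml cos_geN1 cos_le1.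
  rewrite -[leRHS]mulr1; apply: ler_pM => //.
  rewrite ger0_norm; last by apply: ltW; apply: lt_le_trans em.
  exact: le_trans (ler_norm _).
  by rewrite ler_norml cos_geN1 cos_le1.
 by rewrite normfV gtr0_norm // lef_pV2.
split; [by rewrite gt_eqF| |].
 by apply: le_trans rB _; rewrite lerDl.
rewrite /dric normrN; apply: le_trans (ler_normD _ _) _; rewrite -[leLHS]add0r lerD // lerD //.
 have h2: 0 <= 2^-1 :> R by rewrite invr_ge0 ler0n.
 by rewrite normrM (normrM (ric m t)) (ger0_norm h2) ler_wpM2l // ler_pM.
have h4: 0 <= 2 * w ^+ 2 by rewrite mulr_ge0 ?sqr_ge0 ?ler0n.
by rewrite (ger0_norm h4).
Qed.
(** The constant is uniform over [m] in [[e, K]], the range of the eigenvalues of a test field; this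
    is what makes the matrix field continuously differentiable in the sup norm. *)
Lemma ric_C1 (e K: R): 0 < e -> exists L, 0 <= L /\ forall m, e <= m <= K ->
 forall s t, 0 <= s <= 1 -> 0 <= t <= 1 ->
 `|dric m s - dric m t| <= L * `|s - t| /\
 `|ric m s - ric m t - (s - t) * dric m t| <= L * `|s - t| ^+ 2.
move=> e0; have [B [B0 H]] := ric_bounds K e0.
exists (B * B); split => [|m em s t s01 t01]; first by rewrite mulr_ge0.
have lip x y: 0 <= x <= 1 -> 0 <= y <= 1 -> `|ric m x - ric m y| <= B * `|x - y|.
 move=> x01 y01.
 have [|c [c01 _] ->] := mean_value_abs (f := ric m) (df := dric m) 0 y01 x01.
  by move=> z z01; apply: ric_derive; have [] := H m z em z01.
 by rewrite normrM ler_wpM2r //; have [] := H m c em c01.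
have dlip x y: 0 <= x <= 1 -> 0 <= y <= 1 -> `|dric m x - dric m y| <= B * B * `|x - y|.
 move=> x01 y01; rewrite (_: _ - _ = - (2^-1 * (ric m x + ric m y)) * (ric m x - ric m y)).
  rewrite normrM normrN -mulrA; apply: ler_pM => //; last exact: lip.
  have [_ h1 _] := H m x em x01; have [_ h2 _] := H m y em y01.
  have h3: 0 <= 2^-1 :> R by rewrite invr_ge0 ler0n.
  rewrite normrM (ger0_norm h3).
  have := ler_normD (ric m x) (ric m y); lra.
 by rewrite /dric; field.
split; first exact: dlip.
have [|c [c01 cs] ->] := mean_value_abs (f := ric m) (df := dric m) 0 t01 s01.
 by move=> z z01; apply: ric_derive; have [] := H m z em z01.
rewrite [X in _ - X]mulrC -mulrBl normrM expr2 mulrA ler_wpM2r //.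
by apply: le_trans (dlip _ _ c01 t01) _; rewrite ler_wpM2l // mulr_ge0.
Qed.
End wave.

(** * Curves extended to the real line *)

Section curve_measurability.
Context {R : realType} {d : nat} {Omega : ptopologicalType}.
Local Notation M := 'M[R[i]]_d.
Lemma pairingZ (G: psd_measure R d Omega) r (Psi: Omega -> M): CbH Psi ->
 pairing G (fun x => r *c Psi x) = r * pairing G Psi.
move=> cP; have mP := CbH_meas cP; have [g hg] := prob_dens G.
have mrP: mxmfun (fun x: borel Omega => r *c Psi x) by exact: mxmZ.
rewrite (pairing_dens hg mrP) (pairing_dens hg mP).
under eq_Rintegral do rewrite frobZr.
by rewrite RintegralZl //; exact: pairing_CbH_intg hg cP.
Qed.
Lemma pairing_dTV (G H: psd_measure R d Omega) Psi (K: R): CbH Psi -> 0 < K ->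
 (forall x, frobnorm (Psi x) <= K) ->
 (`|pairing G Psi - pairing H Psi|%:E <= K%:E * dTV G H)%E.
move=> cP K0 PK; rewrite -lee_pdivrMl // -EFinM.
rewrite -{1}(gtr0_norm (_: 0 < K^-1)) ?invr_gt0 // -normrM mulrBr -!pairingZ //.
apply: ereal_sup_ubound; exists (fun x => K^-1 *c Psi x) => //=; split.
 by apply: (CbHZ (u := fun=> K^-1) (L := `|K^-1|)) => // x; exact: cvg_cst.
by move=> x; rewrite frobnormZ gtr0_norm ?invr_gt0 // mulrC ler_pdivrMr // mul1r.
Qed.
Lemma curve_modulus (G: curve R d Omega) t e: 0 <= t <= 1 -> 0 < e ->
 exists2 r, 0 < r & forall s, 0 <= s <= 1 -> `|s - t| < r -> (dTV (G s) (G t) < e%:E)%E.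
move=> t01 e0; have t01': t \in `[0 : R, 1] by rewrite in_itv.
have := @curve_continuous _ _ _ G t t01' [set y | (y < e%:E)%E].
have N: nbhs (0%E : \bar R) [set y | (y < e%:E)%E].
 by apply: open_nbhs_nbhs; split; [exact: open_ereal_lt_ereal|rewrite /= lte_fin].
move=> /(_ N); rewrite /= /within /= => /nbhs_ballP[r /= r0 H].
exists r => // s s01 st; apply: (H s); last by rewrite /= in_itv.
by rewrite /ball /= distrC.
Qed.
(** Composition with this retraction onto [0, 1] extends a curve, which is meaningful on [0, 1]
    only, to a continuous curve on the line. *)
Definition clamp (t: R): R := if t <= 0 then 0 else if 1 <= t then 1 else t.
Lemma clamp01 t: 0 <= clamp t <= 1.
by rewrite /clamp; case: (leP t 0) => h; [lra|case: (leP 1 t) => h'; lra]. Qed.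
Lemma clamp_id t: 0 <= t <= 1 -> clamp t = t.
by move=> /andP[h0 h1]; rewrite /clamp; case: leP => h; [lra|case: leP => h'; lra]. Qed.
Lemma clamp_lip s t: `|clamp s - clamp t| <= `|s - t|.
rewrite ler_norml /clamp; have := ler_norm (s - t); have := ler_norm (t - s).
rewrite (distrC t s) => h1 h2.
by case: (leP s 0) => ?; case: (leP t 0) => ?; try case: (leP 1 s) => ?; try case: (leP 1 t) => ?; apply/andP; split; lra.
Qed.
Lemma curve_pairing_continuous (G: curve R d Omega) Psi: CbH Psi ->
 continuous (fun t => pairing (G (clamp t)) Psi).
move=> cP t; case: (cP) => _ _ [K0 PK0]; pose K := Num.max K0 1.
have K1: 0 < K by rewrite lt_max ltr01 orbT.
have PK x: frobnorm (Psi x) <= K by rewrite le_max PK0.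
apply/cvgrPdist_lt => e e0.
have [r r0 H] := curve_modulus G (clamp01 t) (divr_gt0 e0 K1).
exists r => //= s; rewrite /ball /= => st; rewrite distrC -lte_fin.
apply: le_lt_trans (pairing_dTV _ _ cP K1 PK) _.
rewrite -lte_pdivlMl // -EFinM mulrC; apply: H (clamp01 s) _.
by apply: le_lt_trans (clamp_lip _ _) _; rewrite distrC.
Qed.
Variable dist : Omega -> Omega -> R.
Hypothesis dM : metrizes dist.
Lemma curve_sqnorm_meas (G: curve R d Omega) U :
 mx_measurable (`[0 : R, 1] `*` setT) (fun z: R * borel Omega => U z.1 z.2 : M) ->
 measurable_fun `[0 : R, 1] (fun t => sqnorm (G t) (U t)).
move=> mU.
have hx Psi: CbH Psi -> mfun (fun t => pairing (G (clamp t)) Psi).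
 by move=> cP; apply: continuous_measurable_fun; exact: curve_pairing_continuous.
have hk W (pW: psd W) (A: set (borel Omega)) (mA: measurable A) :=
 curve_frob_meas dM hx pW mA.
pose D : set (R * borel Omega) := `[0 : R, 1] `*` setT.
have mD: measurable D by exact: measurableX.
pose U' (z: R * borel Omega) : M := if z \in D then U z.1 z.2 else 0.
have mU': mxmfun U'.
 move=> i j; have [m1 m2] := mU i j.
 move/(measurable_restrictT _ mD) : m1 => m1; move/(measurable_restrictT _ mD) : m2 => m2.
 split.
  apply: (eq_measurable_fun _ _ m1) => z _; rewrite patchE /U'.
  by case: ifP => // _; rewrite mxE.
 apply: (eq_measurable_fun _ _ m2) => z _; rewrite patchE /U'.
 by case: ifP => // _; rewrite mxE.
have H: measurable_fun `[0 : R, 1] (fun t => sqnorm (G (clamp t)) (fun y => U' (t, y))).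
 exact: (measurable_funTS (sqnorm_meas hk mU')).
apply: (eq_measurable_fun _ _ H) => t; rewrite inE /= in_itv /= => t01.
rewrite clamp_id //; congr (sqnorm _ _); apply/funext => y; rewrite /U' ifT //.
by rewrite inE /D /=; split => //=; rewrite in_itv.
Qed.
End curve_measurability.

(** * Test fields solving the Hamilton-Jacobi equation *)

Section dual.
Context {R : realType} {d : nat} {Omega : ptopologicalType}.
Local Notation M := 'M[R[i]]_d.
Lemma mx_continuous_inv (P: Omega -> M) e: 0 < e -> (forall x, psd (P x - e *c 1%:M)) ->
 mx_continuous P -> mx_continuous (fun x => invmx (P x)).
move=> e0 pP cP.
have uP x: P x \in unitmx by exact: coercive_unit (pP x) e0.
have cD x: frobnorm (P y - P x) @[y --> x] --> (0: R).
 rewrite -[X in _ --> X](sqrtr0 R); apply: continuous_cvg; first exact: sqrt_continuous.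
 have C: mx_continuous (fun y => P y + - P x).
  by apply: mx_continuousD => //; exact: mx_continuous_cst.
 have ->: 0 = frob (P x - P x) (P x - P x) by rewrite subrr frob0l.
 have : continuous (fun y => frob (P y - P x) (P y - P x)).
  under eq_fun do rewrite frobE.
  apply: continuous_sumr => i; apply: continuous_sumr => j y.
  rewrite /continuous_at; apply: cvgD; apply: cvgM;
  by [exact: (C i j).1|exact: (C i j).2].
 exact.
have L x y: frobnorm (invmx (P y) - invmx (P x)) <= (d%:R / e) ^+ 2 * frobnorm (P y - P x).
 have ->: invmx (P y) - invmx (P x) = invmx (P y) *m (P x - P y) *m invmx (P x).
  by rewrite mulmxBr mulVmx // mulmxBl mul1mx -mulmxA mulmxV // mulmx1.
 apply: le_trans (frobnormM _ _) _.
 have n0 A: 0 <= frobnorm (A: M) by exact: fnorm_ge0.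
 rewrite expr2 mulrAC; apply: ler_pM => //; last exact: frobnorm_inv (pP x) e0.
 apply: le_trans (frobnormM _ _) _; rewrite -(frobnormN (P x - P y)) opprB.
 by apply: ler_wpM2r => //; exact: frobnorm_inv (pP y) e0.
have Lc x: (fun y => (d%:R / e) ^+ 2 * frobnorm (P y - P x)) @ x --> (0: R).
 rewrite -[X in _ --> X](mulr0 ((d%:R / e) ^+ 2)); apply: cvgM; [exact: cvg_cst|exact: cD].
have key (f: M -> R) x : (forall A B, `|f A - f B| <= frobnorm (A - B)) ->
  (fun y => f (invmx (P y))) @ x --> f (invmx (P x)).
 move=> fL; apply/cvgrPdist_lt => r r0.
 have /cvgrPdist_lt /(_ _ r0) := Lc x; apply: filterS => y; rewrite sub0r normrN => h.
 rewrite distrC; apply: le_lt_trans (fL _ _) _; apply: le_lt_trans (L x y) _.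
 exact: le_lt_trans (ler_norm _) h.
move=> i j; split => x; apply: (key (fun A => _ (A i j))) => A B.
 by rewrite -ReN -ReD; apply: le_trans (Re_le_frobnorm (A - B) i j); rewrite !mxE.
by rewrite -ImN -ImD; apply: le_trans (Im_le_frobnorm (A - B) i j); rewrite !mxE.
Qed.
Lemma frobnorm_spf (Q: M) mu (c: R): Q *m Q ^t* = 1%:M -> (forall i, `|mu i| <= c) ->
 frobnorm (spf Q mu) <= d%:R * c.
move=> QQ mc.
have [c0|c0] := leP 0 c; last first.
 suff d0 : d = 0%N.
  rewrite /frobnorm spf_frob // big1 ?sqrtr0 ?d0 ?mul0r // => i _.
  by have := le_lt_trans (normr_ge0 _) (le_lt_trans (mc i) c0); rewrite ltxx.
 case: (posnP d) => // dp; have := le_lt_trans (normr_ge0 _) (le_lt_trans (mc (Ordinal dp)) c0).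
 by rewrite ltxx.
rewrite -(@ler_pXn2r _ 2) // ?nnegrE ?mulr_ge0 ?fnorm_ge0 //.
rewrite sqr_frobnorm spf_frob // (@le_trans _ _ (\sum_(i < d) c ^+ 2)) //.
 by apply: ler_sum => i _; rewrite -expr2 -real_normK ?num_real // lerXn2r ?nnegrE.
rewrite sumr_const card_ord -[leLHS]mulr_natl exprMn; apply: ler_wpM2r; first exact: sqr_ge0.
by case: (d) => [|n]; rewrite ?expr0n // -natrX ler_nat expnS leq_pmulr.
Qed.
Lemma spfB (Q: M) mu nu: spf Q mu - spf Q nu = spf Q (fun i => mu i - nu i).
rewrite -scaleN1r; have ->: -1 = real_complex R (-1) by rewrite rmorphN rmorph1.
by rewrite spfZ spfD; congr (spf _ _); apply/funext => i; rewrite mulN1r.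
Qed.

Section test_field.
Variables (w eps K: R) (P: Omega -> M).
Hypotheses (w0: 0 < w) (wpi: w <= pi / 2) (e0: 0 < eps).
Hypotheses (cP: mx_continuous P) (pP: forall x, psd (P x - eps *c 1%:M))
 (PK: forall x, frobnorm (P x) <= K).
Definition waveF t x: M := ((sin w)^-1 * sin (w + - w * t)) *c 1%:M +
 ((sin w)^-1 * sin (0 + w * t)) *c P x.
Definition dwaveF t x: M := (- ((sin w)^-1 * w * cos (w + - w * t))) *c 1%:M +
 ((sin w)^-1 * w * cos (0 + w * t)) *c P x.
(** All matrices at [x] are functions of the single matrix [P x] and commute, so the scalar formula
    carries over and [dricF] is its time derivative. *)
Definition ricF t x: M := 2 *c (dwaveF t x *m invmx (waveF t x)).
Definition dricF t x: M := (- 2^-1) *c (ricF t x *m ricF t x) + (- (2 * w ^+ 2)) *c 1%:M.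
Lemma field_spectral x: exists Q mu, [/\ Q *m Q ^t* = 1%:M, forall i, eps <= mu i <= K,
 P x = spf Q mu,
 forall t, waveF t x = spf Q (fun i => wave w (mu i) t) &
 forall t, 0 <= t <= 1 -> ricF t x = spf Q (fun i => ric w (mu i) t) /\
  dricF t x = spf Q (fun i => dric w (mu i) t)].
have [Q [mu [QQ mue PE]]] := psd_coercive (pP x) e0.
have muK i: mu i <= K.
 apply: le_trans (PK x); rewrite PE -(@ler_pXn2r _ 2) // ?nnegrE ?fnorm_ge0 //.
  by rewrite sqr_frobnorm spf_frob // (bigD1 i) //= -expr2 lerDl sumr_ge0 // => j _; rewrite -expr2 sqr_ge0.
 exact: le_trans (ltW e0) (mue i).
have wE t: waveF t x = spf Q (fun i => wave w (mu i) t).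
 rewrite /waveF PE -(spf1 QQ) !spfZ spfD; congr (spf _ _); apply/funext => i.
 by rewrite /wave; ring.
exists Q, mu; split => // [i|t t01]; first by rewrite mue muK.
have rE: ricF t x = spf Q (fun i => ric w (mu i) t).
 rewrite /ricF wE (spf_inv QQ); last first.
  move=> i; have [B [_ H]] := ric_bounds w0 wpi K e0.
  by have [] := H (mu i) t _ t01; rewrite ?mue ?muK.
 rewrite /dwaveF PE -(spf1 QQ) !spfZ spfD spfM // spfZ; congr (spf _ _); apply/funext => i.
 by rewrite /ric /dwave; ring.
split; first exact: rE.
rewrite /dricF rE -(spf1 QQ) spfM // !spfZ spfD; congr (spf _ _).
by apply/funext => i; rewrite /dric; ring.
Qed.
Lemma wave_coercive t x: 0 <= t <= 1 -> psd (waveF t x - (Num.min eps 1) *c 1%:M).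
move=> t01; have [Q [mu [QQ mue _ -> _]]] := field_spectral x.
rewrite -(spf1 QQ) spfZ spfB; apply: spf_psd => // i; rewrite mulr1 subr_ge0.
apply: wave_lb => //; rewrite ?ge_min ?lexx ?orbT ?le_min ?ler01 ?(ltW e0) //.
by have /andP[->] := mue i.
Qed.
Lemma mu_ge1: 0 < Num.min eps 1. Proof. by rewrite lt_min e0 ltr01. Qed.
Lemma lin_continuous (a b: R): mx_continuous (fun x => a *c 1%:M + b *c P x).
by apply: mx_continuousD; first exact: mx_continuous_cst;
 apply: mx_continuousZ => // x; exact: cvg_cst.
Qed.
Lemma ricF_CbH t: 0 <= t <= 1 -> CbH (ricF t) /\ CbH (dricF t).
move=> t01; have [B [B0 H]] := ric_bounds w0 wpi K e0.
have c1: mx_continuous (ricF t).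
 apply: mx_continuousZ; first by move=> x; exact: cvg_cst.
 apply: mx_continuousM; first exact: lin_continuous.
 apply: (mx_continuous_inv mu_ge1); last exact: lin_continuous.
 by move=> x; exact: wave_coercive.
split; split => //.
- move=> x; apply/hermP; have [Q [mu [QQ _ _ _ /(_ t t01)[-> _]]]] := field_spectral x.
 exact: spf_adj.
- exists (d%:R * B) => x; have [Q [mu [QQ mK _ _ /(_ t t01)[-> _]]]] := field_spectral x.
 by apply: frobnorm_spf => // i; have [] := H _ t (mK i) t01.
- move=> x; apply/hermP; have [Q [mu [QQ _ _ _ /(_ t t01)[_ ->]]]] := field_spectral x.
 exact: spf_adj.
- apply: mx_continuousD; last exact: mx_continuous_cst.
 apply: mx_continuousZ; first by move=> x; exact: cvg_cst.
 exact: mx_continuousM.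
- exists (d%:R * B) => x; have [Q [mu [QQ mK _ _ /(_ t t01)[_ ->]]]] := field_spectral x.
 by apply: frobnorm_spf => // i; have [] := H _ t (mK i) t01.
Qed.
Lemma ricF_C1: C1_CbH ricF dricF.
have [L [L0 H]] := ric_C1 w0 wpi K e0.
have dL: 0 < d%:R * L + 1 :> R by rewrite ltr_wpDl // mulr_ge0.
split; first by move=> t; rewrite in_itv; exact: ricF_CbH.
 move=> t; rewrite in_itv /= => t01 e ep; exists (e / (d%:R * L + 1)); first exact: divr_gt0.
 move=> s; rewrite in_itv /= => s01 st x.
 have [Q [mu [QQ mK _ _ E]]] := field_spectral x.
 rewrite (E s s01).2 (E t t01).2 spfB.
 apply: le_trans (frobnorm_spf (c := L * `|s - t|) QQ _) _.
  by move=> i; have [] := H _ (mK i) s t s01 t01.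
 rewrite mulrA; move: st; rewrite ltr_pdivlMr // => /ltW h.
 by apply: le_trans h; rewrite mulrC ler_wpM2l // lerDl.
move=> t; rewrite in_itv /= => t01 e ep; exists (e / (d%:R * L + 1)); first exact: divr_gt0.
move=> s; rewrite in_itv /= => s01 st x.
have [Q [mu [QQ mK _ _ E]]] := field_spectral x.
rewrite (E s s01).1 (E t t01).1 (E t t01).2 spfB spfZ spfB.
apply: le_trans (frobnorm_spf (c := L * `|s - t| ^+ 2) QQ _) _.
 by move=> i; have [] := H _ (mK i) s t s01 t01.
rewrite expr2 !mulrA; apply: ler_wpM2r => //; move: st; rewrite ltr_pdivlMr // => /ltW h.
by apply: le_trans h; rewrite mulrC ler_wpM2l // lerDl.
Qed.
(** At the two end times the field is affine in [P] and in its inverse respectively; this is how the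
    sum that defines [fid] emerges from the weak equation. *)
Lemma ricF0 x: ricF 0 x = (2 * w / sin w) *c P x + (- (2 * w / sin w * cos w)) *c 1%:M.
have s0 := sin_w_gt0 w0 wpi; have sn: sin w != 0 by rewrite gt_eqF.
have [Q [mu [QQ mK -> _ E]]] := field_spectral x.
rewrite (E 0 _).1 ?lexx ?ler01 // -(spf1 QQ) !spfZ spfD; congr (spf _ _); apply/funext => i.
rewrite /ric /dwave /wave !mulr0 !addr0 sin0 cos0 mulr0 addr0; field.
by rewrite sn.
Qed.
Lemma ricF1 x: ricF 1 x = (2 * w / sin w * cos w) *c 1%:M + (- (2 * w / sin w)) *c invmx (P x).
have s0 := sin_w_gt0 w0 wpi; have sn: sin w != 0 by rewrite gt_eqF.
have [Q [mu [QQ mK -> _ E]]] := field_spectral x.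
have mp i: mu i != 0 by have /andP[h _] := mK i; rewrite gt_eqF // (lt_le_trans e0).
rewrite (E 1 _).1 ?lexx ?ler01 // spf_inv // -(spf1 QQ) !spfZ spfD; congr (spf _ _); apply/funext => i.
rewrite /ric /dwave /wave !mulr1 !add0r subrr sin0 cos0 add0r; field.
by rewrite sn mp.
Qed.
End test_field.
End dual.

(** * The dual lower bound for the action *)

Section dual_inequality.
Context {R : realType} {d : nat} {Omega : ptopologicalType}.
Local Notation M := 'M[R[i]]_d.
Lemma pairingD (G: psd_measure R d Omega) (Psi Psi': Omega -> M): CbH Psi -> CbH Psi' ->
 pairing G (fun x => Psi x + Psi' x) = pairing G Psi + pairing G Psi'.
move=> c1 c2; have [g hg] := prob_dens G.
rewrite (pairing_dens hg (CbH_meas (CbHD c1 c2))).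
rewrite (pairing_dens hg (CbH_meas c1)) (pairing_dens hg (CbH_meas c2)).
under eq_Rintegral do rewrite frobDr.
by rewrite RintegralD //; apply: pairing_CbH_intg hg _.
Qed.
Lemma CbH_scale r (Psi: Omega -> M): CbH Psi -> CbH (fun x => r *c Psi x).
by move=> c; apply: (CbHZ (u := fun=> r) (L := `|r|)) => // x; exact: cvg_cst. Qed.
Lemma pairing_affine (G: prob R d Omega) (a b: R) Psi: CbH Psi ->
 pairing G (fun x => a *c 1%:M + b *c Psi x) = a + b * pairing G Psi.
move=> c; have c1: CbH (fun _: Omega => 1%:M : M) by apply: CbH_cst; exact: ctr1.
rewrite (pairingD G (CbH_scale a c1) (CbH_scale b c)) (pairingZ _ _ c1) (pairingZ _ _ c).
by rewrite pairing1 mulr1.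
Qed.
Lemma frob_polar (g U V: M): psd g ->
 frob (g *m (U + V)) (U + V) = frob (g *m U) U + 2 * frob (g *m U) V + frob (g *m V) V.
move=> pg; have E: frob (g *m V) U = frob (g *m U) V.
 by rewrite frob_mull (psd_herm pg) frobC.
by rewrite mulmxDr !frobDl !frobDr E; ring.
Qed.
Lemma frob_young (g U V: M): psd g ->
 `|frob (g *m U) V| <= 2^-1 * (frob (g *m U) U + frob (g *m V) V).
move=> pg; have h1 := psd_quad (U + V) pg; have h2 := psd_quad (U + (- V)) pg.
move: h1 h2; rewrite !frob_polar // mulmxN !(frobNr, frobNl) => h1 h2.
by rewrite ler_norml; apply/andP; split; lra.
Qed.
Lemma half_infty_bounds (h b c: R): (h%:E <= (2^-1)%:E * +oo - b%:E)%E /\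
 (- (2^-1)%:E * +oo - c%:E <= h%:E)%E.
have p2: (0 < (2^-1)%:E :> \bar R)%E by rewrite lte_fin invr_gt0.
by rewrite mulNe gt0_muley // addye // addNye leey leNye.
Qed.
Lemma dual_integrals (mu: {measure set (borel Omega) -> \bar R})
  (f q t x: borel Omega -> R) (c K: R) :
 intg mu setT f -> intg mu setT q -> intg mu setT t -> intg mu setT x ->
 \int[mu]_y t y = 1 -> (forall y, `|x y| <= 2^-1 * (f y + q y)) ->
 (forall y, q y <= K * t y) ->
 \int[mu]_y (- 2^-1 * q y - c * t y + x y) <= 2^-1 * \int[mu]_y f y - c /\
 - 2^-1 * \int[mu]_y f y - (K + c) <= \int[mu]_y (- 2^-1 * q y - c * t y + x y).
move=> If Iq It Ix t1 xb qt; have mT := @mtop _ (borel Omega).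
have Iq2 := intgZ (- 2^-1) mT Iq; have Ict := intgZ c mT It.
have Ifq := intgD mT If Iq; have Ifq2 := intgZ 2^-1 mT Ifq.
rewrite (RintegralD mT (intgB mT Iq2 Ict) Ix) (RintegralB mT Iq2 Ict).
rewrite (RintegralZl _ mT Iq) (RintegralZl _ mT It) t1.
have h1: \int[mu]_y q y <= K.
 by rewrite -[leRHS]mulr1 -t1 -(RintegralZl _ mT It); apply: (le_Rintegral mT Iq (intgZ K mT It)).
have h2: \int[mu]_y x y <= 2^-1 * (\int[mu]_y f y + \int[mu]_y q y).
 rewrite -(RintegralD mT If Iq) -(RintegralZl _ mT Ifq); apply: (le_Rintegral mT Ix Ifq2) => y _.
 exact: le_trans (ler_norm _) (xb y).
have h3: - 2^-1 * (\int[mu]_y f y + \int[mu]_y q y) <= \int[mu]_y x y.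
 rewrite -(RintegralD mT If Iq) -(RintegralZl _ mT Ifq).
 apply: (le_Rintegral mT (intgZ (- 2^-1) mT Ifq) Ix) => y _.
 by have := xb y; rewrite ler_norml mulNr => /andP[].
by split; lra.
Qed.
Lemma frob_affine_r (g A: M) (a c: R) :
 frob g (a *c A + (- c) *c 1%:M) = a * frob g A - c * tr_re g.
by rewrite frobDr !frobZr (frobC g 1%:M) frob1l mulNr. Qed.
Lemma frob_le_tr (g A: M) K: psd g -> frobnorm A <= K -> frob g A <= K * tr_re g.
move=> pg AK; apply: le_trans (frob_CS _ _) _; rewrite mulrC.
by apply: ler_pM; rewrite ?fnorm_ge0 // psd_le_tr.
Qed.

Section fixed_time.
Variables (G: prob R d Omega) (U Psi: Omega -> M) (c K: R).
Hypotheses (mU: mxmfun (U: borel Omega -> M)) (cP: CbH Psi).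
Let dPsi x: M := (- 2^-1) *c (Psi x *m Psi x) + (- c) *c 1%:M.
Hypotheses (cdP: CbH dPsi) (PK: forall x, frobnorm (Psi x *m Psi x) <= K).
(** Young's inequality bounds the term linear in [U] by half the quadratic forms of [U] and of
    [Psi]; the [Psi] part cancels against the square in [dPsi], and [c] remains because the trace is
    1. An infinite norm of [U] is treated apart. *)
Lemma dual_fixed_time: let h := pairing G dPsi + pairing2 G U Psi in
 (h%:E <= (2^-1)%:E * sqnorm G U - c%:E)%E /\
 (- (2^-1)%:E * sqnorm G U - (K + c)%:E <= h%:E)%E.
move=> h; have [g hg] := prob_dens G; pose tm := trace_measure G.
pose f x := frob (g x *m U x) (U x).
have mg := hasdens_meas hg; have mP := CbH_meas cP.
have mf: mfun f by apply: measurable_frob => //; exact: mxmM.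
have f0 x: 0 <= f x by apply: psd_quad; exact: hasdens_psd hg.
have SE: sqnorm G U = (\int[tm]_x (f x)%:E)%E by exact: sqnorm_dens hg mU.
have S0: (0 <= sqnorm G U)%E by rewrite SE; apply: integral_ge0 => x _; rewrite lee_fin.
have [Sy|Sy] := eqVneq (sqnorm G U) +oo%E.
 rewrite Sy; exact: half_infty_bounds.
have iF: intg tm setT f.
 apply/integrableP; split; first exact/mEFinP.
 rewrite (eq_integral (fun x => (f x)%:E)) => [|x _]; last by rewrite /= ger0_norm.
 by rewrite -SE ltey.
have mS: mxmfun (fun x: borel Omega => Psi x *m Psi x) by exact: mxmM.
have sq x: frob (g x *m Psi x) (Psi x) = frob (g x) (Psi x *m Psi x).
 by rewrite frob_mulr; congr (frob _ (_ *m _)); have [/(_ x)/hermP-> _ _] := cP.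
have iP: intg tm setT (fun x => frob (g x) (Psi x *m Psi x)) by exact: hasdens_frob_intg hg mS PK.
have iT: intg tm setT (fun x => tr_re (g x)) by exact: hasdens_tr_intg hg.
have mX: mfun (fun x => frob (g x *m U x) (Psi x)).
 exact: (measurable_frob (mxmM mg mU) mP).
have bX x: `|frob (g x *m U x) (Psi x)| <= 2^-1 * (f x + frob (g x) (Psi x *m Psi x)).
 by rewrite -sq; apply: frob_young; exact: hasdens_psd hg.
have iX: intg tm setT (fun x => frob (g x *m U x) (Psi x)).
 exact: (intg_dom mtop mX (fun x _ => bX x) (intgZ 2^-1 mtop (intgD mtop iF iP))).
have dE x: frob (g x) (dPsi x) = - 2^-1 * frob (g x) (Psi x *m Psi x) - c * tr_re (g x).
 exact: frob_affine_r.
have qt x: frob (g x) (Psi x *m Psi x) <= K * tr_re (g x).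
 exact: frob_le_tr (hasdens_psd x hg) (PK x).
have [up lo] := dual_integrals c iF iP iT iX (prob_tr hg) bX qt.
have hE: h = \int[tm]_x (- 2^-1 * frob (g x) (Psi x *m Psi x) - c * tr_re (g x)
  + frob (g x *m U x) (Psi x)).
 rewrite /h (pairing_dens hg (CbH_meas cdP)) (pairing2_dens hg mU mP).
 under eq_Rintegral do rewrite dE.
 by rewrite (RintegralD mtop (intgB mtop (intgZ (- 2^-1) mtop iP)
  (intgZ c mtop iT)) iX).
rewrite SE -(EFin_Rintegral mtop iF) -EFinN -!EFinM -!EFinB !lee_fin hE; split; [exact: up|exact: lo].
Qed.
End fixed_time.
Variable dist : Omega -> Omega -> R.
Hypothesis dM : metrizes dist.
Lemma integral01_affine (S: R -> \bar R) (a b: R): measurable_fun `[0 : R, 1] S ->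
 (forall t, 0 <= S t)%E -> (\int[lebesgue_measure]_(t in `[0%R, 1%R]) S t < +oo)%E ->
 (\int[lebesgue_measure]_(t in `[0%R, 1%R]) (a%:E * S t - b%:E) =
  a%:E * \int[lebesgue_measure]_(t in `[0%R, 1%R]) S t - b%:E)%E.
move=> mS S0 Soo; pose mu := @lebesgue_measure R.
have m01: (mu `[0%R, 1%R]%classic = 1)%E by rewrite /mu lebesgue_measure_itv /= lte01 sube0.
have iS: mu.-integrable `[0%R, 1%R] S.
 apply/integrableP; split => //.
 by under eq_integral do rewrite gee0_abs //.
have ib: mu.-integrable `[0%R, 1%R] (cst b%:E).
 apply/integrableP; split; first exact: measurable_cst.
 by rewrite /= integral_cst //= [X in (_ * X)%E](_: _ = 1%E) ?mule1 ?ltry //; exact: m01.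
have iaS: mu.-integrable `[0%R, 1%R] (fun t => a%:E * S t)%E by exact: integrableZl.
rewrite (integralB _ iaS ib) // integralZl // integral_cst //=.
by rewrite [X in (_ - _ * X)%E]m01 mule1.
Qed.
(** The fixed-time inequality integrated over [0, 1]. When [cos w] is the fidelity of the end points
    and [P] is nearly optimal, the bracket nearly vanishes and [4 w^2], the squared distance,
    remains. *)
Lemma dual_action (G: curve R d Omega) U (w eps K: R) (P: Omega -> M) :
 0 < w -> w <= pi / 2 -> 0 < eps -> mx_continuous P ->
 (forall x, psd (P x - eps *c 1%:M)) -> (forall x, frobnorm (P x) <= K) ->
 L2_field G U -> weak_equation G U ->
 ((4 * w ^+ 2 + 4 * w / sin w * (2 * cos w - pairing (G 1%R) (fun x => invmx (P x)) -
  pairing (G 0%R) P))%:E <= action G U)%E.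
move=> w0 wpi e0 cP pP PK [hU mU actU] weak.
have CP := ricF_CbH w0 wpi e0 cP pP PK.
have C1 := ricF_C1 w0 wpi e0 cP pP PK.
have [B [B0 HB]] := ric_bounds w0 wpi K e0.
have ricB t x: 0 <= t <= 1 -> frobnorm (ricF w P t x) <= d%:R * B.
 move=> t01; have [Q [mu [QQ mK _ _ /(_ t t01)[-> _]]]] := field_spectral w0 wpi e0 pP PK x.
 by apply: frobnorm_spf => // i; have [] := HB _ t (mK i) t01.
have in01 t: t \in `[0 : R, 1] -> 0 <= t <= 1 by rewrite in_itv.
have mUt t: 0 <= t <= 1 -> mxmfun (U t: borel Omega -> M).
 move=> t01 i j; have [m1 m2] := mU i j.
 have mD: measurable (`[0 : R, 1] `*` [set: borel Omega]) by exact: measurableX.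
 have inD y: (t, y) \in `[0 : R, 1] `*` [set: borel Omega].
  by rewrite inE; split => //=; rewrite in_itv.
 move/(measurable_restrictT _ mD) : m1 => m1; move/(measurable_restrictT _ mD) : m2 => m2.
 split.
  apply: (eq_measurable_fun _ _ (mcomp m1 (pair1_measurable t))) => y _ /=.
  by rewrite patchE inD.
 apply: (eq_measurable_fun _ _ (mcomp m2 (pair1_measurable t))) => y _ /=.
 by rewrite patchE inD.
pose S t := if 0 <= t <= 1 then sqnorm (G t) (U t) else 0%E.
have S0 t: (0 <= S t)%E.
 rewrite /S; case: ifP => // t01; have [g hg] := prob_dens (G t).
 rewrite (sqnorm_dens hg (mUt t t01)); apply: integral_ge0 => x _.
 by rewrite lee_fin; apply: psd_quad; exact: hasdens_psd hg.
have mS: measurable_fun `[0 : R, 1] S.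
 apply: (eq_measurable_fun _ _ (@curve_sqnorm_meas R d Omega dist dM G U mU)) => t.
 by rewrite inE /= in_itv /S /= => ->.
have actE: action G U = (\int[lebesgue_measure]_(t in `[0%R, 1%R]) S t)%E.
 by apply: eq_integral => t; rewrite inE /= in_itv /S /= => ->.
pose h t := pairing (G t) (dricF w P t) + pairing2 (G t) (U t) (ricF w P t).
have hb t: 0 <= t <= 1 -> ((h t)%:E <= (2^-1)%:E * S t - (2 * w ^+ 2)%:E)%E /\
  ((- 2^-1)%:E * S t - ((d%:R * B) * (d%:R * B) + 2 * w ^+ 2)%:E <= (h t)%:E)%E.
 move=> t01; rewrite /S t01 EFinN; have [c1 c2] := CP t t01.
 apply: (@dual_fixed_time (G t) (U t) (ricF w P t) (2 * w ^+ 2) _ (mUt t t01) c1 c2) => x.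
 by apply: le_trans (frobnormM _ _) _; apply: ler_pM; rewrite ?fnorm_ge0 ?ricB.
have Soo: (\int[lebesgue_measure]_(t in `[0%R, 1%R]) S t < +oo)%E by rewrite -actE.
have Ige: (0 <= \int[lebesgue_measure]_(t in `[0%R, 1%R]) S t)%E by exact: integral_ge0.
have up: (\int[lebesgue_measure]_(t in `[0%R, 1%R]) (h t)%:E <=
  (2^-1)%:E * action G U - (2 * w ^+ 2)%:E)%E.
 rewrite actE -integral01_affine //; apply: le_integral_any => t /=.
 by rewrite in_itv => t01; have [] := hb t t01.
(* The lower bound excludes the value [-oo] of the integral, which [fine] would turn into 0. *)
have lo: ((- 2^-1)%:E * action G U - ((d%:R * B) * (d%:R * B) + 2 * w ^+ 2)%:E <=
  \int[lebesgue_measure]_(t in `[0%R, 1%R]) (h t)%:E)%E.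
 rewrite actE -integral01_affine //; apply: le_integral_any => t /=.
 by rewrite in_itv => t01; have [] := hb t t01.
have W := weak _ _ C1 0 1; rewrite /oriented_integral ler01 in W.
have {}W := W (ltac:(by rewrite in_itv /= lexx ler01)) (ltac:(by rewrite in_itv /= lexx ler01)).
have CPP: CbH P.
 split => //; last by exists K.
 by move=> x; apply/hermP; exact: psd_herm (coercive_psd (pP x) e0).
have Cinv: CbH (fun x => invmx (P x)).
 split; last by exists (d%:R / eps) => x; exact: frobnorm_inv.
  move=> x; have uP := coercive_unit (pP x) e0.
  apply/hermP; exact: psd_herm (psd_inv (coercive_psd (pP x) e0) uP).
 exact: (mx_continuous_inv e0 pP cP).
move: W.
rewrite (_: ricF w P 0 = fun x => (- (2 * w / sin w * cos w)) *c 1%:M + (2 * w / sin w) *c P x); last first.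
 by apply/funext => x; rewrite (ricF0 w0 wpi e0 pP PK) addrC.
rewrite (_: ricF w P 1 = fun x => (2 * w / sin w * cos w) *c 1%:M + (- (2 * w / sin w)) *c invmx (P x)); last first.
 by apply/funext => x; rewrite (ricF1 w0 wpi e0 pP PK).
rewrite !pairing_affine // => W.
move: up lo Ige Soo; rewrite actE.
set A := (\int[lebesgue_measure]_(t in `[0%R, 1%R]) S t)%E; case: A => [a| |] // up lo _ _.
move: up lo W; rewrite /Rintegral -!EFinM -!EFinB -/h.
rewrite (_: (fun tau => (pairing _ _ + pairing2 _ _ _)%:E) = fun x => (h x)%:E) //.
set I := (\int[_]_(t in _) _)%E; case: I => [I| |] //=; rewrite !lee_fin => up _ W.
move: W; set q := 2 * w / sin w => W.
rewrite (_: 4 * w / sin w = 2 * q); last by rewrite /q; ring.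
move: W up; lra.
Qed.
End dual_inequality.
Lemma limn_einf_le {R: realType} (u: (\bar R)^nat) (l: \bar R) :
 (forall n, u n <= l)%E -> (limn_einf u <= l)%E.
move=> ul; rewrite limn_einf_lim; apply: lime_le; first exact: is_cvg_einfs.
by apply: nearW => n; apply: le_trans (ul n); apply: ereal_inf_lbound; exists n => /=.
Qed.

(** * A monotone criterion for L2 limits *)

Section square_integrable_limits.
Context {disp : measure_display} {T : measurableType disp} {R : realType}.
Variables (mu: {measure set T -> \bar R}) (D: set T).
Hypotheses (mD: measurable D) (D1: (mu D <= 1)%E).
Local Notation intg f := (mu.-integrable D (EFin \o f)).
Lemma intg_cst (c: R): intg (fun=> c).
apply/integrableP; split; first exact: (measurable_cst c%:E).
rewrite /= integral_cst //; apply: lte_mul_pinfty => //.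
by apply: le_lt_trans D1 _; rewrite ltry.
Qed.
Lemma intg_bounded (u: T -> R) (B: R): measurable_fun D u ->
 (forall t, D t -> `|u t| <= B) -> intg u.
by move=> mu' uB; exact: (intg_dom mD mu' uB (intg_cst B)). Qed.
Variables (e: nat -> T -> R) (C: R).
Hypotheses (me: forall N, measurable_fun D (e N)) (e0: forall N t, 0 <= e N t)
 (eB: forall N, exists B, forall t, D t -> `|e N t| <= B)
 (eC: forall N, \int[mu]_(t in D) (e N t * e N t) <= C)
 (eM: forall N M, (N <= M)%N ->
  \int[mu]_(t in D) (e N t * e N t) <= \int[mu]_(t in D) (e N t * e M t)).
Let ie N: intg (e N).
by have [B h] := eB N; exact: intg_bounded (me N) h. Qed.
Let iee N M: intg (fun t => e N t * e M t).
by have [B h] := eB N; exact: (intgM_bounded mD (ie M) (me N) h). Qed.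
Let a N := \int[mu]_(t in D) (e N t * e N t).
(** Expanding the square and applying [eM], as one does for martingales: the squared norms [a]
    increase, and their gaps control distances. *)
Let dist2 N M: (N <= M)%N -> \int[mu]_(t in D) ((e M t - e N t) * (e M t - e N t)) <= a M - a N.
move=> NM; have h: \int[mu]_(t in D) ((e M t - e N t) * (e M t - e N t)) =
  a M + a N - 2 * \int[mu]_(t in D) (e N t * e M t).
 rewrite -(RintegralD mD (iee M M) (iee N N)) -(RintegralZl 2 mD (iee N M)).
 rewrite -(RintegralB mD (intgD mD (iee M M) (iee N N)) (intgZ 2 mD (iee N M))).
 by apply: eq_Rintegral => t _; ring.
have := eM NM; rewrite h -/(a N); lra.
Qed.
Let a_homo: {homo a : n m / (n <= m)%N >-> n <= m}.
move=> N M NM; rewrite -subr_ge0; apply: le_trans (dist2 NM).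
by apply: Rintegral_ge0 => t _; rewrite -expr2 sqr_ge0.
Qed.
Let a_sup k: exists n, (k <= n)%N /\ sup (range a) - (2^-1) ^+ k * (2^-1) ^+ k <= a n.
have hs: has_sup (range a) by split; [exists (a 0%N); exists 0%N|exists C => _ [n _ <-]; exact: eC].
have k0: 0 < (2^-1 : R) ^+ k * (2^-1) ^+ k by rewrite mulr_gt0 // exprn_gt0 // invr_gt0.
have [_ [n _ <-] h] := sup_adherent k0 hs.
exists (maxn k n); split; first exact: leq_maxl.
by apply: le_trans (ltW h) _; apply: a_homo; exact: leq_maxr.
Qed.
Let a_le n: a n <= sup (range a).
by apply: ub_le_sup; [exists C => _ [m _ <-]; exact: eC|exists n]. Qed.
(** The squared norms increase to a finite supremum. Along indices where the gap is at most [4^-k],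
    consecutive terms differ by at most [2^-k] in L1, so the sequence converges almost everywhere
    under an integrable bound. Dominated convergence gives the integrals, and Fatou's lemma the norm
    of the limit. *)
Lemma L2_limit: exists (q: T -> R) (phi: nat -> nat),
 [/\ forall k, (k <= phi k)%N, forall t, 0 <= q t, measurable_fun D q /\ intg q,
  (\int[mu]_(t in D) (q t * q t)%:E <= C%:E)%E &
  forall A, measurable A -> A `<=` D ->
  (fun k => \int[mu]_(t in A) e (phi k) t) @ \oo --> \int[mu]_(t in A) q t].
have [phi Hphi] := choice a_sup.
pose E k := e (phi k); pose u k t := E k.+1 t - E k t.
have mE k: measurable_fun D (E k) by exact: me.
have mu_ k: measurable_fun D (u k) by apply: measurable_funB; exact: mE.
have uB k: exists B, forall t, D t -> `|u k t| <= B.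
 have [B1 h1] := eB (phi k); have [B2 h2] := eB (phi k.+1).
 exists (B2 + B1) => t Dt; apply: le_trans (ler_normB _ _) _; apply: lerD; [exact: h2|exact: h1].
have iu k: intg (u k) by have [B h] := uB k; exact: intg_bounded (mu_ k) h.
have iuu k: intg (fun t => u k t * u k t).
 by have [B h] := uB k; exact: (intgM_bounded mD (iu k) (mu_ k) h).
have u2 k: \int[mu]_(t in D) (u k t * u k t) <= (2^-1) ^+ k * (2^-1) ^+ k.
 have h1 := (Hphi k).2; have h2 := (Hphi k.+1).2.
 have h3 := a_le (phi k); have h4 := a_le (phi k.+1).
 have h5: (2^-1) ^+ k.+1 * (2^-1) ^+ k.+1 <= (2^-1 : R) ^+ k * (2^-1) ^+ k.
  have p0: 0 <= (2^-1 : R) ^+ k * (2^-1) ^+ k by rewrite mulr_ge0 // exprn_ge0 // invr_ge0.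
  rewrite exprS mulrACA; move: p0; set X := _ * _; lra.
 have [kk|kk] := leqP (phi k) (phi k.+1).
  by apply: le_trans (dist2 kk) _; lra.
 rewrite (_: \int[mu]_(t in D) _ = \int[mu]_(t in D)
  ((e (phi k) t - e (phi k.+1) t) * (e (phi k) t - e (phi k.+1) t))); last first.
  by apply: eq_Rintegral => t _; rewrite /u /E; ring.
 by apply: le_trans (dist2 (ltnW kk)) _; lra.
have au k: (\int[mu]_(t in D) (`|u k t|)%:E <= ((2^-1) ^+ k)%:E)%E.
 have iau: intg (fun t => `|u k t|).
  have [B h] := uB k; apply: (@intg_bounded _ B); first exact: mcomp (mu_ k).
  by move=> t Dt; rewrite normr_id; exact: h.
 rewrite -(EFin_Rintegral mD iau) lee_fin.
 have p0: 0 < (2^-1 : R) ^+ k by rewrite exprn_gt0 // invr_gt0.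
 pose p := (2^-1 : R) ^+ k.
 (* The inequality between arithmetic and geometric mean with weight [p]: both terms then integrate
    to at most [p], as the mass of [D] is at most 1. *)
 have pt t: `|u k t| <= 2^-1 * (p^-1 * (u k t * u k t) + p).
  have : 0 <= p^-1 * (`|u k t| - p) ^+ 2 by rewrite mulr_ge0 ?sqr_ge0 // invr_ge0 ltW.
  rewrite (_: p^-1 * _ = p^-1 * (u k t * u k t) + p - 2 * `|u k t|).
  by set X := p^-1 * _; lra.
  have E2: `|u k t| ^+ 2 = u k t * u k t by rewrite real_normK ?num_real // expr2.
  rewrite sqrrB E2; field; exact: lt0r_neq0.
 have i1: intg (fun t => p^-1 * (u k t * u k t)) by exact: intgZ.
 have i2: intg (fun t => p^-1 * (u k t * u k t) + p) by apply: intgD => //; exact: intg_cst.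
 apply: le_trans (le_Rintegral mD iau (intgZ 2^-1 mD i2) (fun t _ => pt t)) _.
 rewrite (RintegralZl _ mD i2) (RintegralD mD i1 (intg_cst p)) (RintegralZl _ mD (iuu k)).
 have h1: p^-1 * \int[mu]_(t in D) (u k t * u k t) <= p.
  by rewrite mulrC ler_pdivrMr //; exact: u2.
 have h2: \int[mu]_(t in D) p <= p.
  rewrite -lee_fin (EFin_Rintegral mD (intg_cst p)) integral_cst //.
  by rewrite -[leRHS]mule1; apply: lee_wpmul2l => //; rewrite lee_fin ltW.
 rewrite -/p; lra.
pose W t := (\sum_(k <oo) (`|u k t|)%:E)%E.
have mW: measurable_fun D W.
 apply: (ge0_emeasurable_sum (h := fun k t => (`|u k t|)%:E) (P := xpredT)) => //.
 by move=> k _; apply/mEFinP; exact: mcomp (mu_ k).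
have W0 t: (0 <= W t)%E by apply: nneseries_ge0 => k _ _; rewrite lee_fin.
have IW: (\int[mu]_(t in D) W t <= 2%:E)%E.
 have mu1 k: measurable_fun D (fun t => (`|u k t|)%:E).
  by apply/mEFinP; exact: mcomp (mu_ k).
 have u0 k t: D t -> (0 <= (`|u k t|)%:E)%E by move=> _; rewrite lee_fin.
 rewrite /W (integral_nneseries _ mD mu1 u0).
 apply: lime_le.
  by apply: is_cvg_nneseries => k _ _; apply: integral_ge0 => t _; rewrite lee_fin.
 apply: nearW => n; apply: (@le_trans _ _ (\sum_(0 <= k < n) ((2^-1) ^+ k)%:E)%E).
  by apply: lee_sum => k _; exact: au.
 rewrite sumEFin lee_fin; suff -> : \sum_(0 <= k < n) (2^-1 : R) ^+ k = 2 - 2 * (2^-1) ^+ n.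
  by rewrite lerBlDr lerDl mulr_ge0 // exprn_ge0 // invr_ge0.
 elim: n => [|n IH]; first by rewrite big_geq // expr0 mulr1 subrr.
 by rewrite big_nat_recr //= IH exprS; field.
have iW: mu.-integrable D W.
 apply/integrableP; split => //; under eq_integral do rewrite gee0_abs //.
 by apply: le_lt_trans IW _; rewrite ltry.
have tele k t: E k t = E 0%N t + \sum_(0 <= i < k) u i t.
 by rewrite (telescope_sumr (fun i => E i t)) // addrC subrK.
have Ecvg t: W t \is a fin_num -> cvgn (fun k => E k t).
 move=> Wf; have c1: cvgn [normed series (u ^~ t)].
  apply: nondecreasing_is_cvgn.
  by apply: nondecreasing_series => k _ _; exact: normr_ge0.
  exists (fine (W t)) => _ [n _ <-]; rewrite -lee_fin fineK // /series /= -sumEFin.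
  by apply: (@nneseries_lim_ge R (fun k => (`|u k t|)%:E) xpredT 0%N n) => k _ _; rewrite lee_fin.
 have c2 := normed_cvg c1.
 rewrite (_: (fun k => E k t) = fun k => E 0%N t + series (u ^~ t) k).
  by apply: is_cvgD => //; exact: is_cvg_cst.
 by apply/funext => k; rewrite tele.
(* The upper limit exists at every point and is measurable; the absolute value makes it nonnegative
   also where the sequence diverges. *)
pose q t := `|fine (limn_esup (fun k => (E k t)%:E))|.
have qE t: W t \is a fin_num -> (fun k => E k t) @ \oo --> q t.
 move=> /Ecvg cE; have l0: 0 <= limn (fun k => E k t).
  by apply: limr_ge => //; apply: nearW => k; exact: e0.
 have cE': (fun k => (E k t)%:E) @ \oo --> (limn (fun k => E k t))%:E.
  by apply: cvg_EFin; [exact: nearW|exact: cE].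
 rewrite /q (_: limn_esup _ = (limn (fun k => E k t))%:E) /= ?ger0_norm //.
 by have [_ ->] := cvg_limn_einf_sup cE'.
have mq: measurable_fun D q.
 apply: mcomp => //; apply: (mcomp (fine_measurable mtop)).
 by apply: measurable_fun_limn_esup => k; apply/mEFinP; exact: mE.
have Wfin: {ae mu, forall t, D t -> W t \is a fin_num} by exact: integrable_ae iW.
pose g t := ((`|E 0%N t|)%:E + W t)%E.
have ig: mu.-integrable D g.
 have i0: mu.-integrable D (fun t => (`|E 0%N t|)%:E).
  have [B h] := eB (phi 0%N); apply: (@intg_bounded (fun t => `|E 0%N t|) B).
  exact: mcomp (mE 0%N).
  by move=> t Dt; rewrite normr_id; exact: h.
 exact: integrableD.
have Eg k t: (`|(E k t)%:E| <= g t)%E.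
 rewrite tele; apply: (@le_trans _ _ ((`|E 0%N t|)%:E + (\sum_(0 <= i < k) `|u i t|)%:E)%E).
  rewrite -EFinD lee_fin; apply: le_trans (ler_normD _ _) _; rewrite lerD2l.
  exact: ler_norm_sum.
 apply: leeD2l; rewrite -sumEFin.
 by apply: (@nneseries_lim_ge R (fun k => (`|u k t|)%:E) xpredT 0%N k) => i _ _; rewrite lee_fin.
have DC A: measurable A -> A `<=` D -> mu.-integrable A (EFin \o q) /\
  (fun k => (\int[mu]_(t in A) (E k t)%:E)%E) @ \oo --> (\int[mu]_(t in A) (q t)%:E)%E.
 move=> mA AD.
 have [] := @dominated_convergence _ T R mu A mA (fun k t => (E k t)%:E) (fun t => (q t)%:E) g.
 - by move=> k; apply/mEFinP; exact: measurable_funS (mE k).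
 - by apply/mEFinP; exact: measurable_funS mq.
 - apply: filterS Wfin => t h At; apply: cvg_EFin; first exact: nearW.
  by apply: qE; apply: h; exact: AD.
 - exact: integrableS ig.
 - by apply: aeW => t k _; exact: Eg.
 by move=> h1 _ h2; split.
have iq: intg q by have [] := DC D mD (fun _ => id).
exists q, phi; split => //.
- by move=> k; have [] := Hphi k.
- by move=> t; exact: normr_ge0.
- have mE2 k: measurable_fun D (fun t => (E k t * E k t)%:E).
  by apply/mEFinP; apply: measurable_funM.
 have := @fatou _ T R mu D mD (fun k t => (E k t * E k t)%:E) mE2 _.
 move=> /(_ (fun k t _ => ltac:(by rewrite lee_fin -expr2 sqr_ge0))) F.
 rewrite (_: (\int[mu]_(t in D) _)%E = (\int[mu]_(t in D) limn_einf (fun k => (E k t * E k t)%:E))%E).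
  apply: le_trans F _.
  have h n: (\int[mu]_(t in D) (E n t * E n t)%:E <= C%:E)%E.
  by rewrite -(EFin_Rintegral mD (iee _ _)) lee_fin; exact: eC.
  exact: limn_einf_le.
 apply: ae_eq_integral => //.
 + by apply/mEFinP; exact: measurable_funM.
 + rewrite (_: (fun x => _) = fun x => (- limn_esup (fun k => - (E k x * E k x)%:E))%E).
  apply: (mcomp (f := -%E)) => //.
  apply: measurable_fun_limn_esup => k.
  by apply: (mcomp (f := -%E)) => //; exact: mE2.
  apply/funext => x; rewrite -[RHS]/(- limn_esup (-%E \o (fun k => (E k x * E k x)%:E)))%E.
  by rewrite limn_esupN oppeK.
 apply: filterS Wfin => t h Dt; apply/esym.
 have c: (fun k => (E k t * E k t)%:E) @ \oo --> (q t * q t)%:E.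
  apply: cvg_EFin; first exact: nearW.
  by apply: cvgM; apply: qE; exact: h.
 by have [-> _] := cvg_limn_einf_sup c.
- move=> A mA AD; have [iA cA] := DC A mA AD.
 by apply: fine_cvg; rewrite fineK //; exact: integrable_fin_num.
Qed.
End square_integrable_limits.

(** * Integrals over subintervals of the unit interval *)

Section interval_integrals.
Context {R : realType}.
Local Notation mu := (@lebesgue_measure R).
Local Notation intg D f := (mu.-integrable D (EFin \o f)).
Implicit Types (q f: R -> R) (s t u: R).
Definition iint q s t: R := \int[mu]_(x in `]s, t]) q x.
Lemma mu_oc s t: s <= t -> mu `]s, t]%classic = (t - s)%:E.
move=> st; rewrite lebesgue_measure_itv /=; case: ifPn => //.
by rewrite lte_fin -leNgt => ts; rewrite (le_anti (introT andP (conj st ts))) subrr.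
Qed.
Lemma mI s t: measurable (`]s, t]%classic : set (measurableTypeR R)).
exact: measurable_itv. Qed.
Lemma Rintegral_cst_oc (c: R) s t: s <= t -> \int[mu]_(x in `]s, t]) c = c * (t - s).
move=> st; rewrite Rintegral_cst // [X in fine X](_: _ = (t - s)%:E) //; exact: mu_oc.
Qed.
Lemma intg_itv q (i: interval R): intg setT q -> intg [set` i] q.
by move=> h; apply: integrableS h. Qed.
Lemma iint_cc q s t: intg setT q -> \int[mu]_(x in `[s, t]) q x = iint q s t.
by move=> h; rewrite /iint Rintegral_itv_obnd_cbnd //; exact: intg_itv. Qed.
Lemma iint_split q s t u: intg setT q -> s <= t -> t <= u -> iint q s u = iint q s t + iint q t u.
move=> h st tu; rewrite /iint -(@Rintegral_itvB _ q (BRight s) (BRight u) t) //.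
- by rewrite addrC subrK.
- exact: intg_itv.
Qed.
Lemma iint_ge0 q s t: (forall x, 0 <= q x) -> 0 <= iint q s t.
by move=> h; apply: Rintegral_ge0. Qed.
Lemma iint_le q f s t: intg setT q -> intg setT f -> (forall x, q x <= f x) -> iint q s t <= iint f s t.
by move=> h1 h2 h; apply: le_Rintegral => //; exact: intg_itv. Qed.
Lemma iint_mono q s t s' t': intg setT q -> (forall x, 0 <= q x) -> s <= s' -> s' <= t' -> t' <= t ->
 iint q s' t' <= iint q s t.
move=> h q0 h1 h2 h3; rewrite (iint_split h h1 (le_trans h2 h3)) (iint_split h h2 h3).
have := iint_ge0 s s' q0; have := iint_ge0 t' t q0; lra.
Qed.
Lemma iint_cst c s t: s <= t -> iint (fun=> c) s t = c * (t - s).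
exact: Rintegral_cst_oc. Qed.
Lemma iint_CS q s t: s <= t -> intg setT q -> intg setT (fun x => q x * q x) ->
 iint q s t ^+ 2 <= (t - s) * iint (fun x => q x * q x) s t.
move=> st iq iqq; have [->|ts] := eqVneq s t.
 by rewrite /iint set_itv_ge ?bnd_simp ?ltxx // !Rintegral_set0 expr0n subrr mul0r.
have st': 0 < t - s by rewrite subr_gt0 lt_neqAle ts.
pose m := iint q s t / (t - s).
have im: intg `]s, t] (fun=> m * m).
 apply/integrableP; split; first exact: (measurable_cst (m * m)%:E).
 by rewrite /= integral_cst //= [X in (_ * X)%E]mu_oc // -EFinM ltry.
have i1 := intg_itv `]s, t] iq; have i2 := intg_itv `]s, t] iqq.
have : 0 <= iint (fun x => (q x - m) ^+ 2) s t by apply: iint_ge0 => x; exact: sqr_ge0.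
have ->: iint (fun x => (q x - m) ^+ 2) s t =
  iint (fun x => q x * q x) s t - 2 * m * iint q s t + m * m * (t - s).
 rewrite -(iint_cst (m * m) st) /iint -(RintegralZl (2 * m) (mI _ _) i1).
 rewrite -(RintegralB (mI _ _) i2 (intgZ (2 * m) (mI _ _) i1)).
 rewrite -(RintegralD (mI _ _) (intgB (mI _ _) i2 (intgZ (2 * m) (mI _ _) i1)) im).
 by apply: eq_Rintegral => x _; ring.
have E: m * (t - s) = iint q s t by rewrite /m divfK // gt_eqF.
rewrite -E; set Q := iint _ s t => h.
have ->: (m * (t - s)) ^+ 2 = (t - s) * (m * m * (t - s)) by ring.
by apply: ler_wpM2l; [exact: ltW|move: h; lra].
Qed.
(** Functions on the whole line supported in []0, 1]], the half-open shape used by [iint], so that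
    integrals over the line and over the unit interval agree. *)
Definition L2fun q := [/\ mfun q, forall t, 0 <= q t,
 forall t, ~~ (0 < t <= 1) -> q t = 0 & intg setT (fun t => q t * q t)].
Lemma mu01: mu `]0, 1]%classic = 1%E.
by rewrite mu_oc // subr0. Qed.
Definition ind01: R -> R := ((fun=> 1) : R -> R) \_ (`]0, 1]%classic : set R).
Lemma ind01_in x: 0 < x <= 1 -> ind01 x = 1.
by move=> h; rewrite /ind01 patchE mem_set //= in_itv. Qed.
Lemma ind01_ge0 x: 0 <= ind01 x.
by rewrite /ind01 patchE; case: ifP. Qed.
Lemma intg_ind01: intg setT ind01.
rewrite /ind01 -restrict_EFin; apply/(integrable_mkcond _ (mI _ _)).
apply/integrableP; split; first exact: (measurable_cst 1%:E).
by rewrite /= integral_cst //= [X in (_ * X)%E]mu01 mule1 ltry.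
Qed.
Lemma L2fun_intg q: L2fun q -> intg setT q.
move=> [mq q0 qs iqq].
refine (@intg_dom R _ (measurableTypeR R) mu setT q (fun x => ind01 x + q x * q x)
 mtop mq _ (intgD mtop intg_ind01 iqq)) => x _.
rewrite ger0_norm //; case: (boolP (0 < x <= 1)) => h.
 by rewrite ind01_in //; have := sqr_ge0 (q x - 2^-1); rewrite sqrrB; lra.
by rewrite qs // mulr0 addr0 ind01_ge0.
Qed.
End interval_integrals.

(** * Dyadic difference quotients of a distance *)

Section grid.
Context {R : realType}.
Local Notation mu := (@lebesgue_measure R).
Local Notation intg D f := (mu.-integrable D (EFin \o f)).
Variable D : R -> R -> R.
Hypothesis D0 : forall s t, 0 <= D s t.
Hypothesis DT : forall s t u, D s u <= D s t + D t u.
Definition gp (n k: nat): R := k%:R / n%:R.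
Definition cell n k: set R := `]gp n k, gp n k.+1].
(** The difference quotient of [D] over the grid cell containing [t]; its integral over a union of
    cells is the length of the corresponding polygon. *)
Definition gridf n (t: R): R :=
 \sum_(k < n) (n%:R * D (gp n k) (gp n k.+1)) * (\1_(cell n k) t : R).
Lemma gp_le n k l: (k <= l)%N -> gp n k <= gp n l.
by move=> kl; rewrite /gp ler_wpM2r ?invr_ge0 // ler_nat. Qed.
Lemma gp0 n: gp n 0 = 0. Proof. by rewrite /gp mul0r. Qed.
Lemma gpn n: (0 < n)%N -> gp n n = 1.
by move=> n0; rewrite /gp divff // pnatr_eq0 -lt0n. Qed.
Lemma gpB n k: gp n k.+1 - gp n k = n%:R^-1.
by rewrite /gp -mulrBl -natrB // subSnn mul1r. Qed.
Lemma gpM n m k: (0 < m)%N -> gp (m * n) (m * k) = gp n k.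
by move=> m0; rewrite /gp !natrM -mulf_div divff ?mul1r // pnatr_eq0 -lt0n. Qed.
Lemma gridf_cell n l t: (l < n)%N -> cell n l t ->
 gridf n t = n%:R * D (gp n l) (gp n l.+1).
move=> ln tl; rewrite /gridf (bigD1 (Ordinal ln)) //= indicE mem_set // mulr1 big1 ?addr0 // => k kl.
rewrite indicE memNset ?mulr0 //; move: tl; rewrite /cell /= !in_itv /= => /andP[h1 h2] /andP[h3 h4].
have : (k < l)%N || (l < k)%N by rewrite -neq_ltn; apply: contra kl => /eqP h; apply/eqP/val_inj.
case/orP => h.
 by have := gp_le n h; rewrite leNgt (lt_le_trans h1 h4).
by have := gp_le n h; rewrite leNgt (lt_le_trans h3 h2).
Qed.
Lemma gridf_ge0 n t: 0 <= gridf n t.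
by apply: sumr_ge0 => k _; rewrite !mulr_ge0 // indicE. Qed.
Lemma gridf_meas n (A: set (measurableTypeR R)): measurable_fun A (gridf n).
apply: measurable_funTS; apply: measurable_sum => k; apply: measurable_funM => //.
by apply: measurable_indic; exact: measurable_itv.
Qed.
Lemma gridf_bounded n t: `|gridf n t| <= \sum_(k < n) (n%:R * D (gp n k) (gp n k.+1)).
rewrite ger0_norm ?gridf_ge0 //; by apply: ler_sum => k _; rewrite ler_piMr // ?mulr_ge0 // indicE; case: (_ \in _).
Qed.
Lemma gridf_intg n: intg setT (gridf n).
pose B := \sum_(k < n) (n%:R * D (gp n k) (gp n k.+1)).
have Z t: ~~ (0 < t <= 1) -> gridf n t = 0.
 move=> h; rewrite /gridf big1 // => k _; rewrite indicE memNset ?mulr0 //.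
 rewrite /cell /= in_itv /= => /andP[h1 h2]; move/negP: h; apply.
 have n0: (0 < n)%N by exact: leq_ltn_trans (leq0n k) (ltn_ord k).
 apply/andP; split; first by apply: le_lt_trans h1; rewrite -(gp0 n) gp_le.
 by apply: le_trans h2 _; rewrite -(gpn n0) gp_le.
refine (@intg_dom R _ (measurableTypeR R) mu setT (gridf n) (fun x => B * ind01 x)
 mtop (@gridf_meas n setT) _ (intgZ B mtop intg_ind01)) => t _.
case: (boolP (0 < t <= 1)) => h; first by rewrite ind01_in // mulr1 gridf_bounded.
by rewrite Z // normr0 mulr_ge0 ?ind01_ge0 //; apply: sumr_ge0 => k _; rewrite mulr_ge0.
Qed.
Lemma gridf_iint n i j: (i <= j)%N -> (j <= n)%N ->
 iint (gridf n) (gp n i) (gp n j) = \sum_(i <= l < j) D (gp n l) (gp n l.+1).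
elim: j => [|j IH] ij jn.
 move: ij; rewrite leqn0 => /eqP ->; rewrite big_geq // /iint set_itv_ge ?Rintegral_set0 //.
 by rewrite bnd_simp ltxx.
move: ij; rewrite leq_eqVlt => /orP[/eqP ->|]; last rewrite ltnS => ij.
 by rewrite big_geq // /iint set_itv_ge ?Rintegral_set0 // bnd_simp ltxx.
rewrite (iint_split (gridf_intg n) (gp_le n ij) (gp_le n (leqnSn j))) IH //; last exact: ltnW.
rewrite big_nat_recr //=; congr (_ + _).
rewrite /iint (_: \int[mu]_(x in _) _ = \int[mu]_(x in `]gp n j, gp n j.+1])
  (n%:R * D (gp n j) (gp n j.+1))); last first.
 by apply: eq_Rintegral => x; rewrite inE => hx; exact: gridf_cell.
rewrite Rintegral_cst_oc ?gp_le //= gpB mulrC mulrA mulVf ?mul1r //.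
by rewrite pnatr_eq0 -lt0n (leq_trans _ jn).
Qed.
Lemma D_chain n i j: (i <= j)%N -> (forall s, D s s = 0) ->
 D (gp n i) (gp n j) <= \sum_(i <= l < j) D (gp n l) (gp n l.+1).
move=> + Dss; elim: j => [|j IH] ij; first by move: ij; rewrite leqn0 => /eqP ->; rewrite Dss big_geq.
move: ij; rewrite leq_eqVlt => /orP[/eqP ->|]; first by rewrite Dss big_geq.
rewrite ltnS => ij; rewrite big_nat_recr //=; apply: le_trans (DT _ (gp n j) _) _.
by rewrite lerD2r; exact: IH.
Qed.
Hypothesis Dss : forall s, D s s = 0.
Definition dy N := gridf (2 ^ N).
Lemma exp2_gt0 N: (0 < 2 ^ N)%N. Proof. by rewrite expn_gt0. Qed.
Lemma dyadic_lift N M k: (N <= M)%N -> gp (2 ^ N) k = gp (2 ^ M) (2 ^ (M - N) * k).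
move=> NM; have ->: (2 ^ M = 2 ^ (M - N) * 2 ^ N)%N by rewrite -expnD subnK.
by rewrite gpM // exp2_gt0.
Qed.
Lemma dyadic_sub N M i j: (N <= M)%N -> (i <= j)%N -> (j <= 2 ^ N)%N ->
 iint (dy M) (gp (2 ^ N) i) (gp (2 ^ N) j) =
 \sum_(2 ^ (M - N) * i <= l < 2 ^ (M - N) * j) D (gp (2 ^ M) l) (gp (2 ^ M) l.+1).
move=> NM ij jN; rewrite !(dyadic_lift _ NM) gridf_iint //; first by rewrite leq_mul2l ij orbT.
by rewrite -{2}(subnK NM) expnD leq_mul2l jN orbT.
Qed.
(** By the triangle inequality, refining the grid can only lengthen the polygon. *)
Lemma dyadic_ge N M i j: (N <= M)%N -> (i <= j)%N -> (j <= 2 ^ N)%N ->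
 D (gp (2 ^ N) i) (gp (2 ^ N) j) <= iint (dy M) (gp (2 ^ N) i) (gp (2 ^ N) j).
move=> NM ij jN; rewrite (dyadic_sub NM ij jN) !(dyadic_lift _ NM); apply: D_chain => //.
by rewrite leq_mul2l ij orbT.
Qed.
Lemma grid_product n (f: R -> R): (0 < n)%N -> intg setT f ->
 \int[mu]_(t in `]0, 1]) (gridf n t * f t) =
 \sum_(k < n) (n%:R * D (gp n k) (gp n k.+1)) * iint f (gp n k) (gp n k.+1).
move=> n0 If; pose c (k: nat) := n%:R * D (gp n k) (gp n k.+1).
have i1 (k: 'I_n) : intg setT (fun t => (\1_(cell n k) t : R) * f t).
 apply: (intgM_bounded (K := 1)) => //; first by apply: measurable_indic; exact: measurable_itv.
 by move=> t _; rewrite indicE; case: (_ \in _); rewrite /= ?normr1 ?normr0.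
have i2 (k: 'I_n) : intg `]0, 1] (fun t => c k * ((\1_(cell n k) t : R) * f t)).
 by apply: intgZ => //; exact: intg_itv.
rewrite (_: \int[mu]_(t in _) _ = \int[mu]_(t in `]0, 1])
  \sum_(k <- index_enum 'I_n) (c k * ((\1_(cell n k) t : R) * f t))); last first.
 apply: eq_Rintegral => t _; rewrite /gridf mulr_suml; apply: eq_bigr => k _.
 by rewrite /c mulrA.
rewrite (Rintegral_sum (index_enum 'I_n) (mI _ _) i2); apply: eq_bigr => k _.
rewrite (RintegralZl _ (mI _ _) (intg_itv _ (i1 k))); congr (_ * _).
rewrite /iint [RHS]Rintegral_mkcond Rintegral_mkcond; apply: eq_Rintegral => t _.
rewrite !patchE indicE; have E: (t \in cell n k) = (t \in `]gp n k, gp n k.+1]%classic) by [].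
rewrite E; case: (boolP (t \in `]gp n k, gp n k.+1]%classic)) => [|_]; last by rewrite mul0r if_same.
rewrite inE /= in_itv /= mul1r => /andP[h1 h2]; rewrite ifT // inE /= in_itv /=.
apply/andP; split; first by apply: le_lt_trans h1; rewrite -(gp0 n) gp_le.
by apply: le_trans h2 _; rewrite -(gpn n0) gp_le.
Qed.
Variable C : R.
Hypothesis DC : forall s t, 0 <= s -> s <= t -> t <= 1 -> D s t ^+ 2 <= C * (t - s).
Hypothesis DE : forall N, \sum_(k < 2 ^ N) (2 ^ N)%:R * D (gp (2 ^ N) k) (gp (2 ^ N) k.+1) ^+ 2 <= C.
(** Since refinement lengthens, the integral of a finer quotient over a coarse cell is at least that
    of the coarse one; this is the monotonicity asked by [L2_limit], and [DE] bounds the norms. *)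
Lemma dyadic_limit: exists (q: R -> R), exists phi: nat -> nat,
 [/\ L2fun q, \int[mu]_t (q t * q t) <= C, forall k, (k <= phi k)%N &
  forall s t, 0 <= s -> s <= t -> t <= 1 -> (fun k => iint (dy (phi k)) s t) @ \oo --> iint q s t].
have m01: (mu `]0%R, 1%R]%classic <= 1)%E by rewrite mu01.
have E N: \int[mu]_(t in `]0, 1]) (dy N t * dy N t) =
  \sum_(k < 2 ^ N) (2 ^ N)%:R * D (gp (2 ^ N) k) (gp (2 ^ N) k.+1) ^+ 2.
 rewrite (grid_product (exp2_gt0 N) (gridf_intg _)); apply: eq_bigr => k _.
 by rewrite gridf_iint // big_nat1 -mulrA expr2.
have [|||||q0 [phi [hphi q00 [mq0 iq0] qq qlim]]] := @L2_limit _ _ R mu `]0, 1]%classic (mI _ _) m01 dy C.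
- by move=> N; exact: gridf_meas.
- by move=> N t; exact: gridf_ge0.
- by move=> N; eexists => t _; exact: gridf_bounded.
- by move=> N; rewrite E.
- move=> N M NM; rewrite E (grid_product (exp2_gt0 N) (gridf_intg _)); apply: ler_sum => k _.
 rewrite expr2 mulrA; apply: ler_wpM2l; first by rewrite mulr_ge0.
 exact: dyadic_ge.
pose q := q0 \_ `]0, 1]%classic.
have qin t: 0 < t <= 1 -> q t = q0 t by move=> h; rewrite /q patchE mem_set //= in_itv.
have qout t: ~~ (0 < t <= 1) -> q t = 0.
 by move=> h; rewrite /q patchE memNset //= in_itv; exact/negP.
have q_ge0 t: 0 <= q t by rewrite /q patchE; case: ifP.
have mq: mfun q by apply/(measurable_restrictT _ _).1.
have QE: (\int[mu]_t (q t * q t)%:E = \int[mu]_(t in `]0%R, 1%R]) (q0 t * q0 t)%:E)%E.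
 rewrite [RHS]integral_mkcond; apply: eq_integral => t _; rewrite patchE.
 case: (boolP (0 < t <= 1)) => h; first by rewrite mem_set /= ?in_itv // qin.
 by rewrite memNset ?qout ?mul0r //= in_itv; exact/negP.
have iqq: intg setT (fun t => q t * q t).
 apply/integrableP; split; first by apply/mEFinP; exact: measurable_funM.
 under eq_integral => t _ do rewrite /= ger0_norm ?mulr_ge0 //.
 by rewrite QE (le_lt_trans qq) // ltry.
exists q, phi; split => //.
 by rewrite -lee_fin (EFin_Rintegral mtop iqq) QE.
move=> s t s0 st t1.
have sub: (`]s, t]%classic : set R) `<=` `]0, 1]%classic.
 by move=> x /=; rewrite !in_itv /= => /andP[h1 h2]; rewrite (le_lt_trans s0 h1) (le_trans h2 t1).
have ->: iint q s t = \int[mu]_(x in `]s, t]) q0 x.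
 apply: eq_Rintegral => x; rewrite inE => /sub /=; rewrite in_itv /=; exact: qin.
by apply: qlim => //; exact: measurable_itv.
Qed.
End grid.

(** * Curves of finite energy and absolutely continuous functions *)

Section metric_density.
Context {R : realType}.
Local Notation mu := (@lebesgue_measure R).
Local Notation intg D f := (mu.-integrable D (EFin \o f)).
Implicit Types (s t u: R).
Lemma exp2_archimedean (C r: R): 0 < r -> exists N, C <= r * (2 ^ N)%:R.
move=> r0; pose x := Num.max 0 (C / r); have x0: 0 <= x by rewrite le_max lexx.
exists (Num.bound x); rewrite mulrC -ler_pdivrMr //.
apply: (@le_trans _ _ x); first by rewrite le_max lexx orbT.
apply: ltW; apply: lt_le_trans (archi_boundP x0) _.
by rewrite ler_nat ltnW // ltn_expl.
Qed.
Lemma gp_ge0 n k: 0 <= gp n k :> R.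
by rewrite /gp mulr_ge0 // invr_ge0. Qed.
Lemma gp_le1 n k: (0 < n)%N -> (k <= n)%N -> gp n k <= 1 :> R.
by move=> n0 kn; rewrite /gp ler_pdivrMr ?mul1r ?ler_nat // ltr0n. Qed.
Lemma iint_grid (h: R -> R) n: (0 < n)%N -> intg setT h ->
 \sum_(k < n) iint h (gp n k) (gp n k.+1) = iint h 0 1.
move=> n0 ih; have H j: \sum_(k < j) iint h (gp n k) (gp n k.+1) = iint h (gp n 0) (gp n j).
 elim: j => [|j IH]; first by rewrite big_ord0 /iint set_itv_ge ?Rintegral_set0 // bnd_simp ltxx.
 by rewrite big_ord_recr /= IH -(iint_split ih (gp_le n (leq0n j)) (gp_le n (leqnSn j))).
by rewrite H gp0 gpn.
Qed.
Lemma le_iint_total (h: R -> R) s t: intg setT h -> (forall x, 0 <= h x) ->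
 iint h s t <= \int[mu]_x h x.
move=> ih h0; rewrite /iint Rintegral_mkcond; apply: le_Rintegral => //.
 by rewrite -restrict_EFin; apply/(integrable_mkcond _ (mI _ _)); exact: integrableS ih.
by move=> x _; rewrite patchE; case: ifP.
Qed.

Section energy.
Variable D : R -> R -> R.
Hypothesis D0 : forall s t, 0 <= D s t.
Hypothesis DT : forall s t u, D s u <= D s t + D t u.
Hypothesis Dss : forall s, D s s = 0.
Hypothesis Dsym : forall s t, D s t = D t s.
Variable C : R.
Hypothesis DC : forall s t, 0 <= s -> s <= t -> t <= 1 -> D s t ^+ 2 <= C * (t - s).
Hypothesis DE : forall N, \sum_(k < 2 ^ N)
 (2 ^ N)%:R * D (gp (2 ^ N) k) (gp (2 ^ N) k.+1) ^+ 2 <= C.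
(** On dyadic points [q] dominates [D] because polygons lengthen. General end points are moved down
    to the grid, at a cost that [DC] and Cauchy-Schwarz make small. *)
Lemma energy_density: exists q, [/\ L2fun q, \int[mu]_t (q t * q t) <= C,
 forall s t, 0 <= s -> s <= t -> t <= 1 -> D s t <= iint q s t &
 (forall s t u, 0 <= s -> s <= t -> t <= u -> u <= 1 -> D s u = D s t + D t u) ->
 forall s t, 0 <= s -> s <= t -> t <= 1 -> D s t = iint q s t].
have [q [phi [Lq qC hphi qlim]]] := dyadic_limit D0 DT Dss DE.
have iq := L2fun_intg Lq; have [mq q0 qs iqq] := Lq.
have dyad N i j: (i <= j)%N -> (j <= 2 ^ N)%N ->
  D (gp (2 ^ N) i) (gp (2 ^ N) j) <= iint q (gp (2 ^ N) i) (gp (2 ^ N) j).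
 move=> ij jN.
 have a0: 0 <= gp (2 ^ N) i :> R by exact: gp_ge0.
 have b1: gp (2 ^ N) j <= 1 :> R by exact: (gp_le1 (exp2_gt0 N)).
 have c := qlim _ _ a0 (gp_le (2 ^ N) ij) b1.
 rewrite -(cvg_lim _ c) //; apply: limr_ge; first by apply/cvg_ex; eexists; exact: c.
 near=> k; apply: (dyadic_ge D0 DT Dss) => //; apply: leq_trans (hphi k).
 by near: k; exact: nbhs_infty_ge.
have C0: 0 <= C by apply: le_trans qC; apply: Rintegral_ge0 => t _; rewrite mulr_ge0.
have low s t: 0 <= s -> s <= t -> t <= 1 -> D s t <= iint q s t.
 move=> s0 st t1; apply/ler_addgt0Pr => e e0.
 have r0: 0 < (e / 3) ^+ 2 by rewrite exprn_gt0 // divr_gt0.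
 have [N hN] := exp2_archimedean C r0.
 have n0: 0 < (2 ^ N)%:R :> R by rewrite ltr0n exp2_gt0.
 have small x y: 0 <= x -> 0 <= y -> x ^+ 2 <= C * y -> y <= (2 ^ N)%:R^-1 -> x <= e / 3.
  move=> x0 y0 xy yN; rewrite -(@ler_pXn2r _ 2) ?nnegrE ?divr_ge0 ?(ltW e0) //.
  apply: le_trans xy _; apply: (@le_trans _ _ (C * (2 ^ N)%:R^-1)).
  exact: ler_wpM2l.
  by rewrite ler_pdivrMr.
 pose tr (x: R) := Num.trunc (x * (2 ^ N)%:R).
 have trP x: 0 <= x -> gp (2 ^ N) (tr x) <= x /\ x - gp (2 ^ N) (tr x) <= (2 ^ N)%:R^-1.
  move=> x0; have x0': 0 <= x * (2 ^ N)%:R by rewrite mulr_ge0 // ltW.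
  have /andP[h1 h2] := truncn_itv x0'.
  rewrite /gp ler_pdivrMr //; split => //.
  rewrite lerBlDl -[X in _ <= _ + X]mul1r -mulrDl ler_pdivlMr // -natr1 in h2 *.
  exact: ltW.
 have [a1 a2] := trP s s0; have [b1 b2] := trP t (le_trans s0 st).
 set a := gp (2 ^ N) (tr s) in a1 a2; set b := gp (2 ^ N) (tr t) in b1 b2.
 have trle: (tr s <= tr t)%N by apply: le_truncn; rewrite ler_wpM2r // ltW.
 have trN: (tr t <= 2 ^ N)%N.
  rewrite -(ler_nat R); apply: (@le_trans _ _ (t * (2 ^ N)%:R)).
  by have /andP[] := truncn_itv (mulr_ge0 (le_trans s0 st) (ltW n0)).
  by rewrite ler_piMl // ltW.
 have ab := dyad N _ _ trle trN; rewrite -/a -/b in ab.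
 have a0: 0 <= a :> R by exact: gp_ge0.
 have b0: 0 <= b :> R by exact: gp_ge0.
 have leab: a <= b by exact: gp_le.
 have h1: D a s <= e / 3 by apply: small (D0 _ _) _ (DC a0 a1 (le_trans st t1)) a2; rewrite subr_ge0.
 have h2: D b t <= e / 3 by apply: small (D0 _ _) _ (DC b0 b1 t1) b2; rewrite subr_ge0.
 have h3: iint q a s <= e / 3.
  apply: small (iint_ge0 _ _ q0) _ _ a2; first by rewrite subr_ge0.
  apply: le_trans (iint_CS a1 iq iqq) _; rewrite mulrC; apply: ler_wpM2r; first by rewrite subr_ge0.
  by apply: le_trans qC; apply: le_iint_total => // x; rewrite mulr_ge0.
 have h4: iint q a b <= iint q s t + iint q a s.
  have := iint_split iq a1 st; have := iint_mono iq q0 (lexx a) leab b1; lra.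
 have := DT s a t; have := DT a b t; rewrite (Dsym s a); lra.
(* For additive [D] the dyadic sums telescope, so the total integral of [q] is [D 0 1]. As [q]
   dominates [D] on each piece, equality on the whole forces equality on every piece. *)
exists q; split => // add.
have e01: iint q 0 1 = D 0 1.
 have c := qlim 0 1 (lexx _) ler01 (lexx _).
 rewrite -(cvg_lim _ c) // (_: (fun k => _) = fun=> D 0 1) ?lim_cst //.
 apply/funext => k.
 have ->: iint (dy D (phi k)) 0 1 = iint (gridf D (2 ^ phi k)) (gp (2 ^ phi k) 0) (gp (2 ^ phi k) (2 ^ phi k)).
  by rewrite gp0 gpn // exp2_gt0.
 rewrite gridf_iint //.
 have H j: (j <= 2 ^ phi k)%N -> \sum_(0 <= l < j) D (gp (2 ^ phi k) l) (gp (2 ^ phi k) l.+1)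
  = D 0 (gp (2 ^ phi k) j).
  elim: j => [|j IH] jk; first by rewrite big_geq // gp0 Dss.
  rewrite big_nat_recr //= IH; last exact: ltnW.
  rewrite -add // ?gp_le //; first exact: gp_ge0.
  exact: (gp_le1 (exp2_gt0 (phi k))).
 by rewrite H // gpn // exp2_gt0.
move=> s t s0 st t1.
have := low 0 s (lexx _) s0 (le_trans st t1); have := low s t s0 st t1.
have := low t 1 (le_trans s0 st) t1 (lexx _).
have := add 0 s 1 (lexx _) s0 (le_trans st t1) (lexx _).
have := add s t 1 s0 st t1 (lexx _).
have := iint_split iq s0 (le_trans st t1); have := iint_split iq st t1; lra.
Unshelve. all: by end_near. Qed.
End energy.
(** An absolutely continuous function is the integral of its derivative, obtained here from the
    additive case of [energy_density]. *)
Lemma ac_density_real (f eta: R -> R): L2fun eta ->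
 (forall s t, 0 <= s -> s <= t -> t <= 1 -> `|f t - f s| <= iint eta s t) ->
 exists2 q, intg setT q & forall s t, 0 <= s -> s <= t -> t <= 1 -> f t - f s = iint q s t.
move=> Le hf; have ie := L2fun_intg Le; have [me e0 es iee] := Le.
(* Adding the integral of the bound makes the function nondecreasing, so [D] is additive; its
   increments are at most twice those of the integral, whence the factor 4 in [C]. *)
pose g t := f (clamp t) + iint eta 0 (clamp t); pose D s t := `|g t - g s|.
pose C := 4 * \int[mu]_t (eta t * eta t).
have gE s t: 0 <= s -> s <= t -> t <= 1 -> D s t = f t - f s + iint eta s t.
 move=> s0 st t1; rewrite /D /g !clamp_id; [|by lra|by lra].
 have := iint_split ie s0 st; have := hf s t s0 st t1; rewrite ler_norml => /andP[h1 h2] h3.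
 rewrite ger0_norm; lra.
have D2 s t: 0 <= s -> s <= t -> t <= 1 -> D s t ^+ 2 <= 4 * ((t - s) * iint (fun t => eta t * eta t) s t).
 move=> s0 st t1; have h := iint_CS st ie iee.
 have : D s t <= 2 * iint eta s t.
  rewrite gE //; have := hf s t s0 st t1; rewrite ler_norml => /andP[h1 h2]; lra.
 have := normr_ge0 (g t - g s); rewrite -/(D s t) => d0 d1.
 have : D s t ^+ 2 <= (2 * iint eta s t) ^+ 2 by rewrite ler_pXn2r ?nnegrE // (le_trans d0).
 by rewrite exprMn; lra.
have [||||||q [Lq _ _ qE]] := @energy_density D _ _ _ _ C.
- by move=> s t; exact: normr_ge0.
- by move=> s t u; have := ler_distD (g t) (g u) (g s); rewrite /D; lra.
- by move=> s; rewrite /D subrr normr0.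
- by move=> s t; rewrite /D distrC.
- move=> s t s0 st t1; apply: le_trans (D2 s t s0 st t1) _.
 rewrite /C -mulrA; apply: ler_wpM2l => //; rewrite mulrC; apply: ler_wpM2r; first by rewrite subr_ge0.
 by apply: le_iint_total => // x; rewrite mulr_ge0.
- move=> N; apply: (@le_trans _ _ (\sum_(k < 2 ^ N) 4 * iint (fun t => eta t * eta t) (gp (2 ^ N) k) (gp (2 ^ N) k.+1))).
  apply: ler_sum => k _.
  have a0: 0 <= gp (2 ^ N) k :> R by exact: gp_ge0.
  have b1: gp (2 ^ N) k.+1 <= 1 :> R by exact: (gp_le1 (exp2_gt0 N)).
  have := D2 _ _ a0 (gp_le (2 ^ N) (leqnSn k)) b1; rewrite gpB => h.
  apply: le_trans (ler_wpM2l _ h) _ => //.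
  have : (2 ^ N)%:R != 0 :> R by rewrite pnatr_eq0 -lt0n exp2_gt0.
  set n := (2 ^ N)%:R => n0; set I := iint _ _ _.
  by rewrite (_: n * (4 * (n^-1 * I)) = 4 * I) //; field.
 rewrite -mulr_sumr iint_grid ?exp2_gt0 // /C; apply: ler_wpM2l => //.
 by apply: le_iint_total => // x; rewrite mulr_ge0.
exists (fun t => q t - eta t); first by apply: intgB => //; exact: L2fun_intg.
move=> s t s0 st t1; have iq := L2fun_intg Lq.
have ->: iint (fun t => q t - eta t) s t = iint q s t - iint eta s t.
 by rewrite /iint RintegralB //; exact: intg_itv.
rewrite -qE //; first by rewrite gE //; ring.
move=> a b c a0 ab bc c1; rewrite !gE //; try lra.
have := iint_split ie ab bc; lra.
Qed.
Lemma iint_derive_ae (q: R -> R): intg setT q ->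
 {ae mu, forall t, 0 < t ->
  (h^-1 * (iint q 0 (t + h) - iint q 0 t)) @[h --> 0^'] --> q t}.
move=> iq; have lq: locally_integrable [set: R] q.
 have := integrable_locally mtop iq; rewrite (_: q \_ setT = q) //.
 by apply/funext => x; rewrite patchE mem_set.
have /= FT := @FTC1 R q (BRight 0) (fun y => intg_itv _ iq) lq.
apply: filterS FT => t H t0.
 have [|dF E] := H; first by rewrite lte_fin.
have := dF; rewrite /derivable => /cvg_ex[l cl].
have lE: l = q t by rewrite -E derive1E /derive; apply/esym/cvg_lim.
rewrite lE in cl; apply: cvg_trans cl; apply: near_eq_cvg; near=> h.
by rewrite /iint /= scaler1 [h + t]addrC.
Unshelve. all: by end_near. Qed.
End metric_density.

(** * Metric speed *)

Section metric_speed_ae.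
Context {R : realType}.
Local Notation mu := (@lebesgue_measure R).
Local Notation intg D f := (mu.-integrable D (EFin \o f)).
Implicit Types (s t u: R).
Variable D : R -> R -> R.
Hypothesis D0 : forall s t, 0 <= D s t.
Hypothesis DT : forall s t u, D s u <= D s t + D t u.
Hypothesis Dss : forall s, D s s = 0.
Hypothesis Dsym : forall s t, D s t = D t s.
Variable eta : R -> R.
Hypothesis Leta : L2fun eta.
Hypothesis Deta : forall s t, 0 <= s -> s <= t -> t <= 1 -> D s t <= iint eta s t.
Definition ratpt (i: nat): R := clamp (ratr (odflt 0 (unpickle i: option rat))).
Lemma ratpt_dense s e: 0 <= s <= 1 -> 0 < e -> exists i, `|ratpt i - s| < e.
move=> s01 e0; have [q] := @rat_in_itvoo R (s - e) (s + e) (ltac:(lra)).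
rewrite in_itv /= => /andP[h1 h2]; exists (pickle q); rewrite /ratpt pickleK /=.
rewrite -{1}(clamp_id s01); apply: le_lt_trans (clamp_lip _ _) _.
by rewrite ltr_norml; apply/andP; split; lra.
Qed.
Lemma dist_ratpt s t r: `|D r t - D r s| <= D s t.
by rewrite ler_norml; have := DT r s t; have := DT r t s; rewrite (Dsym t s) => h1 h2; apply/andP; split; lra. Qed.
Lemma iint_deriv_near (q: R -> R) (t: R): 0 < t -> t < 1 ->
 \forall h \near (0: R)^', 0 < t + h < 1.
move=> t0 t1; near=> h.
have : `|h| < Num.min t (1 - t).
 by near: h; apply: dnbhs0_lt; rewrite lt_min t0 subr_gt0.
by rewrite lt_min !ltr_norml => /andP[/andP[h1 h2] /andP[h3 h4]]; apply/andP; split; lra.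
Unshelve. all: by end_near. Qed.
Lemma iint_neg (q: R -> R) s t: intg setT q -> 0 <= s -> s <= t -> iint q 0 t - iint q 0 s = iint q s t.
by move=> iq s0 st; rewrite (iint_split iq s0 st); ring. Qed.
Lemma quot_bound (a b A B h: R): h != 0 -> (0 < h -> `|a - b| <= A - B) -> (h < 0 -> `|b - a| <= B - A) ->
 `|h^-1 * (a - b)| <= h^-1 * (A - B).
move=> h0 H1 H2; have [hp|hn|h00] := ltrgtP h 0.
- rewrite -(opprK h) invrN normrM normrN mulNr -mulrN opprB.
 have hp': 0 <= (- h)^-1 by rewrite invr_ge0; lra.
 by rewrite (ger0_norm hp') ler_wpM2l // distrC H2.
- by rewrite normrM (ger0_norm (_: 0 <= h^-1)) ?invr_ge0 ?(ltW hn) // ler_wpM2l ?invr_ge0 ?(ltW hn) // H1.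
- by rewrite h00 eqxx in h0.
Qed.
(** The speed is the supremum of the absolute derivatives of [t -> D r t] over a countable dense set
    of [r]: each of these functions is absolutely continuous, the triangle inequality makes its
    derivative a lower bound for the speed, and the supremum is large enough to dominate [D]. *)
Theorem metric_speed_density : exists m, [/\ L2fun m,
 forall s t, 0 <= s -> s <= t -> t <= 1 -> D s t <= iint m s t &
 {ae mu, forall t, 0 < t < 1 -> (D t (t + h) * `|h|^-1) @[h --> 0^'] --> m t}].
have ie := L2fun_intg Leta; have [me e0 es iee] := Leta.
have hf i s t: 0 <= s -> s <= t -> t <= 1 -> `|D (ratpt i) t - D (ratpt i) s| <= iint eta s t.
 by move=> s0 st t1; apply: le_trans (dist_ratpt _ _ _) _; exact: Deta.
have H i: exists q, intg setT q /\ forall s t, 0 <= s -> s <= t -> t <= 1 ->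
  D (ratpt i) t - D (ratpt i) s = iint q s t.
 by have [q iq qE] := ac_density_real Leta (hf i); exists q.
have [q Hq] := choice H.
have iq i := (Hq i).1; have qE i := (Hq i).2.
(* The minimum with [eta] makes the supremum finite at every point; almost everywhere in the
   interior it changes nothing, by [qle]. *)
pose mn i t := Num.min `|q i t| (eta t); pose m t := sups (mn ^~ t) 0.
have mn0 i t: 0 <= mn i t by rewrite le_min normr_ge0 e0.
have mne i t: mn i t <= eta t by rewrite ge_min lexx orbT.
have mq i: mfun (q i) by exact: intg_mfun (iq i).
have mmn i: mfun (mn i).
 by apply: measurable_minr => //; exact: mcomp (mq i).
have ub t: has_ubound (range (mn ^~ t)) by exists (eta t) => _ [i _ <-].
have rE t: sdrop (mn ^~ t) 0 = range (mn ^~ t).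
 by apply/seteqP; split => x [i _ <-]; exists i.
have mle i t: mn i t <= m t.
 by rewrite /m /sups /= rE; apply: ub_le_sup => //; exists i.
have meta t: m t <= eta t.
 rewrite /m /sups /= rE; apply: ge_sup; first by exists (mn 0%N t); exists 0%N.
 by move=> _ [i _ <-].
have m0 t: 0 <= m t by apply: le_trans (mn0 0%N t) (mle _ _).
have mm: mfun m.
 by apply: measurable_fun_sups => [t _|i]; [exact: ub|exact: mmn].
have Lm: L2fun m.
 split => //.
  by move=> t t01; apply/eqP; rewrite eq_le m0 andbT -(es _ t01).
 refine (@intg_dom R _ (measurableTypeR R) mu setT (fun t => m t * m t) (fun t => eta t * eta t)
  mtop _ _ iee) => [|t _]; first exact: measurable_funM.
 by rewrite ger0_norm ?mulr_ge0 // ler_pM.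
have im := L2fun_intg Lm.
have AE := ae_foralln (fun i => iint_derive_ae (iq i)).
have AEe := iint_derive_ae ie; have AEm := iint_derive_ae im.
have qle: {ae mu, forall t, 0 < t < 1 -> forall i, `|q i t| <= eta t}.
 move: AE AEe; apply: filterS2 => t h1 h2 /andP[t0 t1] i.
 have c1 := h1 i t0; have c2 := h2 t0.
 apply: ler_cvg_to (cvg_norm c1) c2 _.
 have ht := iint_deriv_near (q i) t0 t1; near=> h.
 have h0: h != 0 by near: h; exact: nbhs_dnbhs_neq.
 have /andP[th0 th1]: 0 < t + h < 1 by near: h.
 apply: quot_bound => // hh.
  rewrite !iint_neg ?(ltW t0) //; try lra.
  by rewrite -qE ?(ltW t0) ?(ltW th1) //; try lra; apply: hf; lra.
 rewrite !iint_neg ?(ltW th0) //; try lra.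
 by rewrite -qE ?(ltW t1) ?(ltW th0) //; try lra; apply: hf; lra.
have Dm s t: 0 <= s -> s <= t -> t <= 1 -> D s t <= iint m s t.
 move=> s0 st t1; apply/ler_addgt0Pr => e e_gt0.
 pose C := \int[mu]_x (eta x * eta x).
 have C0: 0 <= C by apply: Rintegral_ge0 => x _; rewrite mulr_ge0.
 (* For [r] near [s], [D s t <= D r t - D r s + 2 D r s]. The difference is the integral of a
    derivative below [m], and [D r s <= e/2] by Cauchy-Schwarz for this choice of closeness. *)
 have [i ri] := @ratpt_dense s ((e / 2) ^+ 2 / (C + 1)) (ltac:(lra))
  (divr_gt0 (exprn_gt0 2 (divr_gt0 e_gt0 (ltr0n R 2))) (ltr_wpDl C0 ltr01)).
 set r := ratpt i in ri; have r01: 0 <= r <= 1 by exact: clamp01.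
 have Dr: D r s <= e / 2.
  have key a b: 0 <= a -> a <= b -> b <= 1 -> b - a < (e / 2) ^+ 2 / (C + 1) -> D a b <= e / 2.
  move=> a0 ab b1 hab; apply: le_trans (Deta a0 ab b1) _.
  rewrite -(@ler_pXn2r _ 2) ?nnegrE ?iint_ge0 ?divr_ge0 ?(ltW e_gt0) //.
  apply: le_trans (iint_CS ab ie iee) _.
  have ba: 0 <= b - a by rewrite subr_ge0.
  apply: (@le_trans _ _ ((b - a) * (C + 1))).
  apply: ler_wpM2l => //; apply: (@le_trans _ _ C); last by rewrite lerDl.
  by apply: le_iint_total => // x; rewrite mulr_ge0.
  by move: hab; rewrite ltr_pdivlMr ?ltr_wpDl // => /ltW.
  have /andP[r0 r1] := r01; have [rs|sr] := leP r s.
  by apply: key => //; [lra|move: ri; rewrite ler0_norm; lra].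
  by rewrite Dsym; apply: key => //; [lra|move: ri; rewrite ger0_norm; lra].
 have h1 := DT s r t; rewrite (Dsym s r) in h1.
 have h2 := qE i s t s0 st t1; rewrite -/r in h2.
 suff h3 : iint (q i) s t <= iint m s t by lra.
 have iaq: intg setT (fun x => `|q i x|) by exact: (integrable_norm (iq i)).
 have imn: intg setT (mn i).
  refine (@intg_dom R _ (measurableTypeR R) mu setT (mn i) eta mtop (mmn i) _ ie) => x _.
  by rewrite ger0_norm.
 apply: le_trans (iint_le s t (iq i) iaq (fun x => ler_norm _)) _.
 apply: le_trans (iint_le s t imn im (mle i)).
 rewrite le_eqVlt; apply/orP; left; apply/eqP; rewrite /iint /Rintegral; congr fine.
 apply: ae_eq_integral => //.
 - by apply/mEFinP; apply: measurable_funTS; exact: intg_mfun iaq.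
 - by apply/mEFinP; apply: measurable_funTS; exact: mmn.
 have n1: {ae mu, forall x: R, x != 1}.
  exists [set 1]; split; [exact: measurable_set1|exact: lebesgue_measure_set1|].
  by move=> x /= /negP; rewrite negbK => /eqP.
 move: qle n1; apply: filterS2 => x h nx; rewrite /= in_itv /= => /andP[sx xt].
 congr EFin; rewrite /mn; apply/esym/min_idPl; apply: h; apply/andP; split.
  exact: le_lt_trans sx.
 by rewrite lt_neqAle nx (le_trans xt).
exists m; split => //.
move: AE AEm qle; apply: filterS3 => t h1 h2 h3 /andP[t0 t1].
have cm := h2 t0; apply/cvgrPdist_lt => e e_gt0.
have hs: has_sup (range (mn ^~ t)) by split; [exists (mn 0%N t); exists 0%N|].
have [_ [i _ <-]] := sup_adherent (divr_gt0 e_gt0 (ltr0n R 2)) hs.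
rewrite -rE -[sup _]/(m t) => mi.
have cq: Num.norm (h^-1 * (iint (q i) 0 (t + h) - iint (q i) 0 t)) @[h --> 0^'] --> Num.norm (q i t).
 exact: cvg_norm (h1 i t0).
have mqi: mn i t = `|q i t| by apply/min_idPl; apply: h3; rewrite t0 t1.
have ht := iint_deriv_near (q i) t0 t1.
have e2: 0 < e / 2 by rewrite divr_gt0.
near=> h.
have h0: h != 0 by near: h; exact: nbhs_dnbhs_neq.
have /andP[th0 th1]: 0 < t + h < 1 by near: h.
have A1: `|m t - h^-1 * (iint m 0 (t + h) - iint m 0 t)| < e.
 by near: h; move/cvgrPdist_lt : cm; exact.
have A2: Num.norm (Num.norm (q i t) - Num.norm (h^-1 * (iint (q i) 0 (t + h) - iint (q i) 0 t))) < e / 2.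
 by near: h; move/cvgrPdist_lt : cq; exact.
have up: D t (t + h) * `|h|^-1 <= h^-1 * (iint m 0 (t + h) - iint m 0 t).
 have [hp|hn|h00] := ltrgtP h 0; last by rewrite h00 eqxx in h0.
  have hn: 0 < - h by lra.
  have ->: h^-1 * (iint m 0 (t + h) - iint m 0 t) = (- h)^-1 * (iint m 0 t - iint m 0 (t + h)) by rewrite invrN mulNr -mulrN opprB.
  rewrite (ltr0_norm hp) mulrC Dsym iint_neg ?(ltW th0) //; last by lra.
  by apply: ler_wpM2l; [rewrite invr_ge0 ltW|apply: Dm; [exact: ltW|by rewrite gerDl ltW|exact: ltW]].
 rewrite (gtr0_norm hn) mulrC iint_neg //; [|exact: ltW|lra].
 by apply: ler_wpM2l; [rewrite invr_ge0 ltW|apply: Dm; [exact: ltW|by rewrite lerDl ltW|exact: ltW]].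
have lo: `|h^-1 * (iint (q i) 0 (t + h) - iint (q i) 0 t)| <= D t (t + h) * `|h|^-1.
 rewrite normrM normfV mulrC ler_wpM2r ?invr_ge0 //.
 have [th|th] := leP t (t + h).
  by rewrite iint_neg ?(ltW t0) // -qE ?(ltW t0) ?(ltW th1) //; exact: dist_ratpt.
 rewrite distrC iint_neg ?(ltW th0) ?(ltW th) // -qE ?(ltW t1) ?(ltW th0) ?(ltW th) //.
 by rewrite (Dsym t (t + h)); exact: dist_ratpt.
move: A1 A2; rewrite !ltr_norml => /andP[B1 B2] /andP[B3 B4].
by rewrite mqi in mi; apply/andP; split; lra.
Unshelve. all: by end_near. Qed.
End metric_speed_ae.

(** * Fidelity *)

Section fidelity.
Context {R : realType} {d : nat} {Omega : ptopologicalType}.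
Local Notation M := 'M[R[i]]_d.
Implicit Types (G H: prob R d Omega) (P: Omega -> M).
Definition posfield P := [/\ mx_continuous P,
 exists2 e: R, 0 < e & forall x, psd (P x - e *c 1%:M) & exists K, forall x, frobnorm (P x) <= K].
Lemma posfield_psd P x: posfield P -> psd (P x).
by case=> _ [e e0 h] _; exact: coercive_psd (h x) e0. Qed.
Lemma posfield_unit P x: posfield P -> P x \in unitmx.
by case=> _ [e e0 h] _; exact: coercive_unit (h x) e0. Qed.
Lemma posfield_CbH P: posfield P -> CbH P.
move=> pP; case: (pP) => c _ k; split => // x.
by apply/hermP; exact: psd_herm (posfield_psd x pP).
Qed.
Lemma posfield1: posfield (fun=> 1%:M).
split; first exact: mx_continuous_cst; last by exists (frobnorm (1%:M : M)).
exists 1 => // x; rewrite (_: real_complex R 1 = 1) ?rmorph1 // scale1r subrr; exact: psd0.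
Qed.
Lemma posfield_inv P: posfield P -> posfield (fun x => invmx (P x)).
move=> pP; have [cP [e e0 pe] [K0 hK0]] := pP; pose K := Num.max K0 1.
have K_gt0: 0 < K by rewrite lt_max ltr01 orbT.
have hK x: frobnorm (P x) <= K by rewrite le_max hK0.
split; first exact: mx_continuous_inv e0 pe cP.
 exists K^-1 => [|x]; first by rewrite invr_gt0.
 have [Q [mu [QQ mue PE]]] := psd_coercive (pe x) e0.
 have mup i: 0 < mu i by exact: lt_le_trans e0 (mue i).
 rewrite PE (spf_inv QQ); last by move=> i; rewrite gt_eqF.
 rewrite -(spf1 QQ) spfZ spfB; apply: spf_psd => // i; rewrite mulr1 subr_ge0 lef_pV2 ?posrE //.
 apply: le_trans (hK x); rewrite PE -(@ler_pXn2r _ 2) ?nnegrE ?fnorm_ge0 ?(ltW (mup _)) //.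
 by rewrite sqr_frobnorm spf_frob // (bigD1 i) //= -expr2 lerDl sumr_ge0 // => j _; rewrite -expr2 sqr_ge0.
by exists (d%:R / e) => x; exact: frobnorm_inv (pe x) e0.
Qed.
Lemma pairing_ge0 G P: CbH P -> (forall x, psd (P x)) -> 0 <= pairing G P.
move=> cP pP; have [g hg] := prob_dens G; rewrite (pairing_dens hg (CbH_meas cP)).
by apply: Rintegral_ge0 => x _; apply: psd_frob_ge0 => //; exact: hasdens_psd hg.
Qed.
Definition half P G H: R := 2^-1 * (pairing G P + pairing H (fun x => invmx (P x))).
(** The dual form of Uhlmann's fidelity, the integral of the trace of [(g^(1/2) h g^(1/2))^(1/2)].
    Only continuous fields enter, so each competitor passes to narrow limits. *)
Definition fid G H: R := inf [set half P G H | P in posfield].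
Lemma half_ge0 P G H: posfield P -> 0 <= half P G H.
move=> pP; have pI := posfield_inv pP.
rewrite mulr_ge0 ?invr_ge0 // addr_ge0 //; apply: pairing_ge0; try exact: posfield_CbH.
 by move=> x; exact: posfield_psd.
by move=> x; exact: (posfield_psd x pI).
Qed.
Lemma fid_le P G H: posfield P -> fid G H <= half P G H.
by move=> pP; apply: ge_inf; [exists 0 => _ [Q pQ <-]; exact: half_ge0|exists P]. Qed.
Lemma fid_lb x G H: (forall P, posfield P -> x <= half P G H) -> x <= fid G H.
move=> h; apply: lb_le_inf; first by exists (half (fun=> 1%:M) G H), (fun=> 1%:M) => //; exact: posfield1.
by move=> _ [P pP <-]; exact: h.
Qed.
Lemma fid_approx e G H: 0 < e -> exists2 P, posfield P & half P G H < fid G H + e.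
move=> e0; have [|_ [P pP <-] h] := @inf_adherent R [set half P G H | P in posfield] e e0.
 split; last by exists 0 => _ [Q pQ <-]; exact: half_ge0.
 by exists (half (fun=> 1%:M) G H), (fun=> 1%:M) => //; exact: posfield1.
by exists P.
Qed.
Lemma fid_ge0 G H: 0 <= fid G H.
by apply: fid_lb => P pP; exact: half_ge0. Qed.
Lemma half_inv P G H: posfield P -> half (fun x => invmx (P x)) G H = half P H G.
move=> pP; rewrite /half addrC; congr (_ * (pairing _ _ + _)).
by apply/funext => x; rewrite invmxK.
Qed.
Lemma fid_sym G H: fid G H = fid H G.
have L A B: fid A B <= fid B A.
 by apply: fid_lb => P pP; rewrite -half_inv //; apply: fid_le; exact: posfield_inv.
by apply/eqP; rewrite eq_le !L.
Qed.
Lemma fid_le1 G H: fid G H <= 1.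
apply: le_trans (fid_le G H posfield1) _.
rewrite /half (_: (fun x: Omega => invmx 1%:M) = fun=> 1%:M :> M); last by apply/funext => x; rewrite invmx1.
rewrite !pairing1; lra.
Qed.
(** Joint concavity: every competitor is affine in the pair of measures. *)
Lemma fid_mix (t: R) G H G1 H1 G2 H2: 0 <= t <= 1 ->
 (forall P, CbH P -> pairing G P = (1 - t) * pairing G1 P + t * pairing G2 P) ->
 (forall P, CbH P -> pairing H P = (1 - t) * pairing H1 P + t * pairing H2 P) ->
 (1 - t) * fid G1 H1 + t * fid G2 H2 <= fid G H.
move=> t01 hG hH; apply: fid_lb => P pP.
have h1 := fid_le G1 H1 pP; have h2 := fid_le G2 H2 pP.
have := posfield_CbH (posfield_inv pP); have := posfield_CbH pP => c1 c2.
rewrite /half hG // hH //; move: h1 h2; rewrite /half; set a := pairing G1 _; set b := pairing H1 _.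
set a' := pairing G2 _; set b' := pairing H2 _ => h1 h2.
have : (1 - t) * fid G1 H1 <= (1 - t) * (2^-1 * (a + b)) by apply: ler_wpM2l => //; lra.
have : t * fid G2 H2 <= t * (2^-1 * (a' + b')) by apply: ler_wpM2l => //; lra.
lra.
Qed.
Lemma fid_usc (Gn Hn: nat -> prob R d Omega) G H e: 0 < e ->
 (forall P, CbH P -> (fun n => pairing (Gn n) P) @ \oo --> pairing G P) ->
 (forall P, CbH P -> (fun n => pairing (Hn n) P) @ \oo --> pairing H P) ->
 \forall n \near \oo, fid (Gn n) (Hn n) < fid G H + e.
move=> e0 cG cH; have [P pP h] := fid_approx G H (divr_gt0 e0 (ltr0n R 2)).
have c1 := cG _ (posfield_CbH pP); have c2 := cH _ (posfield_CbH (posfield_inv pP)).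
have c: (fun n => half P (Gn n) (Hn n)) @ \oo --> half P G H.
 by apply: cvgM; [exact: cvg_cst|exact: cvgD].
have e2: 0 < e / 2 by rewrite divr_gt0.
move/cvgrPdist_lt : c => /(_ _ e2); apply: filterS => n hn.
apply: le_lt_trans (fid_le _ _ pP) _; move: hn; rewrite ltr_norml => /andP[h1 h2]; lra.
Qed.
(** The square completed with [P T1 - T2], that is, positivity of its congruence of [r] tested
    against the inverse of [P]. *)
Lemma frob_transport (r T1 T2 P: M): psd r -> psd P -> P \in unitmx ->
 T1 ^t* = T1 -> T2 ^t* = T2 ->
 2 * frob (r *m T1) T2 <= frob (T1 *m r *m T1) P + frob (T2 *m r *m T2) (invmx P).
move=> pr pP uP h1 h2; have hP := psd_herm pP; have hr := psd_herm pr.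
have hX: (P *m T1 - T2) ^t* = T1 *m P - T2 by rewrite ctrB ctrM hP h1 h2.
have := psd_frob_ge0 (psd_congr (P *m T1 - T2) pr) (psd_inv pP uP); rewrite hX.
have E: (P *m T1 - T2) *m r *m (T1 *m P - T2) =
  P *m (T1 *m r *m T1) *m P - P *m (T1 *m r *m T2) - (T2 *m r *m T1) *m P + T2 *m r *m T2.
 by rewrite !mulmxBl !mulmxBr !mulmxA opprB !addrA addrAC -!addrA.
have hI: (invmx P) ^t* = invmx P by rewrite ctr_inv // hP.
have e1: frob (P *m (T1 *m r *m T1) *m P) (invmx P) = frob (T1 *m r *m T1) P.
 by rewrite frob_mulr hP mulVmx // frob_mull hP mulmx1.
have e2: frob (P *m (T1 *m r *m T2)) (invmx P) = frob (r *m T1) T2.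
 rewrite frob_mull hP mulmxV // frob_mulr h2 mul1mx -(frob_ctr (T1 *m r)) ctrM h1 hr h2 //.
have e3: frob (T2 *m r *m T1 *m P) (invmx P) = frob (r *m T1) T2.
 rewrite frob_mulr hP mulVmx // -mulmxA frob_mull h2 mulmx1 //.
rewrite E frobDl !frobBl e1 e2 e3.
move: (frob (T1 *m r *m T1) P) (frob (T2 *m r *m T2) _) (frob (r *m T1) T2) => a b c h.
by rewrite -subr_ge0 (_: a + b - 2 * c = a - c - c + b) //; ring.
Qed.

Section transport.
Variables (mu: finmeas R Omega) (r T1 T2: borel Omega -> M).
Variables (A B: prob R d Omega).
Hypotheses (mr: mxmfun r) (pr: forall x, psd (r x)).
Hypotheses (mT1: mxmfun T1) (mT2: mxmfun T2).
Hypotheses (hT1: forall x, (T1 x) ^t* = T1 x) (hT2: forall x, (T2 x) ^t* = T2 x).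
Hypotheses (hA: hasdens mu (fun x => T1 x *m r x *m T1 x) A)
 (hB: hasdens mu (fun x => T2 x *m r x *m T2 x) B).
Lemma frob_sq (g X: M): X ^t* = X -> frob (g *m X) X = tr_re (X *m g *m X).
by move=> hX; rewrite /tr_re -[RHS]frob1l [RHS]frobC -mulmxA [RHS]frob_mull hX mulmx1. Qed.
Lemma intg_cross: intg mu setT (fun x => frob (r x *m T1 x) (T2 x)).
have i1 := hasdens_tr_intg hA; have i2 := hasdens_tr_intg hB.
apply: (@intg_dom R _ (borel Omega) mu setT _ (fun x => 2^-1 *
 (tr_re (T1 x *m r x *m T1 x) + tr_re (T2 x *m r x *m T2 x)))) => //.
- by apply: measurable_frob => //; exact: mxmM.
- by move=> x _; rewrite -!frob_sq //; exact: frob_young.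
- by apply: intgZ => //; exact: intgD.
Qed.
(** The bound of [frob_transport] holds for every competitor [P], so any two Hermitian maps that
    push a common density [r] to [A] and [B] bound the fidelity from below. *)
Lemma fid_ge_cross: \int[mu]_x frob (r x *m T1 x) (T2 x) <= fid A B.
apply: fid_lb => P pP; have pI := posfield_inv pP.
have c1 := posfield_CbH pP; have c2 := posfield_CbH pI.
rewrite /half (pairing_dens hA (CbH_meas c1)) (pairing_dens hB (CbH_meas c2)).
have i1 := pairing_CbH_intg hA c1; have i2 := pairing_CbH_intg hB c2.
rewrite -(RintegralD mtop i1 i2) -(RintegralZl _ mtop (intgD mtop i1 i2)).
apply: (le_Rintegral mtop intg_cross (intgZ _ mtop (intgD mtop i1 i2))) => x _.
have := frob_transport (pr x) (posfield_psd x pP) (posfield_unit x pP) (hT1 x) (hT2 x); lra.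
Qed.
End transport.
End fidelity.

(** * Optimal maps attain the fidelity *)

Section fidelity_upper.
Context {R : realType} {d : nat} {Omega : ptopologicalType}.
Local Notation M := 'M[R[i]]_d.
Variable dist : Omega -> Omega -> R.
Hypothesis dM : metrizes dist.
Variable mu : finmeas R Omega.
Lemma Rintegral_dominated_ae (f: nat -> borel Omega -> R) (f' h: borel Omega -> R) :
 (forall n, mfun (f n)) -> mfun f' -> intg mu setT h ->
 (forall n x, `|f n x| <= h x) -> {ae mu, forall x, (fun n => f n x) @ \oo --> f' x} ->
 intg mu setT f' /\ (fun n => \int[mu]_x f n x) @ \oo --> \int[mu]_x f' x.
move=> mf mf' ih fh cv.
have [] := @dominated_convergence _ (borel Omega) R mu setT mtop
 (fun n x => (f n x)%:E) (fun x => (f' x)%:E) (fun x => (h x)%:E).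
- by move=> n; exact/mEFinP.
- exact/mEFinP.
- apply: filterS cv => x c _; apply: cvg_EFin; [exact: nearW|exact: c].
- exact: ih.
- by apply: aeW => x n _; rewrite lee_fin.
move=> i1 _ c; split => //; apply: fine_cvg; rewrite fineK //; exact: integrable_fin_num.
Qed.
Lemma ae_foralln_fin (I: finType) (Q: I -> borel Omega -> Prop) :
 (forall i, {ae mu, forall x, Q i x}) -> {ae mu, forall x, forall i, Q i x}.
move=> h; have H: {ae mu, forall x, forall n: nat, forall i, pickle i = n -> Q i x}.
 apply: ae_foralln => n; case E : (unpickle n: option I) => [i|].
  by apply: filterS (h i) => x qx j jn; have := pickleK j; rewrite jn E => -[<-].
 by apply: aeW => x j jn; have := pickleK j; rewrite jn E.
by apply: filterS H => x hx i; exact: (hx (pickle i)).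
Qed.
Lemma frobnorm_cvg (Zn: nat -> M) (Z: M) :
 (forall i j, (fun n => Re (Zn n i j)) @ \oo --> Re (Z i j)) ->
 (forall i j, (fun n => Im (Zn n i j)) @ \oo --> Im (Z i j)) ->
 (fun n => frobnorm (Zn n - Z)) @ \oo --> (0: R).
move=> hR hI; rewrite -[X in _ --> X](sqrtr0 R); apply: continuous_cvg; first exact: sqrt_continuous.
have ->: 0 = \sum_(i < d) \sum_(j < d) (0 * 0 + 0 * 0 : R).
 by rewrite big1 // => i _; rewrite big1 // => j _; rewrite mulr0 addr0.
under eq_fun do rewrite frobE.
apply: cvg_sumr => i; apply: cvg_sumr => j.
have cR: (fun n => Re ((Zn n - Z) i j)) @ \oo --> (0: R).
 rewrite -(subrr (Re (Z i j))); under eq_fun do rewrite !mxE ReD ReN.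
 by apply: cvgB; [exact: hR|exact: cvg_cst].
have cI: (fun n => Im ((Zn n - Z) i j)) @ \oo --> (0: R).
 rewrite -(subrr (Im (Z i j))); under eq_fun do rewrite !mxE ImD ImN.
 by apply: cvgB; [exact: hI|exact: cvg_cst].
by apply: cvgD; apply: cvgM.
Qed.
Lemma frob_cvg (A: M) (Pn: nat -> M) (P: M) (u: nat -> R) :
 (forall n, frobnorm (Pn n - P) <= u n) -> u @ \oo --> (0: R) ->
 (fun n => frob A (Pn n)) @ \oo --> frob A P.
move=> hu u0; apply/cvgrPdist_lt => e e0.
have c: (fun n => frobnorm A * u n) @ \oo --> (0: R).
 by rewrite -[X in _ --> X](mulr0 (frobnorm A)); apply: cvgM => //; exact: cvg_cst.
move/cvgrPdist_lt : c => /(_ e e0); apply: filterS => n; rewrite sub0r normrN => h.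
rewrite distrC -frobBr; apply: le_lt_trans (frob_CS_norm _ _) _.
apply: le_lt_trans _ (le_lt_trans (ler_norm _) h).
by apply: ler_wpM2l; [exact: fnorm_ge0|exact: hu].
Qed.
Lemma frobnorm_entries (A: M) (L: R): 0 <= L -> (forall i j, `|Re (A i j)| <= L) ->
 (forall i j, `|Im (A i j)| <= L) -> frobnorm A <= 2 * d%:R * L.
move=> L0 hR hI; have dL: 0 <= 2 * d%:R * L by rewrite !mulr_ge0.
rewrite -(@ler_pXn2r _ 2) ?nnegrE ?fnorm_ge0 // sqr_frobnorm frobE.
apply: (@le_trans _ _ (\sum_(i < d) \sum_(j < d) (2 * L ^+ 2))).
 apply: ler_sum => i _; apply: ler_sum => j _; rewrite -!expr2.
 have h1: Re (A i j) ^+ 2 <= L ^+ 2 by rewrite -real_normK ?num_real // ler_pXn2r ?nnegrE.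
 have h2: Im (A i j) ^+ 2 <= L ^+ 2 by rewrite -real_normK ?num_real // ler_pXn2r ?nnegrE.
 lra.
rewrite !sumr_const !card_ord -[leLHS]mulr_natr -(mulr_natr (2 * _)) !exprMn.
have : 0 <= L ^+ 2 * d%:R * d%:R by rewrite !mulr_ge0 // sqr_ge0.
rewrite !expr2; lra.
Qed.
Lemma gram_coercive (Z: M) (e: R): 0 <= e -> psd (Z ^t* *m Z + e *c 1%:M - e *c 1%:M).
move=> e0; rewrite addrK; have := psd_congr (Z ^t*) psd1.
by rewrite mulmx1 trmxCK.
Qed.
Lemma fid_le_measurable (A B: prob R d Omega) a b (Z: borel Omega -> M) (L e: R) :
 hasdens mu a A -> hasdens mu b B -> mxmfun Z -> (forall x, frobnorm (Z x) <= L) ->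
 0 < e ->
 fid A B <= 2^-1 * (\int[mu]_x frob (a x) ((Z x) ^t* *m Z x + e *c 1%:M) +
  \int[mu]_x frob (b x) (invmx ((Z x) ^t* *m Z x + e *c 1%:M))).
move=> ha hb mZ ZL e0.
have L0: 0 <= L by apply: le_trans (fnorm_ge0 (Z point)) (ZL _).
have exR (ij: 'I_d * 'I_d) := lusin_ae dM mu (mZ ij.1 ij.2).1
 (fun x => le_trans (Re_le_frobnorm (Z x) ij.1 ij.2) (ZL x)).
have exI (ij: 'I_d * 'I_d) := lusin_ae dM mu (mZ ij.1 ij.2).2
 (fun x => le_trans (Im_le_frobnorm (Z x) ij.1 ij.2) (ZL x)).
have [u hu] := choice exR; have [v hv] := choice exI.
pose Zn n (x: Omega) : M := \matrix_(i, j) Complex (u (i, j) n x) (v (i, j) n x).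
have cZn n: mx_continuous (Zn n).
 move=> i j; split.
  by under eq_fun do rewrite mxE /=; have [h _ _] := hu (i, j); exact: h.
 by under eq_fun do rewrite mxE /=; have [h _ _] := hv (i, j); exact: h.
pose L' := 2 * d%:R * L; have L'0: 0 <= L' by rewrite !mulr_ge0.
have ZnL n x: frobnorm (Zn n x) <= L'.
 apply: frobnorm_entries => // i j; rewrite mxE /=.
  by have [_ h _] := hu (i, j); exact: h.
 by have [_ h _] := hv (i, j); exact: h.
pose P (Y: M) := Y ^t* *m Y + e *c 1%:M.
have pP Y: psd (P Y - e *c 1%:M) by apply: gram_coercive; exact: ltW.
pose K := L' * L' + frobnorm (e *c (1%:M : M)).
have PK n x: frobnorm (P (Zn n x)) <= K.
 apply: le_trans (frobnormD _ _) _; rewrite lerD2r; apply: le_trans (frobnormM _ _) _.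
 by rewrite frobnorm_ctr; apply: ler_pM; rewrite ?fnorm_ge0.
have cP n: mx_continuous (fun x => P (Zn n x)).
 apply: mx_continuousD; last exact: mx_continuous_cst.
 by apply: mx_continuousM => //; exact: mx_continuous_ctr.
have fP n: posfield (fun x => P (Zn n x)).
 by split; [exact: cP|exists e|exists K].
have FF: Filter (almost_everywhere mu) by exact: (ae_filter_ringOfSetsType mu).
have aeZ: {ae mu, forall x, (fun n => frobnorm (Zn n x - Z x)) @ \oo --> (0: R)}.
 have h1: {ae mu, forall x, forall ij, (fun n => u ij n x) @ \oo --> Re (Z x ij.1 ij.2)}.
  by apply/ae_foralln_fin => ij; have [_ _ h] := hu ij.
 have h2: {ae mu, forall x, forall ij, (fun n => v ij n x) @ \oo --> Im (Z x ij.1 ij.2)}.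
  by apply/ae_foralln_fin => ij; have [_ _ h] := hv ij.
 move: h1 h2; apply: filterS2 => x h1 h2; apply: frobnorm_cvg => i j.
  by under eq_fun do rewrite mxE /=; exact: (h1 (i, j)).
 by under eq_fun do rewrite mxE /=; exact: (h2 (i, j)).
have dP n x: frobnorm (P (Zn n x) - P (Z x)) <= (L' + L) * frobnorm (Zn n x - Z x).
 rewrite /P opprD addrACA subrr addr0.
 have ->: (Zn n x) ^t* *m Zn n x - (Z x) ^t* *m Z x =
  (Zn n x - Z x) ^t* *m Zn n x + (Z x) ^t* *m (Zn n x - Z x).
  by rewrite ctrB mulmxBl mulmxBr addrA subrK.
 apply: le_trans (frobnormD _ _) _; rewrite mulrDl; apply: lerD.
  apply: le_trans (frobnormM _ _) _; rewrite frobnorm_ctr mulrC.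
  by apply: ler_wpM2r; rewrite ?fnorm_ge0.
 apply: le_trans (frobnormM _ _) _; rewrite frobnorm_ctr.
 by apply: ler_wpM2r; rewrite ?fnorm_ge0.
have uP Y: P Y \in unitmx by exact: coercive_unit (pP Y) e0.
have nI Y: frobnorm (invmx (P Y)) <= d%:R / e by exact: frobnorm_inv (pP Y) e0.
have dI n x: frobnorm (invmx (P (Zn n x)) - invmx (P (Z x))) <=
  (d%:R / e) ^+ 2 * ((L' + L) * frobnorm (Zn n x - Z x)).
 have ->: invmx (P (Zn n x)) - invmx (P (Z x)) =
  invmx (P (Zn n x)) *m (P (Z x) - P (Zn n x)) *m invmx (P (Z x)).
  by rewrite mulmxBr mulVmx // mulmxBl mul1mx -mulmxA mulmxV // mulmx1.
 have n0 (Y: M) : 0 <= frobnorm Y by exact: fnorm_ge0.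
 apply: le_trans (frobnormM _ _) _; rewrite expr2 mulrAC; apply: ler_pM => //.
 apply: le_trans (frobnormM _ _) _; rewrite -(frobnormN (P (Z x) - _)) opprB.
 by apply: ler_pM.
have mP: mxmfun (fun x => P (Z x)).
 by apply: mxmD; [apply: mxmM => //; exact: mxm_ctr|exact: mxm_cst].
have mPI: mxmfun (fun x => invmx (P (Z x))) by apply: mxm_inv.
have ma := hasdens_meas ha; have mb := hasdens_meas hb.
have mPn n: mxmfun (fun x: borel Omega => P (Zn n x)) by exact: mx_continuous_borel.
have mPIn n: mxmfun (fun x: borel Omega => invmx (P (Zn n x))) by apply: mxm_inv.
have b1 n x: `|frob (a x) (P (Zn n x))| <= K * tr_re (a x).
 by apply: le_trans (frob_CS_norm _ _) _; rewrite mulrC;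
  apply: ler_pM; rewrite ?fnorm_ge0 //; exact: psd_le_tr (hasdens_psd x ha).
have b2 n x: `|frob (b x) (invmx (P (Zn n x)))| <= (d%:R / e) * tr_re (b x).
 by apply: le_trans (frob_CS_norm _ _) _; rewrite mulrC;
  apply: ler_pM; rewrite ?fnorm_ge0 //; exact: psd_le_tr (hasdens_psd x hb).
have l1: {ae mu, forall x, (fun n => frob (a x) (P (Zn n x))) @ \oo --> frob (a x) (P (Z x))}.
 apply: filterS aeZ => x hx; apply: (@frob_cvg _ _ _ (fun n => (L' + L) * frobnorm (Zn n x - Z x))) => //.
 by rewrite -[X in _ --> X](mulr0 (L' + L)); apply: cvgM => //; exact: cvg_cst.
have l2: {ae mu, forall x, (fun n => frob (b x) (invmx (P (Zn n x)))) @ \oo --> frob (b x) (invmx (P (Z x)))}.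
 apply: filterS aeZ => x hx.
 apply: (@frob_cvg _ _ _ (fun n => (d%:R / e) ^+ 2 * ((L' + L) * frobnorm (Zn n x - Z x)))) => //.
 rewrite -[X in _ --> X](mulr0 ((d%:R / e) ^+ 2)); apply: cvgM; first exact: cvg_cst.
 by rewrite -[X in _ --> X](mulr0 (L' + L)); apply: cvgM => //; exact: cvg_cst.
have [_ c1] := Rintegral_dominated_ae (fun n => measurable_frob ma (mPn n)) (measurable_frob ma mP)
 (intgZ K mtop (hasdens_tr_intg ha)) b1 l1.
have [_ c2] := Rintegral_dominated_ae (fun n => measurable_frob mb (mPIn n)) (measurable_frob mb mPI)
 (intgZ (d%:R / e) mtop (hasdens_tr_intg hb)) b2 l2.
have hc: (fun n => half (fun x => P (Zn n x)) A B) @ \oo -->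
  2^-1 * (\int[mu]_x frob (a x) (P (Z x)) + \int[mu]_x frob (b x) (invmx (P (Z x)))).
 apply: cvgM; first exact: cvg_cst.
 under eq_fun do rewrite (pairing_dens ha (mPn _)) (pairing_dens hb (mPIn _)).
 exact: cvgD.
rewrite -(cvg_lim _ hc) //; apply: limr_ge; first by apply/cvg_ex; eexists; exact: hc.
by apply: nearW => n; exact: fid_le.
Qed.
(** On eigenvalues of [T] this is [nu^2 / (nu + e) <= nu]. *)
Lemma spectral_resolvent (r T: M) (e: R): psd r -> psd T -> 0 < e ->
 frob (T *m r *m T) (invmx (T + e *c 1%:M)) <= frob r T.
move=> pr pT e0; have [Q [nu [QQ nu0 TE]]] := psd_spectral pT.
have hT := psd_herm pT.
have ->: frob (T *m r *m T) (invmx (T + e *c 1%:M)) = frob r (T *m invmx (T + e *c 1%:M) *m T).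
 by rewrite frob_mulr hT frob_mull hT mulmxA.
rewrite -subr_ge0 -frobBr; apply: psd_frob_ge0 => //.
have ne i: nu i + e != 0 by rewrite gt_eqF // ltr_wpDl.
rewrite TE -(spf1 QQ) spfZ spfD.
rewrite (_: (fun i => nu i + e * 1) = fun i => nu i + e); last by apply/funext => i; rewrite mulr1.
rewrite (spf_inv QQ) // !(spfM QQ) spfB; apply: spf_psd => // i.
have ->: nu i - nu i * (nu i + e)^-1 * nu i = nu i * e / (nu i + e) by field.
by rewrite !mulr_ge0 ?(ltW e0) // invr_ge0 addr_ge0 // ltW.
Qed.
Lemma invmx_scalar (e: R): e != 0 -> invmx (e *c (1%:M : M)) = e^-1 *c 1%:M.
move=> e0; have Q1: (1%:M : M) *m (1%:M : M) ^t* = 1%:M by rewrite ctr1 mulmx1.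
by rewrite -(spf1 Q1) !spfZ (spf_inv Q1) => [|i]; rewrite ?mulr1 //; congr (spf _ _); apply/funext => i; rewrite !mulr1.
Qed.
(** The optimal competitor is [T] itself, which is neither bounded nor coercive. It is truncated at
    level [n] and shifted by [e]; the error vanishes as [n] grows for fixed [e], after which [e]
    tends to 0. *)
Lemma fid_trace_le (A B: prob R d Omega) r T: hasdens mu r A -> hasdens mu (fun x => T x *m r x *m T x) B ->
 mxmfun T -> (forall x, psd (T x)) ->
 fid A B <= \int[mu]_x frob (r x) (T x).
move=> hA hB mT pT; have mr := hasdens_meas hA; have pr x := hasdens_psd x hA.
pose b x := T x *m r x *m T x; have mb := hasdens_meas hB.
pose I := \int[mu]_x frob (r x) (T x).
have trb x: frob (r x *m T x) (T x) = tr_re (b x) by apply: frob_sq; exact: psd_herm.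
have iA := hasdens_tr_intg hA; have iB := hasdens_tr_intg hB.
have irT: intg mu setT (fun x => frob (r x) (T x)).
 apply: (@intg_dom R _ (borel Omega) mu setT _ (fun x => 2^-1 * (tr_re (r x) + tr_re (b x)))) => //.
 - exact: measurable_frob.
 - move=> x _; rewrite -trb; have := frob_young 1%:M (T x) (pr x).
  by rewrite mulmx1 (frobC (r x) 1%:M) frob1l.
 - by apply: intgZ => //; exact: intgD.
pose Tn n x := trunc n (T x); pose Z n x := msqrt (Tn n x).
have pTn n x: psd (Tn n x) by rewrite /Tn /trunc; case: ifP => // _; exact: psd0.
have mTn n: mxmfun (Tn n) by exact: mxm_trunc.
have mZ n: mxmfun (Z n) by exact: mxm_msqrt.
have ZZ n x: (Z n x) ^t* *m Z n x = Tn n x.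
 by rewrite (psd_herm (psd_msqrt (pTn n x))) msqrtK.
have ZL n x: frobnorm (Z n x) <= 1 + 2 * d%:R * n%:R.
 have h: frobnorm (Z n x) ^+ 2 <= 2 * d%:R * n%:R + 0.
  rewrite addr0 sqr_frobnorm -[Z n x]mul1mx frob_mulr mul1mx.
  have hZ: (Z n x) ^t* = Z n x by exact: psd_herm (psd_msqrt (pTn n x)).
  have ->: Z n x *m (Z n x) ^t* = Tn n x by rewrite hZ; exact: msqrtK.
  apply: le_trans (frob_CS _ _) _; apply: ler_pM; rewrite ?fnorm_ge0 ?trunc_bound //.
  rewrite -(@ler_pXn2r _ 2) ?nnegrE ?fnorm_ge0 ?mulr_ge0 // sqr_frobnorm frob1l mxtrace1.
  rewrite -(rmorph_nat (real_complex R)) /= expr2.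
  have d2: d%:R <= d%:R * d%:R :> R.
  by rewrite -natrM ler_nat; case: (d) => // k; rewrite leq_pmulr.
  have := ler0n R d; move: d2; nra.
 have n0 := fnorm_ge0 (Z n x); have : 0 <= 2 * d%:R * n%:R :> R by rewrite !mulr_ge0.
 move: h n0; set a := frobnorm _; set c := 2 * _ * _; rewrite addr0 expr2 => h a0 c0.
 have [a1|a1] := leP a 1; first lra.
 by apply: le_trans (_: a <= a * a) _; [rewrite ler_peMr // ltW|lra].
(* The part of [B] where the truncation acts; the competitor is just [e] there and costs [1/e] times
   this trace. *)
pose bt n x := (if frobnorm (T x) <= n%:R then 0 else 1) * tr_re (b x).
have mbt n: mfun (bt n).
 apply: measurable_funM; last exact: hasdens_tr_meas hB.
 apply: measurable_fun_ifT => //; apply: measurable_fun_ler => //.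
 apply: (@mcomp _ _ _ _ _ _ (@Num.sqrt R)); last exact: measurable_frob.
 by apply: continuous_measurable_fun => y; exact: sqrt_continuous.
have btb n x: `|bt n x| <= tr_re (b x).
 have t0: 0 <= tr_re (b x) by exact: hasdens_tr_ge0 hB.
 by rewrite /bt; case: ifP => _; rewrite ?mul0r ?mul1r ?normr0 // ger0_norm.
have ibt n: intg mu setT (bt n) by apply: (intg_dom mtop (mbt n) (fun x _ => btb n x) iB).
have [_ cbt]: intg mu setT (fun=> 0) /\ (fun n => \int[mu]_x bt n x) @ \oo --> \int[mu]_x (0: R).
 apply: (Rintegral_dominated_ae mbt (measurable_cst (0: R)) iB btb).
 apply: aeW => x; apply: cvg_near_cst; near=> n.
 by rewrite /bt ifT ?mul0r //; near: n; exact: nbhs_infty_ger.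
have key (e: R) n : 0 < e -> fid A B <= I + 2^-1 * e + 2^-1 * (e^-1 * \int[mu]_x bt n x).
 move=> e0; apply: le_trans (fid_le_measurable hA hB (mZ n) (ZL n) e0) _.
 have E1: \int[mu]_x frob (r x) ((Z n x) ^t* *m Z n x + e *c 1%:M) <= I + e.
  rewrite -[e in leRHS]mulr1 -(prob_tr hA) -(RintegralZl e mtop iA).
  rewrite -(RintegralD mtop irT (intgZ e mtop iA)).
  apply: (le_Rintegral mtop _ (intgD mtop irT (intgZ e mtop iA))).
  apply: (hasdens_frob_intg (K := n%:R + frobnorm (e *c (1%:M : M))) hA).
  under [X in mx_measurable _ X]eq_fun do rewrite ZZ.
  by apply: mxmD => //; exact: mxm_cst.
  by move=> x; rewrite ZZ; apply: le_trans (frobnormD _ _) _; rewrite lerD2r trunc_bound.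
  move=> x _; rewrite ZZ frobDr frobZr (frobC _ 1%:M) frob1l lerD2r /Tn /trunc.
  by case: ifP => // _; rewrite frob0r; apply: psd_frob_ge0.
 have E2: \int[mu]_x frob (b x) (invmx ((Z n x) ^t* *m Z n x + e *c 1%:M)) <=
  I + e^-1 * \int[mu]_x bt n x.
  rewrite -(RintegralZl _ mtop (ibt n)).
  rewrite -(RintegralD mtop irT (intgZ _ mtop (ibt n))).
  apply: (le_Rintegral mtop _ (intgD mtop irT (intgZ _ mtop (ibt n)))).
  apply: (hasdens_frob_intg (K := d%:R / e) hB).
  apply: mxm_inv => // [|x _]; last exact: (coercive_unit (gram_coercive _ (ltW e0)) e0).
  by apply: mxmD; [apply: mxmM => //; exact: mxm_ctr|exact: mxm_cst].
  by move=> x; exact: (frobnorm_inv (gram_coercive _ (ltW e0)) e0).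
  move=> x _; rewrite ZZ /bt /Tn /trunc; case: ifP => _.
  by rewrite mul0r mulr0 addr0; exact: spectral_resolvent.
  rewrite add0r mul1r invmx_scalar ?gt_eqF // frobZr (frobC _ 1%:M) frob1l lerDr.
  exact: psd_frob_ge0.
 rewrite -/b in E2 *; move: E1 E2; lra.
apply/ler_addgt0Pr => e e0; rewrite -/I.
have c0: (fun n => 2^-1 * (e^-1 * \int[mu]_x bt n x)) @ \oo --> (0: R).
 rewrite -(mulr0 (2^-1 : R)); apply: cvgM; first exact: cvg_cst.
 rewrite -(mulr0 (e^-1 : R)); apply: cvgM; first exact: cvg_cst.
 by move: cbt; rewrite Rintegral_cst // mul0r.
have : fid A B <= I + 2^-1 * e + 0.
 have c1: (fun n => I + 2^-1 * e + 2^-1 * (e^-1 * \int[mu]_x bt n x)) @ \oo --> I + 2^-1 * e + 0.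
  by apply: cvgD => //; exact: cvg_cst.
 rewrite -(cvg_lim _ c1) //; apply: limr_ge; first by apply/cvg_ex; eexists; exact: c1.
 by apply: nearW => n; exact: key.
lra.
Unshelve. all: by end_near. Qed.
(** The geometric mean of the inverse of [r] and [a], a positive solution [T] of [T r T = a]; it is
    also the optimal map between centred Gaussians. *)
Definition transport (r a: M): M :=
 invmx (msqrt r) *m msqrt (msqrt r *m a *m msqrt r) *m invmx (msqrt r).
Lemma transportP (r a: M): psd r -> r \in unitmx -> psd a ->
 psd (transport r a) /\ transport r a *m r *m transport r a = a.
move=> pr ur pa; have ps := psd_msqrt pr; have us := msqrt_unit pr ur.
have hs := psd_herm ps; have hi: (invmx (msqrt r)) ^t* = invmx (msqrt r) by rewrite ctr_inv // hs.
have pc: psd (msqrt r *m a *m msqrt r) by exact: psd_congr_herm.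
split; first exact: (psd_congr_herm hi (psd_msqrt pc)).
rewrite /transport; set s := msqrt r in us *; set c := msqrt (_ *m _ *m _).
have cc: c *m c = s *m a *m s by exact: msqrtK.
have rE: r = s *m s by rewrite msqrtK.
rewrite [X in _ *m X *m _]rE.
rewrite -!mulmxA (mulmxA (invmx s) s) mulVmx // mul1mx (mulmxA s (invmx s)) mulmxV // mul1mx.
by rewrite (mulmxA c c) cc -!mulmxA mulmxV // mulmx1 mulmxA mulVmx // mul1mx.
Qed.
(** The optimal map gives both bounds: [fid_trace_le] from above, and [fid_ge_cross] with the
    identity as first map from below. *)
Lemma transport_fid (A B: prob R d Omega) r a: hasdens mu r A -> hasdens mu a B ->
 (forall x, r x \in unitmx) ->
 exists T, [/\ mxmfun T, forall x, psd (T x), forall x, T x *m r x *m T x = a x &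
  \int[mu]_x frob (r x) (T x) = fid A B].
move=> hA hB ur; have mr := hasdens_meas hA; have ma := hasdens_meas hB.
have pr x := hasdens_psd x hA; have pa x := hasdens_psd x hB.
exists (fun x => transport (r x) (a x)).
have ms: mxmfun (fun x => msqrt (r x)) by exact: mxm_msqrt.
have mi: mxmfun (fun x => invmx (msqrt (r x))).
 by apply: mxm_inv => // x _; exact: msqrt_unit.
have mT: mxmfun (fun x => transport (r x) (a x)).
 apply: mxmM => //; apply: mxmM => //; apply: mxm_msqrt => //.
  by apply: mxmM => //; exact: mxmM.
 by move=> x _; apply: psd_congr_herm => //; apply: psd_herm; exact: psd_msqrt.
have pT x: psd (transport (r x) (a x)) by have [] := transportP (pr x) (ur x) (pa x).
have TE x: transport (r x) (a x) *m r x *m transport (r x) (a x) = a x.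
 by have [] := transportP (pr x) (ur x) (pa x).
have hB': hasdens mu (fun x => transport (r x) (a x) *m r x *m transport (r x) (a x)) B.
 by under eq_fun do rewrite TE.
split => //; apply/eqP; rewrite eq_le; apply/andP; split; last exact: fid_trace_le hA hB' mT pT.
have hA': hasdens mu (fun x => 1%:M *m r x *m 1%:M) A by under eq_fun do rewrite mul1mx mulmx1.
have := @fid_ge_cross R d Omega mu r (fun=> 1%:M) (fun x => transport (r x) (a x)) A B mr pr
 (mxm_cst _ _) mT (fun=> ctr1) (fun x => psd_herm (pT x)) hA' hB'.
by under eq_Rintegral do rewrite mulmx1.
Qed.
End fidelity_upper.

(** * Mixtures of measures *)

Section mixtures.
Context {R : realType} {d : nat} {Omega : ptopologicalType}.
Local Notation M := 'M[R[i]]_d.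

Section definition.
Variables (t: R) (G H: prob R d Omega).
Let c := clamp t.
Let c01: 0 <= c <= 1. Proof. exact: clamp01. Qed.
(** The clamped weight makes the mixture a probability for every real [t], so that the record needs
    no side condition. *)
Definition mix_fun (A: set (borel Omega)): M := (1 - c) *c G A + c *c H A.
Lemma mix_psd A: psd (mix_fun A).
have /andP[h0 h1] := c01.
by apply: psdD; apply: psdZ; rewrite ?subr_ge0 //; exact: psdm_psd.
Qed.
Lemma mix0: mix_fun set0 = 0.
by rewrite /mix_fun !psdm0 !scaler0 addr0. Qed.
Lemma mix_sigma: forall F: (set (borel Omega))^nat,
  (forall n, measurable (F n)) -> trivIset setT F -> forall i j,
  (fun n => \sum_(0 <= k < n) Re (mix_fun (F k) i j)) @ \oo
  --> Re (mix_fun (\bigcup_k F k) i j) /\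
  (fun n => \sum_(0 <= k < n) Im (mix_fun (F k) i j)) @ \oo
  --> Im (mix_fun (\bigcup_k F k) i j).
move=> F mF tF i j.
have [g1 g2] := psdm_sigma_additive G mF tF i j.
have [h1 h2] := psdm_sigma_additive H mF tF i j.
split.
 rewrite (_: (fun n => _) = fun n => (1 - c) * \sum_(0 <= k < n) Re (G (F k) i j) +
  c * \sum_(0 <= k < n) Re (H (F k) i j)); last first.
  apply/funext => n; rewrite !mulr_sumr -big_split; apply: eq_bigr => k _.
  by rewrite !mxE ReD !ReMr.
 by rewrite !mxE ReD !ReMr; apply: cvgD; apply: cvgM => //; exact: cvg_cst.
rewrite (_: (fun n => _) = fun n => (1 - c) * \sum_(0 <= k < n) Im (G (F k) i j) +
  c * \sum_(0 <= k < n) Im (H (F k) i j)); last first.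
 apply/funext => n; rewrite !mulr_sumr -big_split; apply: eq_bigr => k _.
 by rewrite !mxE ImD !ImMr.
by rewrite !mxE ImD !ImMr; apply: cvgD; apply: cvgM => //; exact: cvg_cst.
Qed.
Definition mix_measure := PsdMeasure mix_psd mix0 mix_sigma.
Lemma mix_trace: \tr (mix_measure setT) = 1.
rewrite /= /mix_fun mxtraceD !mxtraceZ !prob_trace !mulr1 -rmorphD /= subrK.
by rewrite rmorph1.
Qed.
Definition mix: prob R d Omega := Prob mix_trace.
End definition.
Lemma mixE t G H A: 0 <= t <= 1 -> mix t G H A = (1 - t) *c G A + t *c H A.
by move=> t01; rewrite /= /mix_fun clamp_id. Qed.
Lemma hasdens_mix (mu: finmeas R Omega) t (G H: prob R d Omega) g h: 0 <= t <= 1 ->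
 hasdens mu g G -> hasdens mu h H -> hasdens mu (fun x => (1 - t) *c g x + t *c h x) (mix t G H).
move=> t01 [[mg ig Gg] pg] [[mh ih Hh] ph]; have /andP[t0 t1] := t01.
have i1 (f1 f2: borel Omega -> R) A : measurable A -> intg mu setT f1 -> intg mu setT f2 ->
  intg mu setT (fun x => (1 - t) * f1 x + t * f2 x) /\
  \int[mu]_(x in A) ((1 - t) * f1 x + t * f2 x) = (1 - t) * \int[mu]_(x in A) f1 x + t * \int[mu]_(x in A) f2 x.
 move=> mA if1 if2; have j1 := intgZ (1 - t) mtop if1; have j2 := intgZ t mtop if2.
 split; first exact: intgD.
 have k1 := integrableS mtop mA (@subsetT _ A) if1.
 have k2 := integrableS mtop mA (@subsetT _ A) if2.
 by rewrite (RintegralD mA (intgZ (1 - t) mA k1) (intgZ t mA k2)) (RintegralZl _ mA k1) (RintegralZl _ mA k2).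
split; last by move=> x; apply: psdD; apply: psdZ; rewrite ?subr_ge0.
split.
- by apply: mxmD; apply: mxmZ => //; exact: measurable_cst.
- move=> i j; have [a1 a2] := ig i j; have [b1 b2] := ih i j; split.
  under [X in _.-integrable _ (_ \o X)]eq_fun do rewrite !mxE ReD !ReMr.
  by have [] := i1 _ _ setT mtop a1 b1.
 under [X in _.-integrable _ (_ \o X)]eq_fun do rewrite !mxE ImD !ImMr.
 by have [] := i1 _ _ setT mtop a2 b2.
- move=> A mA i j; rewrite mixE //; have [e1 e2] := Gg A mA i j; have [e3 e4] := Hh A mA i j.
 have [a1 a2] := ig i j; have [b1 b2] := ih i j; split.
  rewrite !mxE ReD !ReMr e1 e3; under [RHS]eq_Rintegral do rewrite !mxE ReD !ReMr.
  by have [_ ->] := i1 _ _ A mA a1 b1.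
 rewrite !mxE ImD !ImMr e2 e4; under [RHS]eq_Rintegral do rewrite !mxE ImD !ImMr.
 by have [_ ->] := i1 _ _ A mA a2 b2.
Qed.
Lemma trace_mix t G H A: 0 <= t <= 1 -> trace_measure (mix t G H) A =
 ((1 - t)%:E * trace_measure G A + t%:E * trace_measure H A)%E.
move=> t01; rewrite /trace_measure mixE // mxtraceD !mxtraceZ ReD !ReMr.
by rewrite EFinD !EFinM.
Qed.
Lemma mix_dom t G H: 0 < t < 1 -> trace_measure G `<< trace_measure (mix t G H) /\
 trace_measure H `<< trace_measure (mix t G H).
move=> /andP[t0 t1]; have t01: 0 <= t <= 1 by rewrite !ltW.
have key A: trace_measure (mix t G H) A = 0%E -> trace_measure G A = 0%E /\ trace_measure H A = 0%E.
 rewrite trace_mix // /trace_measure -!EFinM -EFinD => -[h].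
 have h1: 0 <= Re (\tr (G A)) by apply: psd_tr_ge0; exact: psdm_psd.
 have h2: 0 <= Re (\tr (H A)) by apply: psd_tr_ge0; exact: psdm_psd.
 have g1: 0 <= (1 - t) * Re (\tr (G A)) by rewrite mulr_ge0 // subr_ge0 ltW.
 have g2: 0 <= t * Re (\tr (H A)) by rewrite mulr_ge0 // ltW.
 have e1: (1 - t) * Re (\tr (G A)) = 0 by lra.
 have e2: t * Re (\tr (H A)) = 0 by lra.
 split; congr EFin; apply/eqP.
  by move/eqP : e1; rewrite mulf_eq0 gt_eqF ?subr_gt0.
 by move/eqP : e2; rewrite mulf_eq0 gt_eqF.
by split; apply/null_content_dominatesP => A mA /key[].
Qed.
Lemma pairing_mix t G H Psi: 0 <= t <= 1 -> CbH Psi ->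
 pairing (mix t G H) Psi = (1 - t) * pairing G Psi + t * pairing H Psi.
move=> t01 cP; have half01: 0 < (2^-1 : R) < 1 by apply/andP; split; lra.
have [dG dH] := mix_dom G H half01.
have [g hg] := hasdens_exists dG; have [h hh] := hasdens_exists dH.
have mP := CbH_meas cP.
rewrite (pairing_dens hg mP) (pairing_dens hh mP) (pairing_dens (hasdens_mix t01 hg hh) mP).
have i1 := pairing_CbH_intg hg cP; have i2 := pairing_CbH_intg hh cP.
rewrite -(RintegralZl _ mtop i1) -(RintegralZl _ mtop i2).
rewrite -(RintegralD mtop (intgZ _ mtop i1) (intgZ _ mtop i2)).
by apply: eq_Rintegral => x _; rewrite frobDl !frobZl.
Qed.
Lemma trace_prob_setT (G: prob R d Omega): trace_measure G setT = 1%E.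
by rewrite /trace_measure prob_trace. Qed.
Hypothesis d0 : (0 < d)%N.
Lemma uniform_exists (G: prob R d Omega): exists U: prob R d Omega,
 hasdens (trace_measure G) (fun=> d%:R^-1 *c (1%:M : M)) U.
have dn: d%:R != 0 :> R by rewrite pnatr_eq0 -lt0n.
have di: 0 <= (d%:R^-1 : R) by rewrite invr_ge0.
have tr1: tr_re (d%:R^-1 *c (1%:M : M)) = 1.
 by rewrite /tr_re -frob1l frobZr frob1l mxtrace1 -(rmorph_nat (real_complex R)) /= mulVf.
have mg: mxmfun (fun _: borel Omega => d%:R^-1 *c (1%:M : M)) by exact: mxm_cst.
have pg (x: borel Omega) : psd (d%:R^-1 *c (1%:M : M)) by exact: psd_scalar.
have ig: intg (trace_measure G) setT (fun=> tr_re (d%:R^-1 *c (1%:M : M))).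
 rewrite tr1; apply: (intg_cst mtop); by rewrite [X in (X <= _)%E]trace_prob_setT.
have g1: \int[trace_measure G]_x tr_re (d%:R^-1 *c (1%:M : M)) = 1.
 by rewrite tr1 Rintegral_cst // [X in fine X]trace_prob_setT mulr1.
by exists (prob_of_dens mg pg ig g1); exact: of_densP.
Qed.
End mixtures.

(** * Triangle inequality for the angle *)

Section angle.
Context {R : realType} {d : nat} {Omega : ptopologicalType}.
Local Notation M := 'M[R[i]]_d.
Lemma discriminant (p b q: R): 0 <= p -> 0 <= q ->
 (forall x y, 0 <= x ^+ 2 * p + 2 * (x * y * b) + y ^+ 2 * q) -> b ^+ 2 <= p * q.
move=> p0 q0 H; have [qz|qnz] := eqVneq q 0.
 (* For [q = 0] this choice gives the value [- b^2 (p + 2)], which forces [b = 0]. *)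
 have := H b (- (p + 1)); rewrite qz.
 rewrite (_: _ + _ = - (b ^+ 2 * (p + 2))); last by ring.
 have : 0 <= b ^+ 2 * p by rewrite mulr_ge0 ?sqr_ge0.
 have := sqr_ge0 b; rewrite mulrDr; lra.
have qp: 0 < q by rewrite lt_neqAle eq_sym qnz.
have := H q (- b); rewrite (_: _ + _ = q * (p * q - b ^+ 2)); last by ring.
by rewrite pmulr_rge0 // subr_ge0.
Qed.
Lemma acos_le (x y: R): 0 <= x <= 1 -> 0 <= y <= pi -> cos y <= x -> acos x <= y.
move=> /andP[x0 x1] /andP[y0 ypi] h; rewrite leNgt; apply/negP => yx.
have xx: -1 <= x <= 1 by apply/andP; split; lra.
have ax := acos_ge0 xx; have ap := acos_lepi xx.
have ain: acos x \in `[0, pi] by rewrite in_itv /= ax ap.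
have yin: y \in `[0, pi] by rewrite in_itv /= y0 ypi.
have E: (cos (acos x) < cos y) = (y < acos x) by exact: ltr_cos.
by move: yx; rewrite -E acosK ?in_itv //= ltNge h.
Qed.
Lemma acos_pihalf (x: R): 0 <= x <= 1 -> 0 <= acos x <= pi / 2.
move=> /andP[x0 x1]; have xx: -1 <= x <= 1 by apply/andP; split; lra.
have p0 := pi_gt0 R.
rewrite acos_ge0 //=; apply: acos_le; [by rewrite x0|by apply/andP; split; lra|by rewrite cos_pihalf].
Qed.
Variable mu : finmeas R Omega.
Lemma Rint_add_scale (f g: borel Omega -> R) c: intg mu setT f -> intg mu setT g ->
 intg mu setT (fun x => f x + c * g x) /\
 \int[mu]_x (f x + c * g x) = \int[mu]_x f x + c * \int[mu]_x g x.
move=> i1 i2; have i3 := intgZ c mtop i2; split; first exact: intgD.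
by rewrite (RintegralD mtop i1 i3) (RintegralZl _ mtop i2).
Qed.
Lemma Rint_six (f1 f2 f3 f4 f5 f6: borel Omega -> R) c1 c2 c3 c4 c5 c6 :
 intg mu setT f1 -> intg mu setT f2 -> intg mu setT f3 ->
 intg mu setT f4 -> intg mu setT f5 -> intg mu setT f6 ->
 \int[mu]_x f1 x = 1 -> \int[mu]_x f2 x = 1 -> \int[mu]_x f3 x = 1 ->
 \int[mu]_x (c1 * f1 x + c2 * f2 x + c3 * f3 x + c4 * f4 x + c5 * f5 x + c6 * f6 x) =
 c1 + c2 + c3 + c4 * \int[mu]_x f4 x + c5 * \int[mu]_x f5 x + c6 * \int[mu]_x f6 x.
move=> i1 i2 i3 i4 i5 i6 e1 e2 e3.
have [j1 I1] := Rint_add_scale c2 (intgZ c1 mtop i1) i2.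
have [j2 I2] := Rint_add_scale c3 j1 i3.
have [j3 I3] := Rint_add_scale c4 j2 i4.
have [j4 I4] := Rint_add_scale c5 j3 i5.
have [j5 ->] := Rint_add_scale c6 j4 i6.
by rewrite I4 I3 I2 I1 (RintegralZl _ mtop i1) e1 e2 e3 !mulr1.
Qed.
Variable dist : Omega -> Omega -> R.
Hypothesis dM : metrizes dist.
(** For the semi-inner product [int r X : Y], the maps 1, [T1], [T2] to [B], [A], [C] are unit
    vectors with products [u], [v] and [z]. Cauchy-Schwarz after removing the component along 1
    gives [(z - u v)^2 <= (1 - u^2)(1 - v^2)], the spherical triangle inequality, and [z] is at most
    the fidelity of [A] and [C]. *)
Lemma fid_cos_add (A B C: prob R d Omega) r a c :
 hasdens mu r B -> (forall x, r x \in unitmx) -> hasdens mu a A -> hasdens mu c C ->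
 fid B A * fid B C - Num.sqrt (1 - fid B A ^+ 2) * Num.sqrt (1 - fid B C ^+ 2) <= fid A C.
move=> hB ur hA hC; have mr := hasdens_meas hB; have pr x := hasdens_psd x hB.
have [T1 [m1 p1 E1 u_]] := transport_fid dM hB hA ur.
have [T2 [m2 p2 E2 v_]] := transport_fid dM hB hC ur.
have h1 x := psd_herm (p1 x); have h2 x := psd_herm (p2 x).
have hA': hasdens mu (fun x => T1 x *m r x *m T1 x) A by under eq_fun do rewrite E1.
have hC': hasdens mu (fun x => T2 x *m r x *m T2 x) C by under eq_fun do rewrite E2.
have hB': hasdens mu (fun x => 1%:M *m r x *m 1%:M) B by under eq_fun do rewrite mul1mx mulmx1.
have zle := fid_ge_cross mr pr m1 m2 h1 h2 hA' hC'.
have i12 := intg_cross mr pr m1 m2 h1 h2 hA' hC'.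
have i01 := intg_cross mr pr (mxm_cst _ _) m1 (fun=> ctr1) h1 hB' hA'.
have i02 := intg_cross mr pr (mxm_cst _ _) m2 (fun=> ctr1) h2 hB' hC'.
have iA := hasdens_tr_intg hA'; have iC := hasdens_tr_intg hC'; have iB := hasdens_tr_intg hB'.
move: zle; set z := \int[mu]_x _ => zle.
have uE: \int[mu]_x frob (r x *m 1%:M) (T1 x) = fid B A by under eq_Rintegral do rewrite mulmx1.
have vE: \int[mu]_x frob (r x *m 1%:M) (T2 x) = fid B C by under eq_Rintegral do rewrite mulmx1.
set u := fid B A in uE *; set v := fid B C in vE *.
have u01: 0 <= u <= 1 by rewrite fid_ge0 fid_le1.
have v01: 0 <= v <= 1 by rewrite fid_ge0 fid_le1.
have Q x y: 0 <= x ^+ 2 * (1 - u ^+ 2) + 2 * (x * y * (z - u * v)) + y ^+ 2 * (1 - v ^+ 2).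
 pose k := x * u + y * v.
 have I5 := Rint_six (x ^+ 2) (y ^+ 2) (k ^+ 2) (2 * (x * y)) (- (2 * (x * k))) (- (2 * (y * k)))
  iA iC iB i12 i01 i02 (prob_tr hA') (prob_tr hC') (prob_tr hB').
 have ->: x ^+ 2 * (1 - u ^+ 2) + 2 * (x * y * (z - u * v)) + y ^+ 2 * (1 - v ^+ 2) =
  x ^+ 2 + y ^+ 2 + k ^+ 2 + 2 * (x * y) * z + - (2 * (x * k)) * u + - (2 * (y * k)) * v.
  by rewrite /k; ring.
 rewrite -{1}uE -{1}vE -I5; apply: Rintegral_ge0 => w _.
 have := psd_quad (x *c T1 w + y *c T2 w + (- k) *c 1%:M) (pr w).
 have s12: frob (r w *m T2 w) (T1 w) = frob (r w *m T1 w) (T2 w).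
  by rewrite frob_mull (psd_herm (pr w)) frobC.
 have s1: frob (r w *m T1 w) 1%:M = frob (r w *m 1%:M) (T1 w).
  by rewrite frob_mull (psd_herm (pr w)) frobC.
 have s2: frob (r w *m T2 w) 1%:M = frob (r w *m 1%:M) (T2 w).
  by rewrite frob_mull (psd_herm (pr w)) frobC.
 rewrite !mulmxDr -!scalemxAr !frobDl !frobDr !frobZl !frobZr s12 s1 s2.
 rewrite -(frob_sq (r w) (h1 w)) -(frob_sq (r w) (h2 w)) -(frob_sq (r w) (@ctr1 R d)) => h.
 apply: le_trans h _; rewrite le_eqVlt; apply/orP; left; apply/eqP; ring.
have p0: 0 <= 1 - u ^+ 2 by rewrite subr_ge0 expr_le1 //; have /andP[] := u01.
have q0: 0 <= 1 - v ^+ 2 by rewrite subr_ge0 expr_le1 //; have /andP[] := v01.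
have disc := discriminant p0 q0 Q.
apply: le_trans zle; rewrite -sqrtrM // lerBlDr -lerBlDl.
apply: le_trans (_: `|z - u * v| <= _); first by rewrite -opprB -normrN ler_norm.
by rewrite -sqrtr_sqr ler_wsqrtr.
Qed.
Lemma ang_triangle_unit (A B C: prob R d Omega) r a c :
 hasdens mu r B -> (forall x, r x \in unitmx) -> hasdens mu a A -> hasdens mu c C ->
 acos (fid A C) <= acos (fid B A) + acos (fid B C).
move=> hB ur hA hC; have h := fid_cos_add hB ur hA hC.
have u01: 0 <= fid B A <= 1 by rewrite fid_ge0 fid_le1.
have v01: 0 <= fid B C <= 1 by rewrite fid_ge0 fid_le1.
have /andP[a0 a1] := acos_pihalf u01; have /andP[b0 b1] := acos_pihalf v01.
have u11: -1 <= fid B A <= 1 by move: u01 => /andP[? ?]; apply/andP; split; lra.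
have v11: -1 <= fid B C <= 1 by move: v01 => /andP[? ?]; apply/andP; split; lra.
apply: acos_le; first by rewrite fid_ge0 fid_le1.
 by apply/andP; split; lra.
by rewrite cosD !acosK ?in_itv //= !sin_acos.
Qed.
End angle.

Section ae_any.
Context {disp : measure_display} {T : measurableType disp} {R : realType}.
Variable mu : {measure set T -> \bar R}.
(** [f] may fail to be measurable: it lies between the modifications of [g] that take the values
    [-oo] and [+oo] on the null set, and both have the integral of [g]. *)
Lemma ae_eq_integral_any (D: set T) (f g: T -> \bar R): measurable D -> measurable_fun D g ->
 {ae mu, forall x, D x -> f x = g x} -> (\int[mu]_(x in D) f x = \int[mu]_(x in D) g x)%E.
move=> mD mg [N [mN N0 sub]].
have key (c: \bar R) : measurable_fun D (fun x => if x \in N then c else g x) /\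
  (\int[mu]_(x in D) (if x \in N then c else g x) = \int[mu]_(x in D) g x)%E.
 have m: measurable_fun D (fun x => if x \in N then c else g x).
  apply: measurable_fun_if => //.
  - apply: (@measurable_fun_bool _ _ _ _ true).
  have ->: (fun x => x \in N) @^-1` [set true] = N by apply/seteqP; split => x /=; [move/set_mem|move/mem_set].
  exact: measurableI.
  - by apply: measurable_funS mg => //; exact: subIsetl.
 split => //; apply: ae_eq_integral => //.
 by exists N; split => // x /= H; apply: contrapT => nN; apply: H => _; rewrite memNset.
have fgN x: D x -> x \notin N -> f x = g x.
 move=> Dx; rewrite notin_setE => nN; apply: contrapT => h; apply: nN; apply: sub => /= H.
 by apply: h; exact: H.
apply/eqP; rewrite eq_le; apply/andP; split.
 have [_ <-] := key +oo%E; apply: le_integral_any => x Dx; case: ifPn => [_|/(fgN x Dx) ->] //.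
 exact: leey.
have [_ <-] := key -oo%E; apply: le_integral_any => x Dx; case: ifPn => [_|/(fgN x Dx) ->] //.
exact: leNye.
Qed.
End ae_any.

(** * Fundamental theorem of calculus for Lipschitz functions *)

Section lipschitz_ftc.
Context {R : realType}.
Local Notation mu := (@lebesgue_measure R).
Local Notation intg D f := (mu.-integrable D (EFin \o f)).
Lemma L2fun_cst (L: R): 0 <= L -> L2fun (fun x => L * @ind01 R x) /\
 forall s t, 0 <= s -> s <= t -> t <= 1 -> iint (fun x => L * ind01 x) s t = L * (t - s).
move=> L0; have i1 := @intg_ind01 R.
have mi: mfun (@ind01 R) := intg_mfun i1.
split.
 split.
 - by apply: measurable_funM.
 - by move=> t; rewrite mulr_ge0 // ind01_ge0.
 - by move=> t /negP h; rewrite /ind01 patchE memNset ?mulr0 //= in_itv.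
 - have E: (fun t => L * ind01 t * (L * ind01 t)) = (fun t => (L * L) * @ind01 R t).
  apply/funext => t; case: (boolP (0 < t <= 1)) => h; first by rewrite ind01_in // !mulr1.
  by rewrite /ind01 patchE memNset ?mulr0 //= in_itv; exact/negP.
  by rewrite E; exact: intgZ.
move=> s t s0 st t1; rewrite -(Rintegral_cst_oc L st); apply: eq_Rintegral => x.
rewrite inE /= in_itv /= => /andP[h1 h2]; rewrite ind01_in ?mulr1 //.
by rewrite (le_lt_trans s0 h1) (le_trans h2 t1).
Qed.
Lemma ae_neq (a: R): {ae mu, forall x, x != a}.
exists [set a]; split; [exact: measurable_set1|exact: lebesgue_measure_set1|].
by move=> x /= /negP; rewrite negbK => /eqP.
Qed.
(** [F] is the integral of some density [q], and [h] agrees with [q] almost everywhere by uniqueness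
    of derivatives. One exceptional time [lam] is allowed, at which two arcs are glued later. *)
Lemma lipschitz_ftc (F h: R -> R) (L lam: R): 0 <= L ->
 (forall s t, 0 <= s -> s <= t -> t <= 1 -> `|F t - F s| <= L * (t - s)) ->
 (forall t, 0 < t < 1 -> t != lam -> (d^-1 * (F (t + d) - F t)) @[d --> 0^'] --> h t) ->
 forall s t, 0 <= s -> s <= t -> t <= 1 -> \int[mu]_(x in `[s, t]) h x = F t - F s.
move=> L0 lip dF s t s0 st t1; have [Le Ie] := L2fun_cst L0.
have lip' a b: 0 <= a -> a <= b -> b <= 1 -> `|F b - F a| <= iint (fun x => L * ind01 x) a b.
 by move=> a0 ab b1; rewrite Ie //; exact: lip.
have [q iq qE] := ac_density_real Le lip'.
rewrite qE // -iint_cc //; congr fine; apply: ae_eq_integral_any => //.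
 by apply/mEFinP; apply: measurable_funTS; exact: intg_mfun iq.
have n01: {ae mu, forall x: R, [/\ x != 0, x != 1 & x != lam]}.
 move: (ae_neq 0) (ae_neq 1) (ae_neq lam); apply: filterS3 => x h0 h1 h2; by split.
move: (iint_derive_ae iq) n01; apply: filterS2 => x dq [x0 x1 xl].
rewrite /= in_itv /= => /andP[sx xt]; congr EFin.
have xp: 0 < x by rewrite lt_neqAle eq_sym x0 (le_trans s0 sx).
have x1': x < 1 by rewrite lt_neqAle x1 (le_trans xt t1).
have c1 := dF x (introT andP (conj xp x1')) xl; have c2 := dq xp.
have c3: (d^-1 * (F (x + d) - F x)) @[d --> 0^'] --> q x.
 apply: cvg_trans c2; apply: near_eq_cvg; have hd := iint_deriv_near q xp x1'; near=> d.
 have /andP[xd0 xd1]: 0 < x + d < 1 by near: d.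
 have E a: 0 <= a -> a <= 1 -> iint q 0 a = F a - F 0 by move=> a0 a1; rewrite -qE.
 by rewrite !E ?(ltW xp) ?(ltW x1') ?(ltW xd0) ?(ltW xd1) //; congr (_ * _); ring.
exact: (cvg_unique _ c1 c3).
Unshelve. all: by end_near. Qed.
Lemma C1_lipschitz (P P': R -> R) :
 (forall t, 0 <= t <= 1 -> forall e, 0 < e -> exists2 r, 0 < r &
  forall s, 0 <= s <= 1 -> `|s - t| < r ->
  `|P s - P t - (s - t) * P' t| <= e * `|s - t| /\ `|P' s - P' t| <= e) ->
 (forall t, 0 < t < 1 -> (d^-1 * (P (t + d) - P t)) @[d --> 0^'] --> P' t) /\
 exists2 L: R, 0 <= L & (forall t: R, 0 <= t <= 1 -> `|P t| <= L) /\
  forall s t: R, 0 <= s <= 1 -> 0 <= t <= 1 -> `|P t - P s| <= L * `|t - s|.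
move=> H.
have quot t: 0 < t < 1 -> (d^-1 * (P (t + d) - P t)) @[d --> 0^'] --> P' t.
 move=> /andP[t0 t1]; apply/cvgrPdist_le => e e0.
 have [r r0 hr] := H t (ltac:(lra)) e e0.
 have hd := iint_deriv_near P t0 t1; near=> d.
 have d0: d != 0 by near: d; exact: nbhs_dnbhs_neq.
 have /andP[td0 td1]: 0 < t + d < 1 by near: d.
 have dr: `|d| < r by near: d; exact: dnbhs0_lt.
 have E: t + d - t = d by ring.
 have [] := hr (t + d) (ltac:(lra)); rewrite E //.
 move=> h1 _; rewrite distrC.
 rewrite (_: d^-1 * _ - P' t = d^-1 * (P (t + d) - P t - d * P' t)); last by field.
 by rewrite normrM normfV mulrC ler_pdivrMr ?normr_gt0.
split => //.
pose Q' t := P' (clamp t).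
have cQ': continuous Q'.
 move=> t; apply/cvgrPdist_le => e e0; have [r r0 hr] := H (clamp t) (clamp01 t) e e0.
 exists r => //= s st; rewrite distrC.
 have [] // := hr (clamp s) (clamp01 s).
 by apply: le_lt_trans (clamp_lip _ _) _; rewrite distrC.
have [c c01 hc] := @EVT_max R (fun t => `|Q' t|) 0 1 ler01
  (continuous_subspaceT (fun t => cvg_norm (cQ' t))).
pose B := `|Q' c|; have B0: 0 <= B by exact: normr_ge0.
have bP' t: 0 <= t <= 1 -> `|P' t| <= B.
 by move=> t01; have := hc t; rewrite in_itv /= /Q' clamp_id //; exact.
have cP t: 0 <= t <= 1 -> {for t, continuous (fun x => P (clamp x))}.
 move=> t01; apply/cvgrPdist_le => e e0.
 have [r r0 hr] := H t t01 1 ltr01.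
 have B1: 0 < B + 1 by rewrite ltr_wpDl.
 exists (Num.min r (e / (B + 1))) => /=; first by rewrite lt_min r0 divr_gt0.
 move=> s /=; rewrite lt_min => /andP[sr se].
 have sr': `|clamp s - t| < r.
  by rewrite -{1}(clamp_id t01); apply: le_lt_trans (clamp_lip _ _) _; rewrite distrC.
 have se': `|clamp s - t| < e / (B + 1).
  by rewrite -{1}(clamp_id t01); apply: le_lt_trans (clamp_lip _ _) _; rewrite distrC.
 have [h1 _] := hr (clamp s) (clamp01 s) sr'.
 rewrite clamp_id // distrC.
 have ->: P (clamp s) - P t = (P (clamp s) - P t - (clamp s - t) * P' t) + (clamp s - t) * P' t by ring.
 apply: le_trans (ler_normD _ _) _; rewrite normrM.
 have h3 := bP' t t01; have n0 := normr_ge0 (clamp s - t).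
 have h4: `|clamp s - t| * `|P' t| <= `|clamp s - t| * B by apply: ler_wpM2l.
 move: se'; rewrite ltr_pdivlMr // => se'; lra.
have lip s t: 0 <= s -> s <= t -> t <= 1 -> `|P t - P s| <= B * (t - s).
 move=> s0 st t1.
 have h1 (x: R) : x \in `]s, t[ -> is_derive x 1 (fun x => P (clamp x)) (P' x).
  rewrite in_itv /= => /andP[sx xt]; have x0: 0 < x by lra.
  have x1: x < 1 by lra.
  have cq: (fun h => h^-1 *: (P (clamp (h *: 1 + x)) - P (clamp x))) @ (0: R)^' --> P' x.
  apply: cvg_trans (quot x (introT andP (conj x0 x1))); apply: near_eq_cvg.
  have hd := iint_deriv_near P x0 x1; near=> d.
  have /andP[td0 td1]: 0 < x + d < 1 by near: d.
  have E: d *: (1: R) + x = x + d by rewrite /GRing.scale /= mulr1 addrC.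
  by rewrite E !clamp_id //; apply/andP; split; lra.
  split; first by apply/cvg_ex; exists (P' x).
  exact/cvg_lim.
 have h2: {within `[s, t], continuous (fun x => P (clamp x))}.
  apply: continuous_in_subspaceT => x; rewrite inE /= in_itv /= => /andP[sx xt].
  by apply: cP; apply/andP; split; lra.
 have [x] := MVT_segment st h1 h2; rewrite in_itv /= => /andP[sx xt].
 rewrite !clamp_id; [|by apply/andP; split; lra|by apply/andP; split; lra].
 move=> ->; rewrite normrM (ger0_norm (_: 0 <= t - s)); last by rewrite subr_ge0.
 by apply: ler_wpM2r; [rewrite subr_ge0|apply: bP'; apply/andP; split; lra].
exists (B + `|P 0|); first by rewrite addr_ge0.
split.
 move=> t /andP[t0 t1]; have := lip 0 t (lexx _) t0 t1; rewrite subr0 => h.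
 have ->: P t = (P t - P 0) + P 0 by ring.
 apply: le_trans (ler_normD _ _) _; rewrite lerD2r; apply: le_trans h _.
 by rewrite ler_piMr.
move=> s t /andP[s0 s1] /andP[t0 t1].
have w a b: 0 <= a -> a <= b -> b <= 1 -> `|P b - P a| <= (B + `|P 0|) * (b - a).
 move=> a0 ab b1; apply: le_trans (lip a b a0 ab b1) _; apply: ler_wpM2r; first by rewrite subr_ge0.
 by rewrite lerDl.
have [st|ts] := leP s t; first by rewrite [`|t - s|]ger0_norm ?subr_ge0 //; exact: w.
by rewrite distrC [`|t - s|]distrC [`|s - t|]ger0_norm ?subr_ge0 ?(ltW ts) //; apply: w => //; exact: ltW.
Unshelve. all: by end_near. Qed.
End lipschitz_ftc.

Section lipschitz_differentiable.
Context {R : realType}.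
Variable lam : R.
Implicit Types f g : R -> R.
(** The class on which [lipschitz_ftc] acts, stable under sums, products and gluing at [lam]. *)
Definition lipd f f' := (exists2 L: R, 0 <= L & (forall t: R, 0 <= t <= 1 -> `|f t| <= L) /\
  forall s t: R, 0 <= s <= 1 -> 0 <= t <= 1 -> `|f t - f s| <= L * `|t - s|) /\
 forall t: R, 0 < t < 1 -> t != lam -> (e^-1 * (f (t + e) - f t)) @[e --> 0^'] --> (f' t: R).
Lemma lipd_cst a: lipd (fun=> a) (fun=> 0).
split; first exists `|a| => //; first split=> // s t _ _; first by rewrite subrr normr0 mulr_ge0.
by move=> t _ _; under eq_fun do rewrite subrr mulr0; exact: cvg_cst.
Qed.
Lemma lipdD f f' g g': lipd f f' -> lipd g g' -> lipd (fun t => f t + g t) (fun t => f' t + g' t).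
move=> [[L L0 [bf lf]] qf] [[K K0 [bg lg]] qg]; split; last first.
 move=> t t01 tl; rewrite (_: (fun e => _) = fun e => e^-1 * (f (t + e) - f t) + e^-1 * (g (t + e) - g t)).
  by apply: cvgD; [exact: qf|exact: qg].
 by apply/funext => e; ring.
exists (L + K); first exact: addr_ge0.
split=> [t t01|s t s01 t01].
 by apply: le_trans (ler_normD _ _) _; apply: lerD; [exact: bf|exact: bg].
have ->: f t + g t - (f s + g s) = (f t - f s) + (g t - g s) by ring.
by apply: le_trans (ler_normD _ _) _; rewrite mulrDl; apply: lerD; [exact: lf|exact: lg].
Qed.
Lemma lipdM f f' g g': lipd f f' -> lipd g g' ->
 lipd (fun t => f t * g t) (fun t => f' t * g t + f t * g' t).
move=> [[L L0 [bf lf]] qf] [[K K0 [bg lg]] qg]; split; last first.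
 move=> t t01 tl; have cg: (g (t + e)) @[e --> 0^'] --> g t.
  have : (g t + e * (e^-1 * (g (t + e) - g t))) @[e --> 0^'] --> g t + 0 * g' t.
  apply: cvgD; first exact: cvg_cst; apply: cvgM; last exact: qg.
  exact: cvg_trans (@nbhs_dnbhs R 0) (@cvg_id _ (nbhs (0: R))).
  rewrite mul0r addr0; apply: cvg_trans; apply: near_eq_cvg; near=> e.
  have e0: e != 0 by near: e; exact: nbhs_dnbhs_neq.
  by rewrite mulrA mulfV // mul1r addrC subrK.
 rewrite (_: (fun e => _) = fun e => e^-1 * (f (t + e) - f t) * g (t + e) + f t * (e^-1 * (g (t + e) - g t))).
  apply: cvgD; apply: cvgM => //; [exact: qf|exact: cvg_cst|exact: qg].
 by apply/funext => e; ring.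
exists (L * K + (L * K + L * K)); first by rewrite !addr_ge0 ?mulr_ge0.
have h0: 0 <= L * K by rewrite mulr_ge0.
split=> [t t01|s t s01 t01].
 rewrite normrM; apply: le_trans (_: L * K <= _); last by lra.
 by apply: ler_pM => //; [exact: bf|exact: bg].
have ->: f t * g t - f s * g s = (f t - f s) * g t + f s * (g t - g s) by ring.
apply: le_trans (ler_normD _ _) _; rewrite !normrM.
have h1: `|f t - f s| * `|g t| <= L * `|t - s| * K by apply: ler_pM => //; [exact: lf|exact: bg].
have h2: `|f s| * `|g t - g s| <= L * (K * `|t - s|) by apply: ler_pM => //; [exact: bf|exact: lg].
have h3: 0 <= L * K * `|t - s| by rewrite mulr_ge0.
have ->: (L * K + (L * K + L * K)) * `|t - s| = L * K * `|t - s| + L * `|t - s| * K + L * (K * `|t - s|) by ring.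
lra.
Unshelve. all: by end_near. Qed.
Lemma lipd_sum (I: Type) (s: seq I) (F F': I -> R -> R): (forall i, lipd (F i) (F' i)) ->
 lipd (fun t => \sum_(i <- s) F i t) (fun t => \sum_(i <- s) F' i t).
move=> h; elim: s => [|i s ih].
 by under eq_fun do rewrite big_nil; under [X in lipd _ X]eq_fun do rewrite big_nil; exact: lipd_cst.
under eq_fun do rewrite big_cons; under [X in lipd _ X]eq_fun do rewrite big_cons; exact: lipdD.
Qed.
Lemma lipd_eq f f' g': lipd f f' -> (forall t, 0 < t < 1 -> t != lam -> f' t = g' t) -> lipd f g'.
by move=> [h q] e; split=> // t t01 tl; rewrite -e //; exact: q. Qed.
Lemma lipd_glue f f' g g': 0 < lam < 1 -> lipd f f' -> lipd g g' -> f lam = g lam ->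
 lipd (fun t => if t <= lam then f t else g t) (fun t => if t <= lam then f' t else g' t).
move=> /andP[l0 l1] [[L L0 [bf lf]] qf] [[K K0 [bg lg]] qg] fg; split; last first.
 move=> t t01 tl; case: ifPn => [tl1|]; last rewrite -ltNge => tl1.
  have tl2: t < lam by rewrite lt_neqAle tl.
  apply: cvg_trans (qf t t01 tl); apply: near_eq_cvg; near=> e.
  have h: `|e| < lam - t by near: e; apply: dnbhs0_lt; rewrite subr_gt0.
  rewrite (_: t + e <= lam) ?tl1 //; have := ler_norm e; lra.
 apply: cvg_trans (qg t t01 tl); apply: near_eq_cvg; near=> e.
 have h: `|e| < t - lam by near: e; apply: dnbhs0_lt; rewrite subr_gt0.
 rewrite leNgt (_: lam < t + e) /= ?leNgt ?tl1 //; have := ler_norm (- e); rewrite normrN; lra.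
have lam01: 0 <= lam <= 1 by rewrite !ltW.
exists (L + K); first exact: addr_ge0.
have w (t: R) : 0 <= K * `|t| /\ 0 <= L * `|t| by rewrite !mulr_ge0.
split=> [t t01|].
 by case: ifP => _; [apply: le_trans (bf t t01) _; rewrite lerDl|apply: le_trans (bg t t01) _; rewrite lerDr].
have key s t: s <= t -> 0 <= s <= 1 -> 0 <= t <= 1 ->
  `|(if t <= lam then f t else g t) - (if s <= lam then f s else g s)| <= (L + K) * `|t - s|.
 move=> st s01 t01; have [w1 w2] := w (t - s); rewrite mulrDl.
 case: (leP t lam) => tl; case: (leP s lam) => sl.
 - by have := lf s t s01 t01; lra.
 - by lra.
 - have h1 := lf s lam s01 lam01; have h2 := lg lam t lam01 t01.
  have ->: g t - f s = (g t - g lam) + (f lam - f s) by rewrite fg; ring.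
  apply: le_trans (ler_normD _ _) _.
  have e1: `|lam - s| <= `|t - s| by rewrite !ger0_norm; lra.
  have e2: `|t - lam| <= `|t - s| by rewrite !ger0_norm; lra.
  have e3 := ler_wpM2l L0 e1; have e4 := ler_wpM2l K0 e2; lra.
 - by have := lg s t s01 t01; lra.
move=> s t s01 t01; have [st|ts] := leP s t; first exact: key.
by rewrite distrC [`|t - s|]distrC; apply: key => //; exact: ltW.
Unshelve. all: by end_near. Qed.
Lemma lipd_derive f f' K: (forall t: R, 0 <= t <= 1 -> is_derive t (1: R) f (f' t)) ->
 (forall t: R, 0 <= t <= 1 -> `|f' t| <= K) -> lipd f f'.
move=> df bf; have z01: 0 <= (0: R) <= 1 by lra.
have K0: 0 <= K := le_trans (normr_ge0 _) (bf 0 z01).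
have key s t: 0 <= s -> s <= t -> t <= 1 -> `|f t - f s| <= K * `|t - s|.
 move=> s0 st t1; have sub x: s <= x <= t -> 0 <= x <= 1 by move=> /andP[h1 h2]; apply/andP; split; lra.
 have [c /sub c01 ->] := mean_value st (fun x h => df x (sub x h)).
 by rewrite normrM ler_wpM2r //; exact: bf.
have lip (s t: R) : 0 <= s <= 1 -> 0 <= t <= 1 -> `|f t - f s| <= K * `|t - s|.
 move=> /andP[s0 s1] /andP[t0 t1]; have [st|ts] := leP s t; first exact: key.
 by rewrite distrC [`|t - s|]distrC; apply: key => //; exact: ltW.
split.
 exists (K + `|f 0|); first exact: addr_ge0.
 split=> [t t01|s t s01 t01].
  have ->: f t = (f t - f 0) + f 0 by ring.
  apply: le_trans (ler_normD _ _) _; rewrite lerD2r; apply: le_trans (lip _ _ z01 t01) _.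
  by case/andP: t01 => t0 t1; rewrite subr0 ger0_norm // ler_piMr.
 by apply: le_trans (lip _ _ s01 t01) _; apply: ler_wpM2r => //; rewrite lerDl.
move=> t /andP[t0 t1] _; have [|dv <-] := df t; first by rewrite !ltW.
rewrite /derive; rewrite (_: (fun e => _) = fun h => h^-1 *: ((f \o shift t) (h *: 1) - f t)); first exact: dv.
by apply/funext => h; rewrite /= /GRing.scale /= mulr1 [h + t]addrC.
Unshelve. all: by end_near. Qed.
End lipschitz_differentiable.

(** * Congruences of a density by linear combinations of fixed maps *)

Section combinations.
Context {R : realType} {d : nat} {Omega : ptopologicalType}.
Local Notation M := 'M[R[i]]_d.
Lemma frob_sumr (I: Type) (s: seq I) (A: M) (F: I -> M) :
 frob A (\sum_(i <- s) F i) = \sum_(i <- s) frob A (F i).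
elim: s => [|i s ih]; first by rewrite !big_nil frob0r.
by rewrite !big_cons frobDr ih.
Qed.
Lemma ctr_sum (I: Type) (s: seq I) (F: I -> M) :
 (\sum_(i <- s) F i) ^t* = \sum_(i <- s) (F i) ^t*.
elim: s => [|i s ih]; last by rewrite !big_cons ctrD ih.
by rewrite !big_nil; have := ctrZ (d := d) (0: R) 0; rewrite rmorph0 !scale0r.
Qed.
Lemma mxm_sum {disp} {T: measurableType disp} (D: set T) (I: Type) (s: seq I)
  (F: I -> T -> M) : measurable D -> (forall i, mx_measurable D (F i)) ->
 mx_measurable D (fun x => \sum_(i <- s) F i x).
move=> mD h; elim: s => [|i s ih].
 by under eq_fun do rewrite big_nil; exact: mxm_cst.
by under eq_fun do rewrite big_cons; exact: mxmD.
Qed.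
Lemma hasdens_unique (mu: finmeas R Omega) g
  (G H: psd_measure R d Omega) : hasdens mu g G -> hasdens mu g H -> eq_measure G H.
move=> [[_ _ hG] _] [[_ _ hH] _] A mA; apply/matrixP => i j.
by have [e1 e2] := hG A mA i j; have [e3 e4] := hH A mA i j; apply: complex_ext; rewrite ?e1 ?e2 ?e3 ?e4.
Qed.
Variables (mu: finmeas R Omega) (r: borel Omega -> M).
Variables (I: finType) (T: I -> borel Omega -> M).
Hypotheses (mr: mxmfun r) (pr: forall x, psd (r x)).
Hypotheses (mT: forall i, mxmfun (T i)) (hT: forall i x, (T i x) ^t* = T i x).
Hypothesis iT : forall i, intg mu setT (fun x => tr_re (T i x *m r x *m T i x)).
Definition comb (a: I -> R) x: M := \sum_i a i *c T i x.
Lemma comb_herm a x: (comb a x) ^t* = comb a x.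
by rewrite ctr_sum; apply: eq_bigr => i _; rewrite ctrZ hT. Qed.
Lemma comb_meas a: mxmfun (comb a).
by apply: mxm_sum => // i; apply: mxmZ => //; exact: measurable_cst. Qed.
Definition cross i j x: M := T i x *m r x *m T j x.
Let ct i x := tr_re (cross i i x).
Let ct_ge0 i x: 0 <= ct i x.
by apply: psd_tr_ge0; exact: psd_congr_herm. Qed.
(** With [s] the root of [r], the cross term is a product of [s T i] and [s T j], whose squared
    norms are the traces on the right. *)
Lemma cross_bound i j x: frobnorm (cross i j x) <= 2^-1 * (ct i x + ct j x).
have e := msqrtK (pr x); have hs := psd_herm (psd_msqrt (pr x)); set s := msqrt (r x) in e hs.
have n k: frobnorm (s *m T k x) ^+ 2 = ct k x.
 by rewrite sqr_frobnorm frob_mull hs mulmxA e frobC frob_sq.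
have ->: cross i j x = (s *m T i x) ^t* *m (s *m T j x).
 by rewrite ctrM hs hT -!mulmxA [s *m (s *m _)]mulmxA e /cross !mulmxA.
apply: le_trans (frobnormM _ _) _; rewrite frobnorm_ctr -!n.
move: (frobnorm _) (frobnorm _) => a b; have := sqr_ge0 (a - b); nra.
Qed.
Let cross_meas i j: mxmfun (cross i j).
by apply: mxmM => //; exact: mxmM. Qed.
Lemma cross_intg i j (Psi: borel Omega -> M) (K: R): mxmfun Psi ->
 (forall x, frobnorm (Psi x) <= K) -> intg mu setT (fun x => frob (cross i j x) (Psi x)) /\
 `|\int[mu]_x frob (cross i j x) (Psi x)| <= 2^-1 * (\int[mu]_x ct i x + \int[mu]_x ct j x) * K.
move=> mP bP.
have i1: intg mu setT (fun x => ct i x + ct j x) := intgD mtop (iT i) (iT j).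
have i2: intg mu setT (fun x => 2^-1 * (ct i x + ct j x)) := intgZ 2^-1 mtop i1.
have ib: intg mu setT (fun x => K * (2^-1 * (ct i x + ct j x))) := intgZ K mtop i2.
have mf: mfun (fun x => frob (cross i j x) (Psi x)) by exact: measurable_frob.
have le x: `|frob (cross i j x) (Psi x)| <= K * (2^-1 * (ct i x + ct j x)).
 apply: le_trans (frob_CS_norm _ _) _; rewrite mulrC; apply: ler_pM; rewrite ?fnorm_ge0 //.
 exact: cross_bound.
have ii: intg mu setT (fun x => frob (cross i j x) (Psi x)).
 by refine (@intg_dom R _ (borel Omega) mu setT _ _ mtop mf _ ib) => x _; exact: le.
split => //; apply: le_trans (le_normr_Rintegral _ ii) _ => //.
have ->: 2^-1 * (\int[mu]_x ct i x + \int[mu]_x ct j x) * K =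
  \int[mu]_x (K * (2^-1 * (ct i x + ct j x))).
 by rewrite (RintegralZl K mtop i2) (RintegralZl 2^-1 mtop i1) (RintegralD mtop (iT i) (iT j)) mulrC.
by apply: le_Rintegral => //; exact: integrable_norm.
Qed.
Lemma frob_comb a b x (V: M): frob (comb a x *m r x *m comb b x) V =
 \sum_i \sum_j a i * b j * frob (cross i j x) V.
rewrite /comb !mulmx_suml frobC frob_sumr; apply: eq_bigr => i _.
rewrite mulmx_sumr frob_sumr; apply: eq_bigr => j _.
by rewrite -!scalemxAl -scalemxAr frobC !frobZl mulrA.
Qed.
Lemma comb_integral a b (Psi: borel Omega -> M) (K: R): mxmfun Psi ->
 (forall x, frobnorm (Psi x) <= K) ->
 intg mu setT (fun x => frob (comb a x *m r x *m comb b x) (Psi x)) /\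
 \int[mu]_x frob (comb a x *m r x *m comb b x) (Psi x) =
 \sum_i \sum_j a i * b j * \int[mu]_x frob (cross i j x) (Psi x).
move=> mP bP; have ic i j := (cross_intg i j mP bP).1.
under eq_fun do rewrite frob_comb.
have ij i j: intg mu setT (fun x => a i * b j * frob (cross i j x) (Psi x)) by exact: intgZ.
have ii i: intg mu setT (fun x => \sum_j a i * b j * frob (cross i j x) (Psi x)) by exact: intg_sum.
split; first exact: intg_sum.
rewrite Rintegral_sum //; apply: eq_bigr => i _; rewrite Rintegral_sum //; apply: eq_bigr => j _.
by rewrite RintegralZl.
Qed.
Lemma comb_tr a: intg mu setT (fun x => tr_re (comb a x *m r x *m comb a x)).
have h1: forall x: borel Omega, frobnorm (1%:M : M) <= frobnorm (1%:M : M) by [].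
have := (comb_integral a a (mxm_cst setT 1%:M) h1).1.
by under eq_fun do rewrite frobC frob1l.
Qed.
Lemma comb_sym a b x (V: M): V ^t* = V ->
 frob (comb a x *m r x *m comb b x) V = frob (comb b x *m r x *m comb a x) V.
by move=> hV; rewrite -frob_ctr hV !ctrM !comb_herm (psd_herm (pr x)) mulmxA.
Qed.
End combinations.

Section total_variation.
Context {R : realType} {d : nat} {Omega : ptopologicalType}.
Lemma CbHB (P Q: Omega -> 'M[R[i]]_d): CbH P -> CbH Q -> CbH (fun x => P x - Q x).
move=> cP cQ; have := CbHD cP (CbH_scale (- 1) cQ).
by under eq_fun do rewrite rmorphN rmorph1 scaleN1r.
Qed.
Lemma pairing_0 (G: psd_measure R d Omega): pairing G (fun=> 0) = 0.
by rewrite /pairing; under eq_Rintegral do rewrite frob0r; rewrite Rintegral_cst // mul0r. Qed.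
Lemma dTV_ge0 (G H: psd_measure R d Omega): (0 <= dTV G H)%E.
apply: ereal_sup_ubound; exists (fun=> 0); last by rewrite !pairing_0 subrr normr0.
split; last by move=> x; rewrite frobnorm0 ler01.
exact: CbH_cst (psd_herm psd0).
Qed.
Lemma frob_velocity (r X Y: 'M[R[i]]_d): X ^t* = X -> X \in unitmx -> X *m Y = Y *m X ->
 frob (X *m r *m X *m (2 *c (Y *m invmx X))) (2 *c (Y *m invmx X)) = 4 * frob (r *m Y) Y.
move=> hX u e; rewrite frobZr -scalemxAr frobZl mulrA (_: 2 * 2 = 4); last by ring.
congr (_ * _); have E: X *m (Y *m invmx X) = Y by rewrite mulmxA e mulmxK.
by rewrite -!mulmxA E (frob_mull X) hX E.
Qed.
End total_variation.

(** * Admissible curves from commuting congruences *)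

Section bridge.
Context {R : realType} {d : nat} {Omega : ptopologicalType}.
Local Notation M := 'M[R[i]]_d.
Variables (mu: finmeas R Omega) (r: borel Omega -> M).
Variables (I: finType) (T: I -> borel Omega -> M).
Hypotheses (mr: mxmfun r) (pr: forall x, psd (r x)).
Hypotheses (mT: forall i, mxmfun (T i)) (hT: forall i x, (T i x) ^t* = T i x).
Hypothesis iT : forall i, intg mu setT (fun x => tr_re (T i x *m r x *m T i x)).
Variables (lam: R) (c c': I -> R -> R) (S: R).
Hypotheses (lc: forall i, lipd lam (c i) (c' i)) (S0: 0 <= S).
Hypotheses (mc: forall i, mfun (c i)) (mc': forall i, mfun (c' i)).
Let X t x := comb T (c^~ t) x.
Let X' t x := comb T (c'^~ t) x.
Hypothesis n1 : forall t, 0 <= t <= 1 -> \int[mu]_x tr_re (X t x *m r x *m X t x) = 1.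
Hypothesis regular : forall t x, 0 < t < 1 -> t != lam ->
 X t x \in unitmx /\ X t x *m X' t x = X' t x *m X t x.
Hypothesis speed : forall t, 0 < t < 1 -> t != lam ->
 \int[mu]_x frob (r x *m X' t x) (X' t x) <= S.
Let Phi i j Psi: R := \int[mu]_x frob (cross r T i j x) (Psi x).
Let mX a: mxmfun (comb T a). Proof. exact: comb_meas. Qed.
Let hX a x: (comb T a x) ^t* = comb T a x. Proof. exact: comb_herm. Qed.
Let gmeas t: mxmfun (fun x => X (clamp t) x *m r x *m X (clamp t) x).
by rewrite /X; apply: mxmM => //; apply: mxmM. Qed.
Let gpsd t x: psd (X (clamp t) x *m r x *m X (clamp t) x).
by apply: psd_congr_herm => //; exact: hX. Qed.
Let gint t: intg mu setT (fun x => tr_re (X (clamp t) x *m r x *m X (clamp t) x)).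
exact: comb_tr. Qed.
Definition bridge_fun t: prob R d Omega :=
 prob_of_dens (gmeas t) (gpsd t) (gint t) (n1 (clamp01 t)).
Lemma bridge_dens t: 0 <= t <= 1 ->
 hasdens mu (fun x => comb T (c^~ t) x *m r x *m comb T (c^~ t) x) (bridge_fun t).
move=> t01; have ->: (fun x => comb T (c^~ t) x *m r x *m comb T (c^~ t) x) =
  fun x => X (clamp t) x *m r x *m X (clamp t) x by rewrite clamp_id.
exact: (of_densP (gmeas t) (gpsd t) (gint t)).
Qed.
Lemma bridge_pairing t Psi: 0 <= t <= 1 -> CbH Psi ->
 pairing (bridge_fun t) Psi = \sum_i \sum_j c i t * c j t * Phi i j Psi.
move=> t01 cP; have [_ _ [K bP]] := cP.
rewrite (pairing_dens (bridge_dens t01) (CbH_meas cP)).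
exact: (comb_integral mr pr mT hT iT _ _ (CbH_meas cP) bP).2.
Qed.
Let K i j := 2^-1 * (\int[mu]_x tr_re (cross r T i i x) + \int[mu]_x tr_re (cross r T j j x)).
Let K0 i j: 0 <= K i j.
by rewrite mulr_ge0 // addr_ge0 //; apply: Rintegral_ge0 => x _; apply: psd_tr_ge0; exact: psd_congr_herm.
Qed.
Let PhiK i j (Psi: Omega -> M) B: mxmfun (Psi: borel Omega -> M) ->
 (forall x, frobnorm (Psi x) <= B) -> `|Phi i j Psi| <= K i j * B.
by move=> mP bP; exact: (cross_intg mr pr mT hT iT i j mP bP).2. Qed.
Let Phi_comb i j P Q V (a: R): CbH P -> CbH Q -> CbH V ->
 Phi i j (fun x => P x - Q x - a *c V x) = Phi i j P - Phi i j Q - a * Phi i j V.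
move=> cP cQ cV.
have ii Psi: CbH Psi -> intg mu setT (fun x => frob (cross r T i j x) (Psi x)).
 by move=> cp; have [_ _ [B bP]] := cp; exact: (cross_intg mr pr mT hT iT i j (CbH_meas cp) bP).1.
rewrite /Phi -(RintegralZl a mtop (ii _ cV)) -RintegralB //; [|exact: ii..].
rewrite -RintegralB //; [|exact: intgB mtop (ii _ cP) (ii _ cQ)|exact: intgZ mtop (ii _ cV)].
by apply: eq_Rintegral => x _; rewrite !frobBr frobZr.
Qed.
Lemma bridge_lipschitz: exists2 C: R, 0 <= C & forall s t Psi, 0 <= s <= 1 -> 0 <= t <= 1 -> CbH Psi ->
 (forall x, frobnorm (Psi x) <= 1) ->
 `|pairing (bridge_fun t) Psi - pairing (bridge_fun s) Psi| <= C * `|t - s|.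
have /boolp.choice [L hL] : forall p: I * I, exists L: R, 0 <= L /\ forall s t: R, 0 <= s <= 1 -> 0 <= t <= 1 ->
  `|c p.1 t * c p.2 t - c p.1 s * c p.2 s| <= L * `|t - s|.
 by move=> [i j]; have [[L L0 [_ lL]] _] := lipdM (lc i) (lc j); exists L.
exists (\sum_i \sum_j L (i, j) * K i j).
 by apply: sumr_ge0 => i _; apply: sumr_ge0 => j _; rewrite mulr_ge0 //; exact: (hL (i, j)).1.
move=> s t Psi s01 t01 cP bP; rewrite !bridge_pairing // -sumrB mulr_suml.
apply: le_trans (ler_norm_sum _ _ _) _; apply: ler_sum => i _; rewrite -sumrB mulr_suml.
apply: le_trans (ler_norm_sum _ _ _) _; apply: ler_sum => j _; rewrite -mulrBl normrM mulrAC.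
apply: ler_pM => //; first exact: (hL (i, j)).2.
by have := PhiK i j (CbH_meas cP) bP; rewrite mulr1.
Qed.
Lemma bridge_dTV: exists2 C: R, 0 <= C & forall s t, 0 <= s <= 1 -> 0 <= t <= 1 ->
 (dTV (bridge_fun t) (bridge_fun s) <= (C * `|t - s|)%:E)%E.
have [C C0 h] := bridge_lipschitz; exists C => // s t s01 t01.
by apply: ge_ereal_sup => _ [Psi [cP bP] <-]; rewrite lee_fin; exact: h.
Qed.
Lemma bridge_continuous: forall t, t \in `[0, 1] ->
 dTV (bridge_fun s) (bridge_fun t) @[s --> within `[0, 1] (nbhs t)] --> 0%E.
move=> t; rewrite in_itv /= => t01; have [C C0 h] := bridge_dTV.
have cL: (C * `|s - t|)%:E @[s --> within `[0, 1] (nbhs t)] --> 0%E.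
 apply: cvg_EFin; first by apply: nearW.
 have cc: (fun s => C * `|s - t|) @ t --> (0: R).
  have ->: 0 = C * `|t - t| :> R by rewrite subrr normr0 mulr0.
  by apply: cvgM; [exact: cvg_cst|apply: cvg_norm; apply: cvgB; [exact: cvg_id|exact: cvg_cst]].
 exact: cvg_within_filter cc.
apply: (squeeze_cvge _ (cvg_cst 0%E) cL); apply: filterS (withinT _ _) => s /=.
by rewrite in_itv /= => s01; rewrite dTV_ge0 /=; exact: h.
Qed.
Definition bridge: curve R d Omega := Curve bridge_continuous.
(** The density [X r X] has derivative [X' r X + X r X'], which is the symmetric part of [X r X U]
    for [U = 2 X' X^-1]; commutation of [X] and [X'] makes [U] Hermitian. At the end times and at
    [lam], where [X] may be singular or not differentiable, the field is 0. *)
Definition bridge_field t x: M := if (0 < t < 1) && (t != lam)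
 then 2 *c (comb T (c'^~ t) x *m invmx (comb T (c^~ t) x)) else 0.
Lemma bridge_field_herm t x: (bridge_field t x) ^t* = bridge_field t x.
rewrite /bridge_field; case: ifPn => [/andP[t01 tl]|_]; last exact: psd_herm psd0.
have [u e] := regular x t01 tl; rewrite -!/(X t x) -!/(X' t x) in e u *.
rewrite ctrZ ctrM ctr_inv // !hX; congr (_ *: _).
by rewrite -[in RHS](mulKmx u (X' t x)) e !mulmxA mulmxK.
Qed.
Lemma bridge_field_meas: mxmfun (fun z: R * borel Omega => bridge_field z.1 z.2).
have mt: mfun (fst: R * borel Omega -> R) := measurable_fst.
have mcomb (a: I -> R -> R) : (forall i, mfun (a i)) ->
  mxmfun (fun z: R * borel Omega => comb T (a^~ z.1) z.2).
 move=> ma; apply: mxm_sum => // i; apply: mxmZ; first exact: mcomp (ma i) mt.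
 by move=> k l; have [h1 h2] := mT i k l; split; [exact: (mcomp h1 measurable_snd)|exact: (mcomp h2 measurable_snd)].
have mb: mfun (fun z: R * borel Omega => (0 < z.1 < 1) && (z.1 != lam)).
 apply: measurable_and; first apply: measurable_and.
 - exact: (measurable_fun_ltr (measurable_cst _) mt).
 - exact: (measurable_fun_ltr mt (measurable_cst _)).
 - by apply: measurable_neg; apply: measurable_fun_eqr.
pose Y (z: R * borel Omega) := if (0 < z.1 < 1) && (z.1 != lam) then comb T (c^~ z.1) z.2 else 1%:M.
have uY z: Y z \in unitmx.
 by rewrite /Y; case: ifPn => [/andP[t01 tl]|_]; [exact: (regular _ t01 tl).1|exact: unitmx1].
have ->: (fun z: R * borel Omega => bridge_field z.1 z.2) = fun z =>
  if (0 < z.1 < 1) && (z.1 != lam) then 2 *c (comb T (c'^~ z.1) z.2 *m invmx (Y z)) else 0.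
 by apply/funext => z; rewrite /bridge_field /Y; case: ifP.
refine (@mxm_if _ _ _ _ setT mtop _ _ _ mb _ (mxm_cst setT 0)).
apply: mxmZ; first exact: measurable_cst.
apply: mxmM; first exact: mcomb.
by apply: mxm_inv => //; exact: (mxm_if mtop mb (mcomb _ mc) (mxm_cst setT 1%:M)).
Qed.
Let field_meas t: mxmfun (bridge_field t: borel Omega -> M).
exact: (mx_measurable_section t bridge_field_meas). Qed.
Lemma bridge_sqnorm t: 0 <= t <= 1 -> (sqnorm (bridge t) (bridge_field t) <= (4 * S)%:E)%E.
move=> t01; rewrite (sqnorm_dens (bridge_dens t01) (field_meas t)).
case: (boolP ((0 < t < 1) && (t != lam))) => [/andP[t01' tl]|h]; last first.
 rewrite /bridge_field (negbTE h); under eq_integral do rewrite frob0r.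
 by rewrite integral0 lee_fin mulr_ge0.
under eq_integral => x _.
 have [u e] := regular x t01' tl; rewrite /bridge_field t01' tl /=.
 rewrite -!/(X t x) -!/(X' t x) in e u *.
 have ->: frob (X t x *m r x *m X t x *m (2 *c (X' t x *m invmx (X t x)))) (2 *c (X' t x *m invmx (X t x))) =
  4 * frob (r x *m X' t x) (X' t x).
  exact: frob_velocity (hX _ _) u e.
 over.
have i0: intg mu setT (fun x => frob (r x *m X' t x) (X' t x)).
 by under eq_fun do rewrite frob_sq ?hX //; exact: comb_tr.
rewrite -(EFin_Rintegral mtop (intgZ 4 mtop i0)) lee_fin (RintegralZl 4 mtop i0).
by rewrite ler_pM2l //; exact: speed.
Qed.
Lemma bridge_action: (action bridge bridge_field <= (4 * S)%:E)%E.
have ->: (4 * S)%:E = (\int[@lebesgue_measure R]_(t in `[0%R, 1%R]) (4 * S)%:E)%E.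
 by rewrite integral_cst //= lebesgue_measure_itv /= lte_fin ltr01 oppr0 adde0 mule1.
by apply: le_integral_any => t /=; rewrite in_itv /= => t01; exact: bridge_sqnorm.
Qed.
Lemma bridge_L2: L2_field bridge bridge_field.
split; [by move=> t x _; apply/hermP; exact: bridge_field_herm| |].
 by move=> i j; have [h1 h2] := bridge_field_meas i j; split; exact: measurable_funTS.
by apply: le_lt_trans bridge_action _; rewrite ltry.
Qed.
Lemma bridge_pairing2 t Psi: 0 < t < 1 -> t != lam -> CbH Psi ->
 pairing2 (bridge t) (bridge_field t) Psi = \sum_i \sum_j (c' i t * c j t + c i t * c' j t) * Phi i j Psi.
move=> t01' tl cP; have t01: 0 <= t <= 1 by case/andP: t01' => a b; rewrite !ltW.
have [hP _ [B bP]] := cP; have mP := CbH_meas cP.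
rewrite (pairing2_dens (bridge_dens t01) (field_meas t) mP).
have E x: frob (X t x *m r x *m X t x *m bridge_field t x) (Psi x) =
  frob (X' t x *m r x *m X t x) (Psi x) + frob (X t x *m r x *m X' t x) (Psi x).
 have [u e] := regular x t01' tl; rewrite /bridge_field t01' tl /= -!/(X t x) -!/(X' t x) in e u *.
 have ->: X t x *m r x *m X t x *m (2 *c (X' t x *m invmx (X t x))) = 2 *c (X t x *m r x *m X' t x).
  rewrite -scalemxAr; congr (_ *: _); rewrite -!mulmxA; congr (_ *m (_ *m _)).
  by rewrite mulmxA e mulmxK.
 have := comb_sym pr hT (c^~ t) (c'^~ t) x ((hermP _).1 (hP x)); rewrite -/(X t x) -/(X' t x) => <-.
 by rewrite frobZl mulr2n mulrDl !mul1r.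
under eq_Rintegral do rewrite E.
have [i1 e1] := comb_integral mr pr mT hT iT (c'^~ t) (c^~ t) mP bP.
have [i2 e2] := comb_integral mr pr mT hT iT (c^~ t) (c'^~ t) mP bP.
transitivity (\sum_i \sum_j c' i t * c j t * Phi i j Psi + \sum_i \sum_j c i t * c' j t * Phi i j Psi).
 rewrite -e1 -e2; exact: (RintegralD mtop i1 i2).
rewrite -big_split; apply: eq_bigr => i _ /=; rewrite -big_split; apply: eq_bigr => j _ /=.
by rewrite -mulrDl.
Qed.
Lemma Phi_lipd Psi dPsi i j: C1_CbH Psi dPsi ->
 lipd lam (fun t => Phi i j (Psi t)) (fun t => Phi i j (dPsi t)).
move=> [cb cdP cP].
have [|q L] := @C1_lipschitz R (fun t => Phi i j (Psi t)) (fun t => Phi i j (dPsi t)); last by split => // t t01 _; exact: q.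
move=> t t01 e e0; have t01': t \in `[0, 1] by rewrite in_itv.
have k0: 0 < K i j + 1 by rewrite ltr_wpDl.
have e1: 0 < e / (K i j + 1) by rewrite divr_gt0.
have [r1 r10 h1] := cP t t01' _ e1; have [r2 r20 h2] := cdP t t01' _ e1.
exists (Num.min r1 r2); first by rewrite lt_min r10.
move=> s s01; rewrite lt_min => /andP[s1 s2]; have s01': s \in `[0, 1] by rewrite in_itv.
have [cs cds] := cb s s01'; have [ct cdt] := cb t t01'.
have le (b x: R) : 0 <= x -> b <= K i j * (e / (K i j + 1) * x) -> b <= e * x.
 move=> x0 h; apply: le_trans h _; rewrite mulrA; apply: ler_wpM2r => //.
 by rewrite mulrCA ler_piMr ?(ltW e0) // ler_pdivrMr // mul1r lerDl.
split.
 rewrite -(Phi_comb i j (s - t) cs ct cdt); apply: le => //; apply: PhiK; last exact: h1.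
 exact: CbH_meas (CbHB (CbHB cs ct) (CbH_scale _ cdt)).
have E0: Phi i j (dPsi s) - Phi i j (dPsi t) = Phi i j (fun x => dPsi s x - dPsi t x - 0 *c dPsi t x).
 by rewrite (Phi_comb i j 0 cds cdt cdt) mul0r subr0.
have le1 := le (`|Phi i j (dPsi s) - Phi i j (dPsi t)|) 1 ler01; rewrite !mulr1 in le1; apply: le1.
have E1: (fun x => dPsi s x - dPsi t x - 0 *c dPsi t x) = (fun x => dPsi s x - dPsi t x).
 by apply/funext => x; rewrite rmorph0 scale0r subr0.
rewrite E0 E1; apply: PhiK; last exact: h2.
exact: CbH_meas (CbHB cds cdt).
Qed.
(** A pairing along the bridge is a finite sum of scalar coefficients times integrals over fixed
    cross terms, so the product rule in time suffices and no derivative is taken under the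
    integral. *)
Lemma bridge_weak: weak_equation bridge bridge_field.
move=> Psi dPsi C1 s t; rewrite !in_itv /= => /andP[s0 s1] /andP[t0 t1].
pose F t := \sum_i \sum_j c i t * c j t * Phi i j (Psi t).
have [cb _ _] := C1.
have lF: lipd lam F (fun t => \sum_i \sum_j ((c' i t * c j t + c i t * c' j t) * Phi i j (Psi t)
  + c i t * c j t * Phi i j (dPsi t))).
 by apply: lipd_sum => i; apply: lipd_sum => j; apply: lipdM; [exact: lipdM|exact: Phi_lipd].
have FE u: 0 <= u <= 1 -> pairing (bridge u) (Psi u) = F u.
 by move=> u01; rewrite bridge_pairing //; apply: (cb u _).1; rewrite in_itv.
pose h u := pairing (bridge u) (dPsi u) + pairing2 (bridge u) (bridge_field u) (Psi u).
have lF2: lipd lam F h.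
 apply: lipd_eq lF _ => u u01 ul; have u01': 0 <= u <= 1 by case/andP: u01 => a b; rewrite !ltW.
 have [ca cd]: CbH (Psi u) /\ CbH (dPsi u) by apply: cb; rewrite in_itv.
 rewrite /h bridge_pairing2 // bridge_pairing // addrC -big_split; apply: eq_bigr => i _ /=.
 by rewrite -big_split.
have [[L L0 [_ lip]] q] := lF2.
have ftc a b: 0 <= a -> a <= b -> b <= 1 -> \int[lebesgue_measure]_(x in `[a, b]) h x = F b - F a.
 apply: (@lipschitz_ftc R F h L lam L0) => // u v u0 uv v1.
 rewrite -[v - u]ger0_norm ?subr_ge0 //; apply: lip; lra.
rewrite !FE; [|lra|lra]; rewrite /oriented_integral; case: ifPn => [st|]; first by rewrite ftc.
by rewrite -ltNge => ts; rewrite ftc ?(ltW ts) // opprB.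
Qed.
Lemma dFR_bridge (A B: prob R d Omega) :
 hasdens mu (fun x => comb T (c^~ 0) x *m r x *m comb T (c^~ 0) x) A ->
 hasdens mu (fun x => comb T (c^~ 1) x *m r x *m comb T (c^~ 1) x) B ->
 (dFR A B <= (Num.sqrt (4 * S))%:E)%E.
move=> hA hB; have z: 0 <= (0: R) <= 1 by lra.
have o: 0 <= (1: R) <= 1 by lra.
have ->: (Num.sqrt (4 * S))%:E = sqrte (4 * S)%:E by [].
rewrite /dFR lee_sqrt ?lee_fin ?mulr_ge0 //; apply: ge_ereal_inf; exists (action bridge bridge_field).
 exists bridge, bridge_field; split; [| |exact: bridge_L2|exact: bridge_weak|by []].
 - exact: hasdens_unique (bridge_dens z) hA.
 - exact: hasdens_unique (bridge_dens o) hB.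
exact: bridge_action.
Qed.
End bridge.

(** * Spherical interpolation *)

Section arc.
Context {R : realType}.
Implicit Types (u a b: R) (p q: R -> R).
(* [p (t) + q (t) T] runs, at constant speed in [s = a + b t], along the geodesic from
  [T] at [s = 0] to [1] at [s = 1], where [u] is the cosine of the angle between both *)
Definition arc u a b p q p' q' :=
 [/\ (forall lam, lipd lam p p' /\ lipd lam q q'),
  [/\ mfun p, mfun q,
  mfun p' & mfun q'],
  forall t, p t ^+ 2 + q t ^+ 2 + 2 * (p t * q t) * u = 1,
  forall t, p' t ^+ 2 + q' t ^+ 2 + 2 * (p' t * q' t) * u = (b * acos u) ^+ 2 &
  forall t, [/\ a + b * t = 0 -> p t = 0 /\ q t = 1, a + b * t = 1 -> p t = 1 /\ q t = 0 &
  0 < a + b * t <= 1 -> 0 < p t /\ 0 <= q t]].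
Lemma derive_measurable (f f': R -> R): (forall t, is_derive t (1: R) f (f' t)) -> mfun f.
by move=> h; apply: continuous_measurable_fun => t; exact: is_derive_continuous (h t).
Qed.
Lemma arc_exists u a b: 0 <= u <= 1 -> exists p q p' q', arc u a b p q p' q'.
move=> /andP[u0]; rewrite le_eqVlt => /orP[/eqP ->|u1].
 (* At [u = 1] the angle is 0 and the sine quotients degenerate; affine interpolation then has norm
    1 and speed 0. *)
 exists (fun t => a + b * t), (fun t => 1 - a + (- b) * t), (fun=> b), (fun=> - b).
 have d1 t := derive_affine a b t; have d2 t := derive_affine (1 - a) (- b) t.
 split.
 - by move=> lam; split; apply: (@lipd_derive _ _ _ _ `|b|) => // t _; rewrite ?normrN.
 - by split; [exact: derive_measurable d1|exact: derive_measurable d2|exact: measurable_cst|exact: measurable_cst].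
 - by move=> t; ring.
 - by move=> t; rewrite acos1 mulr0 expr0n /=; ring.
 - by move=> t; split => h; split; lra.
have uN1: -1 <= u <= 1 by lra.
have al0: 0 < acos u by apply: acos_gt0; lra.
have [_ al2]: 0 <= acos u /\ acos u <= pi / 2 by apply/andP; apply: acos_pihalf; lra.
have cosE := acosK uN1; have [al alE]: exists al, acos u = al by eexists.
rewrite alE in al0 al2 cosE.
have s0: 0 < sin al by apply: sin_gt0_pi; have := pi_gt0 R; lra.
pose p (t: R) := (sin al)^-1 * sin (al * a + al * b * t).
pose q (t: R) := (sin al)^-1 * sin (al * (1 - a) + - (al * b) * t).
pose p' (t: R) := (sin al)^-1 * (cos (al * a + al * b * t) * (al * b)).
pose q' (t: R) := (sin al)^-1 * (cos (al * (1 - a) + - (al * b) * t) * - (al * b)).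
have d1 (t: R) : is_derive t (1: R) p (p' t) by apply: deriveZ'; exact: derive_sin_affine.
have d2 (t: R) : is_derive t (1: R) q (q' t) by apply: deriveZ'; exact: derive_sin_affine.
have mcos (x y: R) : mfun (fun t: R => cos (x + y * t)).
 exact: derive_measurable (fun t => derive_cos_affine x y t).
have bd x: `|(sin al)^-1 * (cos x * (al * b))| <= (sin al)^-1 * `|al * b|.
 rewrite !normrM ger0_norm ?invr_ge0 ?(ltW s0) //; apply: ler_wpM2l; first by rewrite invr_ge0 ltW.
 by rewrite -normrM normrM ler_piMl // ler_norml cos_geN1 cos_le1.
exists p, q, p', q'.
have E t: al * (1 - a) + - (al * b) * t = al - (al * a + al * b * t) by ring.
have pyth x: sin x ^+ 2 = 1 - cos x ^+ 2 :> R by rewrite -(cos2Dsin2 x); ring.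
have sn0: sin al != 0 by rewrite gt_eqF.
split.
- move=> lam; split; first by apply: (lipd_derive lam (fun t _ => d1 t) (K := (sin al)^-1 * `|al * b|)) => t _; exact: bd.
 by apply: (lipd_derive lam (fun t _ => d2 t) (K := (sin al)^-1 * `|al * b|)) => t _; rewrite /q' mulrN mulrN normrN; exact: bd.
- split; [exact: derive_measurable d1|exact: derive_measurable d2| |].
 + by apply: measurable_funM; [exact: measurable_cst|apply: measurable_funM => //; exact: measurable_cst].
 + by apply: measurable_funM; [exact: measurable_cst|apply: measurable_funM => //; exact: measurable_cst].
- move=> t; rewrite /p /q E sinB -cosE; move: (al * a + _) => x.
 have ->: ((sin al)^-1 * sin x) ^+ 2 + ((sin al)^-1 * (sin al * cos x - cos al * sin x)) ^+ 2 +
  2 * ((sin al)^-1 * sin x * ((sin al)^-1 * (sin al * cos x - cos al * sin x))) * cos al =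
  (sin al)^-1 ^+ 2 * (sin x ^+ 2 * (1 - cos al ^+ 2) + sin al ^+ 2 * cos x ^+ 2) by ring.
 by rewrite -pyth [sin x ^+ 2]pyth; field.
- move=> t; rewrite alE /p' /q' E cosB -cosE; move: (al * a + _) => x.
 have ->: ((sin al)^-1 * (cos x * (al * b))) ^+ 2 +
  ((sin al)^-1 * ((cos al * cos x + sin al * sin x) * - (al * b))) ^+ 2 +
  2 * ((sin al)^-1 * (cos x * (al * b)) * ((sin al)^-1 * ((cos al * cos x + sin al * sin x) * - (al * b)))) * cos al =
  (b * al) ^+ 2 * (sin al)^-1 ^+ 2 * (cos x ^+ 2 * (1 - cos al ^+ 2) + sin al ^+ 2 * sin x ^+ 2) by ring.
 by rewrite -pyth [sin x ^+ 2]pyth; field.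
- move=> t; rewrite /p /q E -mulrA -mulrDr; split=> [->|->|].
 + by rewrite mulr0 subr0 sin0 mulr0 mulVf.
 + by rewrite mulr1 subrr sin0 mulr0 mulVf.
 move: (a + b * t) => x /andP[x0 x1]; have h1: 0 < al * x by rewrite mulr_gt0.
 have h2: al * x <= al by rewrite ler_piMr // ltW.
 have pi0 := pi_gt0 R; split.
  by rewrite mulr_gt0 ?invr_gt0 //; apply: sin_gt0_pi; lra.
 by rewrite mulr_ge0 ?invr_ge0 ?(ltW s0) //; apply: sin_ge0_pi; lra.
Qed.
End arc.

Section half_bridge.
Context {R : realType} {d : nat} {Omega : ptopologicalType}.
Local Notation M := 'M[R[i]]_d.
Variables (mu: finmeas R Omega) (r T: borel Omega -> M).
Variables (B A: prob R d Omega).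
Hypotheses (hr: hasdens mu r B) (hA: hasdens mu (fun x => T x *m r x *m T x) A).
Hypotheses (mT: mxmfun T) (pT: forall x, psd (T x)).
Lemma intg_frob_transport: intg mu setT (fun x => frob (r x) (T x)).
have h1: hasdens mu (fun x => 1%:M *m r x *m 1%:M) B by under eq_fun do rewrite mul1mx mulmx1.
have := intg_cross (hasdens_meas hr) (fun x => hasdens_psd x hr) (mxm_cst setT 1%:M) mT
  (fun x => ctr1) (fun x => psd_herm (pT x)) h1 hA.
by under eq_fun do rewrite mulmx1.
Qed.
(** The maps 1 and [T] are unit vectors with product [u], so the identities of [arc] say that the
    path has unit norm and constant speed. *)
Lemma affine_norm (p q u: R): \int[mu]_x frob (r x) (T x) = u ->
 \int[mu]_x frob (r x *m (p *c 1%:M + q *c T x)) (p *c 1%:M + q *c T x) =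
 p ^+ 2 + q ^+ 2 + 2 * (p * q) * u.
move=> <-; set f := fun x => frob (r x) (T x).
transitivity (\int[mu]_x (p ^+ 2 * tr_re (r x) + q ^+ 2 * tr_re (T x *m r x *m T x) + 0 * tr_re (r x)
  + 2 * (p * q) * f x + 0 * f x + 0 * f x)).
 apply: eq_Rintegral => x _; have hT := psd_herm (pT x).
 rewrite -(frob_sq _ hT) !mulmxDr -!scalemxAr mulmx1 !frobDl !frobDr !frobZl !frobZr.
 have ->: frob (r x) 1%:M = tr_re (r x) by rewrite frobC frob1l.
 have ->: frob (r x *m T x) 1%:M = f x by rewrite frob_mulr hT mul1mx.
 by rewrite -/(f x); ring.
have iR := hasdens_tr_intg hr; have iA := hasdens_tr_intg hA; have iC := intg_frob_transport.
have nR := prob_tr hr; have nA := prob_tr hA.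
by rewrite (Rint_six _ _ _ _ _ _ iR iA iR iC iC iC nR nA nR); ring.
Qed.
End half_bridge.

(** * Two arcs through a measure with invertible density *)

Section two_arcs.
Context {R : realType} {d : nat} {Omega : ptopologicalType}.
Local Notation M := 'M[R[i]]_d.
Variable dist : Omega -> Omega -> R.
Hypothesis dM : metrizes dist.
Definition tri {X: Type} (x y z: X) (i: 'I_3) : X :=
 match val i with 0%N => x | 1%N => y | _ => z end.
Lemma comb3 (T1 T2: borel Omega -> M) (f: 'I_3 -> R) x :
 comb (fun i x => tri 1%:M (T1 x) (T2 x) i) f x =
 f ord0 *c 1%:M + f (lift ord0 ord0) *c T1 x + f (lift ord0 (lift ord0 ord0)) *c T2 x.
by rewrite /comb !big_ord_recl big_ord0 /tri /= addr0 addrA. Qed.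
Lemma affine_coercive (T: M) (p q: R): psd T -> 0 < p -> 0 <= q ->
 p *c 1%:M + q *c T \in unitmx.
move=> pT p0 q0; apply: (coercive_unit _ p0).
by rewrite addrAC subrr add0r; exact: psdZ.
Qed.
Lemma affine_commute (T: M) (p q p' q': R) :
 (p *c 1%:M + q *c T) *m (p' *c 1%:M + q' *c T) = (p' *c 1%:M + q' *c T) *m (p *c 1%:M + q *c T).
have h (a b: R): (a *c 1%:M + b *c T) *m T = T *m (a *c 1%:M + b *c T).
 by rewrite mulmxDl mulmxDr -!scalemxAl -!scalemxAr mul1mx mulmx1.
set X := p *c _ + _; rewrite mulmxDr -!scalemxAr mulmx1 /X h -/X [RHS]mulmxDl.
by rewrite -!scalemxAl mul1mx.
Qed.
(** The path runs from the map [T1] to the identity and on to [T2]. Each combination has a positive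
    multiple of the identity except at the end times, which keeps it invertible, and it commutes
    with its derivative since only one map is involved at a time. *)
Lemma dFR_two_arcs (mu: finmeas R Omega) (C A B: prob R d Omega) r a b (e: R) :
 hasdens mu r C -> (forall x, r x \in unitmx) -> hasdens mu a A -> hasdens mu b B -> 0 < e ->
 (dFR A B <= (2 * (acos (fid C A) + acos (fid C B) + 2 * e))%:E)%E.
move=> hr ur ha hb e0.
have [T1 [mT1 pT1 TT1 u1]] := transport_fid dM hr ha ur.
have [T2 [mT2 pT2 TT2 u2]] := transport_fid dM hr hb ur.
have v1: 0 <= fid C A <= 1 by rewrite fid_ge0 fid_le1.
have v2: 0 <= fid C B <= 1 by rewrite fid_ge0 fid_le1.
have /andP[al0 _] := acos_pihalf v1; have /andP[be0 _] := acos_pihalf v2.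
have hA1: hasdens mu (fun x => T1 x *m r x *m T1 x) A by under eq_fun do rewrite TT1.
have hB2: hasdens mu (fun x => T2 x *m r x *m T2 x) B by under eq_fun do rewrite TT2.
pose L := acos (fid C A) + acos (fid C B) + 2 * e.
have L0: 0 < L by rewrite /L; lra.
(* Time is shared in proportion to the enlarged angles, so that both halves have speed at most [L];
   the summand [e] keeps [lam] strictly between 0 and 1 when an angle is 0. *)
pose lam := (acos (fid C A) + e) / L.
have lam0: 0 < lam by rewrite divr_gt0 //; lra.
have lam1: lam < 1 by rewrite ltr_pdivrMr // mul1r /L; lra.
have eL: lam * L = acos (fid C A) + e by rewrite /lam; field; rewrite gt_eqF.
have eL': (1 - lam) * L = acos (fid C B) + e by rewrite mulrBl eL /L; ring.
have lam': 0 < 1 - lam by lra.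
have [p1 [q1 [p1' [q1' [l1 [mp1 mq1 mp1' mq1'] id1 sp1 ev1]]]]] := arc_exists 0 lam^-1 v1.
(* The parameter [(1 - t) / (1 - lam)] runs backwards, from 1 at [t = lam] to 0 at [t = 1]. *)
have [p2 [q2 [p2' [q2' [l2 [mp2 mq2 mp2' mq2'] id2 sp2 ev2]]]]] := arc_exists (1 - lam)^-1 (- (1 - lam)^-1) v2.
have a1: 0 + lam^-1 * lam = 1 by rewrite add0r mulVf // gt_eqF.
have a2: (1 - lam)^-1 + - (1 - lam)^-1 * lam = 1.
 by rewrite mulNr -{1}[(1 - lam)^-1]mulr1 -mulrBr mulVf // gt_eqF.
have [_ /(_ a1) [p1l q1l] _] := ev1 lam; have [_ /(_ a2) [p2l q2l] _] := ev2 lam.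
pose glue (f g: R -> R) t := if t <= lam then f t else g t.
pose c (i: 'I_3) := tri (glue p1 p2) (glue q1 (fun=> 0)) (glue (fun=> 0) q2) i.
pose c' (i: 'I_3) := tri (glue p1' p2') (glue q1' (fun=> 0)) (glue (fun=> 0) q2') i.
pose T (i: 'I_3) (x: borel Omega) : M := tri 1%:M (T1 x) (T2 x) i.
have mr := hasdens_meas hr; have pr x := hasdens_psd x hr.
have mT i: mxmfun (T i).
 by rewrite /T /tri; case: (val i) => [|[|?]] //; exact: mxm_cst.
have hT i x: (T i x) ^t* = T i x.
 by rewrite /T /tri; case: (val i) => [|[|?]]; [exact: ctr1|exact: psd_herm|exact: psd_herm].
have iT i: intg mu setT (fun x => tr_re (T i x *m r x *m T i x)).
 rewrite /T /tri; case: (val i) => [|[|?]].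
 - by under eq_fun do rewrite mul1mx mulmx1; exact: hasdens_tr_intg hr.
 - exact: hasdens_tr_intg hA1.
 - exact: hasdens_tr_intg hB2.
have lam01: 0 < lam < 1 by rewrite lam0.
have lc i: lipd lam (c i) (c' i).
 have zz := lipd_cst lam 0.
 rewrite /c /c' /tri; case: (val i) => [|[|?]]; apply: lipd_glue => //.
 - exact: (l1 lam).1.
 - exact: (l2 lam).1.
 - by rewrite p1l p2l.
 - exact: (l1 lam).2.
 - exact: (l2 lam).2.
have mg (f g: R -> R) : mfun f -> mfun g -> mfun (glue f g).
 move=> mf mg; apply: measurable_fun_ifT => //.
 exact: (measurable_fun_ler (@measurable_id _ _ _) (measurable_cst lam)).
have mz: mfun (fun _: R => 0 : R) by exact: measurable_cst.
have mc i: mfun (c i).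
 by rewrite /c /tri; case: (val i) => [|[|?]]; exact: mg.
have mc' i: mfun (c' i).
 by rewrite /c' /tri; case: (val i) => [|[|?]]; exact: mg.
have cE (f1 f2 f3 f4: R -> R) t x :
  comb T ((fun i => tri (glue f1 f2) (glue f3 (fun=> 0)) (glue (fun=> 0) f4) i)^~ t) x =
  if t <= lam then f1 t *c 1%:M + f3 t *c T1 x else f2 t *c 1%:M + f4 t *c T2 x.
 by rewrite comb3 /tri /glue /=; case: ifP => _; rewrite rmorph0 scale0r addr0.
have n1 t: 0 <= t <= 1 -> \int[mu]_x tr_re (comb T (c^~ t) x *m r x *m comb T (c^~ t) x) = 1.
 move=> _; under eq_Rintegral => x _ do rewrite -(frob_sq _ (comb_herm hT _ _)) cE.
 case: (t <= lam); first by rewrite (affine_norm hr hA1 mT1 pT1 _ _ u1).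
 by rewrite (affine_norm hr hB2 mT2 pT2 _ _ u2).
have reg t x: 0 < t < 1 -> t != lam -> comb T (c^~ t) x \in unitmx /\
  comb T (c^~ t) x *m comb T (c'^~ t) x = comb T (c'^~ t) x *m comb T (c^~ t) x.
 move=> /andP[t0 t1] tl; rewrite !cE; case: ifPn => [tl1|]; last rewrite -ltNge => tl1.
  have [_ _ []] := ev1 t; last by move=> x0 y0; split; [exact: affine_coercive|exact: affine_commute].
  by rewrite add0r mulr_gt0 ?invr_gt0 //= mulrC ler_pdivrMr // mul1r.
 have [_ _ []] := ev2 t; last by move=> x0 y0; split; [exact: affine_coercive|exact: affine_commute].
 have ->: (1 - lam)^-1 + - (1 - lam)^-1 * t = (1 - t) / (1 - lam) by ring.
 by rewrite divr_gt0 ?subr_gt0 //= ler_pdivrMr // mul1r; lra.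
have speed t: 0 < t < 1 -> t != lam ->
  \int[mu]_x frob (r x *m comb T (c'^~ t) x) (comb T (c'^~ t) x) <= L ^+ 2.
 move=> _ _; under eq_Rintegral => x _ do rewrite cE.
 have sq (x: R) : 0 <= x -> x <= L -> x ^+ 2 <= L ^+ 2 by move=> x0 xL; rewrite ler_pXn2r // nnegrE ltW.
 case: (t <= lam).
  rewrite (affine_norm hr hA1 mT1 pT1 _ _ u1) sp1; apply: sq.
  by rewrite mulr_ge0 ?invr_ge0 ?(ltW lam0).
  by rewrite mulrC ler_pdivrMr // mulrC eL; lra.
 rewrite (affine_norm hr hB2 mT2 pT2 _ _ u2) sp2 mulNr sqrrN; apply: sq.
  by rewrite mulr_ge0 ?invr_ge0 ?(ltW lam').
 by rewrite mulrC ler_pdivrMr // mulrC eL'; lra.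
have := @dFR_bridge R d Omega mu r 'I_3 T mr pr mT hT iT lam c c' (L ^+ 2) lc (sqr_ge0 L) mc mc' n1 reg speed A B.
have ->: Num.sqrt (4 * L ^+ 2) = 2 * L.
 have ->: 4 * L ^+ 2 = (2 * L) ^+ 2 by ring.
 by rewrite sqrtr_sqr ger0_norm // mulr_ge0 // ltW.
apply.
 have z1: 0 + lam^-1 * 0 = 0 by rewrite mulr0 addr0.
 have [/(_ z1) [p0 q0] _ _] := ev1 0.
 by under eq_fun do rewrite cE (ltW lam0) p0 q0 rmorph0 rmorph1 scale0r scale1r add0r.
have z2: (1 - lam)^-1 + - (1 - lam)^-1 * 1 = 0 by rewrite mulr1 subrr.
have [/(_ z2) [p0 q0] _ _] := ev2 1.
by under eq_fun do rewrite cE leNgt lam1 p0 q0 rmorph0 rmorph1 scale0r scale1r add0r.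
Qed.
End two_arcs.

(** * Continuity estimates for the arccosine *)

Section acos_perturbation.
Context {R : realType}.
Lemma acos_anti (x y: R): 0 <= x <= 1 -> 0 <= y <= 1 -> x <= y -> acos y <= acos x.
move=> x01 y01 xy; have /andP[h1 h2] := acos_pihalf x01; apply: acos_le => //.
 by rewrite h1 (le_trans h2) // ler_pdivrMr // ler_peMr ?pi_ge0 // ler1n.
by rewrite acosK // in_itv /=; lra.
Qed.
Lemma acos_ge (v y: R): 0 <= v <= pi -> 0 <= y <= 1 -> y <= cos v -> v <= acos y.
move=> v0 y01 yv; have /andP[h1 h2] := acos_pihalf y01; rewrite leNgt; apply/negP => lt.
have := ltr_cos (x := acos y) (y := v); rewrite !in_itv /= h1 v0.
rewrite (le_trans (ltW lt)) ?(andP v0).2 // => /(_ isT isT); rewrite lt acosK; last by rewrite in_itv /=; lra.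
by rewrite ltNge yv.
Qed.
(** The arccosine is not Lipschitz at 1, so the tolerance is taken from the strict decrease of the
    cosine between [acos x] and [acos x + m], with [m] capped to remain below [pi]. *)
Lemma acos_scale (x n: R): 0 <= x <= 1 -> 0 < n -> exists2 e: R, 0 < e &
 forall t y, 0 <= t -> t <= e -> 0 <= y <= 1 -> (1 - t) * x <= y -> acos y <= acos x + n.
move=> x01 n0; have /andP[h1 h2] := acos_pihalf x01.
have pi2: (pi: R) / 2 + pi / 2 = pi by field.
have [m [m0 mn mp]]: exists m, [/\ 0 < m, m <= n & m <= (pi: R) / 2].
 exists (Num.min n (pi / 2)); rewrite lt_min n0 ge_min lexx ge_min lexx orbT divr_gt0 //; exact: pi_gt0.
have := ltr_cos (x := acos x) (y := acos x + m); rewrite !in_itv /= => /(_ _ _).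
move=> /(_ ltac:(apply/andP; split; lra) ltac:(apply/andP; split; lra)); rewrite ltrDl m0 acosK; last by rewrite in_itv /=; lra.
move=> lt; exists (x - cos (acos x + m)); first by rewrite subr_gt0.
move=> t y t0 te y01 ty; apply: le_trans (_: acos x + m <= _); last by rewrite lerD2l.
apply: acos_le => //; first by apply/andP; split; lra.
by move: ty te; rewrite mulrBl mul1r; have : t * x <= t; [rewrite ler_piMr //; lra|lra].
Qed.
Lemma acos_usc (x n: R): 0 <= x <= 1 -> 0 < n -> exists2 e: R, 0 < e &
 forall y, 0 <= y <= 1 -> y <= x + e -> acos x <= acos y + n.
move=> x01 n0; have /andP[h1 h2] := acos_pihalf x01; have pi0 := pi_gt0 R.
have [le|lt] := leP (acos x) n.
 by exists 1 => // y y01 _; have /andP[h3 h4] := acos_pihalf y01; lra.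
have := ltr_cos (x := acos x - n) (y := acos x); rewrite !in_itv /=.
move=> /(_ ltac:(apply/andP; split; lra) ltac:(apply/andP; split; lra)).
rewrite ltrBlDr ltrDl n0 acosK; last by rewrite in_itv /=; lra.
move=> cl; exists (cos (acos x - n) - x); first by rewrite subr_gt0.
move=> y y01 ye; rewrite -lerBlDr; apply: acos_ge => //; first by apply/andP; split; lra.
lra.
Qed.
(** With [v] half the angle, [1 - x = 2 sin(v)^2], while [sin v >= v cos v] and
    [cos(v)^2 >= 1/2]. *)
Lemma acos_sqr_le (x: R): 0 <= x <= 1 -> acos x ^+ 2 <= 4 * (1 - x).
move=> x01; have /andP[h1 h2] := acos_pihalf x01; have pi0 := pi_gt0 R.
have cx: cos (acos x) = x by rewrite acosK // in_itv /=; lra.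
move: (acos x) h1 h2 cx => w w0 wp cx; pose v := w / 2.
have wE: w = v *+ 2 by rewrite /v mulr2n; field.
clearbody v; have v0: 0 <= v by rewrite mulr2n in wE; lra.
have vp: v <= pi / 4 by rewrite mulr2n in wE; lra.
have c2: cos w = cos v ^+ 2 *+ 2 - 1 by rewrite wE cos_mulr2n.
have [c /andP[c0 cv]] := mean_value v0 (fun x _ => is_derive_sin x).
rewrite sin0 !subr0 => sv.
have cc: cos v <= cos c.
 have := ltr_cos (x := v) (y := c); rewrite !in_itv /= [cos v <= _]leNgt.
 by move=> ->; rewrite -?leNgt //; apply/andP; split; lra.
have cv0: 0 <= cos v by apply: cos_ge0_pihalf; lra.
have s2 := sin2cos2 v.
have h: v ^+ 2 * cos v ^+ 2 <= sin v ^+ 2.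
 rewrite sv exprMn mulrC; apply: ler_wpM2r; first exact: sqr_ge0.
 by rewrite ler_pXn2r // nnegrE; lra.
have c3: 1 / 2 <= cos v ^+ 2 by rewrite -cx c2 mulr2n in x01; lra.
have h3: v ^+ 2 * (1 / 2) <= v ^+ 2 * cos v ^+ 2 by apply: ler_wpM2l => //; exact: sqr_ge0.
have ->: w ^+ 2 = 4 * v ^+ 2 by rewrite wE mulr2n; ring.
by rewrite -cx c2 mulr2n; lra.
Qed.
End acos_perturbation.

(** * The distance as an angle *)

Section distance.
Context {R : realType} {d : nat} {Omega : ptopologicalType}.
Local Notation M := 'M[R[i]]_d.
Variable dist : Omega -> Omega -> R.
Hypothesis dM : metrizes dist.
Hypothesis d0 : (0 < d)%N.
Implicit Types A B C G H : prob R d Omega.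
Lemma pairing_eq (G H: psd_measure R d Omega) (Psi: Omega -> M): eq_measure G H -> CbH Psi ->
 pairing G Psi = pairing H Psi.
move=> e cP; have [g hg] := prob_dens G.
by rewrite (pairing_dens hg (CbH_meas cP)) (pairing_dens (hasdens_eq e hg) (CbH_meas cP)).
Qed.
Lemma fid01 A B: 0 <= fid A B <= 1. Proof. by rewrite fid_ge0 fid_le1. Qed.
Lemma fid_refl A: fid A A = 1.
apply/eqP; rewrite eq_le fid_le1 /=; have [r hr] := prob_dens A.
have h1: hasdens (trace_measure A) (fun x => 1%:M *m r x *m 1%:M) A by under eq_fun do rewrite mul1mx mulmx1.
have := fid_ge_cross (hasdens_meas hr) (fun x => hasdens_psd x hr) (mxm_cst setT 1%:M) (mxm_cst setT 1%:M)
  (fun x => ctr1) (fun x => ctr1) h1 h1; rewrite -{1}(prob_tr hr); congr (_ <= _).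
by apply: eq_Rintegral => x _; rewrite mulmx1 frobC frob1l.
Qed.
Lemma fid_mix_l t A B C: 0 <= t <= 1 -> (1 - t) * fid A B <= fid (mix t A C) B.
move=> t01; have h: (1 - t) * fid A B + t * fid C B <= fid (mix t A C) B.
 by apply: fid_mix => // P cP; [exact: pairing_mix|rewrite -mulrDl subrK mul1r].
by apply: le_trans h; rewrite lerDl mulr_ge0 ?fid_ge0 //; lra.
Qed.
Lemma dominating A B C: exists D: prob R d Omega, [/\ trace_measure A `<< trace_measure D,
 trace_measure B `<< trace_measure D & trace_measure C `<< trace_measure D].
have h: 0 < (2^-1 : R) < 1 by lra.
exists (mix 2^-1 (mix 2^-1 A B) C); have [h1 h2] := mix_dom (mix 2^-1 A B) C h.
have [h3 h4] := mix_dom A B h.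
by split => //; [exact: null_dominates_trans h3 h1|exact: null_dominates_trans h4 h1].
Qed.
Lemma perturb_dens (mu: finmeas R Omega) A (U: prob R d Omega) a t: 0 < t <= 1 ->
 hasdens mu a A -> hasdens mu (fun=> d%:R^-1 *c (1%:M : M)) U ->
 hasdens mu (fun x => (1 - t) *c a x + t *c (d%:R^-1 *c (1%:M : M))) (mix t A U) /\
 forall x, (1 - t) *c a x + t *c (d%:R^-1 *c (1%:M : M)) \in unitmx.
move=> /andP[t0 t1] ha hU; split; first by apply: hasdens_mix => //; rewrite ltW.
move=> x; have e0: 0 < t / d%:R :> R by rewrite divr_gt0 // ltr0n.
apply: (coercive_unit _ e0); rewrite (_: _ - _ = (1 - t) *c a x).
 by apply: psdZ; [rewrite subr_ge0|exact: hasdens_psd ha].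
by rewrite scalerA -rmorphM addrK.
Qed.
Definition ang A B: R := 2 * acos (fid A B).
(** The dual bound with [w] the angle. Fidelity 1 is excluded because [w > 0] is needed; the bound
    is trivial there. *)
Lemma ang_le (w: R) A B: fid A B < 1 -> w = acos (fid A B) -> ((2 * w)%:E <= dFR A B)%E.
move=> f1 wE; have f01 := fid01 A B; have /andP[h1 h2] := acos_pihalf f01; have pi0 := pi_gt0 R.
have w0: 0 < w by rewrite wE; apply: acos_gt0; lra.
have wp: w <= pi / 2 by rewrite wE.
have cw: cos w = fid A B by rewrite wE acosK // in_itv /=; lra.
have s0: 0 < sin w by apply: sin_gt0_pi; lra.
have ->: (2 * w)%:E = sqrte ((2 * w) ^+ 2)%:E by rewrite /= sqrtr_sqr ger0_norm //; lra.
rewrite /dFR; set S := ereal_inf _; have key: (((2 * w) ^+ 2)%:E <= S)%E.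
 apply: le_ereal_inf_tmp => _ [G [U [e0 e1 L2 we ->]]]; apply/lee_addgt0Pr => e ep.
 (* The dual bound contains [half] with the factor [8 w / sin w], which fixes the accuracy asked of
    [P]. *)
 have k0: 0 < 8 * w / sin w by rewrite divr_gt0 // mulr_gt0.
 have ek: 0 < e / (8 * w / sin w) by rewrite divr_gt0.
 have [P pP hP] := fid_approx A B ek; have [cP [c c0 pc] [K PK]] := pP.
 have := dual_action dM w0 wp c0 cP pc PK L2 we.
 rewrite (pairing_eq e0 (posfield_CbH pP)) (pairing_eq e1 (posfield_CbH (posfield_inv pP))) => h.
 rewrite addeC -leeBlDl //; apply: le_trans h; rewrite -EFinB lee_fin.
 move: hP; rewrite /half; set x := pairing A P; set y := pairing B _ => hP.
 have : (8 * w / sin w) * (2^-1 * (x + y)) <= (8 * w / sin w) * (fid A B) + e.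
  rewrite (_: _ + e = (8 * w / sin w) * (fid A B + e / (8 * w / sin w))); last by field; rewrite ?gt_eqF.
  by apply: ler_wpM2l; exact: ltW.
 have ->: 8 * w / sin w * (2^-1 * (x + y)) = 4 * w / sin w * (x + y) by field; rewrite gt_eqF.
 have ->: 8 * w / sin w * fid A B = 4 * w / sin w * (2 * cos w) by rewrite cw; field; rewrite gt_eqF.
 have ->: (2 * w) ^+ 2 = 4 * w ^+ 2 by ring.
 have ->: 4 * w / sin w * (2 * cos w - y - x) = 4 * w / sin w * (2 * cos w) - 4 * w / sin w * (x + y) by ring.
 move: (4 * w / sin w * (2 * cos w)) (4 * w / sin w * (x + y)) => p q; lra.
by rewrite lee_sqrt //; apply: le_trans key; rewrite lee_fin sqr_ge0.
Qed.
(** For the upper bound the intermediate measure is [A] mixed with a little of a uniform density.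
    Concavity bounds its fidelity with [B] from below by [(1 - t)] times that of [A], and its
    fidelity with [A] by [1 - t], so the detour is short. Four errors of [n/8], doubled, make
    [n]. *)
Lemma dFR_ang A B: dFR A B = (ang A B)%:E.
have f01 := fid01 A B; apply/eqP; rewrite eq_le; apply/andP; split; last first.
 have [f1|f1] := ltP (fid A B) 1; first exact: ang_le.
 have ->: ang A B = 0 by rewrite /ang (_: fid A B = 1) ?acos1 ?mulr0 //; lra.
 exact: sqrte_ge0.
apply/lee_addgt0Pr => n n0; have n8: 0 < n / 8 by rewrite divr_gt0.
have [e1 e10 h1] := acos_scale f01 n8; have [e2 e20 h2] := acos_scale (fid01 A A) n8.
pose t := Num.min (Num.min e1 e2) 1.
have t0: 0 < t by rewrite !lt_min e10 e20 ltr01.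
have [t1 [te1 te2]]: t <= 1 /\ t <= e1 /\ t <= e2 by rewrite /t !ge_min !lexx !orbT.
have [D [dA dB _]] := dominating A B A; have [U hU] := uniform_exists d0 D.
have [a ha] := hasdens_exists dA; have [b hb] := hasdens_exists dB.
have t01: 0 < t <= 1 by rewrite t0.
have [hr ur] := perturb_dens t01 ha hU.
have t01': 0 <= t <= 1 by rewrite ltW.
have := dFR_two_arcs dM hr ur ha hb n8; move=> h; apply: le_trans h _.
rewrite -EFinD lee_fin /ang.
have := h1 t _ (ltW t0) te1 (fid01 (mix t A U) B) (fid_mix_l A B U t01').
have := h2 t _ (ltW t0) te2 (fid01 (mix t A U) A) (fid_mix_l A A U t01').
rewrite fid_refl acos1; lra.
Qed.
Lemma ang_ge0 A B: 0 <= ang A B.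
by have /andP[h _] := acos_pihalf (fid01 A B); rewrite mulr_ge0. Qed.
Lemma ang_le_pi A B: ang A B <= pi.
by have /andP[_ h] := acos_pihalf (fid01 A B); rewrite /ang; lra. Qed.
Lemma ang_refl A: ang A A = 0. Proof. by rewrite /ang fid_refl acos1 mulr0. Qed.
Lemma ang_sym A B: ang A B = ang B A. Proof. by rewrite /ang fid_sym. Qed.
Lemma ang_triangle A B C: ang A C <= ang A B + ang B C.
have ->: ang A B = ang B A by exact: ang_sym.
rewrite /ang -mulrDr ler_pM2l //; apply/ler_addgt0Pr => n n0; have n2: 0 < n / 2 by rewrite divr_gt0.
have [e1 e10 h1] := acos_scale (fid01 B A) n2; have [e2 e20 h2] := acos_scale (fid01 B C) n2.
pose t := Num.min (Num.min e1 e2) 1.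
have t0: 0 < t by rewrite !lt_min e10 e20 ltr01.
have [t1 [te1 te2]]: t <= 1 /\ t <= e1 /\ t <= e2 by rewrite /t !ge_min !lexx !orbT.
have [D [dA dB dC']] := dominating A B C; have [U hU] := uniform_exists d0 D.
have [a ha] := hasdens_exists dA; have [b hb] := hasdens_exists dB; have [c hc] := hasdens_exists dC'.
have t01: 0 < t <= 1 by rewrite t0.
have [hr ur] := perturb_dens t01 hb hU.
have t01': 0 <= t <= 1 by rewrite ltW.
have := ang_triangle_unit dM hr ur ha hc.
have := h1 t _ (ltW t0) te1 (fid01 (mix t B U) A) (fid_mix_l B A U t01').
have := h2 t _ (ltW t0) te2 (fid01 (mix t B U) C) (fid_mix_l B C U t01').
lra.
Qed.
(** By joint concavity the fidelity of the mixtures is at least [(1 - t) fid A B + t], which is at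
    least [fid A B]. *)
Lemma ang_mix t A B C: 0 <= t <= 1 -> ang (mix t A C) (mix t B C) <= ang A B.
move=> t01; rewrite /ang ler_pM2l //; apply: acos_anti; rewrite ?fid01 //.
have h: (1 - t) * fid A B + t * fid C C <= fid (mix t A C) (mix t B C).
 by apply: fid_mix => // P cP; exact: pairing_mix.
apply: le_trans h; rewrite fid_refl mulr1.
have := fid_le1 A B; have /andP[t0 _] := t01; move=> f1.
have : t * fid A B <= t by rewrite ler_piMr.
lra.
Qed.
Lemma ang_sqr_le A B: ang A B ^+ 2 <= 16 * (1 - fid A B).
by have := acos_sqr_le (fid01 A B); rewrite /ang exprMn; lra. Qed.
Lemma ang_lsc (Gn Hn: nat -> prob R d Omega) G H n: 0 < n ->
 (forall P, CbH P -> (fun k => pairing (Gn k) P) @ \oo --> pairing G P) ->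
 (forall P, CbH P -> (fun k => pairing (Hn k) P) @ \oo --> pairing H P) ->
 \forall k \near \oo, ang G H <= ang (Gn k) (Hn k) + n.
move=> n0 cG cH; have n2: 0 < n / 2 by rewrite divr_gt0.
have [e e0 h] := acos_usc (fid01 G H) n2.
apply: filterS (fid_usc e0 cG cH) => k lt; have := h _ (fid01 (Gn k) (Hn k)) (ltW lt).
rewrite /ang; lra.
Qed.
End distance.

Section liminf_frequently.
Context {R : realType}.
Implicit Types (u: (\bar R)^nat).
Lemma limn_einf_frequently u c N: (limn_einf u < c)%E -> exists2 n, (N <= n)%N & (u n < c)%E.
move=> lt; apply: contrapT => h; move: lt; rewrite ltNge => /negP; apply.
rewrite limn_einf_lim; apply: lime_ge; first exact: is_cvg_einfs.
near=> k; apply: le_ereal_inf_tmp => _ [n /= kn <-]; rewrite leNgt; apply/negP => un.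
by apply: h; exists n => //; apply: leq_trans kn; near: k; exact: nbhs_infty_ge.
Unshelve. all: by end_near. Qed.
Lemma limn_esup_eventually u c: (\forall n \near \oo, (u n <= c)%E) -> (limn_esup u <= c)%E.
move=> [N _ h]; rewrite limn_esup_lim; apply: lime_le; first exact: is_cvg_esups.
near=> k; apply: ge_ereal_sup => _ [n /= kn <-]; apply: h => /=; apply: leq_trans kn.
by near: k; exact: nbhs_infty_ge.
Unshelve. all: by end_near. Qed.
End liminf_frequently.

(** * Kinetic energy as the integral of a minimal density *)

Section kinetic_energy.
Context {R : realType} {d : nat} {Omega : ptopologicalType}.
Local Notation M := 'M[R[i]]_d.
Local Notation mu := (@lebesgue_measure R).
Local Notation intg D f := (mu.-integrable D (EFin \o f)).
Variable dist : Omega -> Omega -> R.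
Hypothesis dM : metrizes dist.
Hypothesis d0 : (0 < d)%N.
Local Notation dFRE := (dFR_ang dM d0).
(** Absolute continuity in real terms: the distance is the finite number [ang], and the dominating
    function lives on the whole line. *)
Definition controlled (G: curve R d Omega) (q: R -> R) := L2fun q /\
 forall s t: R, 0 <= s -> s <= t -> t <= 1 -> ang (G s) (G t) <= iint q s t.
Lemma controlled_AC2 G q: controlled G q -> AC2 dFR G.
move=> [Lq h]; have [mq q0 qs iqq] := Lq; have iq := L2fun_intg Lq; exists q; split.
- by move=> t _; exact: q0.
- exact: measurable_funTS.
- apply: le_lt_trans (_: _ <= \int[mu]_t (q t * q t)%:E)%E _; last by move/integrableP: iqq => [_]; under eq_integral do rewrite gee0_abs ?lee_fin ?mulr_ge0 //.
 under eq_integral do rewrite expr2.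
 apply: ge0_subset_integral => //; first by apply/mEFinP; exact: measurable_funM.
 by move=> t _; rewrite lee_fin mulr_ge0.
- move=> s t s0 st t1; rewrite dFRE -(@EFin_Rintegral _ _ (measurableTypeR R) mu _ _ (measurable_itv `[s, t]) (intg_itv `[s, t] iq)) lee_fin iint_cc //.
 exact: h.
Qed.
Lemma AC2_controlled (G: curve R d Omega): AC2 dFR G -> exists q, controlled G q.
move=> [eta [e0 me ie h]]; pose q := eta \_ (`]0, 1]%classic : set R).
have mI01: measurable (`]0, 1]%classic : set (measurableTypeR R)) := mI 0 1.
have qE t: 0 < t <= 1 -> q t = eta t by move=> t01; rewrite /q patchE mem_set //= in_itv.
have qN t: ~~ (0 < t <= 1) -> q t = 0.
 by move=> t01; rewrite /q patchE memNset //= in_itv /=; exact/negP.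
have q0 t: 0 <= q t.
 by case: (boolP (0 < t <= 1)) => [t01|/qN -> //]; rewrite qE // e0 // in_itv /=; lra.
have sub: (`]0, 1]%classic : set R) `<=` `[0, 1]%classic.
 by move=> t /=; rewrite !in_itv /= => /andP[a b]; rewrite ltW.
have me': measurable_fun (`]0, 1]%classic : set R) eta by apply: measurable_funS me.
have mq: mfun q by exact: (measurable_restrictT eta mI01).1 me'.
have Lq: L2fun q.
 split=> //; apply/integrableP; split; first by apply/mEFinP; exact: measurable_funM.
 apply: le_lt_trans ie; under eq_integral do rewrite gee0_abs ?lee_fin ?mulr_ge0 //.
 rewrite [leRHS]integral_mkcond; apply: le_integral_any => t _; rewrite patchE.
 case: (boolP (0 < t <= 1)) => t01.
  by rewrite /= qE // mem_set //=; apply: sub; rewrite /= in_itv.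
 by rewrite /= qN // mulr0; case: ifP => // _; rewrite lee_fin sqr_ge0.
exists q; split=> // s t s0 st t1; have iq := L2fun_intg Lq.
rewrite -lee_fin -dFRE; apply: le_trans (h s t s0 st t1) _.
rewrite -iint_cc // (@EFin_Rintegral _ _ (measurableTypeR R) mu _ _ (measurable_itv `[s, t]) (intg_itv `[s, t] iq)).
rewrite (@ae_eq_integral_any _ _ _ mu _ _ (fun x => (q x)%:E)) //.
 by apply/mEFinP; exact: measurable_funTS.
apply: filterS (ae_neq (0: R)) => x x0; rewrite /= in_itv /= => /andP[sx xt].
by rewrite qE // (le_trans xt t1) andbT lt_neqAle eq_sym x0 (le_trans s0 sx).
Qed.
(** The metric speed exists almost everywhere and is itself a controlling density; it lies below any
    other one at every time where the integral of the latter is differentiable. *)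
Lemma controlled_kinetic G q: controlled G q -> exists m, [/\ controlled G m,
 kinetic G = (2^-1 * \int[mu]_t (m t * m t))%:E &
 forall q', controlled G q' -> \int[mu]_t (m t * m t) <= \int[mu]_t (q' t * q' t)].
move=> cq; have [Lq h] := cq; pose D s t := ang (G s) (G t).
have [m [Lm hm dm]] := @metric_speed_density R D
 (fun s t u => ang_triangle dM d0 (G s) (G t) (G u))
 (fun s t => ang_sym (G s) (G t)) q Lq h.
have [mm m0 ms imm] := Lm.
have n01: {ae mu, forall x: R, x != 0 /\ x != 1}.
 by move: (ae_neq (0: R)) (ae_neq (1: R)); apply: filterS2.
have m2: mfun (fun t => m t * m t) by exact: measurable_funM.
exists m; split; first by split.
 rewrite /kinetic (asboolT (controlled_AC2 cq)) EFinM; congr (_ * _)%E.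
 rewrite (@EFin_Rintegral _ _ _ _ setT _ mtop imm).
 transitivity (\int[mu]_(t in `[0%R, 1%R]) (m t * m t)%:E)%E; last first.
  have E: ((fun t => (m t * m t)%:E) \_ (`[0, 1]%classic : set R)) = (fun t => (m t * m t)%:E).
  apply/funext => t; rewrite patchE; case: ifPn => //.
  rewrite notin_setE /= in_itv /= => /negP t01; rewrite ms ?mulr0 //.
  by apply: contra t01 => /andP[a b]; rewrite ltW.
  by rewrite -[in RHS]E; exact: integral_mkcond.
 apply: ae_eq_integral_any => //; first by apply/mEFinP; exact: measurable_funTS.
 move: dm n01; apply: filterS2 => t dm [t0 t1]; rewrite /= in_itv /= => /andP[ht0 ht1].
 have t01: 0 < t < 1 by rewrite !lt_neqAle eq_sym t0 ht0 t1.
 have ->: metric_speed dFR G t = (m t)%:E; last by [].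
 apply/cvg_lim => //; have := dm t01; move=> c.
 have E: (fun e: R => dFR (G t) (G (t + e)%R) * (`|e|^-1)%:E)%E = EFin \o (fun e => D t (t + e) * `|e|^-1).
  by apply/funext => e; rewrite dFRE -EFinM.
 by rewrite E; apply: cvg_EFin => //; exact: nearW.
move=> q' [Lq' hq']; have [mq' q0' _ iqq'] := Lq'; have iq' := L2fun_intg Lq'.
rewrite -lee_fin !(@EFin_Rintegral _ _ _ _ setT _ mtop) //.
apply: ae_ge0_le_integral => //.
- by move=> t _; rewrite lee_fin mulr_ge0.
- exact/mEFinP.
- by move=> t _; rewrite lee_fin mulr_ge0.
- by apply/mEFinP; exact: measurable_funM.
move: dm n01 (iint_derive_ae iq'); apply: filterS3 => t dm [t0 t1] dq _; rewrite lee_fin.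
case: (boolP (0 < t <= 1)) => [/andP[ht0 ht1]|/ms ->]; last by rewrite mulr0 mulr_ge0.
have t1': t < 1 by rewrite lt_neqAle t1.
have c1 := dm (introT andP (conj ht0 t1')); have c2 := dq ht0.
have pt (e: R) : e != 0 -> 0 < t + e < 1 ->
  D t (t + e) * `|e|^-1 <= e^-1 * (iint q' 0 (t + e) - iint q' 0 t).
 move=> e0 /andP[te0 te1]; rewrite ler_pdivrMr ?normr_gt0 //; case: (ltrgtP e 0) e0 => // es _.
  rewrite (ltr0_norm es); have ->: e^-1 * (iint q' 0 (t + e) - iint q' 0 t) * - e =
  iint q' 0 t - iint q' 0 (t + e) by field; rewrite lt_eqF.
  have ->: iint q' 0 t - iint q' 0 (t + e) = iint q' (t + e) t by apply: iint_neg => //; lra.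
  by rewrite /D ang_sym; apply: hq'; lra.
 rewrite (gtr0_norm es); have ->: e^-1 * (iint q' 0 (t + e) - iint q' 0 t) * e =
  iint q' 0 (t + e) - iint q' 0 t by field; rewrite gt_eqF.
 have ->: iint q' 0 (t + e) - iint q' 0 t = iint q' t (t + e) by apply: iint_neg => //; lra.
 by apply: hq'; lra.
have le: m t <= q' t.
 rewrite -(cvg_lim _ c1) // -(cvg_lim _ c2) //; apply: ler_lim.
 - by apply/cvg_ex; eexists; exact: c1.
 - by apply/cvg_ex; eexists; exact: c2.
 have hd := iint_deriv_near q' ht0 t1'; near=> e; apply: pt.
 - by near: e; exact: nbhs_dnbhs_neq.
 - by near: e.
by rewrite ler_pM.
Unshelve. all: by end_near. Qed.
Lemma kinetic_ge0 (G: curve R d Omega): (0 <= kinetic G)%E.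
rewrite /kinetic; case: ifP => // _; rewrite mule_ge0 ?lee_fin //; apply: integral_ge0 => t _.
by rewrite expe2 ?sqre_ge0.
Qed.
Lemma kinetic_le_controlled G q: controlled G q -> (kinetic G <= (2^-1 * \int[mu]_t (q t * q t))%:E)%E.
by move=> cq; have [m [cm -> h]] := controlled_kinetic cq; rewrite lee_fin ler_pM2l //; exact: h.
Qed.
Lemma kinetic_lt_controlled G c: (kinetic G <= c%:E)%E -> exists2 m, controlled G m &
 \int[mu]_t (m t * m t) <= 2 * c /\ kinetic G = (2^-1 * \int[mu]_t (m t * m t))%:E.
move=> h; have ac: AC2 dFR G.
 by apply: contrapT => n; move: h; rewrite /kinetic asboolF.
have [q cq] := AC2_controlled ac; have [m [cm e _]] := controlled_kinetic cq.
by exists m => //; split => //; move: h; rewrite e lee_fin; lra.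
Qed.
End kinetic_energy.

(** * Lower semicontinuity of the kinetic energy *)

Section lower_bound.
Context {R : realType} {d : nat} {Omega : ptopologicalType}.
Local Notation M := 'M[R[i]]_d.
Local Notation mu := (@lebesgue_measure R).
Local Notation intg D f := (mu.-integrable D (EFin \o f)).
Variable dist : Omega -> Omega -> R.
Hypothesis dM : metrizes dist.
Hypothesis d0 : (0 < d)%N.
(** Angles are at most [pi], so an additive error passes to squares with a uniform constant. *)
Lemma sqr_perturb (a b n: R): 0 <= a -> 0 <= b -> b <= pi -> 0 < n -> n <= 1 ->
 a <= b + n -> a ^+ 2 <= b ^+ 2 + n * (2 * pi + 1).
move=> a0 b0 bp n0 n1 h; have p0 := pi_gt0 R.
have h1: a ^+ 2 <= (b + n) ^+ 2 by rewrite ler_pXn2r // nnegrE //; lra.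
apply: le_trans h1 _; rewrite sqrrD -addrA lerD2l mulr2n.
have h2: b * n <= pi * n by rewrite ler_wpM2r // ltW.
have h3: n ^+ 2 <= n by rewrite expr2 ler_piMr // ltW.
lra.
Qed.
Lemma controlled_sqr (G: curve R d Omega) m c s t: controlled G m -> \int[mu]_x (m x * m x) <= c ->
 0 <= s -> s <= t -> t <= 1 -> ang (G s) (G t) ^+ 2 <= (t - s) * iint (fun x => m x * m x) s t /\
 (t - s) * iint (fun x => m x * m x) s t <= c * (t - s).
move=> [Lm h] mc s0 st t1; have [mm m0 ms imm] := Lm; have im := L2fun_intg Lm; split.
 apply: le_trans (iint_CS st im imm); rewrite ler_pXn2r ?nnegrE ?ang_ge0 //; first exact: h.
 by apply: iint_ge0.
rewrite mulrC; apply: ler_wpM2r; first by rewrite subr_ge0.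
by apply: le_trans mc; apply: le_iint_total => // x; rewrite mulr_ge0.
Qed.
Lemma controlled_grid (G: curve R d Omega) m c n: controlled G m -> \int[mu]_x (m x * m x) <= c ->
 (0 < n)%N -> \sum_(k < n) n%:R * ang (G (gp n k)) (G (gp n k.+1)) ^+ 2 <= c.
move=> cm mc n0; have [Lm h] := cm; have [mm m0 ms imm] := Lm.
have nR: 0 < n%:R :> R by rewrite ltr0n.
apply: (@le_trans _ _ (\sum_(k < n) iint (fun x => m x * m x) (gp n k) (gp n k.+1))).
 apply: ler_sum => k _; have a0: 0 <= gp n k :> R := gp_ge0 n k.
 have b1: gp n k.+1 <= 1 :> R := gp_le1 n0 (ltn_ord k).
 have [] := controlled_sqr cm mc a0 (gp_le n (leqnSn k)) b1; rewrite gpB => le1 _.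
 by rewrite mulrC -ler_pdivlMr // mulrC.
rewrite iint_grid //; apply: le_trans mc; apply: le_iint_total => // x.
by rewrite mulr_ge0.
Qed.
(** A dyadic energy involves finitely many times and passes to the limit through [ang_lsc]; bounded
    dyadic energies then produce a controlling density for the limit curve. It is enough that the
    energy bound holds for infinitely many indices. *)
Lemma kinetic_lsc (xn: nat -> curve R d Omega) (x: curve R d Omega) (c: R) :
 (forall t, 0 <= t <= 1 -> forall P, CbH P ->
  (fun n => pairing (xn n t) P) @ \oo --> pairing (x t) P) ->
 (forall N, exists2 n, (N <= n)%N & (kinetic (xn n) <= c%:E)%E) -> (kinetic x <= c%:E)%E.
move=> cv fr; have p0 := pi_gt0 R; have p1: 0 < 2 * (pi: R) + 1 by lra.
have lsc s t n: 0 <= s <= 1 -> 0 <= t <= 1 -> 0 < n ->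
  \forall k \near \oo, ang (x s) (x t) <= ang (xn k s) (xn k t) + n.
 by move=> s01 t01 n0; apply: ang_lsc => //; exact: cv.
have pert n s t k: 0 < n -> n <= 1 -> ang (x s) (x t) <= ang (xn k s) (xn k t) + n ->
  ang (x s) (x t) ^+ 2 <= ang (xn k s) (xn k t) ^+ 2 + n * (2 * pi + 1).
 by move=> n0 n1; apply: sqr_perturb; rewrite ?ang_ge0 ?ang_le_pi.
have DC s t: 0 <= s -> s <= t -> t <= 1 -> ang (x s) (x t) ^+ 2 <= 2 * c * (t - s).
 move=> s0 st t1; apply/ler_addgt0Pr => e e0.
 pose n := Num.min 1 (e / (2 * pi + 1)).
 have n0: 0 < n by rewrite lt_min ltr01 divr_gt0.
 have n1: n <= 1 by rewrite ge_min lexx.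
 have ne: n * (2 * pi + 1) <= e by rewrite -ler_pdivlMr // ge_min lexx orbT.
 have s01: 0 <= s <= 1 by rewrite s0 (le_trans st).
 have t01: 0 <= t <= 1 by rewrite t1 (le_trans s0).
 have [N _ hN] := lsc s t n s01 t01 n0; have [k Nk hk] := fr N.
 have [m cm [mc _]] := kinetic_lt_controlled dM d0 hk.
 have [h1 h2] := controlled_sqr cm mc s0 st t1.
 apply: le_trans (pert n s t k n0 n1 (hN k Nk)) _.
 by apply: lerD ne; exact: le_trans h1 h2.
have DE N: \sum_(k < 2 ^ N) (2 ^ N)%:R * ang (x (gp (2 ^ N) k)) (x (gp (2 ^ N) k.+1)) ^+ 2 <= 2 * c.
 apply/ler_addgt0Pr => e e0; have S0: 0 < (2 ^ N)%:R :> R by rewrite ltr0n exp2_gt0.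
 (* There are [2^N] cells with weight [2^N] each, and each square is perturbed by at most
    [n (2 pi + 1)]; the total error is at most [e]. *)
 pose n := Num.min 1 (e / ((2 * pi + 1) * ((2 ^ N)%:R * (2 ^ N)%:R))).
 have q0: 0 < (2 * pi + 1) * ((2 ^ N)%:R * (2 ^ N)%:R) :> R by rewrite !mulr_gt0.
 have n0: 0 < n by rewrite lt_min ltr01 divr_gt0.
 have n1: n <= 1 by rewrite ge_min lexx.
 have ne: n * ((2 * pi + 1) * ((2 ^ N)%:R * (2 ^ N)%:R)) <= e by rewrite -ler_pdivlMr // ge_min lexx orbT.
 have ev: \forall i \near \oo, forall k: 'I_(2 ^ N),
  ang (x (gp (2 ^ N) k)) (x (gp (2 ^ N) k.+1)) <= ang (xn i (gp (2 ^ N) k)) (xn i (gp (2 ^ N) k.+1)) + n.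
  apply: filter_forall => k; have a0: 0 <= gp (2 ^ N) k :> R := gp_ge0 _ _.
  have b1: gp (2 ^ N) k.+1 <= 1 :> R := gp_le1 (exp2_gt0 N) (ltn_ord k).
  have ab: gp (2 ^ N) k <= gp (2 ^ N) k.+1 :> R := gp_le (2 ^ N) (leqnSn k).
  by apply: lsc => //; [rewrite a0 (le_trans ab)|rewrite b1 (le_trans a0)].
 have [K _ hK] := ev; have [k Kk hk] := fr K.
 have [m cm [mc _]] := kinetic_lt_controlled dM d0 hk.
 apply: le_trans (lerD (controlled_grid cm mc (exp2_gt0 N)) ne).
 have ->: n * ((2 * pi + 1) * ((2 ^ N)%:R * (2 ^ N)%:R)) =
  \sum_(i < 2 ^ N) (2 ^ N)%:R * (n * (2 * pi + 1)).
  by rewrite sumr_const card_ord -[RHS]mulr_natl; ring.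
 rewrite -big_split; apply: ler_sum => i _ /=; rewrite -mulrDr.
 apply: ler_wpM2l; first exact: ltW.
 by apply: pert => //; exact: (hK k Kk i).
have [q [Lq qc Dq _]] := energy_density (fun s t => ang_ge0 (x s) (x t))
 (fun s t u => ang_triangle dM d0 (x s) (x t) (x u)) (fun s => ang_refl (x s))
 (fun s t => ang_sym (x s) (x t)) DC DE.
apply: le_trans (kinetic_le_controlled dM d0 (conj Lq Dq)) _.
by rewrite lee_fin; lra.
Qed.
Lemma uniform_weakstar (Gn: nat -> curve R d Omega) (G: curve R d Omega): uniform_cvg Gn G ->
 pointwise_weakstar_cvg Gn G.
move=> h t t01 phi [hp cp vp].
have bP: CbH phi.
 split => //; have [K cK hK] := vp 1 ltr01.
 have cf: continuous (fun x => frob (phi x) (phi x)).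
  under eq_fun do rewrite frobE.
  apply: continuous_sumr => i; apply: continuous_sumr => j x.
  have [c1 c2] := cp i j.
  by apply: cvgD; apply: cvgM; [exact: c1|exact: c1|exact: c2|exact: c2].
 have [B [_ hB]] := compact_bounded (continuous_compact (continuous_subspaceT cf) cK).
 exists (Num.max 1 (Num.sqrt (B + 1))) => x; have [Kx|nK] := pselect (K x).
  rewrite le_max ler_wsqrtr ?orbT //; apply: le_trans (ler_norm _) _.
  by apply: (hB (B + 1)); [rewrite ltrDl|exists x].
 by rewrite le_max (ltW (hK x nK)).
have [_ _ [K0 hK0]] := bP; pose K := `|K0| + 1.
have K1: 0 < K by rewrite ltr_wpDl.
have hK x: frobnorm (phi x) <= K by apply: le_trans (hK0 x) _; have := ler_norm K0; rewrite /K; lra.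
apply/cvgrPdist_lt => e e0; have eK: 0 < e / K by rewrite divr_gt0.
have eKe: (0 < (e / K)%:E)%E by rewrite lte_fin.
have [N _ hN] := h _ (open_ereal_lt' eKe); exists N => // n Nn; have /= lt := hN n Nn.
have le: (dTV (Gn n t) (G t) < (e / K)%:E)%E.
 by apply: le_lt_trans lt; apply: ereal_sup_ubound; exists t.
rewrite distrC -lte_fin; apply: le_lt_trans (pairing_dTV (Gn n t) (G t) bP K1 hK) _.
by rewrite -lte_pdivlMl // -EFinM mulrC.
Qed.
End lower_bound.

Section finite_copy.
Context {disp : measure_display} {T : measurableType disp} {R : realType}.
Variable m : {measure set T -> \bar R}.
(** The same function, carrying its finiteness as a structure so that results on finite measures
    apply to it. *)
Definition finite_copy of fin_num_fun m: set T -> \bar R := m.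
Hypothesis h : fin_num_fun m.
HB.instance Definition _ := Measure.copy (finite_copy h) m.
HB.instance Definition _ := Measure_isFinite.Build _ T R (finite_copy h) h.
End finite_copy.

(** * Lebesgue decomposition with respect to the reference measure *)

Section reference_measure.
Context {R : realType} {d : nat} {Omega : ptopologicalType}.
Local Notation M := 'M[R[i]]_d.
Implicit Types (mu: finmeas R Omega).
Lemma wdens_unique mu g g' (G: psd_measure R d Omega): wdens mu g G -> wdens mu g' G ->
 {ae mu, forall x, g x = g' x}.
move=> [mg ig hg] [mg' ig' hg'].
have key (f f': borel Omega -> R) : intg mu setT f -> intg mu setT f' ->
  (forall A, measurable A -> \int[mu]_(x in A) f x = \int[mu]_(x in A) f' x) ->
  {ae mu, forall x, f x = f' x}.
 have half (f1 f2: borel Omega -> R) : intg mu setT f1 -> intg mu setT f2 ->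
  (forall A, measurable A -> \int[mu]_(x in A) f1 x = \int[mu]_(x in A) f2 x) ->
  {ae mu, forall x, 0 <= f1 x - f2 x}.
  move=> i1 i2 e; apply: Rintegral_ge0_ae; first exact: intgB.
  move=> A mA; have s1 := integrableS mtop mA (@subsetT _ A) i1.
  have s2 := integrableS mtop mA (@subsetT _ A) i2.
  by rewrite (RintegralB mA s1 s2) e // subrr.
 move=> i1 i2 e.
 have h1 := half f f' i1 i2 e; have h2 := half f' f i2 i1 (fun A mA => esym (e A mA)).
 by move: h1 h2; apply: filterS2 => x h1 h2; lra.
have h1: {ae mu, forall x, forall p: 'I_d * 'I_d, Re (g x p.1 p.2) = Re (g' x p.1 p.2)}.
 apply: ae_foralln_fin => -[i j] /=; apply: key; [exact: (ig i j).1|exact: (ig' i j).1|].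
 by move=> A mA; rewrite -(hg A mA i j).1 -(hg' A mA i j).1.
have h2: {ae mu, forall x, forall p: 'I_d * 'I_d, Im (g x p.1 p.2) = Im (g' x p.1 p.2)}.
 apply: ae_foralln_fin => -[i j] /=; apply: key; [exact: (ig i j).2|exact: (ig' i j).2|].
 by move=> A mA; rewrite -(hg A mA i j).2 -(hg' A mA i j).2.
move: h1 h2; apply: filterS2 => x h1 h2; apply/matrixP => i j.
by apply: complex_ext; [exact: (h1 (i, j))|exact: (h2 (i, j))].
Qed.
Lemma has_density_wdens mu g (G: psd_measure R d Omega): has_density mu G g <-> wdens mu g G.
split=> [h|[mg ig h] i j].
 split=> [i j|i j|A mA i j]; have [h1 h2 h3] := h i j.
 - by split; [exact: intg_mfun h1|exact: intg_mfun h2].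
 - by [].
 - by rewrite h3.
split; [exact: (ig i j).1|exact: (ig i j).2|move=> A mA].
by have [e1 e2] := h A mA i j; apply: complex_ext.
Qed.
Lemma dens_null mu g (G: psd_measure R d Omega) A: hasdens mu g G -> measurable A -> mu A = 0%E -> G A = 0.
move=> hg mA t0; have [[_ _ e] _] := hg; apply/matrixP => i j; have [e1 e2] := e A mA i j; rewrite mxE.
apply: complex_ext; rewrite ?e1 ?e2 /Rintegral (null_set_integral mA _ t0) //.
- by apply: measurable_funTS; apply/mEFinP; exact: (hasdens_meas hg i j).1.
- by apply: measurable_funTS; apply/mEFinP; exact: (hasdens_meas hg i j).2.
Qed.
(** With [N] and [N'] the two carrying null sets, the absolutely continuous parts vanish on their
    union and the singular parts vanish outside it. *)
Lemma decomposition_unique mu (G Ga Gs Ga' Gs': psd_measure R d Omega) :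
 lebesgue_decomposition mu G Ga Gs -> lebesgue_decomposition mu G Ga' Gs' -> eq_measure Ga Ga'.
have sub0 (H: psd_measure R d Omega) A B : measurable A -> measurable B -> A `<=` B -> H B = 0 -> H A = 0.
 move=> mA mB AB HB; have [g hg] := prob_dens H.
 have t0: trace_measure H A = 0%E.
  apply/eqP; rewrite eq_le measure_ge0 andbT; apply: le_trans (le_measure (trace_measure H) _ _ AB) _.
  - by rewrite inE.
  - by rewrite inE.
  - by rewrite /= /trace_measure HB mxtrace0.
 exact: dens_null hg mA t0.
move=> [e1 z1 [N [mN N0 s1]]] [e2 z2 [N' [mN' N0' s2]]] A mA.
have mB: measurable (A `\` (N `|` N')) by apply: measurableD => //; exact: measurableU.
have mC: measurable (A `&` (N `|` N')) by apply: measurableI => //; exact: measurableU.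
have C0: mu (A `&` (N `|` N')) = 0%E.
 apply/eqP; rewrite eq_le measure_ge0 andbT.
 apply: le_trans (_: _ <= mu (N `|` N'))%E _.
  by apply: le_measure; rewrite ?inE //; exact: measurableU.
 by rewrite measureU0 // N0.
have split_meas (H: psd_measure R d Omega) : H A = H (A `\` (N `|` N')) + H (A `&` (N `|` N')).
 have [g hg] := prob_dens H; have [[_ ig e] _] := hg.
 have AE: A = (A `\` (N `|` N')) `|` (A `&` (N `|` N')) by rewrite setUC setUIDK.
 have dis: [disjoint (A `\` (N `|` N')) & (A `&` (N `|` N'))].
  by apply/disj_setPS => x /= [[_ h] [_]].
 apply/matrixP => i j; rewrite mxE.
 have [a1 a2] := e A mA i j; have [b1 b2] := e _ mB i j; have [c1 c2] := e _ mC i j.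
 have S f: intg (trace_measure H) setT f -> \int[trace_measure H]_(x in A) f x =
  \int[trace_measure H]_(x in A `\` (N `|` N')) f x + \int[trace_measure H]_(x in A `&` (N `|` N')) f x.
  move=> iF; rewrite {1}AE Rintegral_setU // -AE; exact: integrableS mtop mA (@subsetT _ _) iF.
 apply: complex_ext; rewrite ?ReD ?ImD ?a1 ?b1 ?c1 ?a2 ?b2 ?c2; apply: S.
  exact: (ig i j).1.
 exact: (ig i j).2.
have mNc: measurable (~` N) by exact: measurableC.
have mNc': measurable (~` N') by exact: measurableC.
rewrite (split_meas Ga) (split_meas Ga') (z1 _ mC C0) (z2 _ mC C0) !addr0.
have s1': Gs (A `\` (N `|` N')) = 0 by apply: sub0 s1 => // x /= [_ h] n; apply: h; left.
have s2': Gs' (A `\` (N `|` N')) = 0 by apply: sub0 s2 => // x /= [_ h] n; apply: h; right.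
by have := e1 _ mB; rewrite e2 // s1' s2' !addr0.
Qed.
(** Frees the entropy and the Fisher information from the choice inside [ac_density]: almost
    everywhere it is the density of any decomposition at hand. *)
Lemma ac_density_ae mu (G Ga Gs: psd_measure R d Omega) h: lebesgue_decomposition mu G Ga Gs ->
 hasdens mu h Ga -> {ae mu, forall x, ac_density mu G x = h x}.
move=> dG hh; rewrite /ac_density; case: pselect => [ex|n]; last first.
 by case: n; exists h, Ga; [exists Gs|exact/has_density_wdens/hh.1].
have [Ga' [Gs' dG'] hd] := svalP (cid ex).
have w1: wdens mu (sval (cid ex)) Ga' by exact/has_density_wdens.
exact: wdens_unique w1 (hasdens_eq (decomposition_unique dG dG') hh).1.
Qed.
End reference_measure.

(** * The reference measure as an element of the space *)

Section reference_prob.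
Context {R : realType} {d : nat} {Omega : ptopologicalType}.
Local Notation M := 'M[R[i]]_d.
Variable Lam : finmeas R Omega.
Hypotheses (d0: (0 < d)%N) (hL: ((d%:R)%:E * Lam setT = 1)%E).
Let dR: (d%:R : R) != 0. Proof. by rewrite pnatr_eq0 -lt0n. Qed.
Let dp: 0 < (d%:R : R). Proof. by rewrite ltr0n. Qed.
Lemma tr_re_scalar (r: R): tr_re (r *c (1%:M : M)) = r * d%:R.
by rewrite /tr_re -frob1l frobZr frob1l mxtrace1 -(rmorph_nat (real_complex R)). Qed.
Lemma tr_re1: tr_re (1%:M : M) = d%:R.
by rewrite -[1%:M]scale1r -(rmorph1 (real_complex R)) tr_re_scalar mul1r. Qed.
Lemma Lam_fine: fine (Lam setT) = d%:R^-1.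
have fL := fin_num_measure Lam _ mtop.
by move: hL; rewrite -{1}(fineK fL) -EFinM => -[e]; apply: (mulfI dR); rewrite mulfV.
Qed.
Let ref_intg: intg Lam setT (fun=> tr_re (1%:M : M)).
exact: finite_measure_integrable_cst. Qed.
Let ref_mass: \int[Lam]_x tr_re (1%:M : M) = 1.
by rewrite Rintegral_cst // Lam_fine tr_re1 mulfV. Qed.
Definition ref_prob: prob R d Omega :=
 prob_of_dens (mxm_cst setT 1%:M) (fun=> psd1) ref_intg ref_mass.
Lemma ref_dens: hasdens Lam (fun=> 1%:M) ref_prob.
exact: of_densP. Qed.
Lemma ref_probE A i j: measurable A -> Re (ref_prob A i j) = Re ((1%:M : M) i j) * fine (Lam A) /\
 Im (ref_prob A i j) = 0.
move=> mA; have [[_ _ e] _] := ref_dens; have [-> ->] := e A mA i j; split.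
 by rewrite Rintegral_cst.
rewrite Rintegral_cst // (_: Im _ = 0) ?mul0r // mxE.
by rewrite -(rmorph_nat (real_complex R)).
Qed.
(** [w] is the density of the reference measure with respect to [mu], recovered as the trace of a
    matrix density divided by [d]. *)
Lemma scalar_dens_exists (mu: finmeas R Omega) :
 trace_measure ref_prob `<< mu -> exists w: borel Omega -> R,
 [/\ mfun w, forall x, 0 <= w x & hasdens mu (fun x => w x *c (1%:M : M)) ref_prob].
move=> /hasdens_exists [l hl]; pose w x := d%:R^-1 * tr_re (l x).
have w0 x: 0 <= w x by apply: mulr_ge0; [rewrite invr_ge0 ltW|exact: (hasdens_tr_ge0 x hl)].
have mw: mfun w by apply: measurable_funM => //; exact: hasdens_tr_meas hl.
have iw: intg mu setT w by apply: intgZ => //; exact: hasdens_tr_intg hl.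
have wA A: measurable A -> \int[mu]_(x in A) w x = fine (Lam A).
 move=> mA; have it := integrableS mtop mA (@subsetT _ A) (hasdens_tr_intg hl).
 rewrite (RintegralZl _ mA it).
 have h1 := hasdens_trace hl mA; have h2 := hasdens_trace ref_dens mA.
 rewrite /Rintegral -h1 h2 integral_cst // tr_re1 fineM //; last exact: fin_num_measure.
 by rewrite mulKf.
have E (r: R) i j : Re ((r *c (1%:M : M)) i j) = Re ((1%:M : M) i j) * r /\
  Im ((r *c (1%:M : M)) i j) = Im ((1%:M : M) i j) * r.
 have e: (r *c (1%:M : M)) i j = real_complex R r * (1%:M : M) i j by rewrite mxE.
 by rewrite e ReMr ImMr; split; exact: mulrC.
exists w; split=> //; split; last by move=> x; exact: psd_scalar.
split=> [|i j|A mA i j].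
- by apply: mxmZ => //; exact: mxm_cst.
- split.
  rewrite (_: (fun x => _) = fun x => Re ((1%:M : M) i j) * w x); first exact: intgZ.
  by apply/funext => x; rewrite (E _ _ _).1.
 rewrite (_: (fun x => _) = fun x => Im ((1%:M : M) i j) * w x); first exact: intgZ.
 by apply/funext => x; rewrite (E _ _ _).2.
have [-> ->] := ref_probE i j mA; have iA := integrableS mtop mA (@subsetT _ A) iw.
split.
 under eq_Rintegral do rewrite (E _ _ _).1.
 by rewrite (RintegralZl _ mA iA) wA.
under eq_Rintegral do rewrite (E _ _ _).2.
rewrite (RintegralZl _ mA iA) (_: Im _ = 0) ?mul0r // mxE.
by rewrite -(rmorph_nat (real_complex R)).
Qed.

Section ratio.
Variables (mu: finmeas R Omega) (w: borel Omega -> R).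
Hypotheses (mw: mfun w) (w0: forall x, 0 <= w x)
 (hw: hasdens mu (fun x => w x *c (1%:M : M)) ref_prob).
Lemma ref_change (F: borel Omega -> \bar R): mfun F -> (forall x, 0 <= F x)%E ->
 (\int[Lam]_x F x = \int[mu]_x (F x * (w x)%:E))%E.
move=> mF F0; have di: (0 <= (d%:R^-1 : R)%:E)%E by rewrite lee_fin invr_ge0 ltW.
pose F' x := (F x * (d%:R^-1)%:E)%E.
have mF': mfun F' by exact: emeasurable_funM.
have F'0 x: (0 <= F' x)%E by rewrite mule_ge0.
transitivity (\int[trace_measure ref_prob]_x F' x)%E.
 rewrite (hasdens_change ref_dens mF' F'0); apply: eq_integral => x _.
 by rewrite /F' tr_re1 -muleA -EFinM mulVf // mule1.
rewrite (hasdens_change hw mF' F'0); apply: eq_integral => x _.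
by rewrite /F' tr_re_scalar -muleA -EFinM mulrCA mulVf // mulr1.
Qed.
Lemma ref_changeR (u: borel Omega -> R): mfun u ->
 \int[Lam]_x u x = \int[mu]_x (u x * w x).
move=> mu_; pose u' x := u x * d%:R^-1.
have mu': mfun u' by exact: measurable_funM.
rewrite /Rintegral; congr fine.
transitivity (\int[trace_measure ref_prob]_x (u' x)%:E)%E.
 rewrite (hasdens_changeR ref_dens mu'); apply: eq_integral => x _.
 by rewrite /u' tr_re1 -mulrA mulVf // mulr1.
rewrite (hasdens_changeR hw mu'); apply: eq_integral => x _.
by congr EFin; rewrite /u' tr_re_scalar; field; exact: dR.
Qed.
Lemma ref_null: Lam [set x | w x = 0] = 0%E /\ measurable [set x : borel Omega | w x = 0].
have mN: measurable [set x : borel Omega | w x = 0].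
 by rewrite -[X in measurable X]setTI; exact: (mw mtop (measurable_set1 0)).
split=> //; rewrite -[[set x | _]]setIT -integral_indic //.
have mInd: mfun (fun x => (\1_[set x : borel Omega | w x = 0] x)%:E : \bar R).
 by apply/mEFinP; exact: measurable_indic.
rewrite (ref_change mInd) //.
apply: integral0_eq => x _; rewrite indicE; case: (boolP (x \in _)) => [/set_mem /= ->|_].
 by rewrite mule0.
by rewrite mul0e.
Qed.
Variables (G: psd_measure R d Omega) (g: borel Omega -> M).
Hypothesis hg : hasdens mu g G.
(** The quotient of the two densities. Since [0^-1 = 0] it vanishes where [w] does, a null set of
    the reference measure; on that set [g] is the singular part [gs], elsewhere it is the absolutely
    continuous part [ga]. *)
Let h x: M := (w x)^-1 *c g x.
Let ga x: M := if w x == 0 then 0 else g x.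
Let gs x: M := if w x == 0 then g x else 0.
Let mb: mfun (fun x: borel Omega => w x == 0).
exact: measurable_fun_eqr. Qed.
Let mg: mxmfun g := hasdens_meas hg.
Let mga: mxmfun ga. Proof. by apply: mxm_if => //; exact: mxm_cst. Qed.
Let mgs: mxmfun gs. Proof. by apply: mxm_if => //; exact: mxm_cst. Qed.
Let pga x: psd (ga x). Proof. by rewrite /ga; case: ifP => _; [exact: psd0|exact: hasdens_psd hg]. Qed.
Let pgs x: psd (gs x). Proof. by rewrite /gs; case: ifP => _; [exact: hasdens_psd hg|exact: psd0]. Qed.
Let tr_dom (k: borel Omega -> M): mxmfun k -> (forall x, k x = g x \/ k x = 0) ->
 intg mu setT (fun x => tr_re (k x)).
move=> mk hk; refine (@intg_dom R _ (borel Omega) mu setT _ _ mtop (measurable_tr mk) _ (hasdens_tr_intg hg)).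
move=> x _; have t0 := hasdens_tr_ge0 x hg.
by case: (hk x) => ->; [rewrite ger0_norm|rewrite /tr_re mxtrace0 normr0].
Qed.
Let iga: intg mu setT (fun x => tr_re (ga x)).
by apply: tr_dom => // x; rewrite /ga; case: ifP; [right|left]. Qed.
Let igs: intg mu setT (fun x => tr_re (gs x)).
by apply: tr_dom => // x; rewrite /gs; case: ifP; [left|right]. Qed.
Definition ac_part := of_dens mga pga iga.
Definition singular_part := of_dens mgs pgs igs.
Lemma ratio_dens: hasdens Lam h ac_part.
have ha := of_densP mga pga iga; have [[_ ia ea] _] := ha.
have mh: mxmfun h by apply: mxmZ => //; exact: measurable_inv.
have hE x i j: Re (h x i j) * w x = Re (ga x i j) /\ Im (h x i j) * w x = Im (ga x i j).
 rewrite /h /ga mxE ReMr ImMr; case: eqP => [->|/eqP n].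
  by rewrite !mulr0 mxE.
 by rewrite !(mulrC (w x)^-1) -!mulrA mulVf // !mulr1.
have intL (u v: borel Omega -> R) : mfun u -> (forall x, u x * w x = v x) ->
  intg mu setT v -> intg Lam setT u.
 move=> mu_ e iv; apply/integrableP; split; first exact/mEFinP.
 rewrite (ref_change (F := fun x => `|(EFin \o u) x|%E)) //; last first.
  by apply: mcomp => //; exact/mEFinP.
 move/integrableP: iv => [_]; apply: le_lt_trans; apply: le_integral_any => x _ /=.
 by rewrite -EFinM lee_fin -e normrM (ger0_norm (w0 x)).
have eqL (u v: borel Omega -> R) A : measurable A -> mfun u -> (forall x, u x * w x = v x) ->
  \int[mu]_(x in A) v x = \int[Lam]_(x in A) u x.
 move=> mA mu_ e; rewrite Rintegral_mkcond [RHS]Rintegral_mkcond ref_changeR; last first.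
  by apply/(measurable_restrictT u mA); exact: measurable_funTS.
 by apply: eq_Rintegral => x _; rewrite !patchE -e; case: ifP => // _; rewrite mul0r.
split; last by move=> x; apply: psdZ; [rewrite invr_ge0|exact: hasdens_psd hg].
split=> [//|i j|A mA i j].
 split.
  by apply: intL (ia i j).1 => [|x]; [exact: (mh i j).1|exact: (hE x i j).1].
 by apply: intL (ia i j).2 => [|x]; [exact: (mh i j).2|exact: (hE x i j).2].
have [-> ->] := ea A mA i j; split.
 by apply: eqL => // [|x]; [exact: (mh i j).1|exact: (hE x i j).1].
by apply: eqL => // [|x]; [exact: (mh i j).2|exact: (hE x i j).2].
Qed.
Lemma ratio_decomposition: lebesgue_decomposition Lam G ac_part singular_part.
have ha := of_densP mga pga iga; have [[_ ia ea] _] := ha.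
have hs := of_densP mgs pgs igs; have [[_ is_ es] _] := hs.
have [[_ ig eg] _] := hg; have [N0 mN] := ref_null.
split.
- move=> A mA; apply/matrixP => i j; rewrite mxE.
 have [a1 a2] := ea A mA i j; have [b1 b2] := es A mA i j; have [c1 c2] := eg A mA i j.
 have S f: intg mu setT f -> intg mu A f by exact: integrableS mtop mA (@subsetT _ A).
 apply: complex_ext; rewrite ?ReD ?ImD ?c1 ?c2 ?a1 ?a2 ?b1 ?b2.
  rewrite -(RintegralD mA (S _ (ia i j).1) (S _ (is_ i j).1)); apply: eq_Rintegral => x _.
  by rewrite /ga /gs; case: ifP => _; rewrite mxE ?add0r ?addr0.
 rewrite -(RintegralD mA (S _ (ia i j).2) (S _ (is_ i j).2)); apply: eq_Rintegral => x _.
 by rewrite /ga /gs; case: ifP => _; rewrite mxE ?add0r ?addr0.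
- by move=> A mA; exact: dens_null ratio_dens mA.
exists [set x | w x = 0]; split=> //.
have mNc: measurable (~` [set x : borel Omega | w x = 0]) by exact: measurableC.
apply/matrixP => i j; have [e1 e2] := es _ mNc i j; rewrite mxE; apply: complex_ext; rewrite ?e1 ?e2.
 under eq_Rintegral => x /set_mem /= /eqP n do rewrite /gs (negbTE n) mxE.
 by rewrite Rintegral_cst // mul0r.
under eq_Rintegral => x /set_mem /= /eqP n do rewrite /gs (negbTE n) mxE.
by rewrite Rintegral_cst // mul0r.
Qed.
Lemma ac_density_ratio: {ae Lam, forall x, ac_density Lam G x = (w x)^-1 *c g x}.
exact: ac_density_ae ratio_decomposition ratio_dens. Qed.
Lemma ratio_trace_le (c: R): \int[mu]_x tr_re (g x) <= c ->
 intg Lam setT (fun x => tr_re (h x)) /\ \int[Lam]_x tr_re (h x) <= c.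
move=> gc; have hr := ratio_dens; split; first exact: hasdens_tr_intg hr.
rewrite ref_changeR; last exact: hasdens_tr_meas hr.
apply: le_trans gc; have E x: tr_re (h x) * w x = tr_re (ga x).
 rewrite /h /ga /tr_re -frob1l frobZr frob1l; case: eqP => [->|/eqP n]; first by rewrite mulr0 mxtrace0.
 by rewrite mulrC mulrA mulfV // mul1r.
under eq_Rintegral do rewrite E.
apply: le_Rintegral => //; first exact: hasdens_tr_intg hg.
move=> x _; rewrite /ga; case: ifP => // _; rewrite {1}/tr_re mxtrace0; exact: hasdens_tr_ge0 hg.
Qed.
End ratio.
End reference_prob.

Section ae_comparison.
Context {disp : measure_display} {T : measurableType disp} {R : realType}.
Variable mu : {measure set T -> \bar R}.
Lemma ae_ge_integral_any (f g: T -> \bar R): mfun g ->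
 {ae mu, forall x, (g x <= f x)%E} -> (\int[mu]_x g x <= \int[mu]_x f x)%E.
move=> mg h.
rewrite -(@ae_eq_integral_any _ _ _ mu setT (fun x => if (g x <= f x)%E then g x else f x) g) //.
 by apply: le_integral_any => x _; case: ifP.
by move: h; apply: filterS => x le _; rewrite le.
Qed.
Lemma ae_le_integral_any (f g: T -> \bar R): mfun g ->
 {ae mu, forall x, (f x <= g x)%E} -> (\int[mu]_x f x <= \int[mu]_x g x)%E.
move=> mg h.
rewrite -(@ae_eq_integral_any _ _ _ mu setT (fun x => if (f x <= g x)%E then g x else f x) g) //.
 by apply: le_integral_any => x _; case: ifP.
by move: h; apply: filterS => x le _; rewrite le.
Qed.
End ae_comparison.

(** * Square roots and resolvents *)

Section square_root.
Context {R : realType} {d : nat}.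
Local Notation M := 'M[R[i]]_d.
Lemma psd_quad_eq0 (A D: M): psd A -> frob (A *m D) D = 0 -> A *m D = 0.
move=> pA; have h := psd_herm (psd_msqrt pA); rewrite -{1 2}(msqrtK pA).
by rewrite -mulmxA frob_mull h => /frob_eq0 ->; rewrite mulmx0.
Qed.
(** With [S] the chosen root and [D = S - B], the equality of squares reads [S D + D B = 0]. Pairing
    with [D] makes two nonnegative forms vanish, so [S D = B D = 0] and [D^2 = 0]. *)
Lemma msqrt_unique (A B: M): psd B -> B *m B = A -> msqrt A = B.
move=> pB e; have hB := psd_herm pB.
have pA: psd A.
 by have := psd_congr B psd1; rewrite mulmx1 hB e.
have pS := psd_msqrt pA; have hS := psd_herm pS; have e2 := msqrtK pA.
move: (msqrt A) pS hS e2 => S pS hS e2; pose D := S - B.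
have hD: D ^t* = D by rewrite ctrB hS hB.
have z: S *m D + D *m B = 0.
 by rewrite mulmxBr mulmxBl e2 e addrA subrK subrr.
have z2: frob (S *m D) D + frob (B *m D) D = 0.
 have : frob D (S *m D + D *m B) = 0 by rewrite z frob0r.
 have e3: frob (D *m B) D = frob (B *m D) D by rewrite -[RHS]frob_ctr ctrM hD hB.
 by rewrite frobDr frobC (frobC D (D *m B)) e3.
have := psd_quad D pS; have := psd_quad D pB; move=> q1 q2.
have s0: S *m D = 0 by apply: psd_quad_eq0 => //; lra.
have b0: B *m D = 0 by apply: psd_quad_eq0 => //; lra.
have DD: D *m D = 0 by rewrite {1}/D mulmxBl s0 b0 subrr.
have : frob D D = 0 by rewrite -{1}[D]mul1mx frob_mulr hD DD frob0r.
by move=> /frob_eq0 /eqP; rewrite subr_eq0 => /eqP.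
Qed.
Lemma msqrt_spf (Q: M) mu: Q *m Q ^t* = 1%:M -> (forall i, 0 <= mu i) ->
 msqrt (spf Q mu) = spf Q (fun i => Num.sqrt (mu i)).
move=> QQ m0; apply: msqrt_unique; first by apply: spf_psd => i; exact: sqrtr_ge0.
by rewrite (spfM QQ); congr spf; apply/funext => i; rewrite -expr2 sqr_sqrtr.
Qed.
Definition trres (H: M) (s: R): R := tr_re (invmx (H + s *c 1%:M)).
Lemma trres_spf (Q: M) m s: Q *m Q ^t* = 1%:M -> (forall i, 0 <= m i) -> 0 < s ->
 trres (spf Q m) s = \sum_i (m i + s)^-1.
move=> QQ m0 s0; rewrite /trres -(spf1 QQ) spfZ spfD spf_inv //; last by move=> i; rewrite mulr1 gt_eqF // ltr_wpDl.
by rewrite /tr_re spf_tr //=; apply: eq_bigr => i _; rewrite mulr1.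
Qed.
Lemma trres_ge0 (H: M) s: psd H -> 0 < s -> 0 <= trres H s.
move=> pH s0; have [Q [m [QQ m0 ->]]] := psd_spectral pH; rewrite trres_spf //.
by apply: sumr_ge0 => i _; rewrite invr_ge0 addr_ge0 // ltW.
Qed.
Lemma trres_anti (H: M) s t: psd H -> 0 < s -> s <= t -> trres H t <= trres H s.
move=> pH s0 st; have [Q [m [QQ m0 ->]]] := psd_spectral pH; rewrite !trres_spf //; last exact: lt_le_trans st.
apply: ler_sum => i _; have h: 0 < m i + s by rewrite ltr_wpDl.
by rewrite lef_pV2 ?posrE ?lerD2l //; apply: lt_le_trans h _; rewrite lerD2l.
Qed.
(** On eigenvalues, [(1 - s) m + s] is at least half of [m + s] when [s <= 1/2]. *)
Lemma trinv_mix (H: M) s: psd H -> 0 < s -> s <= 2^-1 ->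
 (trinv ((1 - s) *c H + s *c 1%:M) <= (2 * trres H s)%:E)%E.
move=> pH s0 s2; have c: psd ((1 - s) *c H + s *c 1%:M - s *c 1%:M).
 by rewrite addrK; apply: psdZ => //; lra.
have u := coercive_unit c s0; rewrite /trinv ifN; last by move: u; rewrite unitmxE unitfE.
rewrite lee_fin -/(tr_re _); have [Q [m [QQ m0 ->]]] := psd_spectral pH; rewrite trres_spf //.
rewrite -(spf1 QQ) !spfZ spfD; have p i: 0 < (1 - s) * m i + s * 1.
 by rewrite mulr1 ltr_wpDl // mulr_ge0 //; lra.
rewrite spf_inv //; last by move=> i; rewrite gt_eqF.
rewrite /tr_re spf_tr //= mulr_sumr; apply: ler_sum => i _.
have q: 0 < m i + s by rewrite ltr_wpDl.
rewrite -[leLHS]div1r ler_pdivrMr // mulrAC ler_pdivlMr //; have := m0 i; nra.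
Qed.
Lemma trinv_mix_inv (H: M) s: psd H -> 0 < s -> s <= 1 ->
 (trinv ((1 - s) *c H + s *c 1%:M) <= (d%:R / s)%:E)%E.
move=> pH s0 s1; have c: psd ((1 - s) *c H + s *c 1%:M - s *c 1%:M).
 by rewrite addrK; apply: psdZ => //; lra.
have u := coercive_unit c s0; rewrite /trinv ifN; last by move: u; rewrite unitmxE unitfE.
by rewrite lee_fin; exact: tr_inv_le c s0.
Qed.
Lemma trinv_ge (H: M): psd H -> ((d%:R - tr_re H)%:E <= trinv H - (d%:R)%:E)%E.
move=> pH; rewrite /trinv; case: eqP => [_|/eqP n]; first by rewrite addye // leey.
have u: H \in unitmx by rewrite unitmxE unitfE.
rewrite -EFinB lee_fin -/(tr_re _).
have := frob_dual1 psd1 pH u; rewrite !frob1l -!/(tr_re _) tr_re1; lra.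
Qed.
(** The left side is half the square of the difference of the roots, and that difference times their
    sum is [b - a]. *)
Lemma sqrt_gap (a b: R): 0 <= a -> 0 <= b -> 0 < a ->
 2^-1 * (a + b) - Num.sqrt a * Num.sqrt b <= 2^-1 * ((b - a) ^+ 2 / a).
move=> a0 b0 ap; have ea := sqr_sqrtr a0; have eb := sqr_sqrtr b0.
have x0 := sqrtr_ge0 a; have y0 := sqrtr_ge0 b; have xp: 0 < Num.sqrt a by rewrite sqrtr_gt0.
move: (Num.sqrt a) (Num.sqrt b) ea eb x0 y0 xp => x y <- <- x0 y0 xp.
have ->: 2^-1 * (x ^+ 2 + y ^+ 2) - x * y = 2^-1 * (y - x) ^+ 2 by field.
apply: ler_wpM2l; first by rewrite invr_ge0.
rewrite ler_pdivlMr ?exprn_gt0 //.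
have ->: (y ^+ 2 - x ^+ 2) ^+ 2 = (y - x) ^+ 2 * (y + x) ^+ 2 by ring.
by apply: ler_wpM2l; [exact: sqr_ge0|rewrite ler_pXn2r ?nnegrE //; lra].
Qed.
(** [m] is an eigenvalue of the density of a measure and [w] the density of the reference measure,
    so the mixtures differ by [(t - s)(w - m)]. In [sqrt_gap] the denominator is at least
    [(m + s w)/2], which pays the [w^2] part by the resolvent and the [m^2] part by [m]. *)
Lemma eigen_gap (m w s t: R): 0 <= m -> 0 <= w -> 0 < s -> s <= 2^-1 -> 0 <= t -> t <= 1 ->
 2^-1 * (((1 - s) * m + s * w) + ((1 - t) * m + t * w)) -
  Num.sqrt ((1 - s) * m + s * w) * Num.sqrt ((1 - t) * m + t * w) <=
 (t - s) ^+ 2 * ((w^-1 * m + s)^-1 * w + m).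
move=> m0 w0 s0 s2 t0 t1.
have a0: 0 <= (1 - s) * m + s * w by apply: addr_ge0; apply: mulr_ge0 => //; lra.
have b0: 0 <= (1 - t) * m + t * w by apply: addr_ge0; apply: mulr_ge0 => //; lra.
have sq := sqr_ge0 (t - s).
move: a0; rewrite le_eqVlt => /orP[/eqP a0|ap].
 have [m00 w00]: m = 0 /\ w = 0.
  have h1: 0 <= (1 - s) * m by apply: mulr_ge0 => //; lra.
  have h2: 0 <= s * w by apply: mulr_ge0 => //; lra.
  have /eqP: (1 - s) * m = 0 by lra. 
  have /eqP: s * w = 0 by lra.
  rewrite !mulf_eq0 (gt_eqF s0) /= => /eqP -> /orP[/eqP|/eqP ->] //; lra.
 by rewrite m00 w00 !mulr0 !addr0 sqrtr0 !mulr0 subr0.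
apply: le_trans (sqrt_gap (ltW ap) b0 ap) _.
have ->: (1 - t) * m + t * w - ((1 - s) * m + s * w) = (t - s) * (w - m) by ring.
rewrite exprMn -mulrA mulrCA; apply: ler_wpM2l => //.
rewrite mulrA ler_pdivrMr //; move: w0; rewrite le_eqVlt => /orP[/eqP <-|wp].
 rewrite mulr0 add0r mulr0 addr0; have mm := mulr_ge0 m0 m0.
 by have := mulr_ge0 mm (ltac:(lra) : 0 <= 2^-1 - s); nra.
have q: 0 < m + s * w by rewrite ltr_wpDl // mulr_gt0.
have ->: (w^-1 * m + s)^-1 * w = w ^+ 2 / (m + s * w) by field; rewrite !gt_eqF.
have k1: 2^-1 * (m + s * w) <= (1 - s) * m + s * w by have := mulr_ge0 (ltW s0) (ltW wp); nra.
have k2: 0 <= w ^+ 2 / (m + s * w) by rewrite divr_ge0 ?sqr_ge0 // ltW.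
have k3: w ^+ 2 / (m + s * w) * (2^-1 * (m + s * w)) = 2^-1 * w ^+ 2 by field; rewrite gt_eqF.
have k4 := ler_wpM2l k2 k1.
have k5: m * (2^-1 * m) <= m * ((1 - s) * m + s * w).
 by apply: ler_wpM2l => //; have := mulr_ge0 (ltW s0) (ltW wp); nra.
rewrite mulrDl; have ->: 2^-1 * (w - m) ^+ 2 = 2^-1 * w ^+ 2 + m * (2^-1 * m) - w * m by field.
by have := mulr_ge0 (ltW wp) m0; lra.
Qed.
End square_root.

(** * Fisher information and distance along mixtures with the reference measure *)

Section fisher_information.
Context {R : realType} {d : nat} {Omega : ptopologicalType}.
Local Notation M := 'M[R[i]]_d.
Local Notation lb := (@lebesgue_measure R).
Variable Lam : finmeas R Omega.
Hypotheses (d0: (0 < d)%N) (hL: ((d%:R)%:E * Lam setT = 1)%E).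
Local Notation L0 := (ref_prob d0 hL).
Let dp: 0 < (d%:R : R). Proof. by rewrite ltr0n. Qed.
Lemma Lam_setT: Lam setT = (d%:R^-1)%:E.
by rewrite -(Lam_fine d0 hL) fineK // fin_num_measure. Qed.
(** A common dominating measure: [G] need not be absolutely continuous with respect to the reference
    measure, nor conversely, and [mu] handles both at once. *)
Definition represents (mu: finmeas R Omega) (w: borel Omega -> R)
  (G: prob R d Omega) g :=
 [/\ mfun w, forall x, 0 <= w x, hasdens mu (fun x => w x *c (1%:M : M)) L0 &
  hasdens mu g G].
Lemma represents_exists (G: prob R d Omega): exists (D: prob R d Omega) w g,
 represents (trace_measure D) w G g.
have h2: 0 < (2^-1 : R) < 1 by lra.
have [h1 h3] := mix_dom G L0 h2; exists (mix 2^-1 G L0).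
have [g hg] := hasdens_exists h1; have [w [mw w0 hw]] := scalar_dens_exists h3.
by exists w, g.
Qed.
Lemma represents_eq mu w (G G': prob R d Omega) g: eq_measure G G' -> represents mu w G g -> represents mu w G' g.
by move=> e [h1 h2 h3 h4]; split=> //; exact: hasdens_eq h4. Qed.

Section represented.
Variables (mu: finmeas R Omega) (w: borel Omega -> R) (G: prob R d Omega).
Variable g : borel Omega -> M.
Hypothesis rep : represents mu w G g.
Let mw: mfun w. Proof. by have [] := rep. Qed.
Let w0 x: 0 <= w x. Proof. by have [] := rep. Qed.
Let hw: hasdens mu (fun x => w x *c (1%:M : M)) L0. Proof. by have [] := rep. Qed.
Let hg: hasdens mu g G. Proof. by have [] := rep. Qed.
Definition ratio x: M := (w x)^-1 *c g x.
Lemma ratio_psd x: psd (ratio x).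
by apply: psdZ; [rewrite invr_ge0|exact: hasdens_psd hg]. Qed.
Lemma ratio_meas: mxmfun ratio.
by apply: mxmZ; [exact: measurable_inv|exact: hasdens_meas hg]. Qed.
Lemma ratio_mass: intg Lam setT (fun x => tr_re (ratio x)) /\ \int[Lam]_x tr_re (ratio x) <= 1.
by apply: (ratio_trace_le mw w0 hw hg); rewrite (prob_tr hg). Qed.
Lemma mix_represents t: 0 <= t <= 1 ->
 represents mu w (mix t G L0) (fun x => (1 - t) *c g x + t *c (w x *c 1%:M)).
by move=> t01; split; [exact: mw|exact: w0|exact: hw|exact: hasdens_mix]. Qed.
Lemma ac_density_mix t: 0 <= t <= 1 ->
 {ae Lam, forall x, ac_density Lam (mix t G L0) x = (1 - t) *c ratio x + t *c 1%:M}.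
move=> t01; have [_ _ _ hm] := mix_represents t01.
have [z mz] := ref_null mw hw.
have nz: {ae Lam, forall x, w x != 0}.
 by exists [set x | w x = 0]; split => // x /= /negP; rewrite negbK => /eqP.
move: (ac_density_ratio mw w0 hw hm) nz; apply: filterS2 => x -> wx.
rewrite /ratio scalerDr !scalerA -!rmorphM; congr (real_complex _ _ *: _ + real_complex _ _ *: _).
 exact: mulrC.
by rewrite mulrAC mulVf // mul1r.
Qed.
Lemma ac_density_represented: {ae Lam, forall x, ac_density Lam G x = ratio x}.
by rewrite /ratio; exact: (ac_density_ratio mw w0 hw hg). Qed.
(** Pointwise [tr H^-1 - d >= d - tr H]; the integral of [d] is 1 and that of the trace of the ratio
    is at most 1. *)
Lemma fisher_ge0: (0 <= fisher Lam G)%E.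
have [it lt] := ratio_mass.
have ic: intg Lam setT (fun=> (d%:R : R)) by exact: finite_measure_integrable_cst.
apply: le_trans (_: (\int[Lam]_x (d%:R - tr_re (ratio x))%:E <= _)%E).
 rewrite -(EFin_Rintegral mtop (intgB mtop ic it)) lee_fin (RintegralB mtop ic it).
 by rewrite Rintegral_cst // (Lam_fine d0 hL) mulfV ?gt_eqF // subr_ge0.
apply: ae_ge_integral_any.
 by apply/mEFinP; apply: measurable_funB => //; exact: measurable_tr ratio_meas.
by move: ac_density_represented; apply: filterS => x ->; exact: trinv_ge (ratio_psd x).
Qed.
Definition res s: \bar R := (\int[Lam]_x (trres (ratio x) s)%:E)%E.
Lemma trres_meas s: 0 < s -> mfun (fun x => trres (ratio x) s).
move=> s0; apply: measurable_tr; apply: mxm_inv => //.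
 by apply: mxmD; [exact: ratio_meas|exact: mxm_cst].
by move=> x _; apply: (coercive_unit _ s0); rewrite addrK; exact: ratio_psd.
Qed.
Lemma res_bound s: 0 < s -> (res s <= (s^-1)%:E)%E.
move=> s0; apply: le_trans (_: \int[Lam]_x (cst (d%:R / s)%:E x) <= _)%E.
 apply: le_integral_any => x _; rewrite lee_fin; apply: tr_inv_le => //.
 by rewrite addrK; exact: ratio_psd.
rewrite integral_cst // [X in (_ * X)%E]Lam_setT.
by rewrite -EFinM lee_fin mulrAC mulfV ?gt_eqF // mul1r.
Qed.
Lemma res_ge0 s: 0 < s -> (0 <= res s)%E.
by move=> s0; apply: integral_ge0 => x _; rewrite lee_fin trres_ge0 //; exact: ratio_psd. Qed.
Lemma res_fin s: 0 < s -> res s \is a fin_num.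
by move=> s0; rewrite ge0_fin_numE ?res_ge0 //; apply: le_lt_trans (res_bound s0) _; rewrite ltry. Qed.
Lemma res_anti s t: 0 < s -> s <= t -> (res t <= res s)%E.
by move=> s0 st; apply: le_integral_any => x _; rewrite lee_fin trres_anti //; exact: ratio_psd.
Qed.
(** The density of the mixture is at least [t], and the reference measure has mass [1/d]. *)
Lemma fisher_mix_inv t: 0 < t -> t <= 1 -> (fisher Lam (mix t G L0) <= (t^-1)%:E)%E.
move=> t0 t1.
have t01: 0 <= t <= 1 by rewrite ltW.
apply: le_trans (_: \int[Lam]_x (cst (d%:R / t)%:E x) <= _)%E.
 apply: ae_le_integral_any; first exact: measurable_cst.
 move: (ac_density_mix t01); apply: filterS => x ->.
 rewrite leeBlDr //; apply: le_trans (trinv_mix_inv (ratio_psd x) t0 t1) _.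
 by rewrite -EFinD lee_fin lerDl ltW.
rewrite integral_cst // [X in (_ * X)%E]Lam_setT.
by rewrite -EFinM lee_fin mulrAC mulfV ?gt_eqF // mul1r.
Qed.
Lemma fisher_mix_res t: 0 < t -> t <= 2^-1 -> (fisher Lam (mix t G L0) <= 2%:E * res t)%E.
move=> t0 t1.
have t01: 0 <= t <= 1 by apply/andP; split; lra.
rewrite /res -ge0_integralZl //; last 2 first.
- by apply/mEFinP; exact: trres_meas.
- by move=> x _; rewrite lee_fin trres_ge0 //; exact: ratio_psd.
apply: ae_le_integral_any.
 by apply: emeasurable_funM => //; apply/mEFinP; exact: trres_meas.
move: (ac_density_mix t01); apply: filterS => x ->.
rewrite leeBlDr // -EFinM; apply: le_trans (trinv_mix (ratio_psd x) t0 t1) _.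
by rewrite -EFinD lee_fin lerDl ltW.
Qed.
(** At each point the two mixed densities commute, so their square roots serve as maps out of the
    identity and bound the fidelity from below; what it misses to 1 is the integral of the
    eigenvalue gaps. *)
Lemma ang_mix_ref s t: 0 < s -> s <= 2^-1 -> 0 <= t -> t <= 1 ->
 ang (mix s G L0) (mix t G L0) ^+ 2 <= 16 * ((t - s) ^+ 2 * (fine (res s) + 1)).
move=> s0 s2 t0 t1; apply: le_trans (ang_sqr_le _ _) _; rewrite ler_pM2l //.
have s01: 0 <= s <= 1 by apply/andP; split; lra.
have t01: 0 <= t <= 1 by rewrite t0.
have [_ _ _ ha] := mix_represents s01; have [_ _ _ hb] := mix_represents t01.
set a := fun x => _ in ha; set b := fun x => _ in hb.
have pa x: psd (a x) := hasdens_psd x ha; have pb x: psd (b x) := hasdens_psd x hb.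
pose A x := msqrt (a x); pose B x := msqrt (b x).
have mA: mxmfun A by apply: mxm_msqrt => //; exact: hasdens_meas ha.
have mB: mxmfun B by apply: mxm_msqrt => //; exact: hasdens_meas hb.
have hA x: (A x) ^t* = A x by exact: psd_herm (psd_msqrt (pa x)).
have hB x: (B x) ^t* = B x by exact: psd_herm (psd_msqrt (pb x)).
have hA': hasdens mu (fun x => A x *m 1%:M *m A x) (mix s G L0).
 have E: (fun x => A x *m 1%:M *m A x) = a by apply/funext => x; rewrite mulmx1; exact: msqrtK (pa x).
 by rewrite E.
have hB': hasdens mu (fun x => B x *m 1%:M *m B x) (mix t G L0).
 have E: (fun x => B x *m 1%:M *m B x) = b by apply/funext => x; rewrite mulmx1; exact: msqrtK (pb x).
 by rewrite E.
have m1: mxmfun (fun _: borel Omega => (1%:M : M)) by exact: mxm_cst.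
have le := fid_ge_cross m1 (fun=> psd1) mA mB hA hB hA' hB'.
have ic := intg_cross m1 (fun=> psd1) mA mB hA hB hA' hB'.
have ia := hasdens_tr_intg ha; have ib := hasdens_tr_intg hb.
have na := prob_tr ha; have nb := prob_tr hb.
pose X x := 2^-1 * (tr_re (a x) + tr_re (b x)) - frob (1%:M *m A x) (B x).
have iab := intgD mtop ia ib; have iab2 := intgZ 2^-1 mtop iab.
have iX: intg mu setT X := intgB mtop iab2 ic.
have XE: \int[mu]_x X x = 1 - \int[mu]_x frob (1%:M *m A x) (B x).
 rewrite (RintegralB mtop iab2 ic) (RintegralZl 2^-1 mtop iab) (RintegralD mtop ia ib).
 by rewrite na nb; congr (_ - _); field.
have tsq: 0 <= (t - s) ^+ 2 by exact: sqr_ge0.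
(* Everything is diagonal in an eigenbasis of [g x], and [eigen_gap] applies to each eigenvalue. *)
have pt x: X x <= (t - s) ^+ 2 * (trres (ratio x) s * w x + tr_re (g x)).
 have pg: psd (g x) := hasdens_psd x hg.
 have [Q [m [QQ m0 gE]]] := psd_spectral pg.
 have comb r: (1 - r) *c g x + r *c (w x *c 1%:M) = spf Q (fun i => (1 - r) * m i + r * w x).
  by rewrite gE -(spf1 QQ) !spfZ spfD; congr spf; apply/funext => i; rewrite mulr1.
 have nn r: 0 <= r <= 1 -> forall i, 0 <= (1 - r) * m i + r * w x.
  by move=> /andP[r0 r1] i; rewrite addr_ge0 ?mulr_ge0 // subr_ge0.
 have ->: ratio x = spf Q (fun i => (w x)^-1 * m i) by rewrite /ratio gE spfZ.
 rewrite trres_spf //; last by move=> i; rewrite mulr_ge0 ?invr_ge0.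
 rewrite /X mul1mx /A /B /a /b !comb !msqrt_spf //; [|exact: nn..].
 rewrite (spf_frob QQ) gE /tr_re !spf_tr // /= -big_split mulr_sumr mulr_suml -sumrB -big_split mulr_sumr.
 by apply: ler_sum => i _ /=; exact: eigen_gap.
apply: (@le_trans _ _ (1 - \int[mu]_x frob (1%:M *m A x) (B x))); first by rewrite lerD2l lerN2; exact: le.
rewrite -XE -lee_fin (EFin_Rintegral mtop iX).
have rs: (fine (res s))%:E = res s by rewrite fineK // res_fin.
have mr := trres_meas s0.
have r0 x: 0 <= trres (ratio x) s * w x by rewrite mulr_ge0 ?trres_ge0 //; exact: ratio_psd.
have it := hasdens_tr_intg hg; have tr0 x: 0 <= tr_re (g x) := hasdens_tr_ge0 x hg.
have mt: mfun (fun x => tr_re (g x)) := hasdens_tr_meas hg.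
have mrw: mfun (fun x => trres (ratio x) s * w x) by exact: measurable_funM.
have ->: ((t - s) ^+ 2 * (fine (res s) + 1))%:E =
  (\int[mu]_x ((t - s) ^+ 2 * (trres (ratio x) s * w x + tr_re (g x)))%:E)%E.
 under eq_integral do rewrite EFinM.
 rewrite ge0_integralZl //; last 2 first.
 - by apply/mEFinP; exact: measurable_funD.
 - by move=> x _; rewrite lee_fin addr_ge0.
 rewrite EFinM; congr (_ * _)%E; under eq_integral do rewrite EFinD.
 rewrite ge0_integralD //; last 4 first.
 - by move=> x _; rewrite lee_fin.
 - exact/mEFinP.
 - by move=> x _; rewrite lee_fin.
 - exact/mEFinP.
 rewrite -(EFin_Rintegral mtop it) (prob_tr hg) EFinD rs; congr (_ + _)%E.
 rewrite /res (ref_change hw) //; first by apply/mEFinP.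
 by move=> x; rewrite lee_fin trres_ge0 //; exact: ratio_psd.
by apply: le_integral_any => x _; rewrite lee_fin.
Qed.
End represented.
Lemma fisher_nonneg (G: prob R d Omega): (0 <= fisher Lam G)%E.
by have [D [w [g h]]] := represents_exists G; exact: fisher_ge0 h. Qed.
Lemma fisher_mix_le (G: prob R d Omega) t: 0 < t -> t <= 1 -> (fisher Lam (mix t G L0) <= (t^-1)%:E)%E.
by move=> t0 t1; have [D [w [g h]]] := represents_exists G; exact: (fisher_mix_inv h t0 t1). Qed.
End fisher_information.

(** * Integral of the resolvent over the unit interval *)

Section resolvent_path.
Context {R : realType} {d : nat}.
Local Notation M := 'M[R[i]]_d.
Local Notation lb := (@lebesgue_measure R).
Lemma prod_ln (I: Type) (s: seq I) (m: I -> R): (forall i, 0 < m i) ->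
 0 < \prod_(i <- s) m i /\ ln (\prod_(i <- s) m i) = \sum_(i <- s) ln (m i).
move=> m0; elim: s => [|i s [p0 e]]; first by rewrite !big_nil ln1.
by rewrite !big_cons; split; [exact: mulr_gt0|rewrite lnM ?posrE // e].
Qed.
(* both paths [t] and [1 - t] to the boundary, selected by [b] *)
Definition side (b: bool) (t: R): R := if b then t else 1 - t.
Definition trres_path b (H: M) t: R := if 0 < t < 1 then trres H (side b t) else 0.
Lemma side01 b t: 0 < t < 1 -> 0 < side b t < 1.
by case: b => //= /andP[t0 t1]; apply/andP; split; rewrite /side; lra. Qed.
Lemma trres_path_ge0 b H t: psd H -> 0 <= trres_path b H t.
move=> pH; rewrite /trres_path; case: ifP => // /(side01 b) /andP[s0 _]; exact: trres_ge0.
Qed.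
Lemma log_sum (Q: M) m: Q *m Q ^t* = 1%:M -> (forall i, 0 < m i) ->
 (neglogdet (spf Q m) = (- \sum_i ln (m i))%:E)%E.
move=> QQ m0; have [p e] := prod_ln (index_enum 'I_d) m0.
rewrite /neglogdet spf_det // ifN /= ?e //.
by apply/eqP => /(congr1 (@complex.Re R)) /= h; rewrite h ltxx in p.
Qed.
Lemma trres_path_ftc b (Q: M) m: Q *m Q ^t* = 1%:M -> (forall i, 0 < m i) ->
 \int[lb]_(t in `[0, 1]) trres_path b (spf Q m) t = \sum_i (ln (m i + 1) - ln (m i)).
move=> QQ m0; pose a i : R := if b then m i else m i + 1; pose c : R := if b then 1 else - 1.
have pos i t: 0 <= t <= 1 -> m i <= a i + c * t.
 by move=> /andP[t0 t1]; rewrite /a /c; case: (b); lra.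
have cc: c * c = 1 by rewrite /c; case: (b); ring.
have lF i: lipd 0 (fun t => c * ln (a i + c * t)) (fun t => (a i + c * t)^-1).
 apply: (@lipd_derive _ _ _ _ (m i)^-1) => t t01; have h := pos i t t01; have p := lt_le_trans (m0 i) h.
  have dl := @is_derive1_comp R (@ln R) (fun t => a i + c * t) t _ _ (is_derive1_ln p) (derive_affine (a i) c t).
  by apply: (is_derive_eq (deriveZ' c dl)); rewrite mulrCA cc mulr1.
 by rewrite ger0_norm ?invr_ge0 ?(ltW p) // lef_pV2 ?posrE.
have [[L L0 [_ lip]] q] := lipd_sum (index_enum 'I_d) lF.
have ->: \sum_i (ln (m i + 1) - ln (m i)) = \sum_i c * ln (a i + c * 1) - \sum_i c * ln (a i + c * 0).
 rewrite -sumrB; apply: eq_bigr => i _; rewrite /a /c mulr0 mulr1 addr0; case: (b); first by ring.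
 by rewrite addrK; ring.
pose F t := \sum_i c * ln (a i + c * t).
have h1 (s t: R) : 0 <= s -> s <= t -> t <= 1 -> `|F t - F s| <= L * (t - s).
 by move=> s0 st t1; rewrite -[t - s]ger0_norm ?subr_ge0 //; apply: lip; lra.
have h2 (t: R) : 0 < t < 1 -> t != 0 -> (e^-1 * (F (t + e) - F t)) @[e --> 0^'] --> trres_path b (spf Q m) t.
 move=> t01 t0; have ->: trres_path b (spf Q m) t = \sum_i (a i + c * t)^-1; last exact: q.
 rewrite /trres_path t01; have /andP[s0 s1] := side01 b t01.
 rewrite trres_spf //; last by move=> i; exact: ltW.
 by apply: eq_bigr => i _; rewrite /side /a /c; case: (b) => //; congr (_^-1); ring.
exact: (@lipschitz_ftc R F _ L 0 L0 h1 h2 0 1).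
Qed.
(** The integral is [log det (H + 1) - log det H], in either direction of time, and
    [ln (1 + m) <= m]. The second claim keeps the negative part of the entropy integrand below an
    integrable trace. *)
Lemma trres_path_integral b (H: M): psd H ->
 (\int[lb]_t (trres_path b H t)%:E <= (tr_re H)%:E + neglogdet H)%E /\
 (- (tr_re H)%:E <= neglogdet H)%E.
move=> pH; case: (boolP (\det H == 0)) => [z|nz].
 by rewrite /neglogdet z addey //; split; exact: leey.
have [Q [m [QQ m00 HE]]] := psd_spectral pH.
have m0 i: 0 < m i.
 rewrite lt_neqAle m00 andbT eq_sym; apply: contraNneq nz => mi; rewrite HE spf_det //.
 by rewrite (bigD1 i) //= mi mul0r rmorph0.
have trE: tr_re H = \sum_i m i by rewrite HE /tr_re spf_tr.
have le1: \sum_i (ln (m i + 1) - ln (m i)) <= tr_re H - \sum_i ln (m i).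
 rewrite trE -sumrB; apply: ler_sum => i _; rewrite lerD2r addrC; apply: le_ln1Dx.
 by have := m0 i; lra.
have le2: \sum_i ln (m i) <= tr_re H.
 rewrite trE; apply: ler_sum => i _; have h := m0 i.
 have := le_ln1Dx (x := m i - 1); rewrite (_: 1 + (m i - 1) = m i); last by ring.
 by move=> /(_ ltac:(lra)); lra.
rewrite HE log_sum // -HE; split; last by rewrite -EFinN lee_fin lerN2.
rewrite -EFinB; apply: le_trans (_: (\sum_i (ln (m i + 1) - ln (m i)))%:E <= _)%E; last by rewrite lee_fin.
rewrite -(trres_path_ftc b QQ m0) -HE /Rintegral.
have E: ((fun t => (trres_path b H t)%:E) \_ (`[0, 1]%classic : set R)) = (fun t => (trres_path b H t)%:E).
 apply/funext => t; rewrite patchE; case: ifPn => // /negP n; rewrite /trres_path ifN //.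
 apply/negP => /andP[h1 h2]; apply: n; apply/mem_set; rewrite /= in_itv /=.
 by rewrite !ltW.
rewrite -{1}E -integral_mkcond fineK //; apply/fin_numPlt; apply/andP; split.
 apply: (@lt_le_trans _ _ 0%E) => //; apply: integral_ge0 => t _.
 by rewrite lee_fin; exact: trres_path_ge0.
apply: (@le_lt_trans _ _ (\int[lb]_(t in `[0%R, 1%R]) (\sum_i (m i)^-1)%:E)%E).
 apply: le_integral_any => t _; rewrite lee_fin /trres_path; case: ifP => [t01|_]; last first.
  by apply: sumr_ge0 => i _; rewrite invr_ge0 ltW.
 have /andP[s0 _] := side01 b t01; rewrite HE trres_spf //.
 apply: ler_sum => i _; have p := m0 i; have p2: 0 < m i + side b t by lra.
 by rewrite lef_pV2 ?posrE //; lra.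
by rewrite integral_cst //= lebesgue_measure_itv /= lte_fin ltr01 oppr0 adde0 mule1 ltry.
Qed.
End resolvent_path.

(** * From finite entropy to integrable resolvents *)

Section entropy_bound.
Context {R : realType} {d : nat} {Omega : ptopologicalType}.
Local Notation M := 'M[R[i]]_d.
Local Notation lb := (@lebesgue_measure R).
Variable Lam : finmeas R Omega.
Hypotheses (d0: (0 < d)%N) (hL: ((d%:R)%:E * Lam setT = 1)%E).
Variables (mu: finmeas R Omega) (w: borel Omega -> R) (G: prob R d Omega).
Variable g : borel Omega -> M.
Hypothesis rep : @represents R d Omega Lam d0 hL mu w G g.
Hypothesis fin_entropy : (entropy Lam G < +oo)%E.
Local Notation H := (ratio w g).
Let pH x: psd (H x). Proof. exact: ratio_psd rep x. Qed.
Let mH: mxmfun H. Proof. exact: ratio_meas rep. Qed.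
Lemma neglogdet_meas: mfun (fun x => neglogdet (H x)).
have [mr mi]: cmeas setT (fun x => \det (H x)) by apply: cmeas_det => // i j; exact: mH.
have ->: (fun x => neglogdet (H x)) = fun x =>
  if Re (\det (H x)) == 0 then +oo%E else (- ln (Re (\det (H x))))%:E.
 apply/funext => x; rewrite /neglogdet; have [Q [m [QQ m0 ->]]] := psd_spectral (pH x).
 by rewrite spf_det // -(rmorph0 (real_complex R)) (inj_eq (@complexI R)).
apply: measurable_fun_ifT => //; first exact: measurable_fun_eqr.
by apply/mEFinP; apply: mcomp => //; apply: mcomp.
Qed.
(** The negative part is below the trace, whose integral is finite; a finite entropy therefore
    bounds the positive part as well. *)
Lemma entropy_positive_part: (\int[Lam]_x ((tr_re (H x))%:E + neglogdet (H x)) < +oo)%E.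
have [it lt] := ratio_mass rep; have mP := neglogdet_meas.
have tE: (\int[Lam]_x (tr_re (H x))%:E < +oo)%E.
 by rewrite -(EFin_Rintegral mtop it) ltry.
have t0 x: (0 <= (tr_re (H x))%:E)%E by rewrite lee_fin; exact: psd_tr_ge0.
have mt: mfun (fun x => (tr_re (H x))%:E).
 by apply/mEFinP; exact: measurable_tr.
have lowb x: (- (tr_re (H x))%:E <= neglogdet (H x))%E := (trres_path_integral true (pH x)).2.
have entE: entropy Lam G = (\int[Lam]_x neglogdet (H x))%E.
 apply: ae_eq_integral_any => //.
 by move: (ac_density_represented rep); apply: filterS => x ->.
move: fin_entropy; rewrite entE integralE => fe.
have neg: (\int[Lam]_x (fun x => neglogdet (H x))^\- x < +oo)%E.
 apply: le_lt_trans tE; apply: le_integral_any => x _; rewrite funenegE ge_max t0 andbT.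
 by rewrite leeNl.
have pos: (\int[Lam]_x (fun x => neglogdet (H x))^\+ x < +oo)%E.
 rewrite ltNge leye_eq; apply/negP => /eqP e; move: fe; rewrite e addye ?ltxx //.
 by apply: contraTneq neg => /eqP; rewrite eqe_oppLR => /eqP ->.
apply: (@le_lt_trans _ _ (\int[Lam]_x ((tr_re (H x))%:E + (fun x => neglogdet (H x))^\+ x))%E).
 by apply: le_integral_any => x _; rewrite leeD2l // funeposE le_max lexx.
rewrite ge0_integralD //; first exact: lte_add_pinfty.
exact: measurable_funepos.
Qed.
Definition res_path b (t: R): R := if 0 < t < 1 then fine (res Lam w g (side b t)) else 0.
Lemma res_path_ge0 b t: 0 <= res_path b t.
rewrite /res_path; case: ifP => // /(side01 b) /andP[s0 _]; apply: fine_ge0; exact: (res_ge0 rep).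
Qed.
Lemma trres_path_meas b: mfun (fun z: R * borel Omega => (trres_path b (H z.2) z.1)%:E).
have mt: mfun (fst: R * borel Omega -> R) := measurable_fst.
have mb: mfun (fun z: R * borel Omega => 0 < z.1 < 1).
 apply: measurable_and.
 - exact: (measurable_fun_ltr (measurable_cst _) mt).
 - exact: (measurable_fun_ltr mt (measurable_cst _)).
have ms: mfun (fun z: R * borel Omega => side b z.1).
 by rewrite /side; case: b => //; apply: measurable_funB => //; exact: measurable_cst.
have mH2: mxmfun (fun z: R * borel Omega => H z.2).
 by move=> k l; have [h1 h2] := mH k l; split; [exact: (mcomp h1 measurable_snd)|exact: (mcomp h2 measurable_snd)].
pose Y (z: R * borel Omega) : M := if 0 < z.1 < 1 then H z.2 + side b z.1 *c 1%:M else 1%:M.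
have uY z: Y z \in unitmx.
 rewrite /Y; case: ifPn => [/(side01 b) /andP[s0 _]|_]; last exact: unitmx1.
 by apply: (coercive_unit _ s0); rewrite addrK.
have mY: mxmfun Y.
 refine (mxm_if mtop mb (mxmD mH2 (mxmZ ms (mxm_cst setT 1%:M))) (mxm_cst setT 1%:M)).
have mI: mxmfun (fun z => invmx (Y z)) by exact: mxm_inv.
apply/mEFinP.
have ->: (fun z: R * borel Omega => trres_path b (H z.2) z.1) =
  fun z => if 0 < z.1 < 1 then tr_re (invmx (Y z)) else 0.
 by apply/funext => z; rewrite /trres_path /trres /Y; case: ifP.
by apply: measurable_fun_ifT => //; exact: measurable_tr.
Qed.
(** Tonelli's theorem exchanges time and space, after which the integral in time is bounded
    pointwise by the entropy integrand plus the trace. *)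
Lemma res_path_intg b: intg lb setT (res_path b).
pose f (z: R * borel Omega) : \bar R := (trres_path b (H z.2) z.1)%:E.
have mf := trres_path_meas b.
have f0 z: (0 <= f z)%E by rewrite lee_fin; exact: trres_path_ge0.
have E: EFin \o res_path b = fun t => (\int[Lam]_x f (t, x))%E.
 apply/funext => t; rewrite /= /f /res_path /trres_path /=; case: ifP => [/(side01 b) /andP[s0 _]|_].
  by rewrite fineK // (res_fin rep).
 by rewrite integral0.
rewrite E; apply/integrableP; split.
 exact: (@measurable_fun_fubini_tonelli_F _ _ (measurableTypeR R) (borel Omega) R Lam f mf f0).
under eq_integral do rewrite gee0_abs ?integral_ge0 //.
have ft := @fubini_tonelli _ _ (measurableTypeR R) (borel Omega) R lb Lam f mf f0.
apply: le_lt_trans entropy_positive_part; rewrite [leLHS]ft.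
by apply: le_integral_any => x _; exact: (trres_path_integral b (pH x)).1.
Qed.
End entropy_bound.

(** * Kinetic energy from a distribution function *)

Section mass_bound.
Context {R : realType} {d : nat} {Omega : ptopologicalType}.
Local Notation M := 'M[R[i]]_d.
Variable dist : Omega -> Omega -> R.
Hypothesis dM : metrizes dist.
Hypothesis d0 : (0 < d)%N.
(** Cauchy-Schwarz for two terms; it makes the estimate of [kinetic_le_mass] stable under
    concatenation of intervals. *)
Lemma sqr_concat (a b e x y p q: R): 0 <= a -> 0 <= b -> 0 <= x -> 0 <= y -> 0 <= p -> 0 <= q ->
 a ^+ 2 <= x * p -> b ^+ 2 <= y * q -> 0 <= e -> e <= a + b -> e ^+ 2 <= (x + y) * (p + q).
move=> a0 b0 x0 y0 p0 q0 h1 h2 e0 h.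
have h3: e ^+ 2 <= (a + b) ^+ 2 by rewrite ler_pXn2r // nnegrE //; lra.
apply: le_trans h3 _.
have xq := mulr_ge0 x0 q0; have yp := mulr_ge0 y0 p0; have ab := mulr_ge0 a0 b0.
have h4: a ^+ 2 * b ^+ 2 <= (x * p) * (y * q) by apply: ler_pM => //; exact: sqr_ge0.
have h5: (2 * (a * b)) ^+ 2 <= (x * q + y * p) ^+ 2.
 have := sqr_ge0 (x * q - y * p).
 have ->: (2 * (a * b)) ^+ 2 = 4 * (a ^+ 2 * b ^+ 2) by ring.
 have ->: (x * q + y * p) ^+ 2 = (x * q - y * p) ^+ 2 + 4 * ((x * p) * (y * q)) by ring.
 lra.
have h6: 2 * (a * b) <= x * q + y * p by move: h5; rewrite ler_pXn2r // nnegrE; lra.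
have ->: (a + b) ^+ 2 = a ^+ 2 + b ^+ 2 + 2 * (a * b) by ring.
lra.
Qed.
(** [W] plays the distribution function of twice the energy: summed over a grid the hypothesis
    telescopes, which bounds all dyadic energies by [C]. *)
Lemma kinetic_le_mass (x: curve R d Omega) (W: R -> R) (C: R) :
 (forall s t, 0 <= s -> s <= t -> t <= 1 -> W s <= W t) -> W 1 - W 0 <= C ->
 (forall s t, 0 <= s -> s <= t -> t <= 1 -> ang (x s) (x t) ^+ 2 <= (t - s) * (W t - W s)) ->
 (kinetic x <= (2^-1 * C)%:E)%E.
move=> mW WC h.
have DC s t: 0 <= s -> s <= t -> t <= 1 -> ang (x s) (x t) ^+ 2 <= C * (t - s).
 move=> s0 st t1; apply: le_trans (h s t s0 st t1) _; rewrite mulrC; apply: ler_wpM2r.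
  by rewrite subr_ge0.
 have := mW 0 s (lexx _) s0 (le_trans st t1); have := mW t 1 (le_trans s0 st) t1 (lexx _); lra.
have DE N: \sum_(k < 2 ^ N) (2 ^ N)%:R * ang (x (gp (2 ^ N) k)) (x (gp (2 ^ N) k.+1)) ^+ 2 <= C.
 have S0: 0 < (2 ^ N)%:R :> R by rewrite ltr0n exp2_gt0.
 apply: (@le_trans _ _ (\sum_(k < 2 ^ N) (W (gp (2 ^ N) k.+1) - W (gp (2 ^ N) k)))).
  apply: ler_sum => k _; have a0: 0 <= gp (2 ^ N) k :> R := gp_ge0 _ _.
  have b1: gp (2 ^ N) k.+1 <= 1 :> R := gp_le1 (exp2_gt0 N) (ltn_ord k).
  have := h _ _ a0 (gp_le (2 ^ N) (leqnSn k)) b1; rewrite gpB => le1.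
  by rewrite mulrC -ler_pdivlMr // mulrC.
 rewrite -(big_mkord xpredT (fun k => W (gp (2 ^ N) k.+1) - W (gp (2 ^ N) k))) telescope_sumr //.
 by rewrite gp0 (gpn (exp2_gt0 N)).
have [q [Lq qc Dq _]] := energy_density (fun s t => ang_ge0 (x s) (x t))
 (fun s t u => ang_triangle dM d0 (x s) (x t) (x u)) (fun s => ang_refl (x s))
 (fun s t => ang_sym (x s) (x t)) DC DE.
apply: le_trans (kinetic_le_controlled dM d0 (conj Lq Dq)) _.
by rewrite lee_fin ler_pM2l.
Qed.
End mass_bound.

(** * Total variation estimates *)

Section variation_estimates.
Context {R : realType} {d : nat} {Omega : ptopologicalType}.
Local Notation M := 'M[R[i]]_d.
Implicit Types A B C : prob R d Omega.
Lemma pairing_le1 A Psi: CbH Psi -> (forall x, frobnorm (Psi x) <= 1) -> `|pairing A Psi| <= 1.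
move=> cP bP; have [g hg] := prob_dens A; have mP := CbH_meas cP.
have iP := pairing_CbH_intg hg cP; have it := hasdens_tr_intg hg.
rewrite (pairing_dens hg mP) -(prob_tr hg); apply: le_trans (le_normr_Rintegral mtop iP) _.
apply: le_Rintegral => //; first exact: integrable_norm.
move=> x _; apply: le_trans (frob_CS_norm _ _) _; rewrite -[leRHS]mulr1.
apply: ler_pM; rewrite ?fnorm_ge0 //; exact: psd_le_tr (hasdens_psd x hg).
Qed.
Lemma dTV_le A B (c: \bar R): (forall Psi, CbH Psi -> (forall x, frobnorm (Psi x) <= 1) ->
 (`|pairing A Psi - pairing B Psi|%:E <= c)%E) -> (dTV A B <= c)%E.
by move=> h; apply: ge_ereal_sup => _ [Psi [cP bP] <-]; exact: h. Qed.
Lemma dTV_ge A B Psi: CbH Psi -> (forall x, frobnorm (Psi x) <= 1) ->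
 (`|pairing A Psi - pairing B Psi|%:E <= dTV A B)%E.
by move=> cP bP; apply: ereal_sup_ubound; exists Psi. Qed.
Lemma dTV_triangle A B C: (dTV A C <= dTV A B + dTV B C)%E.
apply: dTV_le => Psi cP bP.
apply: le_trans (leeD (dTV_ge A B cP bP) (dTV_ge B C cP bP)).
rewrite -EFinD lee_fin; have ->: pairing A Psi - pairing C Psi =
 (pairing A Psi - pairing B Psi) + (pairing B Psi - pairing C Psi) by ring.
exact: ler_normD.
Qed.
Lemma dTV_sym A B: dTV A B = dTV B A.
have h (X Y: prob R d Omega) : (dTV X Y <= dTV Y X)%E.
 by apply: dTV_le => Psi cP bP; rewrite distrC; exact: dTV_ge.
by apply/eqP; rewrite eq_le !h.
Qed.
Lemma dTV_mix (t u: R) A B C: 0 <= t <= 1 -> 0 <= u <= 1 ->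
 (dTV (mix t A C) (mix u B C) <= (2 * `|t - u|)%:E + dTV A B)%E.
move=> t01 u01; apply: dTV_le => Psi cP bP.
apply: (@le_trans _ _ ((2 * `|t - u|)%:E + `|pairing A Psi - pairing B Psi|%:E)%E); last first.
 by rewrite leeD2l //; exact: dTV_ge.
rewrite -EFinD lee_fin !pairing_mix //.
have a1 := pairing_le1 A cP bP; have b1 := pairing_le1 B cP bP; have c1 := pairing_le1 C cP bP.
move: (pairing A Psi) (pairing B Psi) (pairing C Psi) a1 b1 c1 => a b c a1 b1 c1.
have ->: (1 - t) * a + t * c - ((1 - u) * b + u * c) = (t - u) * (c - b) + (1 - t) * (a - b) by ring.
apply: le_trans (ler_normD _ _) _; rewrite !normrM; apply: lerD.
 rewrite mulrC; apply: ler_wpM2r => //; apply: le_trans (ler_normB _ _) _; lra.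
by rewrite ler_piMl // ger0_norm; lra.
Qed.
Lemma dTV_mix0 A B: dTV (mix 0 A B) A = 0%E.
have z01: 0 <= (0: R) <= 1 by lra.
apply/eqP; rewrite eq_le dTV_ge0 andbT; apply: dTV_le => Psi cP bP.
by rewrite pairing_mix // subr0 mul1r mul0r addr0 subrr normr0.
Qed.
(** Uniform continuity by compactness of [0, 1], phrased with the near-covering property. *)
Lemma curve_uniform (G: curve R d Omega) (e: R): 0 < e -> exists2 r: R, 0 < r &
 forall s t, 0 <= s <= 1 -> 0 <= t <= 1 -> `|s - t| < r -> (dTV (G s) (G t) < e%:E)%E.
move=> e0; have e2: 0 < e / 2 by rewrite divr_gt0.
have := @segment_compact R 0 1; rewrite compact_near_coveringP => /(_ R (0: R)^'+
 (fun r x => forall s, 0 <= s <= 1 -> 0 <= x <= 1 -> `|s - x| < r -> (dTV (G s) (G x) < e%:E)%E) _) H.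
have : \forall r \near (0: R)^'+, `[0, 1]%classic `<=` (fun x => forall s, 0 <= s <= 1 -> 0 <= x <= 1 ->
  `|s - x| < r -> (dTV (G s) (G x) < e%:E)%E).
 apply: H => x; rewrite /= in_itv /= => x01.
 have [r r0 hr] := curve_modulus G x01 e2; have r2: 0 < r / 2 by rewrite divr_gt0.
 exists ([set y | `|x - y| < r / 2], [set c : R | c < r / 2]).
  by split => /=; [exact: (nbhsx_ballx x (r / 2) r2)|exact: nbhs_right_lt].
 move=> [y c] /= [yx cr] s s01 y01 sy.
 have l1 := hr y y01 (ltac:(rewrite distrC; lra)).
 have l2: `|s - x| < r.
  have ->: s - x = (s - y) + (y - x) by ring.
  by apply: le_lt_trans (ler_normD _ _) _; rewrite (distrC y); lra.
 have l3 := hr s s01 l2.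
 apply: le_lt_trans (dTV_triangle _ (G x) _) _; rewrite [e]splitr EFinD.
 by rewrite dTV_sym in l1; exact: lteD.
move=> h; have [r [r0 hr]]: exists r, 0 < r /\ `[0, 1]%classic `<=` (fun x => forall s, 0 <= s <= 1 -> 0 <= x <= 1 ->
  `|s - x| < r -> (dTV (G s) (G x) < e%:E)%E).
 have := @filter_ex _ _ _ _ (filterI h (nbhs_right_gt (0: R))).
 by move=> [r [h1 h2]]; exists r.
by exists r => // s t s01 t01 st; apply: hr => //=; rewrite in_itv.
Qed.
End variation_estimates.

(** * The recovery curve *)

Section recovery_curve.
Context {R : realType} {d : nat} {Omega : ptopologicalType}.
Variables (G: curve R d Omega) (L: prob R d Omega) (dl: R).
Hypotheses (dl0: 0 < dl) (dl4: 4 * dl <= 1).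
Definition tau (t: R): R := Num.min (Num.min t (1 - t)) dl.
(** The time change rests at 0 and at 1 during the first and last [dl] and runs through [0, 1] in
    between. So near the ends only the mixing weight moves, and in the middle only the curve, at
    constant weight [dl]. *)
Definition warp (t: R): R := clamp ((t - dl) / (1 - 2 * dl)).
Lemma tau_bounds t: 0 <= t <= 1 -> 0 <= tau t <= 1 /\ tau t <= dl.
move=> /andP[t0 t1]; split; last by rewrite /tau ge_min lexx orbT.
by rewrite /tau !le_min !ge_min t0 t1 (ltW dl0) subr_ge0 t1.
Qed.
Lemma tau_lip s t: `|tau s - tau t| <= `|s - t|.
have mm (a b c e k: R) : `|a - b| <= k -> `|c - e| <= k -> `|Num.min a c - Num.min b e| <= k.
 rewrite !ler_norml => /andP[h1 h2] /andP[h3 h4].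
 by rewrite /Order.min; case: ltP => ?; case: ltP => ?; apply/andP; split; lra.
rewrite /tau; apply: (mm); last by rewrite subrr normr0.
apply: mm => //; rewrite (_: 1 - s - (1 - t) = - (s - t)) ?normrN //; ring.
Qed.
Let den0: 0 < 1 - 2 * dl. Proof. by have h0 := dl0; have h4 := dl4; lra. Qed.
Lemma warp01 t: 0 <= warp t <= 1. Proof. exact: clamp01. Qed.
Lemma warp_lip s t: `|warp s - warp t| <= 2 * `|s - t|.
apply: le_trans (clamp_lip _ _) _; rewrite -mulrBl (_: s - dl - (t - dl) = s - t); last by ring.
rewrite normrM normfV (ger0_norm (ltW den0)) mulrC ler_wpM2r //.
by have h4 := dl4; rewrite -[leRHS]invrK lef_pV2 ?posrE ?invr_gt0 //; lra.
Qed.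
Lemma warp_near t: 0 <= t <= 1 -> `|warp t - t| <= 2 * dl.
move=> t01; rewrite -{2}(clamp_id t01); apply: le_trans (clamp_lip _ _) _.
have n0: 1 - 2 * dl != 0 by rewrite gt_eqF.
have ->: (t - dl) / (1 - 2 * dl) - t = dl * ((2 * t - 1) / (1 - 2 * dl)) by field.
rewrite normrM (ger0_norm (ltW dl0)) mulrC ler_wpM2r ?(ltW dl0) //.
rewrite normrM normfV (ger0_norm (ltW den0)) ler_pdivrMr //.
by case/andP: t01 => t0 t1; have h4 := dl4; rewrite ler_norml; apply/andP; split; lra.
Qed.
Definition recovery_fun t: prob R d Omega := mix (tau t) (G (warp t)) L.
Lemma recovery_close t (e: R): 0 <= t <= 1 -> (dTV (G (warp t)) (G t) <= e%:E)%E ->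
 (dTV (recovery_fun t) (G t) <= (2 * dl + e)%:E)%E.
move=> t01 h; have [tb td] := tau_bounds t01; have z01: 0 <= (0: R) <= 1 by lra.
apply: le_trans (dTV_triangle _ (mix 0 (G t) L) _) _; rewrite dTV_mix0 adde0.
apply: le_trans (dTV_mix _ _ _ tb z01) _; rewrite subr0 EFinD; apply: leeD => //.
by rewrite lee_fin ger0_norm; [lra|case/andP: tb].
Qed.
Lemma recovery_continuous: forall t, t \in `[0, 1] ->
 dTV (recovery_fun s) (recovery_fun t) @[s --> within `[0, 1] (nbhs t)] --> 0%E.
move=> t; rewrite in_itv /= => t01; have [tb td] := tau_bounds t01.
have key (e: R) : 0 < e -> \forall s \near within `[0, 1] (nbhs t),
  (dTV (recovery_fun s) (recovery_fun t) <= e%:E)%E.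
 move=> e0; have e2: 0 < e / 2 by rewrite divr_gt0.
 have [r r0 hr] := curve_modulus G (warp01 t) e2.
 have k0: 0 < Num.min (r / 2) (e / 4) by rewrite lt_min !divr_gt0.
 exists (Num.min (r / 2) (e / 4)) => //= s ts; rewrite in_itv /= => s01.
 have [sb sd] := tau_bounds s01; have tl := tau_lip s t; have wl := warp_lip s t.
 move: ts; rewrite /ball /= lt_min distrC => /andP[s1 s2].
 apply: le_trans (dTV_mix _ _ _ sb tb) _; rewrite [in leRHS](splitr e) EFinD; apply: leeD.
  by rewrite lee_fin; lra.
 by apply: ltW; apply: hr; [exact: warp01|lra].
apply/fine_cvgP; split.
 near=> s; rewrite ge0_fin_numE ?dTV_ge0 //; apply: (@le_lt_trans _ _ 1%:E); last by rewrite ltry.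
 by near: s; exact: key.
apply/cvgrPdist_le => e e0; near=> s; rewrite sub0r normrN /=.
have h: (dTV (recovery_fun s) (recovery_fun t) <= e%:E)%E by near: s; exact: key.
have f: dTV (recovery_fun s) (recovery_fun t) \is a fin_num.
 by rewrite ge0_fin_numE ?dTV_ge0 //; apply: le_lt_trans h _; rewrite ltry.
by rewrite ger0_norm ?fine_ge0 ?dTV_ge0 // -lee_fin fineK.
Unshelve. all: by end_near. Qed.
Definition recovery: curve R d Omega := Curve recovery_continuous.
Lemma recovery_ends: eq_measure (recovery 0) (G 0) /\ eq_measure (recovery 1) (G 1).
have w0: warp 0 = 0.
 by rewrite /warp /clamp ifT // sub0r mulNr oppr_le0 divr_ge0 // ltW.
have w1: warp 1 = 1.
 have d2: 1 <= (1 - dl) / (1 - 2 * dl) by rewrite ler_pdivlMr //; have h0 := dl0; lra.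
 by rewrite /warp /clamp ifN -?ltNge ?(lt_le_trans ltr01 d2) // ifT.
have t0: tau 0 = 0.
 by apply/eqP; rewrite eq_le /tau !ge_min !le_min lexx subr0 ler01 (ltW dl0).
have t1: tau 1 = 0.
 by apply/eqP; rewrite eq_le /tau !ge_min !le_min subrr lexx ler01 (ltW dl0) !orbT.
have z01: 0 <= (0: R) <= 1 by lra.
have e0 A: eq_measure (mix 0 A L) A.
 by move=> N mN; rewrite mixE // subr0 rmorph1 scale1r rmorph0 scale0r addr0.
by split; rewrite /= /recovery_fun ?w0 ?w1 ?t0 ?t1; exact: e0.
Qed.
End recovery_curve.

(** * Distribution function of the energy of the recovery curve *)

Section profile.
Context {R : realType}.
Local Notation lb := (@lebesgue_measure R).
Local Notation intg D f := (lb.-integrable D (EFin \o f)).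
Variable dl : R.
Hypotheses (dl0: 0 < dl) (dl4: 4 * dl <= 1).
Let den: 0 < 1 - 2 * dl. Proof. by have h0 := dl0; have h4 := dl4; lra. Qed.
Lemma clamp_mono (a b: R): a <= b -> clamp a <= clamp b.
move=> ab; rewrite /clamp; case: (leP a 0) => ?; case: (leP b 0) => ?;
 case: (leP 1 a) => ?; case: (leP 1 b) => ?; lra.
Qed.
Lemma warp_mono s t: s <= t -> warp dl s <= warp dl t.
by move=> st; apply: clamp_mono; rewrite ler_pM2r ?invr_gt0 // lerD2r. Qed.
Lemma warp_low t: t <= dl -> warp dl t = 0.
by move=> h; rewrite /warp /clamp ifT // pmulr_lle0 ?invr_gt0 // subr_le0. Qed.
Lemma warp_high t: 1 - dl <= t -> warp dl t = 1.
move=> h; have h1: 1 <= (t - dl) / (1 - 2 * dl) by rewrite ler_pdivlMr //; lra.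
by rewrite /warp /clamp ifN -?ltNge ?(lt_le_trans ltr01 h1) // ifT.
Qed.
Lemma warp_mid t: dl <= t -> t <= 1 - dl -> warp dl t = (t - dl) / (1 - 2 * dl).
have dn := den => t0 t1; rewrite /warp clamp_id //; apply/andP; split.
 by apply: divr_ge0; [rewrite subr_ge0|exact: ltW].
by rewrite ler_pdivrMr //; lra.
Qed.
Lemma tau_low t: t <= dl -> tau dl t = t.
move=> h; have h0 := dl0; have h4 := dl4; rewrite /tau (min_l (_: t <= 1 - t)); last by lra.
exact: min_l.
Qed.
Lemma tau_mid t: dl <= t -> t <= 1 - dl -> tau dl t = dl.
by move=> h1 h2; rewrite /tau; apply: min_r; rewrite le_min h1; lra. Qed.
Lemma tau_high t: 1 - dl <= t -> tau dl t = 1 - t.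
move=> h; have h0 := dl0; have h4 := dl4; rewrite /tau (min_r (_: 1 - t <= t)); last by lra.
by apply: min_l; lra.
Qed.
Variables (c: R) (VA VB J: R -> R).
Hypotheses (c0: 0 <= c) (VAm: forall a b, 0 <= a -> a <= b -> VA a <= VA b)
 (VBm: forall a b, 0 <= a -> a <= b -> VB a <= VB b) (Jm: forall a b, 0 <= a -> a <= b -> J a <= J b).
(** The mass spent up to time [t]: [VA] on the first end, the warped energy [J] in the middle, and
    [VB] on the last end, where it is counted backwards from the end time. *)
Definition profile t := VA (Num.min t dl) + c * J (warp dl t) + (VB dl - VB (Num.min (1 - t) dl)).
Lemma profile_mono s t: 0 <= s -> s <= t -> t <= 1 -> profile s <= profile t.
move=> s0 st t1; have h0 := dl0.
have e1: VA (Num.min s dl) <= VA (Num.min t dl).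
 by apply: VAm; rewrite ?le_min ?s0 ?(ltW h0) // !ge_min st lexx orbT.
have e2: c * J (warp dl s) <= c * J (warp dl t).
 apply: ler_wpM2l => //; apply: Jm; last exact: warp_mono.
 by have /andP[] := warp01 dl s.
have e3: VB (Num.min (1 - t) dl) <= VB (Num.min (1 - s) dl).
 by apply: VBm; rewrite ?le_min ?subr_ge0 ?t1 ?(ltW h0) // !ge_min lerD2l lerN2 st lexx orbT.
by rewrite /profile; lra.
Qed.
Lemma profile_low t: t <= dl -> profile t = VA t + c * J 0.
move=> h; have h0 := dl0; have h4 := dl4; rewrite /profile warp_low // (min_l h).
by rewrite (min_r (_: dl <= 1 - t)) ?subrr ?addr0 //; lra.
Qed.
Lemma profile_mid t: dl <= t -> t <= 1 - dl -> profile t = VA dl + c * J (warp dl t).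
move=> h h'; rewrite /profile (min_r h).
by rewrite (min_r (_: dl <= 1 - t)) ?subrr ?addr0 //; lra.
Qed.
Lemma profile_high t: 1 - dl <= t -> profile t = VA dl + c * J 1 + (VB dl - VB (1 - t)).
move=> h; have h0 := dl0; have h4 := dl4; rewrite /profile warp_high //.
by rewrite (min_r (_: dl <= t)) ?(min_l (_: 1 - t <= dl)) //; lra.
Qed.
(** Cuts an arbitrary interval at [dl] and [1 - dl]. *)
Lemma profile_cover (good: R -> R -> Prop) :
 (forall s u t, 0 <= s -> s <= u -> u <= t -> t <= 1 -> good s u -> good u t -> good s t) ->
 (forall s t, 0 <= s -> s <= t -> t <= dl -> good s t) ->
 (forall s t, dl <= s -> s <= t -> t <= 1 - dl -> good s t) ->
 (forall s t, 1 - dl <= s -> s <= t -> t <= 1 -> good s t) ->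
 forall s t, 0 <= s -> s <= t -> t <= 1 -> good s t.
move=> cat left middle right; have h0 := dl0; have h4 := dl4.
have mid s t: dl <= s -> s <= t -> t <= 1 -> good s t.
 move=> s0 st t1; have [td|td] := leP t (1 - dl); first exact: middle.
 have [sd|sd] := leP (1 - dl) s; first exact: right.
 apply: (@cat s (1 - dl) t); [lra|exact: ltW|exact: ltW|exact: t1| |].
  by apply: middle => //; exact: ltW.
 by apply: right => //; exact: ltW.
move=> s t s0 st t1; have [td|td] := leP t dl; first exact: left.
have [sd|sd] := leP dl s; first exact: mid.
apply: (@cat s dl t); [exact: s0|exact: ltW|exact: ltW|exact: t1| |].
 by apply: left => //; exact: ltW.
by apply: mid => //; exact: ltW.
Qed.
Lemma Rint_ends (f g: R -> R) e: intg setT f -> intg setT g ->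
 intg setT (fun t => 2 * f t + 2 * g t + e * ind01 t) /\
 \int[lb]_t (2 * f t + 2 * g t + e * ind01 t) = 2 * \int[lb]_t f t + 2 * \int[lb]_t g t + e.
move=> i_f ig; have i1 := intgZ 2 mtop i_f; have i2 := intgZ 2 mtop ig.
have i3 := intgD mtop i1 i2; have i4 := intgZ e mtop (@intg_ind01 R).
split; first exact: intgD mtop i3 i4.
rewrite (RintegralD mtop i3 i4) (RintegralD mtop i1 i2).
rewrite (RintegralZl 2 mtop i_f) (RintegralZl 2 mtop ig).
rewrite (RintegralZl e mtop (@intg_ind01 R)); congr (_ + _).
rewrite (_: \int[lb]_t ind01 t = 1) ?mulr1 //.
by rewrite -Rintegral_mkcond; have := @Rintegral_cst_oc R 1 0 1 ler01; rewrite subr0 mulr1.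
Qed.
Lemma iint_lower (q: R -> R) (k s t: R): intg setT q -> 0 <= k -> 0 <= s -> s <= t -> t <= 1 ->
 (forall u, s < u <= t -> k <= q u) -> k * (t - s) <= iint q s t.
move=> iq k0 s0 st t1 h; rewrite -((L2fun_cst k0).2 s t s0 st t1); apply: le_Rintegral => //.
- exact: (intg_itv `]s, t] (intgZ k mtop (@intg_ind01 R))).
- exact: (intg_itv `]s, t] iq).
move=> u; rewrite /= in_itv /= => /andP[u0 u1].
by rewrite ind01_in ?mulr1 ?(le_lt_trans s0 u0) ?(le_trans u1 t1) // h // u0.
Qed.
Lemma iint_from0 (q: R -> R) a b: intg setT q -> (forall x, 0 <= q x) -> 0 <= a -> a <= b ->
 iint q 0 a <= iint q 0 b.
by move=> iq q0 a0 ab; apply: iint_mono. Qed.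
Lemma iint_nil (q: R -> R): iint q 0 0 = 0.
by rewrite /iint set_itvoc0 // Rintegral_set0. Qed.
End profile.

(** * Energy and Fisher information of the recovery curve *)

Section recovery_energy.
Context {R : realType} {d : nat} {Omega : ptopologicalType}.
Local Notation M := 'M[R[i]]_d.
Local Notation lb := (@lebesgue_measure R).
Variable dist : Omega -> Omega -> R.
Hypothesis dM : metrizes dist.
Variable Lam : finmeas R Omega.
Hypotheses (d0: (0 < d)%N) (hL: ((d%:R)%:E * Lam setT = 1)%E).
Local Notation L0 := (ref_prob d0 hL).
Definition end_density (w: borel Omega -> R) (g: borel Omega -> M) (x: R): R :=
 16 * (res_path Lam w g true x + ind01 x).

Section one_end.
Variables (mu: finmeas R Omega) (w: borel Omega -> R).
Variables (A: prob R d Omega) (g: borel Omega -> M).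
Hypothesis rep : @represents R d Omega Lam d0 hL mu w A g.
Hypothesis ires : intg lb setT (res_path Lam w g true).
Local Notation q := (end_density w g).
Lemma end_density_ge0 x: 0 <= q x.
by rewrite mulr_ge0 // addr_ge0 ?ind01_ge0 //; exact: res_path_ge0 rep _ _. Qed.
Lemma end_density_intg: intg lb setT q.
by apply: intgZ => //; apply: intgD => //; exact: intg_ind01. Qed.
Let affine16_le (a b: R): a <= b -> 16 * (a + 1) <= 16 * (b + 1).
by move=> ?; lra. Qed.
(** [ang_mix_ref] is based at the later time [t], which is positive even if [s = 0]. As the
    resolvent decreases in time, its value at [t] is below all values on []s, t]], so one factor
    [t - s] becomes an integral. *)
Lemma end_bound s t: 0 <= s -> s <= t -> t <= 2^-1 ->
 ang (mix s A L0) (mix t A L0) ^+ 2 <= (t - s) * (iint q 0 t - iint q 0 s).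
move=> s0 st t2; have iq := end_density_intg; have q0 := end_density_ge0.
rewrite iint_neg //; move: st; rewrite le_eqVlt => /orP[/eqP <-|st].
 by rewrite ang_refl expr0n /= subrr mul0r.
have t0: 0 < t by exact: le_lt_trans st.
have s1: s <= 1 by lra.
rewrite ang_sym; apply: le_trans (ang_mix_ref rep t0 t2 s0 s1) _.
have ->: 16 * ((s - t) ^+ 2 * (fine (res Lam w g t) + 1)) =
  (t - s) * ((16 * (fine (res Lam w g t) + 1)) * (t - s)) by ring.
apply: ler_wpM2l; first by rewrite subr_ge0 ltW.
have f0: 0 <= fine (res Lam w g t) by apply: fine_ge0; exact: (res_ge0 rep).
apply: iint_lower => //; [lra|exact: ltW|lra|].
move=> u /andP[su ut]; have u0: 0 < u by exact: le_lt_trans su.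
have u1: u < 1 by lra.
have i1: ind01 u = 1 by apply: ind01_in; rewrite u0 ltW.
have r1: res_path Lam w g true u = fine (res Lam w g u) by rewrite /res_path u0 u1.
have E: end_density w g u = 16 * (fine (res Lam w g u) + 1) by rewrite /end_density i1 r1.
rewrite E; apply: affine16_le; apply: fine_le; [exact: (res_fin rep)|exact: (res_fin rep)|].
exact: (res_anti rep).
Qed.
End one_end.
Variables (G: curve R d Omega) (m: R -> R).
Hypothesis cm : controlled G m.
Variables (muA muB: finmeas R Omega) (wA wB: borel Omega -> R).
Variables (gA gB: borel Omega -> M).
Hypotheses (repA: @represents R d Omega Lam d0 hL muA wA (G 0) gA)
 (repB: @represents R d Omega Lam d0 hL muB wB (G 1) gB).
Hypotheses (iA: forall b, intg lb setT (res_path Lam wA gA b))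
 (iB: forall b, intg lb setT (res_path Lam wB gB b)).
Variable dl : R.
Hypotheses (dl0: 0 < dl) (dl4: 4 * dl <= 1).
Let X := recovery G L0 dl0 dl4.
Let VA u := iint (end_density wA gA) 0 u.
Let VB u := iint (end_density wB gB) 0 u.
Let J u := iint (fun x => m x * m x) 0 u.
Let c := (1 - 2 * dl)^-1.
Let XE t: X t = mix (tau dl t) (G (warp dl t)) L0. Proof. by []. Qed.
Let den: 0 < 1 - 2 * dl. Proof. by have h0 := dl0; have h4 := dl4; lra. Qed.
Let c0: 0 <= c. Proof. by rewrite invr_ge0 ltW. Qed.
Let imm: intg lb setT (fun x => m x * m x). Proof. by have [[]] := cm. Qed.
Let mm0 x: 0 <= m x * m x. Proof. by have [[_ h _ _] _] := cm; rewrite mulr_ge0. Qed.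
Let VAm a b: 0 <= a -> a <= b -> VA a <= VA b.
by apply: iint_from0; [exact: end_density_intg|exact: end_density_ge0 repA]. Qed.
Let VBm a b: 0 <= a -> a <= b -> VB a <= VB b.
by apply: iint_from0; [exact: end_density_intg|exact: end_density_ge0 repB]. Qed.
Let Jm a b: 0 <= a -> a <= b -> J a <= J b.
exact: iint_from0. Qed.
Let left_bound s t: 0 <= s -> s <= t -> t <= dl ->
 ang (X s) (X t) ^+ 2 <= (t - s) * (VA t - VA s).
move=> s0 st td; have sd := le_trans st td; have h0 := dl0; have h4 := dl4; have t2: t <= 2^-1 by lra.
rewrite !XE !(tau_low dl0 dl4) // !(warp_low dl0 dl4) //.
exact: (end_bound repA (iA true)).
Qed.
(** Mixing both measures with the same weight contracts the angle; the slower clock contributes the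
    factor [c], which tends to 1 with [dl]. *)
Let mid_bound s t: dl <= s -> s <= t -> t <= 1 - dl ->
 ang (X s) (X t) ^+ 2 <= (t - s) * (c * (J (warp dl t) - J (warp dl s))).
move=> s0 st td; have sd := le_trans st td; have t0 := le_trans s0 st; have h0 := dl0; have h4 := dl4.
rewrite !XE !tau_mid //.
have dl01: 0 <= dl <= 1 by apply/andP; split; lra.
have a1: ang (mix dl (G (warp dl s)) L0) (mix dl (G (warp dl t)) L0) ^+ 2 <= ang (G (warp dl s)) (G (warp dl t)) ^+ 2.
 by rewrite ler_pXn2r ?nnegrE ?ang_ge0 //; exact: ang_mix.
apply: le_trans a1 _; have /andP[ws0 ws1] := warp01 dl s; have /andP[wt0 wt1] := warp01 dl t.
have wst := warp_mono dl0 dl4 st.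
have [h _] := controlled_sqr cm (lexx _) ws0 wst wt1; apply: le_trans h _.
have jE := iint_neg imm ws0 wst; rewrite mulrA.
have ->: (t - s) * c = warp dl t - warp dl s.
 by rewrite (warp_mid dl0 dl4 s0 sd) (warp_mid dl0 dl4 t0 td) -mulrBl /c; congr (_ * _); ring.
by rewrite -jE.
Qed.
Let right_bound s t: 1 - dl <= s -> s <= t -> t <= 1 ->
 ang (X s) (X t) ^+ 2 <= (t - s) * (VB (1 - s) - VB (1 - t)).
move=> s0 st t1; have t0 := le_trans s0 st; have h0 := dl0; have h4 := dl4.
have s2: 1 - s <= 2^-1 by lra.
rewrite !XE !(tau_high dl0 dl4) // !(warp_high dl0 dl4) // ang_sym.
have ->: t - s = (1 - s) - (1 - t) by ring.
by apply: (end_bound repB (iB true)); rewrite ?subr_ge0 ?lerD2l ?lerN2.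
Qed.
(** The estimates on the three intervals are combined through [profile]; both end terms are
    integrals over [[0, dl]] and vanish with [dl]. *)
Lemma kinetic_recovery :
 (kinetic X <= (2^-1 * (VA dl + VB dl + c * \int[lb]_x (m x * m x)))%:E)%E.
move: left_bound mid_bound right_bound; have VA0: VA 0 = 0 := iint_nil _; have J0: J 0 = 0 := iint_nil _.
have VB0: VB 0 = 0 := iint_nil _.
have J1: J 1 <= \int[lb]_x (m x * m x) by exact: le_iint_total.
have cJ := ler_wpM2l c0 J1.
move: VAm VBm Jm VA0 VB0 J0 cJ => VAm' VBm' Jm' VA0 VB0 J0 cJ lbd mbd rbd.
have Wm := profile_mono dl0 dl4 c0 VAm' VBm' Jm'.
have h0 := dl0; have h4 := dl4.
apply: (kinetic_le_mass dM d0 Wm).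
 rewrite (profile_low dl0 dl4 _ _ _ _ (ltW dl0)) (profile_high dl0 dl4); last by lra.
 by rewrite subrr VA0 VB0 J0; lra.
apply: (profile_cover dl0 dl4).
- move=> s u t s0 su ut t1 h1 h2; have w1 := Wm s u s0 su (le_trans ut t1).
 have w2 := Wm u t (le_trans s0 su) ut t1; move: (profile _ _ _ _ _ s) (profile _ _ _ _ _ u) (profile _ _ _ _ _ t) w1 w2 h1 h2 => a b e w1 w2 h1 h2.
 have ->: t - s = (u - s) + (t - u) by ring.
 have ->: e - a = (b - a) + (e - b) by ring.
 apply: (sqr_concat (ang_ge0 (X s) (X u)) (ang_ge0 (X u) (X t)) _ _ _ _ h1 h2); rewrite ?subr_ge0 ?ang_ge0 //.
 exact: (ang_triangle dM d0).
- move=> s t s0 st td; rewrite !(profile_low dl0 dl4) // ?(le_trans st) //.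
 by rewrite opprD addrACA subrr addr0; exact: lbd.
- move=> s t s0 st td; rewrite !profile_mid // ?(le_trans st td) ?(le_trans s0 st) //.
 by rewrite opprD addrACA subrr add0r -mulrBr; exact: mbd.
move=> s t s0 st t1; rewrite !(profile_high dl0 dl4) // ?(le_trans s0 st) //.
by rewrite opprD addrACA subrr add0r opprB addrACA addrC addrA subrK; rewrite addrC; exact: rbd.
Qed.
Let half (t e: R): 4 * e <= 1 -> 0 < e -> t <= e -> t <= 2^-1. Proof. by move=> ? ? ?; lra. Qed.
Let half' (t e: R): 1 - e <= t -> 1 - t <= e. Proof. by move=> ?; lra. Qed.
Let le1 (e: R): 4 * e <= 1 -> 0 < e -> e <= 1. Proof. by move=> ? ?; lra. Qed.
Let boundA (x y e: R): 0 <= y -> 0 <= e -> 2 * x <= 2 * x + 2 * y + e.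
by move=> ? ?; lra. Qed.
Let boundB (x y e: R): 0 <= y -> 0 <= e -> 2 * x <= 2 * y + 2 * x + e.
by move=> ? ?; lra. Qed.
(** Near the ends the weight is the distance in time to the end, and the resolvent bound is
    integrable because of the entropy. In the middle the weight is [dl], with bound [1/dl]. *)
Lemma fisher_recovery: (fisher_path Lam X <=
 (2 * \int[lb]_t res_path Lam wA gA true t + 2 * \int[lb]_t res_path Lam wB gB false t + dl^-1)%:E)%E.
have h0 := dl0; have h4 := dl4.
pose f t := 2 * res_path Lam wA gA true t + 2 * res_path Lam wB gB false t.
pose h t := f t + dl^-1 * @ind01 R t.
have rA0 := res_path_ge0 repA; have rB0 := res_path_ge0 repB.
have [ih hE] := Rint_ends dl^-1 (iA true) (iB false).
rewrite -hE (@EFin_Rintegral _ _ _ _ setT _ mtop ih) /fisher_path [leLHS]integral_mkcond.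
apply: (@ae_le_integral_any _ _ _ lb _ (fun t => (h t)%:E)); first by apply/mEFinP; exact: intg_mfun ih.
move: (ae_neq (0: R)) (ae_neq (1: R)); apply: filterS2 => t n0 n1.
have f0: 0 <= f t by rewrite /f addr_ge0 ?mulr_ge0.
rewrite patchE; case: ifPn => [|_]; last first.
 by rewrite lee_fin /h addr_ge0 // mulr_ge0 ?ind01_ge0 // invr_ge0 ltW.
move=> /set_mem; rewrite /= in_itv /= => /andP[t0 t1].
have tp: 0 < t by rewrite lt_neqAle eq_sym n0.
have t1': t < 1 by rewrite lt_neqAle n1.
have hind: h t = f t + dl^-1 by rewrite /h ind01_in ?mulr1 // tp t1.
have t01: 0 < t < 1 by rewrite tp.
have dV: 0 <= dl^-1 by rewrite invr_ge0 ltW.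
rewrite hind; have [td|td] := leP t dl.
 rewrite (tau_low dl0 dl4) // (warp_low dl0 dl4) //.
 have t2 := half h4 h0 td.
 apply: le_trans (fisher_mix_res repA tp t2) _.
 rewrite -(fineK (res_fin repA tp)) -EFinM lee_fin /f /res_path t01 /=.
 by have := rB0 false t; rewrite /res_path t01 => r0; apply: boundA.
have [ud|ud] := leP (1 - dl) t.
 have u3: 0 < 1 - t by rewrite subr_gt0.
 have u4 := half h4 h0 (half' ud).
 rewrite (tau_high dl0 dl4) // (warp_high dl0 dl4) //.
 apply: le_trans (fisher_mix_res repB u3 u4) _.
 rewrite -(fineK (res_fin repB u3)) -EFinM lee_fin /f /res_path t01 /=.
 by have := rA0 true t; rewrite /res_path t01 => r0; apply: boundB.
rewrite (tau_mid (ltW td) (ltW ud)).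
apply: le_trans (fisher_mix_le d0 hL _ h0 (le1 h4 h0)) _.
by rewrite lee_fin lerDr.
Qed.
End recovery_energy.

(** * Limits of sequences *)

Section limits.
Context {R : realType}.
Lemma le_limn_einf (x: \bar R) (u: (\bar R)^nat) :
 (forall c: R, (limn_einf u < c%:E)%E -> (x <= c%:E)%E) -> (x <= limn_einf u)%E.
case: (limn_einf u) => [r h| _ |h]; [|exact: leey|].
 apply/lee_addgt0Pr => e e0; rewrite -EFinD; apply: h.
 by rewrite lte_fin ltrDl.
case: x h => [r h| h |//].
 by have := h (r - 1) (ltNyr _); rewrite lee_fin => ?; exfalso; lra.
by have := h 0 (ltNyr _).
Qed.
(** Transfers the endpoint constraint to the limit when it is known for infinitely many indices
    only. *)
Lemma frequently_limit (u: R^nat) (l a: R): u @ \oo --> l ->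
 (forall N, exists2 n, (N <= n)%N & u n = a) -> l = a.
move=> ul fr; apply/eqP/negPn/negP => la.
have p: 0 < `|l - a| by rewrite normr_gt0 subr_eq0.
have /cvgrPdist_lt /(_ _ p) [N _ hN] := ul.
by have [n Nn ua] := fr N; have := hN n Nn; rewrite /= ua ltxx.
Qed.
Lemma iint_vanishes (q: R -> R) (v: R^nat) :
 (@lebesgue_measure R).-integrable setT (EFin \o q) -> v @ \oo --> 0 ->
 (fun n => iint q 0 (v n)) @ \oo --> 0.
move=> iq v0.
have h := parameterized_integral_cvg_left (@ltr01 R) (intg_itv `[0, 1] iq).
rewrite (_: (fun n => iint q 0 (v n)) = (fun x => parameterized_integral lebesgue_measure 0 x q) \o v).
 exact: cvg_comp v0 h.
by apply/funext => n; rewrite /= /parameterized_integral iint_cc.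
Qed.
(** One summand for each branch of the minimum; both vanish with [e]. *)
Lemma sqr_div_min (e: R): 0 < e -> e ^+ 2 * (Num.min e 4^-1)^-1 <= e + 4 * e ^+ 2.
move=> e0; have [h|h] := leP e 4^-1.
 by rewrite expr2 mulfK ?gt_eqF // lerDl mulr_ge0 // mulr_ge0 // ltW.
by rewrite invrK mulrC lerDr ltW.
Qed.
Lemma penalty_le (k a e: R): 0 < e ->
 (k%:E + (e ^+ 2 / 2)%:E * (a + (Num.min e 4^-1)^-1)%:E <=
  (k + e ^+ 2 / 2 * a + 2^-1 * (e + 4 * e ^+ 2))%:E)%E.
move=> e0; rewrite -EFinM -EFinD lee_fin mulrDr addrA lerD2l; have := sqr_div_min e0.
move: (e ^+ 2) (Num.min _ _)^-1 => x y h; rewrite mulrAC mulrC; exact: ler_wpM2l.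
Qed.
Lemma penalty_cvg (A B v e: R^nat) (K a: R): A @ \oo --> 0 -> B @ \oo --> 0 ->
 v @ \oo --> 0 -> e @ \oo --> 0 ->
 (fun n => 2^-1 * (A n + B n + (1 - 2 * v n)^-1 * K) + e n ^+ 2 / 2 * a +
  2^-1 * (e n + 4 * e n ^+ 2)) @ \oo --> 2^-1 * K.
move=> Ac Bc vc ec.
have e2c: (fun n => e n ^+ 2) @ \oo --> 0.
 rewrite (_: (fun n => _) = (fun n => e n * e n)); last by apply/funext => n; rewrite expr2.
 by rewrite -[X in _ --> X](mulr0 0); exact: cvgM.
have vi: (fun n => (1 - 2 * v n)^-1) @ \oo --> (1: R).
 rewrite -[X in _ --> X]invr1; apply: cvgV; first exact: oner_neq0.
 rewrite -[X in _ --> X]subr0 -[X in _ - X](mulr0 2); apply: cvgB; first exact: cvg_cst.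
 by apply: cvgM; [exact: cvg_cst|exact: vc].
have ->: 2^-1 * K = 2^-1 * (0 + 0 + 1 * K) + 0 / 2 * a + 2^-1 * (0 + 4 * 0).
 by rewrite !(mul0r, mulr0, addr0, add0r, mul1r).
have c1: (fun n => (1 - 2 * v n)^-1 * K) @ \oo --> 1 * K by apply: cvgM vi (cvg_cst _).
have c2: (fun n => 2^-1 * (A n + B n + (1 - 2 * v n)^-1 * K)) @ \oo --> 2^-1 * (0 + 0 + 1 * K).
 by apply: cvgM; [exact: cvg_cst|apply: cvgD => //; exact: cvgD].
have c3: (fun n => e n ^+ 2 / 2 * a) @ \oo --> 0 / 2 * a.
 by apply: cvgM; [apply: cvgM => //; exact: cvg_cst|exact: cvg_cst].
have c4: (fun n => 2^-1 * (e n + 4 * e n ^+ 2)) @ \oo --> (2^-1 * (0 + 4 * 0) : R).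
 apply: cvgM; first exact: cvg_cst.
 by apply: cvgD => //; apply: cvgM => //; exact: cvg_cst.
by apply: cvgD => //; exact: cvgD.
Qed.
End limits.

(** * The two inequalities *)

Section gamma.
Context {R : realType} {d : nat} {Omega : ptopologicalType}.
Local Notation M := 'M[R[i]]_d.
Local Notation lb := (@lebesgue_measure R).
Variable dist : Omega -> Omega -> R.
Hypothesis dM : metrizes dist.
Variable Lam : finmeas R Omega.
Hypotheses (d0: (0 < d)%N) (hL: ((d%:R)%:E * Lam setT = 1)%E).
Variables G0 G1 : prob R d Omega.
Let Phi_ (eps: R) (G: curve R d Omega): \bar R :=
 (kinetic G + (eps ^+ 2 / 2)%:E * fisher_path Lam G + iota_endpoints G0 G1 G)%E.
Let Phi (G: curve R d Omega): \bar R := (kinetic G + iota_endpoints G0 G1 G)%E.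
Lemma fisher_path_ge0 (G: curve R d Omega): (0 <= fisher_path Lam G)%E.
by apply: integral_ge0 => t _; exact: fisher_nonneg. Qed.
Lemma iota_ge0 (G: curve R d Omega): (0 <= iota_endpoints G0 G1 G)%E.
by rewrite /iota_endpoints; case: ifP. Qed.
Lemma penalized_ge0 eps (G: curve R d Omega) :
 (0 <= kinetic G + (eps ^+ 2 / 2)%:E * fisher_path Lam G)%E.
apply: adde_ge0; first exact: kinetic_ge0.
by apply: mule_ge0; [rewrite lee_fin divr_ge0 ?sqr_ge0|exact: fisher_path_ge0].
Qed.
Lemma penalized_lt eps (G: curve R d Omega) c: (Phi_ eps G < c%:E)%E ->
 [/\ (kinetic G <= c%:E)%E, eq_measure (G 0) G0 & eq_measure (G 1) G1].
move=> h; have p0 := penalized_ge0 eps G.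
have f0: (0 <= (eps ^+ 2 / 2)%:E * fisher_path Lam G)%E.
 by apply: mule_ge0; [rewrite lee_fin divr_ge0 ?sqr_ge0|exact: fisher_path_ge0].
have kc: (kinetic G <= c%:E)%E.
 apply: ltW; apply: le_lt_trans h; rewrite /Phi_.
 by apply: le_trans (leeDl _ (iota_ge0 G)); exact: leeDl.
case: (pselect (eq_measure (G 0) G0 /\ eq_measure (G 1) G1)) => [[]//|n].
move: h; rewrite /Phi_ /iota_endpoints asboolF // addey ?ltNge ?leey //.
by rewrite gt_eqF // (lt_le_trans _ p0) // ltNy0.
Qed.
(** Below a finite level the penalised functional bounds the kinetic energy and fixes the end points
    for infinitely many indices; both properties pass to narrow limits. *)
Lemma penalized_liminf (th: Omega -> R) (eps: R^nat) (Gn: nat -> curve R d Omega)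
  (G: curve R d Omega) :
 continuous th -> (forall x, 0 < th x <= 1) ->
 (forall e, 0 < e -> exists2 K: set Omega, compact K & forall x, ~ K x -> th x < e) ->
 pointwise_weakstar_cvg Gn G -> (Phi G <= limn_einf (fun n => Phi_ (eps n) (Gn n)))%E.
move=> thc th01 thv cv; apply: le_limn_einf => c hc.
have fr N: exists2 n, (N <= n)%N &
  [/\ (kinetic (Gn n) <= c%:E)%E, eq_measure (Gn n 0) G0 & eq_measure (Gn n 1) G1].
 by have [n Nn hn] := limn_einf_frequently N hc; exists n => //; exact: penalized_lt hn.
have cvP t: 0 <= t <= 1 -> forall P, CbH P ->
  (fun n => pairing (Gn n t) P) @ \oo --> pairing (G t) P.
 move=> t01 P cP; apply: (narrow_cvg thc th01 thv) => // phi cphi.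
 by apply: cv => //; rewrite in_itv.
have kin: (kinetic G <= c%:E)%E.
 apply: (kinetic_lsc dM d0 cvP) => N.
 by have [n Nn [k _ _]] := fr N; exists n.
have ends t (B: prob R d Omega) : 0 <= t <= 1 ->
  (forall N, exists2 n, (N <= n)%N & eq_measure (Gn n t) B) -> eq_measure (G t) B.
 move=> t01 h; apply: (eq_measure_CbH dM) => P cP.
 apply: (frequently_limit (cvP t t01 P cP)) => N; have [n Nn e] := h N.
 by exists n => //; exact: pairing_eq.
rewrite /Phi /iota_endpoints asboolT ?adde0 //; split.
 by apply: ends => [|N]; [rewrite lexx ler01|have [n ? []] := fr N; exists n].
by apply: ends => [|N]; [rewrite lexx ler01|have [n ? []] := fr N; exists n].
Qed.
Lemma uniform_cvg_close (Gn: nat -> curve R d Omega) (G: curve R d Omega) :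
 (forall e, 0 < e -> \forall n \near \oo, forall t, 0 <= t <= 1 ->
  (dTV (Gn n t) (G t) <= e%:E)%E) -> uniform_cvg Gn G.
move=> h.
pose D n := ereal_sup [set dTV (Gn n t) (G t) | t in `[0, 1]].
have h0 n: (0 <= D n)%E.
 apply: le_trans (dTV_ge0 (Gn n 0) (G 0)) _; apply: ereal_sup_ubound.
 by exists 0 => //; rewrite /= in_itv /= lexx ler01.
have h1 e: 0 < e -> \forall n \near \oo,
  (D n <= e%:E)%E.
 move=> e0; have := h e e0; apply: filterS => n hn.
 by apply: ge_ereal_sup => _ [t /= + <-]; rewrite in_itv; exact: hn.
rewrite /uniform_cvg -/D; have Df n (e: R) : (D n <= e%:E)%E -> D n \is a fin_num.
 by move=> hn; rewrite (ge0_fin_numE (h0 n)); apply: le_lt_trans hn (ltry _).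
apply/fine_cvgP; split.
 have := h1 1 ltr01; apply: filterS => n; exact: Df.
apply/cvgrPdist_le => e e0; have := h1 e e0; apply: filterS => n hn.
rewrite /= sub0r normrN ger0_norm ?(fine_ge0 (h0 n)) //.
by rewrite -lee_fin fineK //; exact: Df hn.
Qed.
Lemma recovery_uniform (G: curve R d Omega) (L: prob R d Omega) (v: R^nat)
  (v0: forall n, 0 < v n) (v4: forall n, 4 * v n <= 1) : v @ \oo --> 0 ->
 uniform_cvg (fun n => recovery G L (v0 n) (v4 n)) G.
move=> vc; apply: uniform_cvg_close => e e0.
have e2: 0 < e / 2 by rewrite divr_gt0.
have [r r0 hr] := curve_uniform G e2.
have p: 0 < Num.min (r / 2) (e / 4) by rewrite lt_min !divr_gt0.
have /cvgrPdist_lt /(_ _ p) := vc; apply: filterS => n; rewrite /= sub0r normrN gtr0_norm //.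
rewrite lt_min => /andP[a b] t t01.
have c1: (dTV (G (warp (v n) t)) (G t) <= (e / 2)%:E)%E.
 apply/ltW/hr => //; first exact: warp01.
 by apply: le_lt_trans (warp_near (v0 n) (v4 n) t01) _; lra.
by apply: le_trans (recovery_close L (v0 n) t01 c1) _; rewrite lee_fin; lra.
Qed.
Lemma constant_uniform (G: curve R d Omega): uniform_cvg (fun=> G) G.
apply: uniform_cvg_close => e e0; near=> n => t _; apply: ge_ereal_sup => _ [P _ <-].
by rewrite lee_fin subrr normr0 ltW.
Unshelve. all: by end_near. Qed.
(** The entropies of the end points make the two resolvent integrals finite constants, which [eps^2]
    suppresses; the middle contributes [eps^2 / v]. *)
Lemma penalized_limsup (eps: R^nat) (G: curve R d Omega) :
 (entropy Lam G0 < +oo)%E -> (entropy Lam G1 < +oo)%E ->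
 (forall n, 0 < eps n) -> eps @ \oo --> 0 ->
 exists2 Gn, uniform_cvg Gn G & (limn_esup (fun n => Phi_ (eps n) (Gn n)) <= Phi G)%E.
move=> fin0 fin1 ep0 epc.
(* Where the limit functional is infinite the constant sequence will do. *)
case: (pselect (Phi G = +oo%E)) => [->|ny].
 by exists (fun=> G); [exact: constant_uniform|exact: leey].
have [a0 a1]: eq_measure (G 0) G0 /\ eq_measure (G 1) G1.
 case: (pselect (eq_measure (G 0) G0 /\ eq_measure (G 1) G1)) => // n; exfalso; apply: ny.
 rewrite /Phi /iota_endpoints asboolF // addey // gt_eqF //.
 by apply: lt_le_trans (kinetic_ge0 G); exact: ltNy0.
have PhiE: Phi G = kinetic G by rewrite /Phi /iota_endpoints asboolT ?adde0.
have kf: kinetic G \is a fin_num.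
 by rewrite ge0_fin_numE ?kinetic_ge0 // ltey; apply/eqP; rewrite -PhiE.
have kle: (kinetic G <= (fine (kinetic G))%:E)%E by rewrite fineK.
have [m cm [_ kE]] := kinetic_lt_controlled dM d0 kle.
have sym (A B: prob R d Omega) : eq_measure A B -> eq_measure B A by move=> h S mS; rewrite h.
have [DA [wA [gA rA]]] := represents_exists d0 hL G0.
have [DB [wB [gB rB]]] := represents_exists d0 hL G1.
have iA := res_path_intg rA fin0; have iB := res_path_intg rB fin1.
have repA := represents_eq (sym _ _ a0) rA; have repB := represents_eq (sym _ _ a1) rB.
pose v n := Num.min (eps n) 4^-1.
have v0 n: 0 < v n by rewrite /v lt_min ep0 /= invr_gt0 ltr0n.
have v4 n: 4 * v n <= 1.
 have : v n <= 4^-1 by rewrite ge_min lexx orbT.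
 by lra.
have vc: v @ \oo --> 0.
 apply/cvgrPdist_lt => e e0; have /cvgrPdist_lt /(_ _ e0) := epc.
 apply: filterS => n; rewrite /= !sub0r !normrN !gtr0_norm //; apply: le_lt_trans.
 by rewrite ge_min lexx.
exists (fun n => recovery G (ref_prob d0 hL) (v0 n) (v4 n)); first exact: recovery_uniform.
rewrite PhiE kE.
set K := \int[lb]_x (m x * m x).
set IA := \int[lb]_t res_path Lam wA gA true t; set IB := \int[lb]_t res_path Lam wB gB false t.
pose VA n := iint (end_density Lam wA gA) 0 (v n); pose VB n := iint (end_density Lam wB gB) 0 (v n).
have VAc: VA @ \oo --> 0 by apply: iint_vanishes vc; exact: end_density_intg (iA true).
have VBc: VB @ \oo --> 0 by apply: iint_vanishes vc; exact: end_density_intg (iB true).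
pose b n := 2^-1 * (VA n + VB n + (1 - 2 * v n)^-1 * K) + eps n ^+ 2 / 2 * (2 * IA + 2 * IB) +
 2^-1 * (eps n + 4 * eps n ^+ 2).
have ub n: (Phi_ (eps n) (recovery G (ref_prob d0 hL) (v0 n) (v4 n)) <= (b n)%:E)%E.
 rewrite /Phi_ /iota_endpoints asboolT ?adde0; last first.
  have [r0 r1] := recovery_ends G (ref_prob d0 hL) (v0 n) (v4 n).
  by split=> S mS; [rewrite r0// a0|rewrite r1// a1].
 have h1 := kinetic_recovery dM cm repA repB iA iB (v0 n) (v4 n).
 have h2 := fisher_recovery repA repB iA iB (v0 n) (v4 n).
 have e2: (0 <= (eps n ^+ 2 / 2)%:E)%E by rewrite lee_fin divr_ge0 ?sqr_ge0.
 apply: le_trans (leeD h1 (lee_wpmul2l e2 h2)) _.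
 exact: penalty_le (ep0 n).
have bc: b @ \oo --> 2^-1 * K by exact: penalty_cvg.
apply/lee_addgt0Pr => e e0; apply: limn_esup_eventually.
have lt: 2^-1 * K < 2^-1 * K + e by rewrite ltrDl.
have := cvgr_le _ bc _ lt; move=> /(_ eventually_filter).
by apply: filterS => n bn; apply: le_trans (ub n) _; rewrite -EFinD lee_fin.
Qed.
End gamma.
Theorem theorem7 (R : realType) (d : nat) (Omega : ptopologicalType)
    (Lambda : {measure set (borel Omega) -> \bar R}) (G0 G1 : prob R d Omega) :
  (0 < d)%N ->
  separable Omega -> locally_compact [set: Omega] -> metrizable R Omega ->
  ((d%:R)%:E * Lambda setT = 1)%E ->
  (entropy Lambda G0 < +oo)%E -> (entropy Lambda G1 < +oo)%E ->
  let Phi_ (eps : R) (G : curve R d Omega) : \bar R :=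
    (kinetic G + (eps ^+ 2 / 2)%:E * fisher_path Lambda G + iota_endpoints G0 G1 G)%E in
  let Phi (G : curve R d Omega) : \bar R :=
    (kinetic G + iota_endpoints G0 G1 G)%E in
  gamma_limit uniform_cvg Phi_ Phi /\ gamma_limit pointwise_weakstar_cvg Phi_ Phi.
Proof.
move=> d0 sep lc [dist [dxx _ dC dT dN]] hL fin0 fin1 Phi_ Phi.
have dM : metrizes dist by split.
(* The normalisation of the trace makes [Lambda] finite, so that it can be passed on as
   [finite_copy h]. *)
have LT : Lambda setT \is a fin_num.
  rewrite ge0_fin_numE // ltey; apply: contraTneq isT => LE; move: hL.
  by rewrite LE gt0_muley // lte_fin ltr0n.
have h : fin_num_fun Lambda.
  move=> A mA; rewrite ge0_fin_numE //; apply: le_lt_trans (_ : _ <= Lambda setT)%E _.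
    by apply: le_measure; rewrite ?inE.
  by rewrite ltey_eq LT.
have [th [thc th01 thv]] := exists_C0_positive dM sep lc.
have inf eps Gn G := @penalized_liminf R d Omega dist dM (finite_copy h) d0 hL G0 G1
  th eps Gn G thc th01 thv.
have sup eps G := @penalized_limsup R d Omega dist dM (finite_copy h) d0 hL G0 G1
  eps G fin0 fin1.
split=> eps ep0 epc; split.
- by move=> Gn G cv; apply: inf; exact: uniform_weakstar.
- by move=> G; exact: sup.
- by move=> Gn G; exact: inf.
by move=> G; have [Gn cv le] := sup eps G ep0 epc; exists Gn => //; exact: uniform_weakstar.
Qed.
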